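(* Consider the dissipative stochastic Hamiltonian system described in the context, with parameter $\mathcal{T}>0$, $\beta:=1/\mathcal{T}$, and suppose that the damping and diffusion matrices satisfy $F(q)=\frac{\beta}{2}G(q)$ for all $q\in S$. Suppose the joint position-momentum PDF $f_t$ of $X_t=(Q_t,P_t)$ satisfies: (i) $(t,x)\mapsto f_t(x)$ belongs to $C^\infty(\mathbb{R}_+\times S\times\mathbb{R}^n,\mathbb{R}_+)$; (ii) $f_t$ belongs to the Schwartz space $\mathcal{S}(S\times\mathbb{R}^n,\mathbb{R}_+)$ for every $t\geq 0$; (iii) $g_t(q)>0$ for all $t\geq 0$, $q\in S$; (iv) $t\mapsto r_t:=f_t/\sqrt{f_*}$ is an infinitely differentiable map from $\mathbb{R}_+$ to the Hilbert space $L^2(S\times\mathbb{R}^n,\mathbb{R})$. Then at any break time $t\in\mathfrak{S}$, the third-order time derivative of the $\chi^2$-divergence $K$ and the second-order time derivative of its position component $K_1$ satisfy $$\dddot K(t)=-2\,\mathbf{E}_*\big(\|M^{-1}\partial_q\xi_t\|_G^2\big),\qquad \ddot K_1(t)=-2\mathcal{T}\,\mathbf{E}_*\big(\|\partial_q\xi_t\|_{M^{-1}}^2\big),$$ where $\mathbf{E}_*(\varphi):=\int_S\varphi(q)g_*(q)\,\mathrm{d}q$ is the expectation over the invariant position PDF $g_*$, and $\xi_t(q):=g_t(q)/g_*(q)$.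
   Context: Position space: $S$ is $\mathbb{R}^n$, $\mathbb{T}^n$ or, more generally, $\mathbb{R}^{n-r}\times\mathbb{T}^r$, with $\mathbb{T}=\mathbb{R}/(2\pi\mathbb{Z})$ identified with $[0,2\pi)$ (functions on $\mathbb{T}$ are $2\pi$-periodic functions on $\mathbb{R}$), equipped with the $n$-dimensional Lebesgue measure; growth/decay conditions at infinity apply only with respect to the Euclidean coordinates and are replaced with periodicity in the $\mathbb{T}$-valued coordinates. $\mathbb{P}_n$ is the set of real symmetric positive definite matrices of order $n$. Notation: $\|v\|_N:=\sqrt{v^{\mathrm T}Nv}$ for $N\succ0$; $\langle K,N\rangle_{\mathrm F}:=\mathrm{Tr}(K^{\mathrm T}N)$; $\partial_q,\partial_p$ are gradients (column vectors) over $q$ and $p$, and $\partial_p^2$ is the Hessian matrix over $p$; $\{\varphi,\psi\}:=\partial_q\varphi^{\mathrm T}\partial_p\psi-\partial_p\varphi^{\mathrm T}\partial_q\psi$; dots denote time derivatives. System: $V\in C^\infty(S,\mathbb{R}_+)$, $M,G,F\in C^\infty(S,\mathbb{P}_n)$ (potential energy, mass, momentum diffusion and damping matrices). The Hamiltonian is $H(x):=V(q)+\frac12\|p\|_{M(q)^{-1}}^2$ for $x=(q,p)\in S\times\mathbb{R}^n$. The state $X_t=(Q_t,P_t)$ is a diffusion process in $S\times\mathbb{R}^n$ governed by $$\dot Q_t=M(Q_t)^{-1}P_t,\qquad \mathrm{d}P_t=\big(-\partial_qH(X_t)-F(Q_t)M(Q_t)^{-1}P_t\big)\mathrm{d}t+\sqrt{G(Q_t)}\,\mathrm{d}W_t,$$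 where $W$ is a standard Wiener process in $\mathbb{R}^n$ independent of $X_0$. It is assumed that for every $t\geq0$, $X_t$ has a PDF $f_t:S\times\mathbb{R}^n\to\mathbb{R}_+$ (with respect to Lebesgue measure), which satisfies the Fokker-Planck-Kolmogorov equation $$\partial_tf_t=\{H,f_t\}+p^{\mathrm T}M^{-1}F\partial_pf_t+\langle F,M^{-1}\rangle_{\mathrm F}f_t+\tfrac12\langle G,\partial_p^2f_t\rangle_{\mathrm F}.$$ The position PDF is $g_t(q):=\int_{\mathbb{R}^n}f_t(q,p)\,\mathrm{d}p$ and the conditional momentum PDF is $h_t(p\mid q):=f_t(q,p)/g_t(q)$. Invariant PDF: $f_*(x):=\frac{1}{\Pi(\beta)}\mathrm{e}^{-\beta H(x)}$, where $\Pi(\beta):=\int_{S\times\mathbb{R}^n}\mathrm{e}^{-\beta H(x)}\mathrm{d}x$ is assumed to be finite. Its position marginal is $g_*(q):=\int_{\mathbb{R}^n}f_*(q,p)\mathrm{d}p$, and its conditional momentum PDF is $h_*(p\mid q):=f_*(q,p)/g_*(q)=\frac{(2\pi\mathcal{T})^{-n/2}}{\sqrt{\det M(q)}}\mathrm{e}^{-\frac{\beta}{2}\|p\|_{M(q)^{-1}}^2}$. The $\chi^2$-divergence and its position component are $$K(t):=\int_{S\times\mathbb{R}^n}\frac{(f_t-f_* )^2}{f_*}\mathrm{d}x,\qquad K_1(t):=\int_S\frac{g_t(q)^2}{g_*(q)}\mathrm{d}q-1.$$ The set of break times is $\mathfrak{S}:=\{t>0:\dot K(t)=0\}=\{t>0:h_t=h_*\text{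 everywhere in }S\times\mathbb{R}^n\}$. *)

(* Defs.v *)
From HB Require Import structures.
From mathcomp Require Import all_boot all_order all_algebra.
From mathcomp Require Import all_classical all_reals all_analysis.
Set Implicit Arguments.
Unset Strict Implicit.
Unset Printing Implicit Defensive.
Import Order.TTheory GRing.Theory Num.Theory.
Import numFieldNormedType.Exports.
Local Open Scope classical_set_scope.
Local Open Scope ring_scope.

Definition mx_display : measure_display. Proof. exact: default_measure_display. Qed.

Section matrix_measurable.
Variables (R : realType) (m n : nat).

Definition mx_cylinders : set (set 'M[R]_(m, n)) :=
  [set B | exists (i : 'I_m) (j : 'I_n) (A : set (measurableTypeR R)),
    measurable A /\ B = [set q : 'M[R]_(m, n) | A (q i j)]].

Let cyl0 : <<s mx_cylinders >> set0.
Proof. exact: sigma_algebra0. Qed.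

Let cylC A : <<s mx_cylinders >> A -> <<s mx_cylinders >> (~` A).
Proof. exact: sigma_algebraC. Qed.

Let cyl_bigcup (F : (set 'M[R]_(m, n))^nat) :
  (forall i, <<s mx_cylinders >> (F i)) -> <<s mx_cylinders >> (\bigcup_i F i).
Proof. exact: sigma_algebra_bigcup. Qed.

HB.instance Definition _ := @isMeasurable.Build mx_display 'M[R]_(m, n)
  <<s mx_cylinders >> cyl0 cylC cyl_bigcup.

Lemma measurable_fun_entry i j :
  measurable_fun [set: 'M[R]_(m, n)] (fun q => q i j : measurableTypeR R).
Proof.
move=> _ A mA; rewrite setTI; apply: sub_sigma_algebra.
by exists i, j, A.
Qed.

Lemma measurable_fun_mx d (T : measurableType d) (f : T -> 'M[R]_(m, n)) :
  (forall i j, measurable_fun [set: T] (fun x => f x i j : measurableTypeR R)) ->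
  measurable_fun [set: T] f.
Proof.
move=> mf; apply: (@measurability _ _ _ _ _ _ mx_cylinders) => //.
move=> _ [_ [i [j [A [mA ->]]]] <-]; rewrite setTI.
by have := mf i j measurableT A mA; rewrite setTI.
Qed.

End matrix_measurable.

Section cV_measure.
Variable R : realType.
Local Notation sfm T := {sigma_finite_measure set T -> \bar R}.

Section cons.
Variables (n : nat) (mu : sfm (measurableTypeR R)) (nu : sfm 'cV[R]_n).

Definition cV_cons (z : measurableTypeR R * 'cV[R]_n) : 'cV[R]_n.+1 :=
  col_mx (z.1)%:M z.2 : 'cV[R]_(1 + n).

Let cV_split (q : 'cV[R]_n.+1) : measurableTypeR R * 'cV[R]_n :=
  (q ord0 0, dsubmx (q : 'cV[R]_(1 + n))).

Let cV_consK : cancel cV_cons cV_split.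
Proof.
move=> [a q]; rewrite /cV_split /cV_cons /= col_mxKd; congr pair.
transitivity ((col_mx a%:M q : 'cV[R]_(1 + n)) (lshift n ord0) 0).
  by congr (col_mx _ _ _ _); apply/val_inj.
by rewrite (col_mxEu (a%:M : 'M[R]_1) q ord0 0) mxE.
Qed.

Let measurable_cons : measurable_fun [set: _] cV_cons.
Proof.
apply: measurable_fun_mx => i j; rewrite (ord1 j).
case: (split_ordP (i : 'I_(1 + n))) => k ->.
- have -> : (fun x => cV_cons x (lshift n k) 0) = fst.
    rewrite funeqE => x.
    by apply: etrans (col_mxEu (x.1%:M : 'M[R]_1) x.2 k 0) _; rewrite mxE ord1.
  exact: measurable_fst.
- have -> : (fun x => cV_cons x (rshift 1 k) 0) =
      (fun q : 'cV[R]_n => q k 0 : measurableTypeR R) \o snd.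
    rewrite funeqE => x.
    exact: (col_mxEd (x.1%:M : 'M[R]_1) x.2 k 0).
  by apply: measurableT_comp; [exact: measurable_fun_entry|exact: measurable_snd].
Qed.

Let measurable_split : measurable_fun [set: _] cV_split.
Proof.
apply/measurable_fun_pairP; split => /=; first exact: measurable_fun_entry.
apply: measurable_fun_mx => i j.
have -> : (fun q : 'cV[R]_n.+1 => (cV_split q).2 i j) =
    (fun q : 'cV[R]_n.+1 => q (rshift 1 i) j : measurableTypeR R).
  by rewrite funeqE => q; rewrite mxE.
exact: measurable_fun_entry.
Qed.

Definition cV_cons_measure : set 'cV[R]_n.+1 -> \bar R :=
  pushforward (mu \x nu)%E cV_cons.

Let cV_cons_measure0 : cV_cons_measure set0 = 0%E.
Proof. by rewrite /cV_cons_measure /pushforward preimage_set0 measure0. Qed.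

Let cV_cons_measure_ge0 A : (0 <= cV_cons_measure A)%E.
Proof. exact: measure_ge0. Qed.

Let cV_cons_measure_additive : semi_sigma_additive cV_cons_measure.
Proof.
move=> F mF tF mUF; rewrite /cV_cons_measure /pushforward preimage_bigcup.
apply: measure_semi_sigma_additive.
- by move=> i; rewrite -[X in measurable X]setTI; exact: measurable_cons.
- apply/trivIsetP => /= i j _ _ ij; rewrite -preimage_setI.
  by move/trivIsetP : tF => /(_ _ _ _ _ ij) ->//; rewrite preimage_set0.
- by rewrite -preimage_bigcup -[X in measurable X]setTI; exact: measurable_cons.
Qed.

HB.instance Definition _ := isMeasure.Build _ _ _ cV_cons_measure
  cV_cons_measure0 cV_cons_measure_ge0 cV_cons_measure_additive.

Let cV_cons_measure_sigma_finite : sigma_finite setT cV_cons_measure.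
Proof.
have /sigma_finiteP[F [TF ndF mF]] := sigma_finiteT mu.
have /sigma_finiteP[G [TG ndG mG]] := sigma_finiteT nu.
exists (fun i => cV_split @^-1` (F i `*` G i)).
  rewrite -preimage_bigcup (_ : \bigcup_i _ = setT) ?preimage_setT//.
  apply/seteqP; split=> // -[x y] _.
  have [k _ Fkx] : (\bigcup_i F i) x by rewrite -TF.
  have [l _ Gly] : (\bigcup_i G i) y by rewrite -TG.
  exists (maxn k l) => //; split => /=.
  - by move: x Fkx; exact/subsetPset/ndF/leq_maxl.
  - by move: y Gly; exact/subsetPset/ndG/leq_maxr.
move=> i; have [mFi Foo] := mF i; have [mGi Goo] := mG i.
have mFG : measurable (F i `*` G i) by exact: measurableX.
split; first by rewrite -[X in measurable X]setTI; exact: measurable_split.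
rewrite /cV_cons_measure /pushforward -comp_preimage.
have -> : cV_split \o cV_cons = id by rewrite funeqE => z /=; rewrite cV_consK.
by rewrite preimage_id product_measure1E// lte_mul_pinfty// ge0_fin_numE.
Qed.

HB.instance Definition _ := Measure_isSigmaFinite.Build _ _ _ cV_cons_measure
  cV_cons_measure_sigma_finite.

End cons.

Fixpoint cV_prod_measure (n : nat) (mu : nat -> sfm (measurableTypeR R)) :
    sfm 'cV[R]_n :=
  if n is n'.+1 then cV_cons_measure (mu 0%N) (cV_prod_measure n' (fun i => mu i.+1))
  else dirac (0 : 'cV[R]_0).

Let measurable_box n (A : 'I_n -> set (measurableTypeR R)) :
  (forall i, measurable (A i)) ->
  measurable [set q : 'cV[R]_n | forall i, A i (q i 0)].
Proof.
move=> mA; have -> : [set q : 'cV[R]_n | forall i, A i (q i 0)] =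
    \bigcap_i [set q : 'cV[R]_n | A i (q i 0)].
  by apply/seteqP; split=> q /= Aq i; [move=> _|]; exact: Aq.
apply: fin_bigcap_measurable => [|i _]; first exact: finite_finset.
have := @measurable_fun_entry R n 1 i 0 measurableT _ (mA i).
by rewrite setTI.
Qed.

Lemma cV_prod_measure_box n mu (A : 'I_n -> set (measurableTypeR R)) :
  (forall i, measurable (A i)) ->
  cV_prod_measure n mu [set q | forall i, A i (q i 0)] =
  (\prod_(i < n) mu i (A i))%E.
Proof.
elim: n mu A => [|n IHn] mu A mA /=.
  rewrite big_ord0 diracE mem_set//= => -[].
  by case.
rewrite /cV_cons_measure /pushforward big_ord_recl /=.
have -> : cV_cons (n := n) @^-1` [set q | forall i, A i (q i 0)] =
    A ord0 `*` [set q : 'cV[R]_n | forall i, A (lift ord0 i) (q i 0)].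
  have E0 (z : measurableTypeR R * 'cV[R]_n) : cV_cons z ord0 0 = z.1.
    transitivity ((col_mx z.1%:M z.2 : 'cV[R]_(1 + n)) (lshift n ord0) 0).
      by congr (col_mx _ _ _ _); apply/val_inj.
    by rewrite (col_mxEu (z.1%:M : 'M[R]_1) z.2 ord0 0) mxE.
  have E1 (z : measurableTypeR R * 'cV[R]_n) i :
      cV_cons z (lift ord0 i) 0 = z.2 i 0.
    transitivity ((col_mx z.1%:M z.2 : 'cV[R]_(1 + n)) (rshift 1 i) 0).
      by congr (col_mx _ _ _ _); apply/val_inj.
    exact: (col_mxEd (z.1%:M : 'M[R]_1) z.2 i 0).
  apply/seteqP; split=> z /=.
  - by move=> Az; split=> [|i]; [rewrite -E0|rewrite -E1].
  - move=> [Az0 Az1] i; case: (unliftP ord0 i) => [j ->|->].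
      by rewrite E1.
    by rewrite E0.
have mA' : measurable [set q : 'cV[R]_n | forall i, A (lift ord0 i) (q i 0)].
  by apply: (measurable_box (A := fun i => A (lift ord0 i))) => i; exact: mA.
rewrite (product_measure1E _ _ (mA ord0) mA').
congr (_ * _)%E.
by apply: (IHn (fun i => mu i.+1) (fun i => A (lift ord0 i))) => i; exact: mA.
Qed.

Let measurable_period : measurable (`[0, 2 * pi[ : set (measurableTypeR R)).
Proof. exact: measurable_itv. Qed.

Definition circle_measure : set (measurableTypeR R) -> \bar R :=
  mrestr lebesgue_measure measurable_period.

HB.instance Definition _ := Measure.on circle_measure.

Let circle_measure_finite : fin_num_fun circle_measure.
Proof.
move=> A mA; rewrite ge0_fin_numE//; apply: (@le_lt_trans _ _ (2 * pi)%:E).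
  rewrite /circle_measure /mrestr.
  apply: (@le_trans _ _ (lebesgue_measure `[0, 2 * pi[)).
    by apply: le_measure; rewrite ?inE//; exact: measurableI.
  rewrite lebesgue_measure_itv /= lte_fin mulr_gt0 ?pi_gt0// oppr0 adde0.
  by [].
by rewrite ltry.
Qed.

HB.instance Definition _ := Measure_isFinite.Build _ _ _ circle_measure
  circle_measure_finite.

Definition lebesgue_cV (n : nat) : sfm 'cV[R]_n :=
  cV_prod_measure n (fun=> lebesgue_measure).

Definition position_measure (n r : nat) : sfm 'cV[R]_n :=
  cV_prod_measure n
    (fun i => if (i < n - r)%N then lebesgue_measure : sfm (measurableTypeR R)
              else circle_measure).

End cV_measure.

Section position_space.
Variables (R : realType) (n r : nat).
Local Notation phase := ('cV[R]_n * 'cV[R]_n)%type.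

(* S = R^(n - r) x T^r: the last r coordinates are angles.  Points of S are
   represented by their lifts to R^n, and functions on S by functions on R^n
   which are 2pi-periodic in the angles. *)
Definition angle (i : 'I_n) : bool := (n - r <= i)%N.

Definition qperiodic (T : Type) (phi : 'cV[R]_n -> T) : Prop :=
  forall i, angle i -> forall q, phi (q + (2 * pi) *: delta_mx i 0) = phi q.

Definition euclidean_part (q : 'cV[R]_n) : 'cV[R]_n :=
  \col_i (if angle i then 0 else q i 0).

Definition phase_measure : set phase -> \bar R :=
  (position_measure R n r \x lebesgue_cV R n)%E.
HB.instance Definition _ := Measure.on phase_measure.

(* Borel subsets of S x R^n *)
Definition phase_event (A : set phase) : Prop :=
  measurable A /\ qperiodic (fun q => [set p | A (q, p)]).

End position_space.
Arguments phase_measure : clear implicits.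

Section calculus.
Variable R : realType.

(* Derivative at t of a map defined on [0, +oo[; it is one-sided at t = 0. *)
Definition time_increment (t : R) : set_system R :=
  within [set h | 0 <= t + h] 0^'.

Definition has_time_derivative (V : normedModType R) (f : R -> V) (t : R) (l : V)
    : Prop :=
  (fun h => h^-1 *: (f (t + h) - f t)) @ time_increment t --> l.

(* f is k times differentiable at t; its k-th derivative is then f^`(k) t. *)
Definition nth_derivable (k : nat) (f : R -> R) (t : R) : Prop :=
  (forall j, (j.+1 < k)%N -> \forall s \near t, derivable (f^`(j))%classic s 1) /\
  (0 < k -> derivable (f^`(k.-1))%classic t 1)%N.

Definition iter_derive (V : normedModType R) (vs : seq V) (f : V -> R) : V -> R :=
  foldr (fun v g => 'D_v g) f vs.

Definition smooth (V : normedModType R) (f : V -> R) : Prop :=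
  forall vs, continuous (iter_derive vs f) /\
    forall x v, derivable (iter_derive vs f) x v.

Variable n : nat.
Local Notation phase := ('cV[R]_n * 'cV[R]_n)%type.

Definition gradient (f : 'cV[R]_n -> R) (q : 'cV[R]_n) : 'cV[R]_n :=
  \col_i 'D_(delta_mx i 0) f q.

Definition hessian (f : 'cV[R]_n -> R) (p : 'cV[R]_n) : 'M[R]_n :=
  \matrix_(i, j) 'D_(delta_mx i 0) ('D_(delta_mx j 0) f) p.

Definition grad_q (phi : phase -> R) (x : phase) : 'cV[R]_n :=
  gradient (fun q => phi (q, x.2)) x.1.

Definition grad_p (phi : phase -> R) (x : phase) : 'cV[R]_n :=
  gradient (fun p => phi (x.1, p)) x.2.

Definition hess_p (phi : phase -> R) (x : phase) : 'M[R]_n :=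
  hessian (fun p => phi (x.1, p)) x.2.

Definition poisson (phi psi : phase -> R) (x : phase) : R :=
  ((grad_q phi x)^T *m grad_p psi x - (grad_p phi x)^T *m grad_q psi x) 0 0.

Definition posdef (N : 'M[R]_n) : Prop :=
  N^T = N /\ forall v : 'cV[R]_n, v != 0 -> 0 < (v^T *m N *m v) 0 0.

Definition wnorm (N : 'M[R]_n) (v : 'cV[R]_n) : R :=
  Num.sqrt ((v^T *m N *m v) 0 0).

Definition frobenius (K N : 'M[R]_n) : R := \tr (K^T *m N).

Definition sqrtmx (N : 'M[R]_n) : 'M[R]_n :=
  xget 0 [set A | posdef A /\ A *m A = N].

Variable r : nat.

Definition smooth_position (V : 'cV[R]_n -> R) : Prop :=
  smooth V /\ qperiodic r V.

Definition smooth_posdef (N : 'cV[R]_n -> 'M[R]_n) : Prop :=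
  [/\ forall i j, smooth (fun q => N q i j), qperiodic r N &
      forall q, posdef (N q)].

(* The decay is required in the Euclidean coordinates only. *)
Definition schwartz (phi : phase -> R) : Prop :=
  [/\ smooth phi, qperiodic r (fun q p => phi (q, p)) &
      forall (k : nat) (vs : seq phase), exists C : R, forall x : phase,
        (1 + `|(euclidean_part r x.1, x.2)|) ^+ k * `|iter_derive vs phi x| <= C].

(* An infinitely differentiable map from [0, +oo[ to L^2(S x R^n), the
   derivatives D k being limits of difference quotients in the L^2 norm. *)
Definition smooth_L2 (u : R -> phase -> R) : Prop :=
  exists D : nat -> R -> phase -> R,
    (forall t, 0 <= t -> D 0%N t = u t) /\
    forall k t, 0 <= t ->
      D k t \in Lfun (phase_measure R n r) 2%:E /\
      (fun h => Lnorm (phase_measure R n r) 2%:E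
         (fun x => (h^-1 * (D k (t + h) x - D k t x) - D k.+1 t x)%:E))
        @ time_increment t --> 0%E.

(* C^oo on the closed half-space t >= 0: smooth extendability past t = 0 *)
Definition smooth_time_phase (f : R -> phase -> R) : Prop :=
  exists2 e : R * phase -> R, smooth e &
    forall t x, 0 <= t -> e (t, x) = f t x.

End calculus.

Section hamiltonian_system.
Variables (R : realType) (n r : nat) (T : R).
Variables (V : 'cV[R]_n -> R) (M G F : 'cV[R]_n -> 'M[R]_n).
Local Notation phase := ('cV[R]_n * 'cV[R]_n)%type.
Local Notation beta := (T^-1).

Definition hamiltonian (x : phase) : R :=
  V x.1 + 2^-1 * wnorm (invmx (M x.1)) x.2 ^+ 2.

Definition drift (x : phase) : 'cV[R]_n :=
  - grad_q hamiltonian x - F x.1 *m invmx (M x.1) *m x.2.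

Definition fpk_equation (f : R -> phase -> R) : Prop :=
  forall t x, 0 <= t ->
    has_time_derivative (fun s => f s x) t
      (poisson hamiltonian (f t) x
       + (x.2^T *m invmx (M x.1) *m F x.1 *m grad_p (f t) x) 0 0
       + frobenius (F x.1) (invmx (M x.1)) * f t x
       + 2^-1 * frobenius (G x.1) (hess_p (f t) x)).

Definition gibbs_weight (x : phase) : R := expR (- (beta * hamiltonian x)).

Definition partition_finite : Prop :=
  (\int[phase_measure R n r]_x (gibbs_weight x)%:E < +oo)%E.

Definition f_star (x : phase) : R :=
  gibbs_weight x / \int[phase_measure R n r]_y gibbs_weight y.

Definition position_pdf (f : phase -> R) (q : 'cV[R]_n) : R :=
  \int[lebesgue_cV R n]_p f (q, p).

Definition g_star : 'cV[R]_n -> R := position_pdf f_star.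

Definition E_star (phi : 'cV[R]_n -> R) : \bar R :=
  (\int[position_measure R n r]_q (phi q * g_star q)%:E)%E.

Variable f : R -> phase -> R.

Definition chi2 (t : R) : R :=
  \int[phase_measure R n r]_x ((f t x - f_star x) ^+ 2 / f_star x).

Definition chi2_position (t : R) : R :=
  \int[position_measure R n r]_q (position_pdf (f t) q ^+ 2 / g_star q) - 1.

Definition break_times : set R :=
  [set t : R | 0 < t /\ is_derive t (1 : R) chi2 0].

Definition xi (t : R) (q : 'cV[R]_n) : R := position_pdf (f t) q / g_star q.

End hamiltonian_system.

Section diffusion.
Variables (R : realType) (n r : nat).
Variables (d : measure_display) (Omega : measurableType d).
Variable Pr : probability Omega R.
Local Notation phase := ('cV[R]_n * 'cV[R]_n)%type.

Definition continuous_paths (V : normedModType R) (Y : R -> Omega -> V) : Prop :=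
  {ae Pr, forall w, {within [set t | 0 <= t], continuous (fun t => Y t w)}}.

(* The components of successive increments are jointly independent and
   centred Gaussian, with variance the length of the time step. *)
Definition wiener (W : R -> Omega -> 'cV[R]_n) : Prop :=
  [/\ forall t, 0 <= t -> measurable_fun [set: Omega] (W t),
      {ae Pr, forall w, W 0 w = 0},
      continuous_paths W &
      forall (m : nat) (t : nat -> R) (B : 'I_m -> 'I_n -> set (measurableTypeR R)),
        0 <= t 0%N -> (forall k, (k < m)%N -> t k < t k.+1) ->
        (forall k i, measurable (B k i)) ->
        Pr [set w | forall k i, B k i (W (t k.+1) w i 0 - W (t k) w i 0)] =
        (\prod_(k < m) \prod_(i < n)
           normal_prob 0 (Num.sqrt (t k.+1 - t k)) (B k i))%E].

Definition independent_of_initial (W : R -> Omega -> 'cV[R]_n)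
    (X0 : Omega -> phase) : Prop :=
  forall (m : nat) (t : 'I_m -> R) (B : 'I_m -> set 'cV[R]_n) (A : set phase),
    (forall k, 0 <= t k) -> (forall k, measurable (B k)) -> phase_event r A ->
    let E := [set w | forall k, B k (W (t k) w)] in
    Pr (X0 @^-1` A `&` E) = (Pr (X0 @^-1` A) * Pr E)%E.

(* dQ/dt = M(Q)^-1 P,  dP = drift(X) dt + sqrt(G(Q)) dW, with X = (Q, P) and Q
   lifted to R^n.  The paths t |-> sqrt(G(Q_t)) being continuously
   differentiable, the Ito integral is the almost sure limit of its left-point
   sums over the uniform partitions of [0, t]. *)
Definition langevin_solution (V : 'cV[R]_n -> R) (M G F : 'cV[R]_n -> 'M[R]_n)
    (W : R -> Omega -> 'cV[R]_n) (X : R -> Omega -> phase) : Prop :=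
  [/\ forall t, 0 <= t -> measurable_fun [set: Omega] (X t),
      continuous_paths X,
      {ae Pr, forall w, forall t, 0 <= t ->
        has_time_derivative (fun s => (X s w).1) t
          (invmx (M (X t w).1) *m (X t w).2)} &
      {ae Pr, forall w, forall t, 0 <= t ->
        (fun N : nat => let s (k : nat) := t * k%:R / N.+1%:R in
           \sum_(k < N.+1)
             sqrtmx (G (X (s k) w).1) *m (W (s k.+1) w - W (s k) w)) @ \oo
        --> (X t w).2 - (X 0 w).2
            - \col_i \int[lebesgue_measure]_(s in `[0, t])
                       drift V M F (X s w) i 0}].

Definition has_pdf (X : Omega -> phase) (f : phase -> R) : Prop :=
  forall A, phase_event r A ->
    Pr (X @^-1` A) = (\int[phase_measure R n r]_(x in A) (f x)%:E)%E.

End diffusion.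

(* Main.v *)
Require Import Defs.
From HB Require Import structures.
From mathcomp Require Import all_boot all_order all_algebra.
From mathcomp Require Import all_classical all_reals all_analysis.
From mathcomp Require Import measurable_realfun ring lra.
Set Implicit Arguments.
Unset Strict Implicit.
Unset Printing Implicit Defensive.
Import Order.TTheory GRing.Theory Num.Theory.
Import numFieldNormedType.Exports.
Local Open Scope classical_set_scope.
Local Open Scope ring_scope.

(** Write [r_t = f_t / sqrt f*] and [u_t = f_t / f*] for the two normalizations of
    the density, and [L] for the Fokker-Planck operator. With [H] the Hamiltonian,
    [L] is the sum of the Poisson bracket with [H], for which [f*] is invariant,
    and of a momentum diffusion: tested with [u], it gives minus half the integral
    of [f* |d_p u|_G ^ 2]. As [K = |r|^2 - 1], one has [K' = 2 <r, r'>] and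
    [K''' = 6 <r', r''> + 2 <r, r'''>]. The position component is [|P r|^2 - 1],
    where [P] averages the momentum against its equilibrium density, so that
    [K1'' = 2 |P r'|^2 + 2 <P r, P r''>].

    At a break time [<r, r'> = 0] forces [d_p u = 0], that is [f = xi(q) f*]
    ([equilibrium]). Formally, [2 <r, r'>] is minus the integral of [f* |d_p u|_G ^ 2]. The integration by
    parts behind it is justified by cutoffs in position and momentum and by the
    renormalized square [u ^ 2 / (1 + e u)]: the transport term is rewritten with
    [vel f* = - T d_p f*] so that only [d_p f] times a logarithm of [u] remains
    ([renormalized_identity]), and Landau's inequality [(d_p f)^2 <= 4 B f],
    together with the decay of [f] and the integrability of [r ^ 2], makes this
    integrable ([log_tail]).

    At such a time [r' = - (vel . grad xi) sqrt f*] ([Lop_equilibrium]), which is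
    odd in the momentum, so that [P r' = 0]. Testing [L] with [xi], a function of
    the position only, sees the transport and not the diffusion:
    [<r, r^(k+1)> = - <r', r^(k)>] ([profile_test], [profile_pairing]). Therefore
    [K1'' = - 2 |r'|^2] and [K''' = 4 <r', r''>].

    It remains to compute two Gaussian integrals. The velocity has covariance
    [T M^-1] given the position ([vel_moment]), which gives [|r'|^2]. In
    [<r', r''>] the transport part of [r''] is even in the momentum and integrates
    to zero against [r']; the diffusive part gives
    [- 1/2 E*(|M^-1 grad xi|_G ^ 2)] ([diffusive_dissipation]).

    The derivatives of [r] in the Hilbert space are those of the density, pointwise
    ([smooth_representative]), and the latter are iterates of [L] because the
    coefficients do not depend on time ([dtn_fpk]). *)

(** * Functions with continuous directional derivatives *)

Section C1_class.
Context {R : realType} {V : normedModType R}.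
Implicit Types (f g : V -> R) (v x : V).

(** Directional derivatives instead of a differential: smoothness is phrased
    with them, and the arguments below move along lines. *)
Definition C1 (f : V -> R) : Prop :=
  continuous f /\ forall v, (forall x, derivable f x v) /\ continuous ('D_v f).

Lemma C1_continuous f : C1 f -> continuous f. Proof. by case. Qed.

Lemma C1_is_derive f x v : C1 f -> is_derive x v f ('D_v f x).
Proof. by move=> [_ /(_ v)[+ _]] => /(_ x); exact: derivableP. Qed.

Lemma C1_continuous_derive f v : C1 f -> continuous ('D_v f).
Proof. by move=> [_ /(_ v)[_]]. Qed.

Lemma C1_intro f : continuous f ->
  (forall v, exists2 df : V -> R, continuous df &
     forall x, is_derive x v f (df x)) -> C1 f.
Proof.
move=> cf df; split=> // v; have [g cg fg] := df v; split=> [x|].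
  by have [] := fg x.
rewrite (_ : 'D_v f = g) // funeqE => x.
by have [_ ->] := fg x.
Qed.

Lemma C1_cst (c : R) : C1 (fun=> c).
Proof.
apply: C1_intro => [x|v]; first exact: cvg_cst.
exists (fun=> 0) => x; [exact: cvg_cst|exact: is_derive_cst].
Qed.

Lemma is_deriveM_fun f g x v df dg : is_derive x v f df -> is_derive x v g dg ->
  is_derive x v (fun y => f y * g y) (f x * dg + g x * df).
Proof. exact: is_deriveM. Qed.

Lemma is_deriveD_fun f g x v df dg : is_derive x v f df -> is_derive x v g dg ->
  is_derive x v (fun y => f y + g y) (df + dg).
Proof. exact: is_deriveD. Qed.

Lemma is_deriveN_fun f x v df : is_derive x v f df ->
  is_derive x v (fun y => - f y) (- df).
Proof. exact: is_deriveN. Qed.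

Lemma is_deriveB_fun f g x v df dg : is_derive x v f df -> is_derive x v g dg ->
  is_derive x v (fun y => f y - g y) (df - dg).
Proof. exact: is_deriveB. Qed.

Lemma is_derive_cstM (c : R) f x v df : is_derive x v f df ->
  is_derive x v (fun y => c * f y) (c * df).
Proof.
move=> ff; apply: is_derive_eq (is_deriveM_fun (is_derive_cst c x v) ff) _.
by rewrite mulr0 addr0.
Qed.

Lemma is_derive_bigsum (I : Type) (s : seq I) (P : pred I) (h : I -> V -> R) x v
    (dh : I -> R) : (forall i, P i -> is_derive x v (h i) (dh i)) ->
  is_derive x v (fun y => \sum_(i <- s | P i) h i y) (\sum_(i <- s | P i) dh i).
Proof.
move=> hdh; elim: s => [|i s IH].
  rewrite big_nil.
  rewrite (_ : (fun _ => _) = cst 0); first exact: is_derive_cst.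
  by rewrite funeqE => y; rewrite big_nil.
rewrite [X in is_derive _ _ X](_ : _ = (fun y => (if P i then h i y else 0) +
   \sum_(j <- s | P j) h j y)); last first.
  by rewrite funeqE => y; rewrite big_cons; case: (P i); rewrite ?add0r.
rewrite big_cons; case: ifPn => [Pi|_]; first by apply: is_deriveD_fun => //; exact: hdh.
apply: is_derive_eq (is_deriveD_fun (is_derive_cst (0:R) x v) IH) _.
by rewrite add0r.
Qed.

(** Along the direction [v] only the one-variable chain rule is involved. *)
Lemma is_derive_comp1 (g : R -> R) f x v df dg :
  is_derive x v f df -> is_derive (f x) (1 : R) g dg ->
  is_derive x v (fun y => g (f y)) (dg * df).
Proof.
move=> [fd <-] [gd <-].
have fd1 : derivable (fun h : R => f (h *: v + x)) 0 1 by exact: (derivable1P _ _ _).1.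
have E0 (h : V -> R) : 'D_v h x = (fun s : R => h (s *: v + x))^`()%classic 0.
  rewrite derive1E /derive; set a := fun s => s^-1 *: _; set b := fun s => s^-1 *: _.
  suff -> : a = b by []; rewrite funeqE => s; rewrite /a /b /=.
  by rewrite addr0 scale0r add0r [_%:A]mulr1.
have Ex : 0 *: v + x = x by rewrite scale0r add0r.
apply: DeriveDef.
  apply: (derivable1P _ _ _).2; apply/derivable1_diffP.
  apply: (@differentiable_comp _ _ _ _ (fun h : R => f (h *: v + x)) g).
    exact/derivable1_diffP.
  by rewrite Ex; exact/derivable1_diffP.
rewrite !E0.
rewrite (@derive1_comp _ (fun h : R => f (h *: v + x)) g) //= ?Ex//.
by rewrite derive1E.
Qed.

Lemma is_deriveV_fun f x v df : f x != 0 -> is_derive x v f df ->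
  is_derive x v (fun y => (f y)^-1) (- (f x) ^- 2 * df).
Proof.
move=> fx0 ff; apply: is_derive_comp1 ff _.
apply: DeriveDef; first by apply: (@derivableV _ _ id).
by rewrite (@deriveV _ _ id)// derive_id scaler1.
Qed.

Lemma C1D f g : C1 f -> C1 g -> C1 (fun x => f x + g x).
Proof.
move=> Cf Cg; apply: C1_intro => [x|v].
  by apply: cvgD; [exact: C1_continuous Cf x|exact: C1_continuous Cg x].
exists (fun x => 'D_v f x + 'D_v g x) => [x|x].
  by apply: cvgD; [exact: C1_continuous_derive|exact: C1_continuous_derive].
by apply: is_deriveD_fun; exact: C1_is_derive.
Qed.

Lemma C1N f : C1 f -> C1 (fun x => - f x).
Proof.
move=> Cf; apply: C1_intro => [x|v].
  by apply: cvgN; exact: C1_continuous Cf x.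
exists (fun x => - 'D_v f x) => [x|x].
  by apply: cvgN; exact: C1_continuous_derive.
by apply: is_deriveN_fun; exact: C1_is_derive.
Qed.

Lemma C1B f g : C1 f -> C1 g -> C1 (fun x => f x - g x).
Proof. by move=> Cf Cg; apply: C1D => //; exact: C1N. Qed.

Lemma C1M f g : C1 f -> C1 g -> C1 (fun x => f x * g x).
Proof.
move=> Cf Cg; have [cf cg] := (C1_continuous Cf, C1_continuous Cg).
apply: C1_intro => [x|v]; first by apply: cvgM; [exact: cf|exact: cg].
exists (fun x => f x * 'D_v g x + g x * 'D_v f x) => [x|x].
  by apply: cvgD; apply: cvgM; do ?[exact: cf|exact: cg];
     exact: C1_continuous_derive.
by apply: is_deriveM_fun; exact: C1_is_derive.
Qed.

Lemma C1Z (c : R) f : C1 f -> C1 (fun x => c * f x).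
Proof. by move=> Cf; apply: C1M => //; exact: C1_cst. Qed.

Lemma C1_sum (I : Type) (s : seq I) (P : pred I) (h : I -> V -> R) :
  (forall i, P i -> C1 (h i)) -> C1 (fun x => \sum_(i <- s | P i) h i x).
Proof.
move=> Ch; elim: s => [|i s IH].
  rewrite (_ : (fun _ => _) = fun=> 0); first exact: C1_cst.
  by rewrite funeqE => y; rewrite big_nil.
rewrite (_ : (fun _ => _) = (fun y => (if P i then h i y else 0) +
   \sum_(j <- s | P j) h j y)); last first.
  by rewrite funeqE => y; rewrite big_cons; case: (P i); rewrite ?add0r.
by apply: C1D => //; case: (boolP (P i)) => [Pi|_]; [exact: Ch|exact: C1_cst].
Qed.

Lemma C1_prod (I : Type) (s : seq I) (P : pred I) (h : I -> V -> R) :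
  (forall i, P i -> C1 (h i)) -> C1 (fun x => \prod_(i <- s | P i) h i x).
Proof.
move=> Ch; elim: s => [|i s IH].
  rewrite (_ : (fun _ => _) = fun=> 1); first exact: C1_cst.
  by rewrite funeqE => y; rewrite big_nil.
rewrite (_ : (fun _ => _) = (fun y => (if P i then h i y else 1) *
   \prod_(j <- s | P j) h j y)); last first.
  by rewrite funeqE => y; rewrite big_cons; case: ifPn => // _; rewrite mul1r.
by apply: C1M => //; case: (boolP (P i)) => [Pi|_]; [exact: Ch|exact: C1_cst].
Qed.

(** The outer function only has to be differentiable on an open set that
    contains the values of [f], so that its derivative need only be continuous
    at those values. *)
Lemma C1_comp1 (g dg : R -> R) f :
  C1 f -> (forall x, is_derive (f x) (1 : R) g (dg (f x))) ->
  (forall x, {for f x, continuous dg}) -> C1 (fun x => g (f x)).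
Proof.
move=> Cf dgP cdg; apply: C1_intro => [x|v].
  apply: (@continuous_comp _ _ _ f g); first exact: C1_continuous.
  apply: differentiable_continuous; apply/derivable1_diffP.
  by have [] := dgP x.
exists (fun x => dg (f x) * 'D_v f x) => [x|x].
  apply: cvgM; last exact: C1_continuous_derive.
  by apply: (@continuous_comp _ _ _ f dg); [exact: C1_continuous|exact: cdg].
exact: (is_derive_comp1 (C1_is_derive x v Cf) (dgP x)).
Qed.

Lemma C1V f : (forall x, f x != 0) -> C1 f -> C1 (fun x => (f x)^-1).
Proof.
move=> f0 Cf; have cf := C1_continuous Cf; apply: C1_intro => [x|v].
  by apply: cvgV; [exact: f0|exact: cf].
exists (fun x => - (f x) ^- 2 * 'D_v f x) => [x|x].
  apply: cvgM; last exact: C1_continuous_derive.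
  apply: cvgN; apply: cvgV; first by rewrite expf_neq0.
  by apply: cvgM; exact: cf.
by apply: is_deriveV_fun => //; exact: C1_is_derive.
Qed.

Lemma C1_expR f : C1 f -> C1 (fun x => expR (f x)).
Proof.
move=> Cf; apply: (@C1_comp1 expR expR) => // x.
exact: continuous_expR.
Qed.

Lemma derive_val_fun f x v df : is_derive x v f df -> 'D_v f x = df.
Proof. by case. Qed.

Lemma smooth_C1 f : smooth f -> C1 f.
Proof.
move=> sf; split; first by have [] := sf [::].
by move=> v; split=> [x|]; [have [_] := sf [::]; exact|have [] := sf [:: v]].
Qed.

Lemma smooth_derive f v : smooth f -> smooth ('D_v f).
Proof.
move=> sf vs; have := sf (rcons vs v).
by rewrite /iter_derive -cats1 foldr_cat.
Qed.

Lemma C1_line f x v : C1 f -> forall s : R,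
  is_derive s (1 : R) (fun h : R => f (x + h *: v)) ('D_v f (x + s *: v)).
Proof.
move=> Cf s; have [fd _] := C1_is_derive (x + s *: v) v Cf.
have E h : x + (h + s) *: v = h *: v + (x + s *: v).
  by rewrite scalerDl addrCA.
apply: DeriveDef.
  apply: (derivable1P _ _ _).2.
  rewrite (_ : (fun _ => _) = (fun h : R => f (h *: v + (x + s *: v)))).
    exact: (derivable1P _ _ _).1.
  by rewrite funeqE => h; rewrite -E [_%:A]mulr1.
rewrite /derive; set a := fun h => h^-1 *: _; set b := fun h => h^-1 *: _.
suff -> : a = b by []; rewrite funeqE => h; rewrite /a /b /=.
by rewrite [_%:A]mulr1 E.
Qed.

End C1_class.

Section pairs.
Context {R : realType} {U V : normedModType R}.

Lemma derive_pairl (f : U * V -> R) (u du : U) (v : V) :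
  'D_du (fun u => f (u, v)) u = 'D_((du, 0) : U * V) f (u, v).
Proof.
rewrite /derive; set a := fun h => h^-1 *: _; set b := fun h => h^-1 *: _.
suff -> : a = b by []; rewrite funeqE => h; rewrite /a /b /=.
congr (_ *: (f _ - _)).
by rewrite /GRing.scale /GRing.add /= /add_pair/= /scale_pair /= scaler0 add0r.
Qed.

Lemma derive_pairr (f : U * V -> R) (u : U) (dv v : V) :
  'D_dv (fun v => f (u, v)) v = 'D_((0, dv) : U * V) f (u, v).
Proof.
rewrite /derive; set a := fun h => h^-1 *: _; set b := fun h => h^-1 *: _.
suff -> : a = b by []; rewrite funeqE => h; rewrite /a /b /=.
congr (_ *: (f _ - _)).
by rewrite /GRing.scale /GRing.add /= /add_pair/= /scale_pair /= scaler0 add0r.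
Qed.

End pairs.

(** * Symmetry of second derivatives *)

Section clairaut.
Context {R : realType} {V : normedModType R}.

Lemma C1_MVT (f : V -> R) (x v : V) (s : R) : C1 f -> 0 < s ->
  exists2 c, 0 < c < s & f (x + s *: v) - f x = s * 'D_v f (x + c *: v).
Proof.
move=> Cf s0.
have df := C1_line x v Cf.
have cf : {within `[0, s], continuous (fun h => f (x + h *: v))}.
  apply: continuous_subspaceT => y.
  apply: differentiable_continuous; apply/derivable1_diffP.
  by have [] := df y.
have [c] := MVT s0 (fun y _ => df y) cf.
rewrite in_itv/= => c0s; rewrite scale0r addr0 subr0 => E.
by exists c => //; rewrite E mulrC.
Qed.

Let dist_half (A B c e : R) : `|A - c| < e / 2 -> `|B - c| < e / 2 -> `|A - B| <= e.
Proof.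
move=> h1 h2; rewrite (_ : A - B = (A - c) - (B - c)); last by ring.
rewrite [e]splitr; apply: le_trans (ler_normB _ _) _.
by apply: lerD; exact: ltW.
Qed.

(** Two mean value theorems turn the second difference into the mixed derivative
    at a nearby point. *)
Let second_difference (f : V -> R) x v w (s : R) : C1 f -> C1 ('D_v f) -> 0 < s ->
  exists a b, [/\ 0 < a < s, 0 < b < s &
    f (x + s *: v + s *: w) - f (x + s *: v) - f (x + s *: w) + f x =
    s * s * 'D_w ('D_v f) (x + a *: v + b *: w)].
Proof.
move=> Cf Cv s0.
have Csh : C1 (fun y => f (y + s *: w)).
  apply: C1_intro => [y|u].
    apply: (@continuous_comp _ _ _ (fun y => y + s *: w) f).
      by apply: cvgD; [exact: cvg_id|exact: cvg_cst].
    exact: C1_continuous.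
  exists (fun y => 'D_u f (y + s *: w)) => [y|y].
    apply: (@continuous_comp _ _ _ (fun y => y + s *: w) ('D_u f)).
      by apply: cvgD; [exact: cvg_id|exact: cvg_cst].
    exact: C1_continuous_derive.
  have [fd _] := C1_is_derive (y + s *: w) u Cf.
  have E h : h *: u + y + s *: w = h *: u + (y + s *: w) by rewrite addrA.
  apply: DeriveDef.
    apply: (derivable1P _ _ _).2.
    rewrite (_ : (fun _ => _) = (fun h : R => f (h *: u + (y + s *: w)))).
      exact: (derivable1P _ _ _).1.
    by rewrite funeqE => h; rewrite -E.
  rewrite /derive; set g1 := fun h => h^-1 *: _; set g2 := fun h => h^-1 *: _.
  by suff -> : g1 = g2 by []; rewrite funeqE => h; rewrite /g1 /g2/= E.
have Dsh u y : 'D_u (fun y => f (y + s *: w)) y = 'D_u f (y + s *: w).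
  rewrite /derive; set g1 := fun h => h^-1 *: _; set g2 := fun h => h^-1 *: _.
  by suff -> : g1 = g2 by []; rewrite funeqE => h; rewrite /g1 /g2/= addrA.
have [a a0s Ea] := C1_MVT x v (C1B Csh Cf) s0.
have [b b0s Eb] := C1_MVT (x + a *: v) w Cv s0.
exists a, b; split => //.
rewrite -mulrA -Eb.
have E : 'D_v (fun y => f (y + s *: w) - f y) (x + a *: v) =
    'D_v f (x + a *: v + s *: w) - 'D_v f (x + a *: v).
  rewrite -Dsh; apply: derive_val_fun; apply: is_deriveB_fun; exact: C1_is_derive.
by rewrite -E -Ea; ring.
Qed.

(** The second difference is symmetric in the two directions, while it selects
    either order of differentiation. *)
Lemma derive_comm (f : V -> R) (v w : V) : C1 f -> C1 ('D_v f) -> C1 ('D_w f) ->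
  'D_v ('D_w f) = 'D_w ('D_v f).
Proof.
move=> Cf Cv Cw; rewrite funeqE => x.
apply/eqP; rewrite -subr_eq0 -normr_le0; apply/ler_addgt0Pl => e e0.
have cc (g : V -> R) : continuous g -> exists2 d, 0 < d &
    forall y, `|x - y| < d -> `|g x - g y| < e / 2.
  move=> cg; have : \forall y \near x, `|g x - g y| < e / 2.
    have e2 : 0 < e / 2 by rewrite divr_gt0.
    by move/cvgrPdist_lt : (cg x) => /(_ _ e2).
  move=> /nbhs_ballP[d /= d0 dP]; exists d => // y xy; apply: dP.
  by rewrite -ball_normE.
have [d1 d10 P1] := cc _ (Cv.2 w).2.
have [d2 d20 P2] := cc _ (Cw.2 v).2.
pose d := Num.min d1 d2; have d0 : 0 < d by rewrite lt_min d10.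
pose m := 1 + `|v| + `|w|; have m0 : 0 < m.
  by rewrite /m -addrA ltr_wpDr// addr_ge0.
pose s := d / (2 * m); have s0 : 0 < s by rewrite divr_gt0// mulr_gt0.
have close a b : 0 < a < s -> 0 < b < s -> `|x - (x + a *: v + b *: w)| < d.
  move=> /andP[a0 as_] /andP[b0 bs_].
  rewrite -addrA opprD addNKr normrN.
  apply: le_lt_trans (ler_normD _ _) _; rewrite !normrZ !gtr0_norm//.
  apply: (@le_lt_trans _ _ (s * m)).
    rewrite /m !mulrDr mulr1 -addrA ler_wpDl ?(ltW s0)//.
    by apply: lerD; rewrite ler_wpM2r// ltW.
  rewrite /s invfM mulrCA mulrA -!mulrA mulVf ?gt_eqF// mulr1.
  by rewrite ltr_pdivrMl// mulr_natl mulr2n ltrDl.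
have [a [b [a0 b0 E1]]] := second_difference x w Cf Cv s0.
have [a' [b' [a'0 b'0 E2]]] := second_difference x v Cf Cw s0.
have E : 'D_w ('D_v f) (x + a *: v + b *: w) =
         'D_v ('D_w f) (x + b' *: v + a' *: w).
  have ss0 : s * s != 0 by rewrite mulf_neq0// gt_eqF.
  have E3 : x + b' *: v + a' *: w = x + a' *: w + b' *: v by rewrite addrAC.
  have E4 : x + s *: w + s *: v = x + s *: v + s *: w by rewrite addrAC.
  rewrite E3; apply: (mulfI ss0); apply: (etrans (esym E1)); apply: etrans E2.
  by rewrite E4 -!addrA; congr (_ + _); rewrite addrCA.
have := P1 _ (lt_le_trans (close _ _ a0 b0) _).
have := P2 _ (lt_le_trans (close _ _ b'0 a'0) _).
rewrite -E !ge_min !lexx !orbT => /(_ isT) H2 /(_ isT) H1.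
rewrite addr0; exact: dist_half H2 H1.
Qed.

End clairaut.

Section smooth_comm.
Context {R : realType} {V : normedModType R}.
Lemma smooth_derive_comm (f : V -> R) (v w : V) : smooth f ->
  'D_v ('D_w f) = 'D_w ('D_v f).
Proof.
move=> sf; exact: (derive_comm (smooth_C1 sf) (smooth_C1 (smooth_derive v sf))
  (smooth_C1 (smooth_derive w sf))).
Qed.
End smooth_comm.

(** * Derivatives on products and of matrices *)

Section pairs_C1.
Context {R : realType} {U V : normedModType R}.

Lemma derive_fst (g : U -> R) (x d : U * V) :
  'D_d (fun x : U * V => g x.1) x = 'D_(d.1) g x.1.
Proof. by []. Qed.

Lemma derive_snd (g : V -> R) (x d : U * V) :
  'D_d (fun x : U * V => g x.2) x = 'D_(d.2) g x.2.
Proof. by []. Qed.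

Lemma C1_fst (g : U -> R) : C1 g -> C1 (fun x : U * V => g x.1).
Proof.
move=> Cg; have cf (h : U -> R) : continuous h -> continuous (fun x : U * V => h x.1).
  by move=> ch x; apply: (@continuous_comp _ _ _ fst h); [exact: cvg_fst|exact: ch].
split; first exact/cf/C1_continuous.
move=> v; split=> [x|]; first exact ((Cg.2 v.1).1 x.1).
exact: (cf _ (Cg.2 v.1).2).
Qed.

Lemma C1_snd (g : V -> R) : C1 g -> C1 (fun x : U * V => g x.2).
Proof.
move=> Cg; have cf (h : V -> R) : continuous h -> continuous (fun x : U * V => h x.2).
  by move=> ch x; apply: (@continuous_comp _ _ _ snd h); [exact: cvg_snd|exact: ch].
split; first exact/cf/C1_continuous.
move=> v; split=> [x|]; first exact ((Cg.2 v.2).1 x.2).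
exact: (cf _ (Cg.2 v.2).2).
Qed.

Lemma C1_restrl (f : U * V -> R) (v : V) : C1 f -> C1 (fun u => f (u, v)).
Proof.
move=> Cf; have cf (h : U * V -> R) : continuous h -> continuous (fun u => h (u, v)).
  move=> ch x; apply: (@continuous_comp _ _ _ (fun u => (u, v)) h); last exact: ch.
  by apply: cvg_pair; [exact: cvg_id|exact: cvg_cst].
split; first exact/cf/C1_continuous.
move=> du; split=> [x|].
  have := (Cf.2 (du, 0)).1 (x, v); rewrite /derivable.
  set g1 := fun h => h^-1 *: _; set g2 := fun h => h^-1 *: _.
  suff -> : g1 = g2 by []; rewrite funeqE => h; rewrite /g1 /g2 /=.
  congr (_ *: (f _ - _)).
  by rewrite /GRing.scale /GRing.add /= /add_pair/= /scale_pair /= scaler0 add0r.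
rewrite (_ : 'D_du _ = fun u => 'D_((du, 0) : U * V) f (u, v)).
  exact: (cf _ (Cf.2 (du, 0)).2).
by rewrite funeqE => u; rewrite derive_pairl.
Qed.

Lemma C1_restrr (f : U * V -> R) (u : U) : C1 f -> C1 (fun v => f (u, v)).
Proof.
move=> Cf; have cf (h : U * V -> R) : continuous h -> continuous (fun v => h (u, v)).
  move=> ch x; apply: (@continuous_comp _ _ _ (fun v => (u, v)) h); last exact: ch.
  by apply: cvg_pair; [exact: cvg_cst|exact: cvg_id].
split; first exact/cf/C1_continuous.
move=> dv; split=> [x|].
  have := (Cf.2 (0, dv)).1 (u, x); rewrite /derivable.
  set g1 := fun h => h^-1 *: _; set g2 := fun h => h^-1 *: _.
  suff -> : g1 = g2 by []; rewrite funeqE => h; rewrite /g1 /g2 /=.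
  congr (_ *: (f _ - _)).
  by rewrite /GRing.scale /GRing.add /= /add_pair/= /scale_pair /= scaler0 add0r.
rewrite (_ : 'D_dv _ = fun v => 'D_((0, dv) : U * V) f (u, v)).
  exact: (cf _ (Cf.2 (0, dv)).2).
by rewrite funeqE => v; rewrite derive_pairr.
Qed.

End pairs_C1.

Section matrices_C1.
Context {R : realType}.

Lemma is_derive_entry (n : nat) (i : 'I_n) (q v : 'cV[R]_n) :
  is_derive q v (fun q : 'cV[R]_n => q i 0) (v i 0).
Proof.
have idv : derivable (@id 'cV[R]_n) q v by exact: ex_derive.
have h := (derivable_mxP (@id 'cV[R]_n) q v).1 idv.
apply: DeriveDef; first exact: h.
have := derive_mx idv; rewrite derive_id => /matrixP/(_ i 0).
by rewrite mxE => ->.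
Qed.

Lemma C1_entry (n : nat) (i : 'I_n) : C1 (fun q : 'cV[R]_n => q i 0).
Proof.
apply: C1_intro; first exact: coord_continuous.
move=> v; exists (fun=> v i 0); first exact: cst_continuous.
by move=> x; exact: is_derive_entry.
Qed.

Context {V : normedModType R}.

Lemma C1_det (n : nat) (A : V -> 'M[R]_n) :
  (forall i j, C1 (fun x => A x i j)) -> C1 (fun x => \det (A x)).
Proof.
move=> CA; rewrite /determinant; apply: C1_sum => s _.
by apply: C1Z; apply: C1_prod => i _; exact: CA.
Qed.

(** By Cramer's formula the inverse is rational in the entries, with a
    nonvanishing denominator. *)
Lemma C1_invmx (n : nat) (A : V -> 'M[R]_n) : (forall x, A x \in unitmx) ->
  (forall i j, C1 (fun x => A x i j)) -> forall i j, C1 (fun x => invmx (A x) i j).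
Proof.
move=> uA CA i j.
rewrite (_ : (fun _ => _) = fun x => (\det (A x))^-1 * cofactor (A x) j i); last first.
  by rewrite funeqE => x; rewrite /invmx uA !mxE.
apply: C1M.
  by apply: C1V; [move=> x; rewrite -unitfE -unitmxE|exact: C1_det].
rewrite /cofactor; apply: C1Z; apply: C1_det => k l.
rewrite (_ : (fun _ => _) = fun x => A x (lift j k) (lift i l)); first exact: CA.
by rewrite funeqE => x; rewrite !mxE.
Qed.

End matrices_C1.

(** * Continuity, measurability and compactness *)

Section mx_norm_lemmas.
Context {R : realType}.

Lemma cV_norm_le (n : nat) (q : 'cV[R]_n) (c : R) : 0 <= c ->
  (forall i, `|q i 0| <= c) -> `|q| <= c.
Proof.
move=> c0 qc; rewrite /Num.norm /= mx_normrE; apply/bigmax_leP; split => //= -[i j] _ /=.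
by rewrite ord1.
Qed.

Lemma entry_le_norm (n : nat) (q : 'cV[R]_n) i : `|q i 0| <= `|q|.
Proof.
by rewrite [leRHS]/Num.norm /= mx_normrE; apply/bigmax_geP; right => /=; exists (i, 0).
Qed.

End mx_norm_lemmas.

Section continuous_measurable.
Context {R : realType}.

(** A continuous function is the pointwise limit of its compositions with
    measurable discretizations of the space, which take countably many values;
    this avoids writing open sets as countable unions of boxes. *)
Lemma discretized_limit_measurable d (T : measurableType d) (C : countType)
    (F : T -> R) (c : nat -> T -> C) (D : nat -> C -> T) :
  (forall k z, measurable (c k @^-1` [set z])) ->
  (forall x, (fun k => F (D k (c k x))) @ \oo --> F x) ->
  measurable_fun [set: T] F.
Proof.
move=> mc FDc; apply: (@measurable_fun_cvg _ _ _ setT (fun k x => F (D k (c k x)))).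
  move=> k _ B mB; rewrite setTI.
  rewrite (_ : _ @^-1` B = \bigcup_z (c k @^-1` [set z] `&` [set x | B (F (D k z))])).
    apply: countable_bigcupT_measurable; first exact: countableP.
    move=> z; have [Bz|nBz] := pselect (B (F (D k z))).
      by rewrite (_ : [set x | _] = setT) ?setIT//; apply/seteqP; split.
    by rewrite (_ : [set x | _] = set0) ?setI0//; apply/seteqP; split.
  apply/seteqP; split => [x Bx|x [z _ [/= -> //]]].
  by exists (c k x).
by move=> x _; exact: FDc.
Qed.

Section code.
Variable n : nat.

Definition code (k : nat) (q : 'cV[R]_n) : 'cV[int]_n :=
  \col_i Num.floor (k.+1%:R * q i 0).

Definition decode (k : nat) (z : 'cV[int]_n) : 'cV[R]_n :=
  \col_i ((z i 0)%:~R / k.+1%:R).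

Lemma measurable_code k z : measurable (code k @^-1` [set z]).
Proof.
rewrite (_ : _ @^-1` _ = \bigcap_(i in [set: 'I_n])
    [set q : 'cV[R]_n | `[(z i 0)%:~R / k.+1%:R, ((z i 0) + 1)%:~R / k.+1%:R[%classic (q i 0)]).
  apply: fin_bigcap_measurable => [|i _]; first exact: finite_finset.
  have := @measurable_fun_entry R n 1 i 0 measurableT
    `[(z i 0)%:~R / k.+1%:R, ((z i 0) + 1)%:~R / k.+1%:R[%classic (measurable_itv _).
  by rewrite setTI.
have k0 : (0 : R) < k.+1%:R by [].
have E (x : R) (m : int) : (m%:~R / k.+1%:R <= x < (m + 1)%:~R / k.+1%:R) =
    (Num.floor (k.+1%:R * x) == m).
  rewrite ler_pdivrMr// ltr_pdivlMr// [x * _]mulrC.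
  apply/idP/eqP => [/Num.Theory.floor_def//|<-].
  by rewrite floor_le_tmp floorD1_gt.
apply/seteqP; split => q /=.
  by move=> <- i _ /=; rewrite in_itv/= !mxE E.
move=> h; apply/matrixP => i j; rewrite ord1 mxE.
by have := h i I; rewrite /= in_itv/= E => /eqP.
Qed.

Lemma decode_code k q : `|q - decode k (code k q)| <= k.+1%:R^-1.
Proof.
apply: cV_norm_le; first by rewrite invr_ge0.
move=> i; rewrite !mxE.
have k0 : (0 : R) < k.+1%:R by [].
have /andP[h1 h2] := floor_itv (k.+1%:R * q i 0).
move: h1 h2; rewrite intrD; set m := (Num.floor _)%:~R => h1 h2.
have -> : q i 0 - m / k.+1%:R = (k.+1%:R * q i 0 - m) / k.+1%:R.
  by field; rewrite gt_eqF.
rewrite ger0_norm; last by rewrite divr_ge0// subr_ge0.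
by rewrite ler_pdivrMr// mulVf ?gt_eqF// lerBlDl ltW.
Qed.

Lemma decode_code_cvg q : (fun k => decode k (code k q)) @ \oo --> q.
Proof.
apply/cvgrPdist_le => e e0.
near=> k.
apply: le_trans (decode_code k q) _.
near: k.
by apply: filterS (near_infty_natSinv_lt (PosNum e0)) => k; exact: ltW.
Unshelve. all: by end_near. Qed.

End code.

Lemma continuous_measurable_cV (n : nat) (F : 'cV[R]_n -> R) :
  continuous F -> measurable_fun [set: 'cV[R]_n] F.
Proof.
move=> cF; apply: (@discretized_limit_measurable _ _ _ F (@code n) (@decode n)).
  exact: measurable_code.
by move=> x; apply: continuous_cvg; [exact: cF|exact: decode_code_cvg].
Qed.

Lemma continuous_measurable_phase (m n : nat) (F : 'cV[R]_m * 'cV[R]_n -> R) :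
  continuous F -> measurable_fun [set: 'cV[R]_m * 'cV[R]_n] F.
Proof.
move=> cF.
apply: (@discretized_limit_measurable _ _ _ F (fun k x => (code k x.1, code k x.2))
  (fun k z => (decode k z.1, decode k z.2))).
  move=> k [z1 z2].
  rewrite (_ : _ @^-1` _ = (code k @^-1` [set z1]) `*` (code k @^-1` [set z2])).
    by apply: measurableX; exact: measurable_code.
  by apply/seteqP; split => -[x y] /= [-> ->].
move=> [x y].
have h : (fun k => (decode k (code k x), decode k (code k y))) @ \oo --> (x, y).
  exact: (cvg_pair (@decode_code_cvg m x) (@decode_code_cvg n y)).
by apply: (continuous_cvg _ _ h); exact: cF.
Qed.

End continuous_measurable.

Section box_bounded.
Context {R : realType}.

Lemma cV_box_compact (n : nat) (c : R) :
  compact [set q : 'cV[R]_n | forall i, `|q i 0| <= c].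
Proof.
have trc : continuous (fun v : 'rV[R]_n => v^T).
  move=> v; have FF : Filter (nbhs v) by exact: nbhs_filter.
  apply/(@cvgrPdist_le _ _ _ _ FF) => e e0.
  have : \forall w \near nbhs v, `|v - w| <= e.
    apply: (@filterS _ _ FF _ _ _ (@nbhsx_ballx _ _ v e e0)) => w.
    by rewrite -ball_normE; exact: ltW.
  apply: (@filterS _ _ FF) => w vw; apply: cV_norm_le; first exact: ltW.
  move=> i; rewrite !mxE; apply: le_trans vw.
  rewrite [leRHS]/Num.norm /= mx_normrE; apply/bigmax_geP; right => /=; exists (0, i) => //.
  by rewrite !mxE.
rewrite (_ : [set q | _] = (fun v : 'rV[R]_n => v^T) @`
    [set v : 'rV[R]_n | forall i, `[- c, c]%classic (v ord0 i)]).
  apply: continuous_compact; first exact: continuous_subspaceT.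
  apply: (@rV_compact _ _ (fun=> `[- c, c]%classic)) => i.
  exact: segment_compact.
apply/seteqP; split => [q /= qc|q [v /= vc <-] i].
  exists q^T; last by rewrite trmxK.
  by move=> i; rewrite mxE in_itv/= -ler_norml.
by rewrite mxE ler_norml; have := vc i; rewrite in_itv.
Qed.

Lemma continuous_bounded_compact (T : topologicalType) (F : T -> R) (A : set T) :
  compact A -> continuous F -> exists C : R, forall x, A x -> `|F x| <= C.
Proof.
move=> cA cF.
have [->|A0] := eqVneq A set0; first by exists 0.
have cN : {within A, continuous (fun x => `|F x|)}.
  apply: continuous_subspaceT => x.
  by apply: (@continuous_comp _ _ _ F (@Num.norm R R)); [exact: cF|exact: norm_continuous].
have [c _ cP] := compact_EVT_max ((set0P _).1 A0) cA cN.
by exists `|F c| => x Ax; apply: cP; rewrite inE.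
Qed.

End box_bounded.

(** * Integrals of real functions *)

Section real_integrals.
Context d (T : measurableType d) (R : realType) (mu : {measure set T -> \bar R}).
Implicit Types f g : T -> R.

Definition intg f := mu.-integrable [set: T] (EFin \o f).

Lemma intg_measurable f : intg f -> measurable_fun [set: T] f.
Proof. by move/measurable_int/measurable_EFinP. Qed.

Lemma intg_le f g : measurable_fun [set: T] f -> intg g ->
  (forall x, `|f x| <= g x) -> intg f.
Proof.
move=> mf ig fg; apply: le_integrable ig => //; first exact/measurable_EFinP.
by move=> x _ /=; rewrite lee_fin (le_trans (fg x))// ler_norm.
Qed.

Lemma intgD f g : intg f -> intg g -> intg (fun x => f x + g x).
Proof. by move=> fi gi; have := integrableD measurableT fi gi. Qed.

Lemma intgN f : intg f -> intg (fun x => - f x).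
Proof. by move=> fi; have := integrableN fi. Qed.

Lemma intgB f g : intg f -> intg g -> intg (fun x => f x - g x).
Proof. by move=> fi gi; have := integrableB measurableT fi gi. Qed.

Lemma intgZ (c : R) f : intg f -> intg (fun x => c * f x).
Proof. by move=> fi; have := integrableZl measurableT c fi. Qed.

Lemma intg0 : intg (fun=> 0).
Proof. exact: integrable0. Qed.

Lemma intg_norm f : intg f -> intg (fun x => `|f x|).
Proof. by move=> fi; have := integrable_abse fi. Qed.

Lemma intg_sum (I : Type) (s : seq I) (P : pred I) (h : I -> T -> R) :
  (forall i, P i -> intg (h i)) -> intg (fun x => \sum_(i <- s | P i) h i x).
Proof.
move=> hi; elim: s => [|i s IH].
  rewrite (_ : (fun _ => _) = fun=> 0); first exact: intg0.
  by rewrite funeqE => x; rewrite big_nil.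
case Pi : (P i); last first.
  rewrite (_ : (fun _ => _) = (fun x => \sum_(j <- s | P j) h j x)) //.
  by rewrite funeqE => x; rewrite big_cons Pi.
rewrite (_ : (fun _ => _) = (fun x => h i x + \sum_(j <- s | P j) h j x)).
  by apply: intgD => //; exact: hi.
by rewrite funeqE => x; rewrite big_cons Pi.
Qed.

Lemma Rint_sum (I : Type) (s : seq I) (P : pred I) (h : I -> T -> R) :
  (forall i, P i -> intg (h i)) ->
  \int[mu]_x (\sum_(i <- s | P i) h i x) = \sum_(i <- s | P i) \int[mu]_x h i x.
Proof.
move=> hi; elim: s => [|i s IH].
  under eq_Rintegral do rewrite big_nil.
  by rewrite big_nil /Rintegral integral0.
rewrite big_cons; case Pi : (P i); last first.
  by rewrite -IH; apply: eq_Rintegral => x _; rewrite big_cons Pi.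
under eq_Rintegral do rewrite big_cons Pi.
by rewrite RintegralD//; [rewrite IH|exact: hi|exact: intg_sum].
Qed.

Lemma RintD f g : intg f -> intg g ->
  \int[mu]_x (f x + g x) = \int[mu]_x f x + \int[mu]_x g x.
Proof. by move=> fi gi; rewrite RintegralD. Qed.

Lemma RintB f g : intg f -> intg g ->
  \int[mu]_x (f x - g x) = \int[mu]_x f x - \int[mu]_x g x.
Proof. by move=> fi gi; rewrite RintegralB. Qed.

Lemma RintZ (c : R) f : intg f -> \int[mu]_x (c * f x) = c * \int[mu]_x f x.
Proof. by move=> fi; rewrite RintegralZl. Qed.

Lemma RintN f : intg f -> \int[mu]_x (- f x) = - \int[mu]_x f x.
Proof.
move=> fi; rewrite -mulN1r -RintZ//; apply: eq_Rintegral => x _.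
by rewrite mulN1r.
Qed.

Lemma Rint_le f g : intg f -> intg g -> (forall x, f x <= g x) ->
  \int[mu]_x f x <= \int[mu]_x g x.
Proof. by move=> fi gi fg; apply: le_Rintegral. Qed.

Lemma Rint_EFin f : intg f -> (\int[mu]_x f x)%:E = (\int[mu]_x (f x)%:E)%E.
Proof.
by move=> fi; rewrite /Rintegral fineK//; exact: integrable_fin_num.
Qed.

Lemma Rint_norm_le f g : intg f -> intg g -> (forall x, `|f x| <= g x) ->
  `|\int[mu]_x f x| <= \int[mu]_x g x.
Proof.
move=> fi gi fg; apply: le_trans (le_normr_Rintegral _ _) _ => //.
by apply: Rint_le => //; exact: intg_norm.
Qed.

Lemma intg_ge0P f : measurable_fun [set: T] f -> (forall x, 0 <= f x) ->
  (\int[mu]_x (f x)%:E < +oo)%E -> intg f.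
Proof.
move=> mf f0 foo; apply/integrableP; split; first exact/measurable_EFinP.
by under eq_integral do rewrite /= ger0_norm//.
Qed.

Lemma Rint_dct (f_ : nat -> T -> R) f g : (forall k, measurable_fun [set: T] (f_ k)) ->
  measurable_fun [set: T] f -> intg g -> (forall k x, `|f_ k x| <= g x) ->
  (forall x, (fun k => f_ k x) @ \oo --> f x) ->
  (fun k => \int[mu]_x f_ k x) @ \oo --> \int[mu]_x f x.
Proof.
move=> mf_ mf ig fg ff.
have [| | | | |ifn _ cv] := @dominated_convergence _ _ _ mu setT measurableT
  (fun k x => (f_ k x)%:E) (EFin \o f) (EFin \o g).
- by move=> k; exact/measurable_EFinP.
- exact/measurable_EFinP.
- by apply: aeW => x _; apply: cvg_EFin; [exact: nearW|exact: ff].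
- exact: ig.
- by apply: aeW => x k _ /=; rewrite lee_fin.
apply: fine_cvg; rewrite fineK; last exact: integrable_fin_num.
exact: cv.
Qed.

(** Bounds on truncated integrals pass to the limit, without knowing beforehand
    that the limit is integrable: this is how all cutoffs are removed. *)
Lemma fatou_le (f_ : nat -> T -> R) f (c_ : nat -> R) c :
  (forall k, measurable_fun [set: T] (f_ k)) -> (forall k x, 0 <= f_ k x) ->
  (forall x, (fun k => f_ k x) @ \oo --> f x) ->
  (forall k, (\int[mu]_x (f_ k x)%:E <= (c_ k)%:E)%E) -> c_ @ \oo --> c ->
  (\int[mu]_x (f x)%:E <= c%:E)%E.
Proof.
move=> mf f0 ff fc cc.
have := @fatou _ _ _ mu setT measurableT (fun k x => (f_ k x)%:E)
  (fun k => (measurable_EFinP _ _).2 (mf k)) (fun k x _ => f0 k x).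
rewrite (_ : \int[mu]_x _ = \int[mu]_x (f x)%:E)%E; last first.
  apply: eq_integral => x _; rewrite is_cvg_limn_einfE.
    by apply/cvg_lim => //; apply: cvg_EFin; [exact: nearW|exact: ff].
  by apply/cvg_ex; exists (f x)%:E; apply: cvg_EFin; [exact: nearW|exact: ff].
move=> /le_trans; apply.
rewrite (_ : c%:E = limn_einf (fun k => (c_ k)%:E)); last first.
  have cE : (fun k => (c_ k)%:E) @ \oo --> c%:E.
    by apply: cvg_EFin; [exact: nearW|exact: cc].
  rewrite is_cvg_limn_einfE; first exact/esym/cvg_lim.
  by apply/cvg_ex; exists c%:E.
rewrite !limn_einf_lim; apply: lee_lim.
- exact: is_cvg_einfs.
- exact: is_cvg_einfs.
- apply: nearW => k; apply: le_ereal_inf_tmp => _ [m /= km <-].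
  by apply: le_trans (fc m); apply: ereal_inf_lbound; exists m.
Qed.

End real_integrals.

(** * Product measures on column vectors *)

Section cons_integrals.
Context {R : realType}.
Local Notation sfm T := {sigma_finite_measure set T -> \bar R}.
Local Notation mR := (measurableTypeR R).

Lemma cV_cons0 n (z : mR * 'cV[R]_n) : cV_cons z ord0 0 = z.1.
Proof.
transitivity ((col_mx z.1%:M z.2 : 'cV[R]_(1 + n)) (lshift n ord0) 0).
  by congr (col_mx _ _ _ _); apply/val_inj.
by rewrite (col_mxEu (z.1%:M : 'M[R]_1) z.2 ord0 0) mxE.
Qed.

Lemma cV_consS n (z : mR * 'cV[R]_n) i : cV_cons z (lift ord0 i) 0 = z.2 i 0.
Proof.
transitivity ((col_mx z.1%:M z.2 : 'cV[R]_(1 + n)) (rshift 1 i) 0).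
  by congr (col_mx _ _ _ _); apply/val_inj.
exact: (col_mxEd (z.1%:M : 'M[R]_1) z.2 i 0).
Qed.

Lemma cV_eqP n (p q : 'cV[R]_n) : (forall i, p i 0 = q i 0) -> p = q.
Proof. by move=> pq; apply/matrixP => i j; rewrite ord1 pq. Qed.

Lemma measurable_cV_cons n : measurable_fun [set: mR * 'cV[R]_n] (@cV_cons R n).
Proof.
apply: measurable_fun_mx => i j; rewrite (ord1 j).
case: (unliftP ord0 i) => [k ->|->].
  rewrite (_ : (fun x => _) = (fun q : 'cV[R]_n => q k 0 : mR) \o snd).
    by apply: measurableT_comp; [exact: measurable_fun_entry|exact: measurable_snd].
  by rewrite funeqE => z /=; rewrite cV_consS.
rewrite (_ : (fun x => _) = fst); first exact: measurable_fst.
by rewrite funeqE => z /=; rewrite cV_cons0.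
Qed.

Section cons.
Variables (n : nat) (mu : nat -> sfm mR).
Local Notation nu := (cV_prod_measure n (fun i => mu i.+1)).
Local Notation nuS := (cV_prod_measure n.+1 mu).

Lemma ge0_integral_cons (F : 'cV[R]_n.+1 -> \bar R) : measurable_fun setT F ->
  (forall q, 0 <= F q)%E ->
  (\int[nuS]_q F q = \int[mu 0%N \x nu]_z F (cV_cons z))%E.
Proof.
move=> mF F0.
have := @ge0_integral_pushforward _ _ _ _ _ _ (@measurable_cV_cons n)
  (mu 0%N \x nu)%E setT F measurableT mF (fun q _ => F0 q).
by rewrite preimage_setT.
Qed.

Lemma integrable_cons (F : 'cV[R]_n.+1 -> \bar R) : nuS.-integrable setT F ->
  (mu 0%N \x nu)%E.-integrable setT (F \o @cV_cons R n).
Proof.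
move=> /integrableP[mF iF]; apply/integrableP; split.
  by apply: measurableT_comp => //; exact: measurable_cV_cons.
rewrite ge0_integral_cons// in iF.
by apply: measurableT_comp.
Qed.

Lemma integral_cons (F : 'cV[R]_n.+1 -> \bar R) : nuS.-integrable setT F ->
  (\int[nuS]_q F q = \int[mu 0%N \x nu]_z F (cV_cons z))%E.
Proof.
move=> iF.
have := @integral_pushforward _ _ _ _ _ _ (@measurable_cV_cons n)
  (mu 0%N \x nu)%E setT F (measurable_int _ iF) _ measurableT.
by rewrite preimage_setT; apply; exact: integrable_cons.
Qed.

End cons.

Lemma prod_weight_lty n (mu : nat -> sfm mR) (k : nat -> mR -> R) :
  (forall i, measurable_fun setT (k i)) -> (forall i s, 0 <= k i s) ->
  (forall i, \int[mu i]_s (k i s)%:E < +oo)%E ->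
  (\int[cV_prod_measure n mu]_q (\prod_(i < n) k i (q i 0))%:E < +oo)%E.
Proof.
elim: n mu k => [|n IH] mu k mk k0 koo.
  rewrite (_ : \int[_]_q _ = \int[cV_prod_measure 0 mu]_q (cst 1%:E q))%E.
    by rewrite integral_cst//= diracT mule1 ltry.
  by apply: eq_integral => q _; rewrite big_ord0.
have mkk m (kk : nat -> mR -> R) : (forall i, measurable_fun setT (kk i)) ->
    measurable_fun [set: 'cV[R]_m] (fun q => \prod_(i < m) kk i (q i 0)).
  move=> mkk; apply: measurable_prod => i _.
  by apply: (measurableT_comp (mkk i)); exact: measurable_fun_entry.
have kk0 m (kk : nat -> mR -> R) : (forall i s, 0 <= kk i s) ->
    forall q : 'cV[R]_m, 0 <= \prod_(i < m) kk i (q i 0).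
  by move=> kk0 q; apply: prodr_ge0 => i _.
rewrite ge0_integral_cons; last 2 first.
- by apply/measurable_EFinP; exact: mkk.
- by move=> q; rewrite lee_fin; exact: kk0.
have E z : (\prod_(i < n.+1) k i (cV_cons z i 0))%:E =
    ((k 0%N z.1)%:E * (\prod_(i < n) k i.+1 (z.2 i 0))%:E)%E.
  rewrite big_ord_recl cV_cons0 EFinM; congr (_ * _%:E)%E.
  by apply: eq_bigr => i _; rewrite cV_consS.
under eq_integral do rewrite E.
have mK : measurable_fun [set: 'cV[R]_n]
    (fun q => (\prod_(i < n) k i.+1 (q i 0))%:E).
  by apply/measurable_EFinP; apply: (mkk n (fun i => k i.+1)).
rewrite fubini_tonelli1/=; last 2 first.
- apply: emeasurable_funM.
    apply/measurable_EFinP; apply: (measurableT_comp (mk 0%N)).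
    exact: measurable_fst.
  exact: (measurableT_comp mK measurable_snd).
- move=> z; rewrite mule_ge0// lee_fin//.
  exact: (kk0 n (fun i => k i.+1)).
under eq_integral => s _.
  rewrite /fubini_F/= ge0_integralZl//; last 2 first.
  - by move=> q _; rewrite lee_fin; exact: (kk0 n (fun i => k i.+1)).
  - by rewrite lee_fin.
  over.
rewrite ge0_integralZr//; last 3 first.
- exact/measurable_EFinP.
- by move=> s _; rewrite lee_fin.
- apply: integral_ge0 => q _; rewrite lee_fin; exact: (kk0 n (fun i => k i.+1)).
apply: lte_mul_pinfty => //.
- by apply: integral_ge0 => s _; rewrite lee_fin.
- rewrite ge0_fin_numE; first exact: koo.
  by apply: integral_ge0 => s _; rewrite lee_fin.
- exact: (IH (fun i => mu i.+1) (fun i => k i.+1)).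
Qed.

Definition upd n (q : 'cV[R]_n) (i : 'I_n) (s : R) : 'cV[R]_n :=
  q + (s - q i 0) *: delta_mx i 0.

Lemma updE n (q : 'cV[R]_n) i s j : upd q i s j 0 = if j == i then s else q j 0.
Proof.
rewrite /upd !mxE eqxx andbT; case: eqP => [->|_]; last by rewrite mulr0 addr0.
by rewrite mulr1 addrC subrK.
Qed.

(** By induction on the dimension, splitting off the first coordinate; applied to
    a partial derivative, this is the divergence theorem. *)
Lemma integral_eq0_coord n (mu : nat -> sfm mR) (i : 'I_n) (F : 'cV[R]_n -> \bar R) :
  (cV_prod_measure n mu).-integrable setT F ->
  (forall q, \int[mu i]_s F (upd q i s) = 0)%E ->
  (\int[cV_prod_measure n mu]_q F q = 0)%E.
Proof.
elim: n mu i F => [|n IH] mu i F iF F0; first by case: i F0.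
rewrite integral_cons//.
have iC := integrable_cons iF.
case: (unliftP ord0 i) => [j ij|i0].
  rewrite -integral12_prod_meas1//.
  apply: (@etrans _ _ (\int[mu 0%N]_s 0)%E); last by rewrite integral0.
  apply: ae_eq_integral => //.
    exact: measurable_fubini_F iC.
  have [N [mN N0 NP]] := ae_integrable1 iC.
  exists N; split => // s /= ns; apply: NP => /= h; apply: ns => _.
  rewrite /fubini_F; apply: (IH (fun i => mu i.+1) j (fun q => F (cV_cons (s, q)))).
    exact: h.
  move=> q; have := F0 (cV_cons (s, q)); rewrite ij lift0 => <-.
  apply: eq_integral => s' _; congr F; apply: cV_eqP => k.
  rewrite updE; case: (unliftP ord0 k) => [l ->|->].
    rewrite cV_consS updE (inj_eq lift_inj).
    by case: eqP => // _; rewrite cV_consS.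
  by rewrite cV_cons0 (negbTE (neq_lift _ _)) cV_cons0.
rewrite -integral21_prod_meas1//.
apply: (@etrans _ _ (\int[cV_prod_measure n (fun i => mu i.+1)]_s 0)%E); last first.
  by rewrite integral0.
apply: eq_integral => q _; rewrite /fubini_G/=.
have := F0 (cV_cons (0, q)); rewrite i0 /= => <-.
apply: eq_integral => s _; congr F; apply: cV_eqP => k.
rewrite updE; case: (unliftP ord0 k) => [l ->|->].
  by rewrite !cV_consS eq_sym (negbTE (neq_lift _ _)).
by rewrite cV_cons0 eqxx.
Qed.

Lemma measurable_oppcV n : measurable_fun [set: 'cV[R]_n] (fun q => - q).
Proof.
apply: measurable_fun_mx => i j; rewrite ord1.
rewrite (_ : (fun x => _) = (fun q : 'cV[R]_n => - (q i 0))).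
  by apply: measurableT_comp => //; exact: measurable_fun_entry.
by rewrite funeqE => q; rewrite mxE.
Qed.

Lemma ge0_integral_opp_lebesgue (F : mR -> \bar R) : measurable_fun setT F ->
  (forall s, 0 <= F s)%E ->
  (\int[lebesgue_measure]_s F (- s)%R = \int[lebesgue_measure]_s F s)%E.
Proof.
move=> mF F0.
have mopp : measurable_fun [set: mR] (-%R : mR -> mR) by [].
have := @ge0_integral_pushforward _ _ _ _ _ _ mopp lebesgue_measure setT F
  measurableT mF (fun q _ => F0 q).
rewrite preimage_setT => <-.
by apply: eq_measure_integral => //= A mA _; exact: lebesgue_measureN.
Qed.

Lemma ge0_integral_opp n (F : 'cV[R]_n -> \bar R) : measurable_fun setT F ->
  (forall q, 0 <= F q)%E ->
  (\int[lebesgue_cV R n]_q F (- q)%R = \int[lebesgue_cV R n]_q F q)%E.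
Proof.
elim: n F => [|n IH] F mF F0.
  apply: eq_integral => q _; congr F; apply: cV_eqP.
  by case.
have mFo : measurable_fun setT (fun q : 'cV[R]_n.+1 => F (- q)).
  exact: (measurableT_comp mF (@measurable_oppcV n.+1)).
rewrite /lebesgue_cV !ge0_integral_cons//.
have mFc : measurable_fun setT (F \o @cV_cons R n).
  by apply: measurableT_comp => //; exact: measurable_cV_cons.
have consN s q : - (cV_cons (s, q) : 'cV[R]_n.+1) = cV_cons (- s, - q).
  apply: cV_eqP => k; rewrite mxE; case: (unliftP ord0 k) => [l ->|->].
    by rewrite !cV_consS mxE.
  by rewrite !cV_cons0.
rewrite fubini_tonelli1//=; last first.
  by apply: (measurableT_comp mFo); exact: measurable_cV_cons.
rewrite [RHS]fubini_tonelli1//=.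
rewrite -[RHS]ge0_integral_opp_lebesgue; last 2 first.
- exact: measurable_fun_fubini_tonelli_F.
- by move=> s; apply: integral_ge0.
apply: eq_integral => s _; rewrite /fubini_F/=.
under eq_integral do rewrite consN.
apply: (IH (fun q => F (cV_cons (- s, q)))) => //.
exact: (measurableT_comp mFc (measurable_pair1 _)).
Qed.

Lemma integral_odd n (F : 'cV[R]_n -> R) : intg (lebesgue_cV R n) F ->
  (forall q, F (- q) = - F q) -> \int[lebesgue_cV R n]_q F q = 0.
Proof.
move=> iF oF; have mF := intg_measurable iF.
have E : (\int[lebesgue_cV R n]_q (EFin \o F)^\- q =
          \int[lebesgue_cV R n]_q (EFin \o F)^\+ q)%E.
  rewrite -(@ge0_integral_opp n ((EFin \o F)^\-)%E)//; last first.
    exact/measurable_funeneg/measurable_EFinP.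
  by apply: eq_integral => q _; rewrite funenegE funeposE /= oF opprK.
rewrite /Rintegral integralE E subee//.
exact: integrable_pos_fin_num.
Qed.

End cons_integrals.

(** * Weights and periodicity on the phase space *)

Section line_and_circle.
Context {R : realType}.
Local Notation mR := (measurableTypeR R).
Local Notation leb := (@lebesgue_measure R).

Lemma integral_circle (f : mR -> \bar R) : measurable_fun [set: mR] f ->
  (\int[@circle_measure R]_s f s = \int[leb]_(s in `[0%R, (2 * pi)%R[) f s)%E.
Proof.
move=> mf; pose D : set mR := `[0%R, (2 * pi)%R[%classic.
have mD : measurable D by exact: measurable_itv.
transitivity (\int[@circle_measure R]_s (f \_ D) s)%E.
  apply: ae_eq_integral => //.
    by apply/(measurable_restrictT _ _).1 => //; exact: measurable_funTS.
  exists (~` D); split; first exact: measurableC.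
    by change (leb (~` D `&` D) = 0)%E; rewrite setICl measure0.
  move=> s /= ns Ds; apply: ns => _; rewrite patchE mem_set//.
rewrite -integral_mkcond.
apply: eq_measure_integral => A mA AD.
by change (leb (A `&` D) = leb A); rewrite setIidl.
Qed.

Lemma integral_derive_circle (g g' : R -> R) :
  (forall s, is_derive s (1 : R) g (g' s)) -> continuous g' -> g (2 * pi) = g 0 ->
  (\int[@circle_measure R]_s (g' s)%:E = 0)%E.
Proof.
move=> gg' cg' per.
have cg : continuous g.
  move=> s; apply: differentiable_continuous; apply/derivable1_diffP.
  by have [] := gg' s.
have mg' : measurable_fun [set: mR] (fun s => (g' s)%:E).
  by apply/measurable_EFinP; exact: continuous_measurable_fun.
rewrite integral_circle// integral_itv_bndo_bndc; last exact: measurable_funTS.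
rewrite (@continuous_FTC2 _ g' g)//.
- by rewrite per subee.
- by rewrite mulr_gt0// pi_gt0.
- exact: continuous_subspaceT.
- split=> [x _||].
  + by have [] := gg' x.
  + exact: cvg_at_right_filter (cg _).
  + exact: cvg_at_left_filter (cg _).
- by move=> x _; rewrite derive1E; have [_ ->] := gg' x.
Qed.

Lemma integral_derive_line (g g' : R -> R) (c : R) :
  (forall s, is_derive s (1 : R) g (g' s)) -> continuous g' ->
  (forall s, c < `|s| -> g s = 0) ->
  (\int[leb]_s (g' s)%:E = 0)%E.
Proof.
move=> gg' cg' g0.
have cg : continuous g.
  move=> s; apply: differentiable_continuous; apply/derivable1_diffP.
  by have [] := gg' s.
have g'0 s : c < `|s| -> g' s = 0.
  move=> cs; have [_ <-] := gg' s.
  transitivity ('D_1 (cst 0 : R -> R) s); last exact: derive_cst.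
  apply: near_eq_derive.
  have : \forall t \near s, c < `|t|.
    exact: (cvgr_gt _ (@norm_continuous _ _ s) _ cs).
  by apply: filterS => t /g0.
pose b := `|c| + 1.
have b0 : 0 < b by rewrite ltr_wpDl.
have cb : c < b by rewrite (le_lt_trans (ler_norm c))// ltrDl.
transitivity (\int[leb]_(s in `[(- b)%R, b]) (g' s)%:E)%E.
  rewrite [RHS]integral_mkcond; apply: eq_integral => s _.
  rewrite patchE; case: ifPn => // sb; rewrite g'0//.
  rewrite ltNge; apply: contra sb => sc; rewrite inE/= in_itv/= -ler_norml.
  by rewrite (le_trans sc)// ltW.
rewrite (@continuous_FTC2 _ g' g)//.
- by rewrite !g0 ?subee// ?normrN gtr0_norm.
- by rewrite (lt_trans _ b0)// oppr_lt0.
- exact: continuous_subspaceT.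
- split=> [x _||].
  + by have [] := gg' x.
  + exact: cvg_at_right_filter (cg _).
  + exact: cvg_at_left_filter (cg _).
- by move=> x _; rewrite derive1E; have [_ ->] := gg' x.
Qed.

Lemma integral_lorentz_lty : (\int[leb]_s ((1 + s ^+ 2)^-1)%:E < +oo)%E.
Proof.
rewrite (@ge0_symfun_integralT _ (fun s : R => (1 + s ^+ 2)^-1)).
- rewrite -set_itvcy.
  rewrite (_ : \int[_]_(x in _) _ =
    \int[leb]_(x in `[0%R, +oo[) (oneDsqr x)^-1%:E)%E; last by [].
  by rewrite integral0y_oneDsqr -EFinM ltry.
- by move=> s; rewrite invr_ge0 addr_ge0// sqr_ge0.
- exact: continuous_oneDsqrV.
- by move=> s /=; rewrite sqrrN.
Qed.

End line_and_circle.

Section phase_space.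
Context {R : realType} (n r : nat).
Local Notation cV := 'cV[R]_n.
Local Notation phase := (cV * cV)%type.
Local Notation mR := (measurableTypeR R).
Local Notation mq := (position_measure R n r).
Local Notation mp := (lebesgue_cV R n).
Local Notation mx := (phase_measure R n r).

(** An integrable weight, Lorentzian in the Euclidean coordinates and constant in
    the angles. *)
Definition qweight (q : cV) : R :=
  \prod_(i < n) (if angle r i then 1 else (1 + q i 0 ^+ 2)^-1).
Definition pweight (p : cV) : R := \prod_(i < n) (1 + p i 0 ^+ 2)^-1.
Definition weight (x : phase) : R := qweight x.1 * pweight x.2.

Let one_le (s : R) : 1 <= 1 + s ^+ 2.
Proof. by rewrite lerDl sqr_ge0. Qed.

Lemma qweight_gt0 q : 0 < qweight q.
Proof.
apply: prodr_gt0 => i _; case: ifPn => // _.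
by rewrite invr_gt0 (lt_le_trans _ (one_le _)).
Qed.

Lemma pweight_gt0 p : 0 < pweight p.
Proof. by apply: prodr_gt0 => i _; rewrite invr_gt0 (lt_le_trans _ (one_le _)). Qed.

Lemma weight_gt0 x : 0 < weight x.
Proof. by rewrite mulr_gt0 ?qweight_gt0 ?pweight_gt0. Qed.

Lemma qweight_le1 q : qweight q <= 1.
Proof.
apply: Num.Theory.prodr_ile1 => i _; case: ifPn => // _; first by rewrite ler01 lexx.
by rewrite invr_ge0 (le_trans ler01)//= invf_le1// (lt_le_trans _ (one_le _)).
Qed.

Lemma pweight_le1 p : pweight p <= 1.
Proof.
apply: Num.Theory.prodr_ile1 => i _.
by rewrite invr_ge0 (le_trans ler01)//= invf_le1// (lt_le_trans _ (one_le _)).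
Qed.

Lemma weight_le1 x : weight x <= 1.
Proof.
rewrite -[1](mulr1 1).
by apply: ler_pM; rewrite ?qweight_le1 ?pweight_le1// ltW// ?qweight_gt0 ?pweight_gt0.
Qed.

Let C1_lorentz (i : 'I_n) : C1 (fun p : cV => (1 + p i 0 ^+ 2)^-1).
Proof.
apply: C1V => [p|]; first by rewrite gt_eqF// (lt_le_trans _ (one_le _)).
by apply: C1D; [exact: C1_cst|apply: C1M; exact: C1_entry].
Qed.

Lemma continuous_qweight : continuous qweight.
Proof.
apply: C1_continuous; apply: C1_prod => i _.
by case: (boolP (angle r i)) => _; [exact: C1_cst|exact: C1_lorentz].
Qed.

Lemma continuous_pweight : continuous pweight.
Proof. by apply: C1_continuous; apply: C1_prod => i _; exact: C1_lorentz. Qed.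

Lemma continuous_weight : continuous weight.
Proof.
move=> x; apply: cvgM.
  by apply: (@continuous_comp _ _ _ fst qweight); [exact: cvg_fst|exact: continuous_qweight].
by apply: (@continuous_comp _ _ _ snd pweight); [exact: cvg_snd|exact: continuous_pweight].
Qed.

Lemma intg_pweight : intg mp pweight.
Proof.
apply: intg_ge0P.
- exact: (continuous_measurable_cV continuous_pweight).
- by move=> p; exact/ltW/pweight_gt0.
- rewrite /pweight /lebesgue_cV.
  apply: (@prod_weight_lty R n (fun=> lebesgue_measure) (fun _ s => (1 + s ^+ 2)^-1)).
  + move=> i; apply: continuous_measurable_fun; exact: continuous_oneDsqrV.
  + by move=> i s; rewrite invr_ge0 addr_ge0// sqr_ge0.
  + by move=> i; exact: integral_lorentz_lty.
Qed.

Lemma intg_qweight : intg mq qweight.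
Proof.
apply: intg_ge0P.
- exact: (continuous_measurable_cV continuous_qweight).
- by move=> q; exact/ltW/qweight_gt0.
- rewrite /qweight /position_measure.
  apply: (@prod_weight_lty R n _ (fun i s => if (n - r <= i)%N then 1 else (1 + s ^+ 2)^-1)).
  + move=> i; case: (boolP (n - r <= i)%N) => // _.
    by apply: continuous_measurable_fun; exact: continuous_oneDsqrV.
  + by move=> i s; case: ifPn => // _; rewrite invr_ge0 addr_ge0// sqr_ge0.
  + move=> i; have [_|_] := ltnP i (n - r).
      exact: integral_lorentz_lty.
    rewrite integral_cst// mul1e ltey_eq fin_num_measure//.
Qed.

Lemma continuous_measurable_x (F : phase -> R) : continuous F ->
  measurable_fun [set: phase] F.
Proof. exact: continuous_measurable_phase. Qed.

Lemma intg_weight : intg mx weight.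
Proof.
apply: intg_ge0P.
- exact: (continuous_measurable_x continuous_weight).
- by move=> q; exact/ltW/weight_gt0.
- rewrite /phase_measure fubini_tonelli1/=; last 2 first.
  + by apply/measurable_EFinP; exact: (continuous_measurable_x continuous_weight).
  + by move=> x; rewrite lee_fin ltW// weight_gt0.
  under eq_integral => q _.
    rewrite /fubini_F/= /weight/=.
    under eq_integral do rewrite EFinM.
    rewrite ge0_integralZl//; last 3 first.
    - by apply/measurable_EFinP; exact: (continuous_measurable_cV continuous_pweight).
    - by move=> p _; rewrite lee_fin ltW// pweight_gt0.
    - by rewrite lee_fin ltW// qweight_gt0.
    rewrite -Rint_EFin; last exact: intg_pweight.
    over.
  rewrite ge0_integralZr//.
  + rewrite -Rint_EFin; last exact: intg_qweight.
    by rewrite -EFinM ltry.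
  + by apply/measurable_EFinP; exact: (continuous_measurable_cV continuous_qweight).
  + by move=> q _; rewrite lee_fin ltW// qweight_gt0.
  + by rewrite lee_fin Rintegral_ge0// => p _; rewrite ltW// pweight_gt0.
Qed.

Lemma intg_weight_le (F : phase -> R) (c : R) : continuous F ->
  (forall x, `|F x| <= c * weight x) -> intg mx F.
Proof.
move=> cF Fw; apply: intg_le (intgZ c intg_weight) _ => //.
exact: continuous_measurable_x.
Qed.

(** ** Periodicity in the angles and compact supports *)

Definition enorm (x : phase) : R := `|(euclidean_part r x.1, x.2)|.

Lemma enorm_ge0 x : 0 <= enorm x. Proof. exact: normr_ge0. Qed.

Lemma enorm_entryq (x : phase) (i : 'I_n) : ~~ angle r i -> `|x.1 i 0| <= enorm x.
Proof.
move=> ai; rewrite /enorm prod_normE/= le_max; apply/orP; left.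
by apply: le_trans (entry_le_norm _ i); rewrite mxE (negbTE ai).
Qed.

Lemma enorm_snd (x : phase) : `|x.2| <= enorm x.
Proof. by rewrite /enorm prod_normE/= le_max lexx orbT. Qed.

Lemma enorm_entryp (x : phase) (i : 'I_n) : `|x.2 i 0| <= enorm x.
Proof. exact: le_trans (entry_le_norm _ i) (enorm_snd x). Qed.

(** Each of the at most [2 n] Lorentzian factors costs a power two: rapid decay
    in the Euclidean coordinates therefore gives domination by the weight. *)
Lemma weight_enorm x : (weight x)^-1 <= (1 + enorm x) ^+ (4 * n).
Proof.
have e0 := enorm_ge0 x.
have h (s : R) : `|s| <= enorm x -> 1 + s ^+ 2 <= (1 + enorm x) ^+ 2.
  move=> sx; rewrite -[s ^+ 2]real_normK ?num_real// sqrrD expr1n -addrA lerD2l mul1r.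
  by rewrite ler_wpDl ?mulrn_wge0// lerXn2r// nnegrE.
have big (k : 'I_n -> R) : (forall i, 0 <= k i <= (1 + enorm x) ^+ 2) ->
    \prod_(i < n) k i <= (1 + enorm x) ^+ (2 * n).
  move=> kx; rewrite exprM -[n in X in _ <= X]card_ord -prodr_const.
  by apply: ler_prod => i _; exact: kx.
rewrite /weight invfM.
rewrite (_ : (4 * n = 2 * n + 2 * n)%N); last by rewrite -mulnDl.
rewrite exprD /qweight /pweight -!prodfV; apply: ler_pM.
- apply: prodr_ge0 => i _; rewrite invr_ge0; case: ifPn => // _.
  by rewrite invr_ge0 (le_trans ler01).
- by apply: prodr_ge0 => i _; rewrite invrK (le_trans ler01).
- apply: big => i; case: ifPn => [_|ai].
    by rewrite invr1 ler01/= exprn_ege1// lerDl.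
  by rewrite invrK (le_trans ler01)//= h// enorm_entryq.
- by apply: big => i; rewrite invrK (le_trans ler01)//= h// enorm_entryp.
Qed.

Definition periodic (F : phase -> R) : Prop := qperiodic r (fun q p => F (q, p)).
Definition bounded_support (F : phase -> R) : Prop :=
  exists c : R, forall x, c < enorm x -> F x = 0.

(** Angles are brought back to the period that the measure charges, where
    compactness applies. *)
Definition reduce (q : cV) : cV :=
  \col_i (if angle r i then q i 0 - 2 * pi * (Num.floor (q i 0 / (2 * pi)))%:~R
          else q i 0).

Lemma qperiodic_int (T : Type) (phi : cV -> T) (i : 'I_n) (z : int) q :
  qperiodic r phi -> angle r i -> phi (q + (2 * pi * z%:~R) *: delta_mx i 0) = phi q.
Proof.
move=> per ai.
have pos (m : nat) q' : phi (q' + (2 * pi * m%:R) *: delta_mx i 0) = phi q'.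
  elim: m q' => [|m IH] q'; first by rewrite mulr0 scale0r addr0.
  by rewrite -[m.+1%:R]natr1 mulrDr mulr1 scalerDl addrA per// IH.
case: z => m; first exact: pos.
rewrite -[in RHS](subrK ((2 * pi * m.+1%:R) *: delta_mx i 0) q).
rewrite NegzE mulrNz mulrN scaleNr.
by rewrite pos.
Qed.

Lemma qperiodic_reduce (T : Type) (phi : cV -> T) q : qperiodic r phi ->
  phi (reduce q) = phi q.
Proof.
move=> per.
pose sh i := if angle r i then
    (2 * pi * (- Num.floor (q i 0 / (2 * pi)))%:~R) *: delta_mx i 0 else 0 : cV.
have -> : reduce q = q + \sum_(i < n) sh i.
  apply: cV_eqP => i; rewrite !mxE summxE (bigD1 i)//= big1 ?addr0.
    rewrite /sh; case: ifPn => _; last by rewrite mxE addr0.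
    by rewrite !mxE !eqxx mulr1 mulrNz mulrN.
  move=> j ji; rewrite /sh; case: ifPn => _; last by rewrite mxE.
  by rewrite !mxE eq_sym (negbTE ji) mulr0.
elim: (index_enum _) => [|i s IH]; first by rewrite big_nil addr0.
rewrite big_cons addrCA addrC /sh; case: ifPn => ai; last by rewrite addr0.
by rewrite qperiodic_int.
Qed.

Lemma reduce_angle q i : angle r i -> 0 <= reduce q i 0 < 2 * pi.
Proof.
move=> ai; rewrite mxE ai.
have p0 : (0 : R) < 2 * pi by rewrite mulr_gt0// pi_gt0.
have /andP[h1 h2] := floor_itv (q i 0 / (2 * pi)).
rewrite ler_pdivlMr// in h1; rewrite ltr_pdivrMr// intrD in h2.
by rewrite subr_ge0 mulrC h1/= ltrBlDl -[X in _ < _ + X]mul1r -mulrDl.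
Qed.

Lemma phase_box_compact (c : R) : compact ([set q : cV | forall i, `|q i 0| <= c] `*`
   [set p : cV | forall i, `|p i 0| <= c]).
Proof. by apply: compact_setX; exact: cV_box_compact. Qed.

(** Reducing the angles to one period leaves a compact box. *)
Lemma periodic_bounded (F : phase -> R) (c : R) : continuous F -> periodic F ->
  exists C : R, forall x, enorm x <= c -> `|F x| <= C.
Proof.
move=> cF pF; pose b := Num.max c (2 * pi).
have [C CP] := continuous_bounded_compact (@phase_box_compact b) cF.
exists C => -[q p] xc.
have := congr1 (fun g => g p) (qperiodic_reduce q pF) => /= <-.
apply: CP; split => i /=.
  case: (boolP (angle r i)) => ai.
    have /andP[h1 h2] := reduce_angle q ai.
    by rewrite ger0_norm// le_max (ltW h2) orbT.
  rewrite mxE (negbTE ai) le_max (le_trans _ xc)//.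
  exact: (@enorm_entryq (q, p)).
by rewrite le_max (le_trans _ xc)//; exact: (@enorm_entryp (q, p)).
Qed.

Lemma intg_bounded_support (F : phase -> R) : continuous F -> periodic F ->
  bounded_support F -> intg mx F.
Proof.
move=> cF pF [c Fc].
have cW : continuous (fun x => F x / weight x).
  move=> x; apply: cvgM; first exact: cF.
  by apply: cvgV; [rewrite gt_eqF// weight_gt0|exact: continuous_weight].
have pW : periodic (fun x => F x / weight x).
  move=> i ai q; apply/funext => p /=.
  have -> : F (q + (2 * pi) *: delta_mx i 0, p) = F (q, p).
    exact: (congr1 (fun g => g p) (pF i ai q)).
  congr (_ / (_ * _)); rewrite /qweight; apply: eq_bigr => j _.
  case: ifPn => // aj; rewrite !mxE.
  by case: eqP => [ji|_]; [rewrite ji ai in aj|rewrite mulr0 addr0].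
have [C CP] := periodic_bounded c cW pW.
apply: (@intg_weight_le _ (Num.max C 0)) => // x.
have w0 := weight_gt0 x.
have [xc|cx] := leP (enorm x) c; last first.
  by rewrite Fc// normr0 mulr_ge0 ?(ltW w0)// le_max lexx orbT.
have := CP _ xc; rewrite normrM normfV (gtr0_norm w0) ler_pdivrMr// => /le_trans; apply.
by rewrite ler_wpM2r ?(ltW w0)// le_max lexx.
Qed.

End phase_space.

(** * The divergence theorem on the phase space *)

Section coordinate_lines.
Context {R : realType} (n : nat).
Local Notation cV := 'cV[R]_n.

Lemma upd_line (q : cV) i s : upd q i s = (q - q i 0 *: delta_mx i 0) + s *: delta_mx i 0.
Proof. by rewrite /upd scalerBl addrAC addrA. Qed.

Lemma is_derive_upd (F : cV -> R) q i s : C1 F ->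
  is_derive s (1 : R) (fun s => F (upd q i s)) ('D_(delta_mx i 0) F (upd q i s)).
Proof.
move=> CF; rewrite (_ : (fun s => _) =
    fun s => F ((q - q i 0 *: delta_mx i 0) + s *: delta_mx i 0)).
  by rewrite upd_line; exact: C1_line.
by rewrite funeqE => t; rewrite upd_line.
Qed.

Lemma continuous_upd (F : cV -> R) q i : continuous F ->
  continuous (fun s => F (upd q i s)).
Proof.
move=> cF s; apply: (@continuous_comp _ _ _ (fun s => upd q i s) F); last exact: cF.
rewrite /upd; apply: cvgD; first exact: cvg_cst.
by apply: cvgZr_tmp; apply: cvgB; [exact: cvg_id|exact: cvg_cst].
Qed.

End coordinate_lines.

Section phase_divergence.
Context {R : realType} (n r : nat).
Local Notation cV := 'cV[R]_n.
Local Notation phase := (cV * cV)%type.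
Local Notation mq := (position_measure R n r).
Local Notation mp := (lebesgue_cV R n).
Local Notation mx := (phase_measure R n r).

Definition dq (i : 'I_n) : phase := (delta_mx i 0, 0).
Definition dp (i : 'I_n) : phase := (0, delta_mx i 0).

Lemma periodic_derive (F : phase -> R) v : periodic r F -> periodic r ('D_v F).
Proof.
move=> pF i ai q; apply/funext => p; rewrite /derive.
set g1 := fun h => h^-1 *: _; set g2 := fun h => h^-1 *: _.
suff -> : g1 = g2 by []; rewrite funeqE => h; rewrite /g1 /g2 /=; congr (_ *: _).
have E q' p' : F (q' + (2 * pi) *: delta_mx i 0, p') = F (q', p').
  exact: (congr1 (fun g => g p') (pF i ai q')).
rewrite E; congr (_ - _).
transitivity (F ((h *: v).1 + (q + (2 * pi) *: delta_mx i 0), (h *: v).2 + p)) => //.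
by rewrite addrA E.
Qed.

Lemma enorm_continuous : continuous (@enorm R n r).
Proof.
move=> x; apply: (@continuous_comp _ _ _
   (fun x : phase => (euclidean_part r x.1, x.2)) (@Num.norm R phase)); last exact: norm_continuous.
suff ce : continuous (fun x : phase => euclidean_part r x.1).
  exact: (cvg_pair (ce x) (@cvg_snd _ _ _ _ _)).
move=> {}x; apply: (@continuous_comp _ _ _ fst (@euclidean_part R n r)); first exact: cvg_fst.
move: (x.1) => q; have FF : Filter (nbhs q) by exact: nbhs_filter.
apply/(@cvgrPdist_le _ _ _ _ FF) => e e0.
apply: (@filterS _ _ FF _ _ _ (@nbhsx_ballx _ _ q e e0)) => q'.
rewrite -ball_normE /= => /ltW qq'; apply: cV_norm_le; first exact: ltW.
move=> i; rewrite !mxE; case: (angle r i); first by rewrite subr0 normr0 ltW.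
by apply: le_trans qq'; have := entry_le_norm (q - q') i; rewrite !mxE.
Qed.

Lemma bounded_support_derive (F : phase -> R) v : bounded_support r F ->
  bounded_support r ('D_v F).
Proof.
move=> [c Fc]; exists c => x cx.
transitivity ('D_v (cst 0 : phase -> R) x); last exact: derive_cst.
apply: near_eq_derive.
have : \forall y \near x, c < enorm r y.
  exact: (cvgr_gt _ (@enorm_continuous x) _ cx).
by apply: filterS => y /Fc.
Qed.

(** Periodicity closes the angles and the bounded support the other coordinates,
    so that integrating by parts leaves no boundary term. *)
Definition testfun (F : phase -> R) :=
  [/\ C1 F, periodic r F & bounded_support r F].

Lemma testfun_intg_derive F v : testfun F -> intg mx ('D_v F).
Proof.
move=> [CF pF sF]; apply: intg_bounded_support.
- exact: C1_continuous_derive.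
- exact: periodic_derive.
- exact: bounded_support_derive.
Qed.

Lemma integral_dq (F : phase -> R) i : testfun F -> \int[mx]_x 'D_(dq i) F x = 0.
Proof.
move=> tF; have iD := testfun_intg_derive (dq i) tF; case: tF => CF pF [c Fc].
rewrite /Rintegral (_ : integral _ _ _ = 0)%E//.
rewrite /phase_measure -integral21_prod_meas1//.
apply: (@etrans _ _ (\int[mp]_s 0)%E); last by rewrite integral0.
apply: ae_eq_integral => //; first exact: measurable_fubini_G iD.
have [N [mN N0 NP]] := ae_integrable2 iD.
exists N; split => // p /= np; apply: NP => /= h; apply: np => _.
rewrite /fubini_G.
apply: (@integral_eq0_coord _ n _ i (fun q => ('D_(dq i) F (q, p))%:E)) => //.
move=> q; have CFp := C1_restrl p CF.
have E s : 'D_(dq i) F (upd q i s, p) = 'D_(delta_mx i 0) (fun q => F (q, p)) (upd q i s).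
  by rewrite derive_pairl.
under eq_integral do rewrite E.
have dF s := is_derive_upd q i s CFp.
have cF := continuous_upd (q := q) (i := i) (C1_continuous_derive (v := delta_mx i 0) CFp).
case: (boolP (angle r i)) => ai.
  rewrite ltnNge -/(angle r i) ai; apply: (integral_derive_circle dF cF).
  have -> : upd q i (2 * pi) = upd q i 0 + (2 * pi) *: delta_mx i 0.
    by rewrite !upd_line scale0r addr0.
  exact: (congr1 (fun g => g p) (pF i ai _)).
rewrite ltnNge -/(angle r i) ai.
apply: (@integral_derive_line _ _ _ c dF cF) => s cs; apply: Fc.
apply: lt_le_trans cs _.
have := @enorm_entryq _ _ r (upd q i s, p) i ai.
by rewrite /= updE eqxx.
Qed.

Lemma integral_dp_cV (F : cV -> R) (c : R) i : C1 F -> (forall p, c < `|p| -> F p = 0) ->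
  intg mp ('D_(delta_mx i 0) F) -> \int[mp]_p 'D_(delta_mx i 0) F p = 0.
Proof.
move=> CF Fc iD; rewrite /Rintegral (_ : integral _ _ _ = 0)%E//.
apply: (@integral_eq0_coord _ n _ i (fun q => ('D_(delta_mx i 0) F q)%:E)) => //.
move=> p.
have dF s := is_derive_upd p i s CF.
have cF := continuous_upd (q := p) (i := i) (C1_continuous_derive (v := delta_mx i 0) CF).
apply: (@integral_derive_line _ _ _ c dF cF) => s cs; apply: Fc.
apply: lt_le_trans cs _.
by have := entry_le_norm (upd p i s) i; rewrite updE eqxx.
Qed.

Lemma integral_dp (F : phase -> R) i : testfun F -> \int[mx]_x 'D_(dp i) F x = 0.
Proof.
move=> tF; have iD := testfun_intg_derive (dp i) tF; case: tF => CF pF [c Fc].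
rewrite /Rintegral (_ : integral _ _ _ = 0)%E//.
rewrite /phase_measure -integral12_prod_meas1//.
apply: (@etrans _ _ (\int[mq]_s 0)%E); last by rewrite integral0.
apply: ae_eq_integral => //; first exact: measurable_fubini_F iD.
have [N [mN N0 NP]] := ae_integrable1 iD.
exists N; split => // q /= nq; apply: NP => /= h; apply: nq => _.
rewrite /fubini_F.
have E p : 'D_(dp i) F (q, p) = 'D_(delta_mx i 0) (fun p => F (q, p)) p.
  by rewrite derive_pairr.
have iE : intg mp ('D_(delta_mx i 0) (fun p => F (q, p))).
  by apply: eq_integrable h => // p _ /=; rewrite E.
have int0 : \int[mp]_p 'D_(delta_mx i 0) (fun p => F (q, p)) p = 0.
  apply: (@integral_dp_cV _ c) iE; first exact: C1_restrr.
  by move=> p cp; apply: Fc; apply: lt_le_trans cp (enorm_snd r (q, p)).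
apply: (@etrans _ _ (\int[mp]_p ('D_(delta_mx i 0) (fun p => F (q, p)) p)%:E)%E).
  by apply: eq_integral => p _; rewrite E.
exact: (etrans (esym (Rint_EFin iE)) (congr1 EFin int0)).
Qed.

Lemma Rint_fubini (F : phase -> R) : intg mx F ->
  \int[mx]_x F x = \int[mq]_q \int[mp]_p F (q, p).
Proof.
move=> iF; rewrite /Rintegral /phase_measure -integral12_prod_meas1//.
congr fine; apply: ae_eq_integral => //.
- exact: measurable_fubini_F iF.
- apply/measurable_EFinP; apply: (measurableT_comp (fine_measurable measurableT)).
  exact: measurable_fubini_F iF.
have [N [mN N0 NP]] := ae_integrable1 iF.
exists N; split => // q /= nq; apply: NP => /= h; apply: nq => _.
by rewrite /fubini_F fineK//; apply: integrable_fin_num.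
Qed.

End phase_divergence.

(** * Square integrable functions *)

Section near_positive.
Context {R : realType}.
Lemma near_pos (t : R) : 0 < t -> \forall s \near t, 0 < s.
Proof. exact: lt_nbhsr. Qed.

End near_positive.

Section L2.
Context d (T : measurableType d) (R : realType) (mu : {measure set T -> \bar R}).
Implicit Types a b c : T -> R.

Definition L2 a := measurable_fun [set: T] a /\ intg mu (fun x => a x ^+ 2).
Definition ip a b := \int[mu]_x (a x * b x).
Definition nrm a := Num.sqrt (ip a a).

Lemma L2_mul a b : L2 a -> L2 b -> intg mu (fun x => a x * b x).
Proof.
move=> [ma ia] [mb ib]; apply: (intg_le _ (intgD ia ib)).
  exact: measurable_funM.
move=> x; rewrite normrM -[a x ^+ 2]real_normK ?num_real//.
rewrite -[b x ^+ 2]real_normK ?num_real//.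
move: `|a x| `|b x| (normr_ge0 (a x)) (normr_ge0 (b x)) => s t s0 t0.
by have := sqr_ge0 (s - t); have := mulr_ge0 s0 t0; rewrite sqrrB; lra.
Qed.

Lemma L2D a b : L2 a -> L2 b -> L2 (fun x => a x + b x).
Proof.
move=> La Lb; have iab := L2_mul La Lb; case: La Lb => ma ia [mb ib]; split.
  exact: measurable_funD.
rewrite (_ : (fun _ => _) = (fun x => a x ^+ 2 + (2 * (a x * b x) + b x ^+ 2))).
  by apply: intgD => //; apply: intgD => //; exact: intgZ.
by rewrite funeqE => x; ring.
Qed.

Lemma L2Z (k : R) a : L2 a -> L2 (fun x => k * a x).
Proof.
move=> [ma ia]; split; first by apply: measurable_funM.
rewrite (_ : (fun _ => _) = (fun x => k ^+ 2 * a x ^+ 2)); first exact: intgZ.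
by rewrite funeqE => x; rewrite exprMn.
Qed.

Lemma L2B a b : L2 a -> L2 b -> L2 (fun x => a x - b x).
Proof.
move=> La Lb; rewrite (_ : (fun _ => _) = (fun x => a x + (-1) * b x)).
  by apply: L2D => //; exact: L2Z.
by rewrite funeqE => x; rewrite mulN1r.
Qed.

Lemma ip_ge0 a : 0 <= ip a a.
Proof. by apply: Rintegral_ge0 => x _; rewrite -expr2 sqr_ge0. Qed.

Lemma ipC a b : ip a b = ip b a.
Proof. by apply: eq_Rintegral => x _; rewrite mulrC. Qed.

Lemma ipDl a b c : L2 a -> L2 b -> L2 c -> ip (fun x => a x + b x) c = ip a c + ip b c.
Proof.
move=> La Lb Lc; rewrite -RintD; [|exact: L2_mul|exact: L2_mul].
by apply: eq_Rintegral => x _; rewrite mulrDl.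
Qed.

Lemma ipZl k a b : L2 a -> L2 b -> ip (fun x => k * a x) b = k * ip a b.
Proof.
move=> La Lb; rewrite -RintZ; last exact: L2_mul.
by apply: eq_Rintegral => x _; rewrite mulrA.
Qed.

Lemma ipBl a b c : L2 a -> L2 b -> L2 c -> ip (fun x => a x - b x) c = ip a c - ip b c.
Proof.
move=> La Lb Lc; rewrite -RintB; [|exact: L2_mul|exact: L2_mul].
by apply: eq_Rintegral => x _; rewrite mulrBl.
Qed.

Lemma ipDr a b c : L2 a -> L2 b -> L2 c -> ip c (fun x => a x + b x) = ip c a + ip c b.
Proof. by move=> La Lb Lc; rewrite ipC ipDl// ![ip _ c]ipC. Qed.

Lemma ipZr k a b : L2 a -> L2 b -> ip b (fun x => k * a x) = k * ip b a.
Proof. by move=> La Lb; rewrite ipC ipZl// [ip a b]ipC. Qed.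

Lemma ipBr a b c : L2 a -> L2 b -> L2 c -> ip c (fun x => a x - b x) = ip c a - ip c b.
Proof. by move=> La Lb Lc; rewrite ipC ipBl// ![ip _ c]ipC. Qed.

Lemma ip_sqE a : ip a a = \int[mu]_x (a x ^+ 2).
Proof. by apply: eq_Rintegral => x _; rewrite expr2. Qed.

Lemma nrm_ge0 a : 0 <= nrm a. Proof. exact: sqrtr_ge0. Qed.

Lemma nrm_sq a : nrm a ^+ 2 = ip a a. Proof. by rewrite sqr_sqrtr// ip_ge0. Qed.

(** The quadratic polynomial [s |-> |a + s b|^2] is nonnegative. *)
Lemma cauchy_schwarz a b : L2 a -> L2 b -> `|ip a b| <= nrm a * nrm b.
Proof.
move=> La Lb.
have Q s : 0 <= ip a a + 2 * s * ip a b + s ^+ 2 * ip b b.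
  have := ip_ge0 (fun x => a x + s * b x).
  have Lsb := L2Z s Lb; rewrite ipDl ?ipZl//; [|exact: L2D|exact: L2D].
  rewrite ipC ipDl// [ip b _]ipC ipDl// !ipZl//.
  by rewrite [ip b a]ipC => /le_trans; apply; rewrite le_eqVlt; apply/orP; left; apply/eqP; ring.
have A0 := ip_ge0 a; have B0 := ip_ge0 b.
rewrite -(@ler_pXn2r _ 2)// ?nnegrE ?mulr_ge0 ?nrm_ge0//.
rewrite exprMn !nrm_sq real_normK ?num_real//.
move: (ip a a) (ip a b) (ip b b) Q A0 B0 => A C B Q A0 B0.
have [B00|Bn0] := eqVneq B 0.
  have [->|C0] := eqVneq C 0; first by rewrite expr0n/= B00 mulr0.
  have := Q (- (A + 1) / (2 * C)).
  rewrite B00 mulr0 addr0 (_ : 2 * _ * C = - (A + 1)); last by field.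
  by rewrite opprD addrA subrr add0r oppr_ge0 leNgt ltr01.
have Bp : 0 < B by rewrite lt_neqAle eq_sym Bn0.
have := Q (- C / B).
rewrite (_ : _ + _ = A - C ^+ 2 / B); last by field.
by rewrite subr_ge0 ler_pdivrMr.
Qed.

Lemma nrm_triangle a b : L2 a -> L2 b -> nrm (fun x => a x + b x) <= nrm a + nrm b.
Proof.
move=> La Lb; have Lab := L2D La Lb.
rewrite -(@ler_pXn2r _ 2)// ?nnegrE ?addr_ge0 ?nrm_ge0//.
rewrite nrm_sq ipDl// [ip a _]ipC [ip b _]ipC !ipDl// sqrrD !nrm_sq [ip b a]ipC.
rewrite mulr2n; have := le_trans (ler_norm _) (cauchy_schwarz La Lb); lra.
Qed.

Lemma eq_nrm a b : a =1 b -> nrm a = nrm b.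
Proof. by move=> /funext ->. Qed.

Lemma L2_Lfun a : a \in Lfun mu 2%:E -> L2 a.
Proof.
move=> aL; split; last exact: Lfun2_integrable_sqr.
by move: aL; rewrite inE => /andP[+ _]; rewrite inE.
Qed.

Lemma Lnorm_nrm a : L2 a -> Lnorm mu 2%:E (EFin \o a) = (nrm a)%:E.
Proof.
move=> [ma ia]; rewrite unlock.
have E : (\int[mu]_x (`|a x|%:E `^ 2) = (ip a a)%:E)%E.
  rewrite ip_sqE Rint_EFin//; apply: eq_integral => x _.
  by rewrite poweR_EFin powR_mulrn// real_normK ?num_real.
rewrite [X in (X `^ _)%E]E poweR_EFin powR12_sqrt//.
exact: ip_ge0.
Qed.

Lemma Rint_ae a b : measurable_fun setT a -> measurable_fun setT b ->
  {ae mu, forall x, a x = b x} -> \int[mu]_x a x = \int[mu]_x b x.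
Proof.
move=> ma mb ab; congr fine; apply: ae_eq_integral => //.
- exact/measurable_EFinP.
- exact/measurable_EFinP.
- by apply: filterS ab => x -> _.
Qed.

Lemma L2_ae a b : measurable_fun setT b -> {ae mu, forall x, a x = b x} -> L2 a -> L2 b.
Proof.
move=> mb ab [ma ia]; split => //; apply: intg_ge0P.
- exact: measurable_funX.
- by move=> x; exact: sqr_ge0.
move/integrableP : ia => [_]; apply: le_lt_trans.
rewrite le_eqVlt; apply/orP; left; apply/eqP/ae_eq_integral => //.
- by apply/measurable_EFinP; exact: measurable_funX.
- by apply: measurableT_comp => //; apply/measurable_EFinP; exact: measurable_funX.
- by apply: filterS ab => x abx _ /=; rewrite abx ger0_norm// sqr_ge0.
Qed.

Lemma ip_ae a a' b b' : measurable_fun setT a -> measurable_fun setT b ->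
  measurable_fun setT a' -> measurable_fun setT b' ->
  {ae mu, forall x, a x = a' x} -> {ae mu, forall x, b x = b' x} -> ip a b = ip a' b'.
Proof.
move=> ma mb ma' mb' aa bb; apply: Rint_ae.
- exact: measurable_funM.
- exact: measurable_funM.
- by apply: filterS2 aa bb => x -> ->.
Qed.

(** * Differentiable curves in a space of square integrable functions *)

Definition quot (u : R -> T -> R) (t h : R) : T -> R :=
  fun x => h^-1 * (u (t + h) x - u t x).

Definition L2deriv (u : R -> T -> R) (l : T -> R) (t : R) :=
  (fun h => nrm (fun x => quot u t h x - l x)) @ 0^' --> 0.

Lemma L2_quot u t h : L2 (u t) -> L2 (u (t + h)) -> L2 (quot u t h).
Proof. by move=> Lu Luh; apply: L2Z; exact: L2B. Qed.

(** The product rule: the difference quotient of the pairing is a combination of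
    pairings of difference quotients, and Cauchy-Schwarz controls the errors. *)
Lemma ip_derive (u v : R -> T -> R) (l m : T -> R) (t : R) :
  (\forall s \near t, L2 (u s)) -> (\forall s \near t, L2 (v s)) -> L2 l -> L2 m ->
  L2deriv u l t -> L2deriv v m t ->
  is_derive t (1 : R) (fun s => ip (u s) (v s)) (ip l (v t) + ip (u t) m).
Proof.
move=> nu nv Ll Lm du dv.
have Lu := nbhs_singleton nu; have Lv := nbhs_singleton nv.
have nsh (P : R -> Prop) : (\forall s \near t, P s) -> \forall h \near 0^', P (t + h).
  move=> Pt; apply: cvg_within; rewrite -(addr0 t) in Pt.
  have : (fun h => t + h) @ (0 : R) --> t + 0.
    by apply: cvgD; [exact: cvg_cst|exact: cvg_id].
  exact.
have Q : (fun h => h^-1 *: (ip (u (h + t)) (v (h + t)) - ip (u t) (v t))) @ 0^' -->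
    ip l (v t) + ip (u t) m.
  apply/cvgrPdist_lt => e e0; pose E h :=
    nrm (fun x => quot u t h x - l x) * nrm (v t) +
    nrm (u t) * nrm (fun x => quot v t h x - m x) +
    `|h| * (nrm (fun x => quot u t h x - l x) + nrm l) *
           (nrm (fun x => quot v t h x - m x) + nrm m).
  have E0 : E @ 0^' --> 0.
    suff : E @ 0^' -->
        0 * nrm (v t) + nrm (u t) * 0 + 0 * (0 + nrm l) * (0 + nrm m).
      by rewrite !(mul0r, mulr0) !addr0.
    apply: cvgD; first apply: cvgD.
    - by apply: cvgM; [exact: du|exact: cvg_cst].
    - by apply: cvgM; [exact: cvg_cst|exact: dv].
    - apply: cvgM; first apply: cvgM.
      + apply: cvg_within_filter.
        by have := @norm_continuous R R 0; rewrite /continuous_at normr0.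
      + by apply: cvgD; [exact: du|exact: cvg_cst].
      + by apply: cvgD; [exact: dv|exact: cvg_cst].
  near=> h.
  have hn0 : h != 0 by near: h; exact: nbhs_dnbhs_neq.
  have Luh : L2 (u (t + h)) by near: h; exact: (nsh (fun s => L2 (u s)) nu).
  have Lvh : L2 (v (t + h)) by near: h; exact: (nsh (fun s => L2 (v s)) nv).
  have Lqu := L2_quot Lu Luh; have Lqv := L2_quot Lv Lvh.
  have Eh : E h < e.
    near: h; exact: (cvgr_lt _ E0).
  apply: le_lt_trans Eh.
  have Lul := L2B Lqu Ll; have Lvm := L2B Lqv Lm.
  have eq1 : h^-1 *: (ip (u (h + t)) (v (h + t)) - ip (u t) (v t)) =
      ip (quot u t h) (v t) + ip (u t) (quot v t h) + h * ip (quot u t h) (quot v t h).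
    have eu : u (h + t) = fun x => u t x + h * quot u t h x.
      by rewrite funeqE => x; rewrite /quot [h + t]addrC mulrA divff// mul1r; ring.
    have ev : v (h + t) = fun x => v t x + h * quot v t h x.
      by rewrite funeqE => x; rewrite /quot [h + t]addrC mulrA divff// mul1r; ring.
    have Lhu := L2Z h Lqu; have Lhv := L2Z h Lqv.
    have Lvv : L2 (fun x => v t x + h * quot v t h x) by exact: L2D.
    rewrite eu ev ipDl//. rewrite (ipDr Lv Lhv Lu). rewrite (ipDr Lv Lhv Lhu).
    rewrite (ipZl h Lqu Lv) (ipZl h Lqu Lhv) (ipZr h Lqv Lu) (ipZr h Lqv Lqu).
    by rewrite /GRing.scale/=; field.
  rewrite eq1 distrC.
  have -> : ip (quot u t h) (v t) + ip (u t) (quot v t h) +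
      h * ip (quot u t h) (quot v t h) - (ip l (v t) + ip (u t) m) =
      ip (fun x => quot u t h x - l x) (v t) + ip (u t) (fun x => quot v t h x - m x)
      + h * ip (quot u t h) (quot v t h).
    by rewrite ipBl// ipBr//; ring.
  apply: le_trans (ler_normD _ _) _; apply: lerD.
    apply: le_trans (ler_normD _ _) _; apply: lerD; exact: cauchy_schwarz.
  rewrite normrM -mulrA ler_wpM2l//.
  apply: le_trans (cauchy_schwarz Lqu Lqv) _; apply: ler_pM; rewrite ?nrm_ge0//.
    apply: le_trans (nrm_triangle Lul Ll); rewrite le_eqVlt; apply/orP; left.
    by apply/eqP/eq_nrm => x; rewrite subrK.
  apply: le_trans (nrm_triangle Lvm Lm); rewrite le_eqVlt; apply/orP; left.
  by apply/eqP/eq_nrm => x; rewrite subrK.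
apply: DeriveDef.
  apply/cvg_ex; exists (ip l (v t) + ip (u t) m) => /=.
  by under eq_fun do rewrite [_%:A]mulr1.
rewrite /derive; apply/cvg_lim => //.
by under eq_fun do rewrite /= [_%:A]mulr1.
Unshelve. all: by end_near. Qed.

(** The derivatives are part of the data, as limits in the norm; only positive
    times are concerned, where two-sided increments make sense. *)
Definition L2chain (D : nat -> R -> T -> R) :=
  forall (k : nat) (t : R), 0 < t -> L2 (D k t) /\ L2deriv (D k) (D k.+1 t) t.

Lemma chain_derive (D : nat -> R -> T -> R) (j k : nat) (t : R) : L2chain D -> 0 < t ->
  is_derive t (1 : R) (fun s => ip (D j s) (D k s))
    (ip (D j.+1 t) (D k t) + ip (D j t) (D k.+1 t)).
Proof.
move=> cD t0.
have near_pos m : \forall s \near t, L2 (D m s).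
  have : \forall s \near t, 0 < s by exact: near_pos.
  by apply: filterS => s s0; have [] := cD m s s0.
apply: ip_derive => //; do ?exact: (cD _ _ t0).1; exact: (cD _ _ t0).2.
Qed.

End L2.

Section nth_derivable.
Context {R : realType}.

(** Nothing is known at nonpositive times: derivatives at [t > 0] are local, and
    so are the candidates [E j]. *)
Lemma nth_derivable_pos (K : R -> R) (E : nat -> R -> R) (m : nat) :
  (forall s, 0 < s -> K s = E 0%N s) ->
  (forall j (s : R), (j < m)%N -> 0 < s -> is_derive s (1 : R) (E j) (E j.+1 s)) ->
  forall t, 0 < t -> nth_derivable m K t /\ (K^`(m))%classic t = E m t.
Proof.
move=> K0 dE.
have H j : (j <= m)%N -> forall s, 0 < s -> (K^`(j))%classic s = E j s.
  elim: j => [|j IH] jm s s0; first by rewrite derive1n0 K0.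
  rewrite derive1nS derive1E; have [_ <-] := dE _ _ jm s0.
  apply: near_eq_derive; have := near_pos s0.
  by apply: filterS => u u0; rewrite IH// ltnW.
have dK j s : (j < m)%N -> 0 < s -> derivable (K^`(j))%classic s 1.
  move=> jm s0; have [+ _] := dE _ _ jm s0.
  apply: near_eq_derivable; have := near_pos s0.
  by apply: filterS => u u0; rewrite H// ltnW.
move=> t t0; split; last exact: H.
split=> [j jm|m0]; last by apply: dK => //; rewrite prednK.
by have := near_pos t0; apply: filterS => s s0; apply: dK => //; exact: ltnW.
Qed.

End nth_derivable.

(** * Pointwise time derivatives *)

Section L2_identification.
Context d (T : measurableType d) (R : realType) (mu : {measure set T -> \bar R}).
Implicit Types a b c : T -> R.

(** By Fatou's lemma the integral of [(e - l) ^ 2] is at most the limit of the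
    squared norms, which is zero. *)
Lemma L2_limit_ae (g : nat -> T -> R) (e l : T -> R) :
  (forall j, L2 mu (g j)) -> L2 mu l -> (forall x, (fun j => g j x) @ \oo --> e x) ->
  (fun j => nrm mu (fun x => g j x - l x)) @ \oo --> 0 ->
  {ae mu, forall x, l x = e x}.
Proof.
move=> Lg Ll ge gl.
have me : measurable_fun setT e.
  by apply: (@measurable_fun_cvg _ _ _ setT g) => [j|x _]; [exact: (Lg j).1|exact: ge].
have Lgl j : L2 mu (fun x => g j x - l x) by exact: L2B.
have H : (\int[mu]_x ((e x - l x) ^+ 2)%:E <= 0%:E)%E.
  apply: (@fatou_le _ _ _ mu (fun j x => (g j x - l x) ^+ 2) _
    (fun j => nrm mu (fun x => g j x - l x) ^+ 2)).
  - by move=> j; apply: measurable_funX; exact: (Lgl j).1.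
  - by move=> j x; exact: sqr_ge0.
  - move=> x; have h : (fun j => g j x - l x) @ \oo --> e x - l x.
      by apply: cvgB; [exact: ge|exact: cvg_cst].
    exact: (cvgM h h).
  - by move=> j; rewrite nrm_sq ip_sqE Rint_EFin//; exact: (Lgl j).2.
  - have h := cvgM gl gl; rewrite mulr0 in h.
    by under eq_fun do rewrite expr2; exact: h.
have mel : measurable_fun setT (fun x => ((e x - l x) ^+ 2)%:E).
  by apply/measurable_EFinP; apply: measurable_funX; apply: measurable_funB => //; exact: Ll.1.
have H0 : (\int[mu]_x `|((e x - l x) ^+ 2)%:E| = 0)%E.
  under eq_integral do rewrite gee0_abs ?lee_fin ?sqr_ge0//.
  by apply/eqP; rewrite eq_le H/=; apply: integral_ge0 => x _; rewrite lee_fin sqr_ge0.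
have := (ae_eq_integral_abs mu measurableT mel).1 H0.
apply: filterS => x /(_ I)/eqP; rewrite eqe sqrf_eq0 subr_eq0 => /eqP.
by [].
Qed.

Definition hseq (j : nat) : R := j.+1%:R^-1.

Lemma hseq_gt0 j : 0 < hseq j. Proof. by rewrite invr_gt0. Qed.

Lemma hseq_time t : 0 <= t -> hseq @ \oo --> time_increment t.
Proof.
move=> t0 A [e /= e0 Ae]; suff : \forall j \near \oo, A (hseq j) by [].
near=> j; apply: Ae.
- rewrite /= sub0r normrN gtr0_norm ?hseq_gt0//.
  near: j; exact: (near_infty_natSinv_lt (PosNum e0)).
- by rewrite gt_eqF// hseq_gt0.
- by rewrite /= addr_ge0// ltW// hseq_gt0.
Unshelve. all: by end_near. Qed.

Lemma time_increment_pos (t : R) : 0 < t -> 0^' --> time_increment t.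
Proof.
move=> t0 A; rewrite /time_increment /within /= => nA.
have n0 : nbhs (0 : R) [set h | 0 <= t + h].
  have : \forall h \near (0 : R), - t < h by apply: lt_nbhsr; rewrite oppr_lt0.
  by apply: filterS => h; rewrite -subr_gt0 opprK addrC => /ltW.
by apply: filterS2 n0 nA => h /= th + h0; apply.
Qed.

(** Along the increments [1 / (j + 1)] the difference quotients converge both in
    norm and pointwise, so that the two limits agree almost everywhere. *)
Lemma chain_identify (D E : nat -> R -> T -> R) :
  (forall k t, 0 <= t -> L2 mu (D k t)) ->
  (forall k t, 0 <= t ->
     (fun h => nrm mu (fun x => quot (D k) t h x - D k.+1 t x)) @ time_increment t --> 0) ->
  (forall k t, 0 <= t -> measurable_fun setT (E k t)) ->
  (forall k t x, 0 <= t -> (fun h => quot (E k) t h x) @ time_increment t --> E k.+1 t x) ->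
  (forall t, 0 <= t -> {ae mu, forall x, D 0%N t x = E 0%N t x}) ->
  forall k t, 0 <= t -> {ae mu, forall x, D k t x = E k t x}.
Proof.
move=> LD dD mE dE D0; elim=> [|k IH] t t0; first exact: D0.
have th j : 0 <= t + hseq j by rewrite addr_ge0// ltW// hseq_gt0.
have aeq j : {ae mu, forall x, quot (D k) t (hseq j) x = quot (E k) t (hseq j) x}.
  by apply: filterS2 (IH t t0) (IH _ (th j)) => x; rewrite /quot => -> ->.
have mQ j : measurable_fun setT (quot (E k) t (hseq j)).
  by apply: measurable_funM => //; apply: measurable_funB; exact: mE.
have LQ j : L2 mu (quot (E k) t (hseq j)).
  by apply: L2_ae (mQ j) (aeq j) _; apply: L2_quot; exact: LD.
apply: (@L2_limit_ae (fun j => quot (E k) t (hseq j))) => //.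
- exact: LD.
- by move=> x; exact: (cvg_comp _ _ (hseq_time t0) (dE k t x t0)).
have cv := cvg_comp _ _ (hseq_time t0) (dD k t t0).
apply: cvg_trans cv; apply: near_eq_cvg; apply: nearW => j /=.
have LL : L2 mu (fun x => quot (D k) t (hseq j) x - D k.+1 t x).
  by apply: L2B; [apply: L2_quot; exact: LD|exact: LD].
have mm : measurable_fun setT (fun x => quot (E k) t (hseq j) x - D k.+1 t x).
  by apply: measurable_funB => //; exact: (LD _ _ t0).1.
congr Num.sqrt; apply: ip_ae => //; do ?exact: LL.1.
- by apply: filterS (aeq j) => x ->.
- by apply: filterS (aeq j) => x ->.
Qed.

Lemma smooth_chain (D : nat -> R -> T -> R) :
  (forall k t, 0 <= t -> D k t \in Lfun mu 2%:E /\
      (fun h => Lnorm mu 2%:E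
         (fun x => (h^-1 * (D k (t + h) x - D k t x) - D k.+1 t x)%:E))
        @ time_increment t --> 0%E) ->
  (forall k t, 0 <= t -> L2 mu (D k t)) /\
  (forall k t, 0 <= t ->
     (fun h => nrm mu (fun x => quot (D k) t h x - D k.+1 t x)) @ time_increment t --> 0).
Proof.
move=> H; have LD k t : 0 <= t -> L2 mu (D k t).
  by move=> t0; apply: L2_Lfun; have [] := H k t t0.
split=> // k t t0; have [_ cv] := H k t t0.
have FF : Filter (time_increment t).
  by apply: within_filter; exact: dnbhs_filter.
have cf : (fine \o (fun h => Lnorm mu 2%:E (fun x =>
    (h^-1 * (D k (t + h) x - D k t x) - D k.+1 t x)%:E))) @ time_increment t --> (0 : R).
  exact: fine_cvg cv.
apply: cvg_trans cf; apply: near_eq_cvg.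
have : \forall h \near time_increment t, 0 <= t + h.
  by rewrite /time_increment; exact: withinT.
apply: filterS => h th /=.
rewrite (@Lnorm_nrm _ _ _ mu (fun x => quot (D k) t h x - D k.+1 t x))//.
by apply: L2B; [apply: L2_quot; exact: LD|exact: LD].
Qed.

End L2_identification.

(** * Projection onto functions of the position *)

Section projection.
Context d1 d2 (T1 : measurableType d1) (T2 : measurableType d2) (R : realType).
Variables (m1 : {sigma_finite_measure set T1 -> \bar R})
          (m2 : {sigma_finite_measure set T2 -> \bar R}).
Local Notation mm := (m1 \x m2)%E.
Variable k : T1 * T2 -> R.
Hypothesis mk : measurable_fun [set: T1 * T2] k.
Hypothesis k1 : forall q, (\int[m2]_p (k (q, p) ^+ 2)%:E = 1)%E.

Definition proj (a : T1 * T2 -> R) (q : T1) : R := \int[m2]_p (a (q, p) * k (q, p)).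

Let mkq q : measurable_fun setT (fun p => k (q, p)).
Proof. exact: (measurableT_comp mk (measurable_pair1 _)). Qed.

Let L2k q : L2 m2 (fun p => k (q, p)).
Proof.
split => //; apply: intg_ge0P.
- exact: measurable_funX.
- by move=> p; exact: sqr_ge0.
- by rewrite k1 ltry.
Qed.

Lemma proj_slice (a : T1 * T2 -> R) : L2 mm a ->
  {ae m1, forall q, L2 m2 (fun p => a (q, p))}.
Proof.
move=> [ma ia]; have := ae_integrable1 ia; apply: filterS => q iq; split.
  exact: (measurableT_comp ma (measurable_pair1 _)).
exact: iq.
Qed.

Let measurable_proj a : measurable_fun setT a -> measurable_fun setT (proj a).
Proof.
move=> ma; rewrite /proj /Rintegral.
apply: (measurableT_comp (fine_measurable measurableT)).
have mak : measurable_fun setT (fun z => (a z * k z)%:E).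
  by apply/measurable_EFinP; exact: measurable_funM.
rewrite (_ : (fun q => _) = (fun q => fubini_F m2 (fun z => (a z * k z)%:E)^\+%E q -
   fubini_F m2 (fun z => (a z * k z)%:E)^\-%E q)%E); last first.
  apply/funext => q; rewrite integralE /fubini_F; congr (_ - _)%E.
    by apply: eq_integral => p _; rewrite !funeposE.
  by apply: eq_integral => p _; rewrite !funenegE.
apply: emeasurable_funB.
  by apply: measurable_fun_fubini_tonelli_F => //; exact: measurable_funepos.
by apply: measurable_fun_fubini_tonelli_F => //; exact: measurable_funeneg.
Qed.

Let proj_sq_le a q : L2 m2 (fun p => a (q, p)) ->
  proj a q ^+ 2 <= \int[m2]_p (a (q, p) ^+ 2).
Proof.
move=> La; have := cauchy_schwarz La (L2k q).
have -> : nrm m2 (fun p => k (q, p)) = 1.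
  by rewrite /nrm ip_sqE /Rintegral k1 sqrtr1.
rewrite mulr1 -[ip _ _ _]/(proj a q) => h.
rewrite -ip_sqE -nrm_sq -[proj a q ^+ 2]real_normK ?num_real//.
by rewrite lerXn2r// nnegrE ?nrm_ge0.
Qed.

(** Integrating out the second variable against a normalized kernel is a
    contraction, by the Cauchy-Schwarz inequality on each slice. *)
Lemma proj_contraction a : L2 mm a -> L2 m1 (proj a) /\ nrm m1 (proj a) <= nrm mm a.
Proof.
move=> La; have [ma ia] := La.
have mp := measurable_proj ma.
have le1 : (\int[m1]_q (proj a q ^+ 2)%:E <= (ip mm a a)%:E)%E.
  rewrite ip_sqE Rint_EFin// fubini_tonelli1/=; last 2 first.
  - by apply/measurable_EFinP; exact: measurable_funX.
  - by move=> x; rewrite lee_fin sqr_ge0.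
  apply: ae_ge0_le_integral => //.
  - by move=> q _; rewrite lee_fin sqr_ge0.
  - by apply/measurable_EFinP; exact: measurable_funX.
  - by move=> q _; apply: integral_ge0 => p _; rewrite lee_fin sqr_ge0.
  - apply: measurable_fun_fubini_tonelli_F => //.
    + by apply/measurable_EFinP; exact: measurable_funX.
    + by move=> x; rewrite lee_fin sqr_ge0.
  - have := proj_slice La; apply: filterS => q Lq _; rewrite /fubini_F/=.
    rewrite -(Rint_EFin (f := fun p => a (q, p) ^+ 2)); last exact: Lq.2.
    by rewrite lee_fin; exact: proj_sq_le.
have Lp : L2 m1 (proj a).
  split=> //; apply: intg_ge0P => //.
  - exact: measurable_funX.
  - by move=> q; exact: sqr_ge0.
  - by apply: le_lt_trans le1 _; rewrite ltry.
split=> //; rewrite ler_sqrt ?ip_ge0//.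
by rewrite -lee_fin; apply: le_trans le1; rewrite ip_sqE Rint_EFin//; exact: Lp.2.
Qed.

Lemma proj_quot (D : R -> T1 * T2 -> R) (l : T1 * T2 -> R) (t h : R) :
  L2 mm (D t) -> L2 mm (D (t + h)) -> L2 mm l ->
  {ae m1, forall q, quot (fun s => proj (D s)) t h q - proj l q =
                    proj (fun x => quot D t h x - l x) q}.
Proof.
move=> L1 L2_ L3; have := proj_slice L1; have := proj_slice L2_; have := proj_slice L3.
apply: filterS3 => q Ll Lh Lt; rewrite /quot /proj.
have i1 := L2_mul Ll (L2k q); have i2 := L2_mul Lh (L2k q); have i3 := L2_mul Lt (L2k q).
rewrite -RintB// -RintZ; last exact: intgB.
rewrite -RintB//; last by apply: intgZ; exact: intgB.
by apply: eq_Rintegral => p _; ring.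
Qed.

(** A linear contraction maps derivatives to derivatives; linearity only holds
    for the almost all positions where the slices are square integrable. *)
Lemma proj_chain (D : nat -> R -> T1 * T2 -> R) : L2chain mm D ->
  L2chain m1 (fun j t => proj (D j t)).
Proof.
move=> cD j t t0; have [Lt dt] := cD j t t0.
split; first exact: (proj_contraction Lt).1.
have Ll := (cD j.+1 t t0).1.
apply: (@squeeze_cvgr _ _ _ _ (fun=> 0)
  (fun h => nrm mm (fun x => quot (D j) t h x - D j.+1 t x))).
- have : \forall h \near 0^', 0 < t + h.
    apply: cvg_within; have : \forall h \near (0 : R), - t < h.
      by apply: lt_nbhsr; rewrite oppr_lt0.
    by apply: filterS => h; rewrite -subr_gt0 opprK addrC.
  apply: filterS => h th; rewrite nrm_ge0/=.
  have Lh := (cD j _ th).1.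
  have LL : L2 mm (fun x => quot (D j) t h x - D j.+1 t x).
    by apply: L2B => //; exact: L2_quot.
  have [LP leP] := proj_contraction LL.
  apply: le_trans leP; rewrite le_eqVlt; apply/orP; left; apply/eqP.
  have E := proj_quot Lt Lh Ll.
  have mL : measurable_fun setT
      (fun q => quot (fun s => proj (D j s)) t h q - proj (D j.+1 t) q).
    apply: measurable_funB; last exact: (proj_contraction Ll).1.1.
    apply: measurable_funM => //; apply: measurable_funB.
      exact: (proj_contraction Lh).1.1.
    exact: (proj_contraction Lt).1.1.
  by congr Num.sqrt; apply: ip_ae => //; exact: LP.1.
- exact: cvg_cst.
- exact: dt.
Qed.

End projection.

(** * Cutoffs and growth estimates *)

Section cutoffs.
Context {R : realType}.

Definition pos (s : R) : R := Num.max 0 s.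

Lemma pos_ge0 s : 0 <= pos s. Proof. by rewrite le_max lexx. Qed.

Lemma continuous_pos : continuous pos.
Proof.
move=> s; rewrite /pos.
by apply: (@continuous_max _ _ (cst 0) id); [exact: cvg_cst|exact: cvg_id].
Qed.

Lemma is_derive_pos (k : nat) (s : R) :
  is_derive s (1 : R) (fun s => pos s ^+ k.+2) (k.+2%:R * pos s ^+ k.+1).
Proof.
have [s0|s0|->] := ltgtP s 0.
- apply: (@near_eq_is_derive _ _ _ (cst 0)); last first.
    apply: is_derive_eq (is_derive_cst _ _ _) _.
    by rewrite /pos max_l ?(ltW s0)// expr0n/= mulr0.
  have : \forall y \near s, y < 0 by exact: lt_nbhsl.
  by apply: filterS => y y0; rewrite /pos max_l ?(ltW y0)// expr0n.
- apply: (@near_eq_is_derive _ R R (fun y : R => y ^+ k.+2)); last first.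
    apply: DeriveDef; first exact: exprn_derivable.
    by rewrite exp_derive [_ *: _]mulr1 /pos max_r ?(ltW s0).
  have := near_pos s0.
  by apply: filterS => y y0; rewrite /pos max_r ?(ltW y0).
- have Q : (fun h : R => h^-1 *: (pos h ^+ k.+2 - pos 0 ^+ k.+2)) @ 0^' --> (0 : R).
    apply/cvgr0Pnorm_lt => e e0.
    have e1 : 0 < Num.min e 1 by rewrite lt_min e0 ltr01.
    near=> h.
    have h1 : `|h| < Num.min e 1.
      by near: h; apply: dnbhs0_lt.
    have hn0 : h != 0 by near: h; exact: nbhs_dnbhs_neq.
    have he : `|h| < e by apply: lt_le_trans h1 _; rewrite ge_min lexx.
    have hl1 : `|h| <= 1.
      by apply: ltW; apply: lt_le_trans h1 _; rewrite ge_min lexx orbT.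
    rewrite /pos maxxx expr0n/= subr0.
    have [h0|h0] := leP h 0; first by rewrite expr0n/= scaler0 normr0.
    rewrite /GRing.scale/= exprS mulKf// gtr0_norm ?exprn_gt0//.
    rewrite gtr0_norm// in he hl1.
    by apply: le_lt_trans he; rewrite exprS ler_piMr ?(ltW h0)// exprn_ile1// ltW.
  have p0 : pos 0 = 0 by rewrite /pos maxxx.
  rewrite p0 expr0n/= mulr0.
  apply: DeriveDef.
    apply/cvg_ex; exists 0 => /=.
    by under eq_fun do rewrite addr0 [_%:A]mulr1.
  rewrite /derive; apply/cvg_lim => //.
  by under eq_fun do rewrite /= addr0 [_%:A]mulr1.
Unshelve. all: by end_near. Qed.

Lemma C1_pos {V : normedModType R} (k : nat) (f : V -> R) : C1 f ->
  C1 (fun x => pos (f x) ^+ k.+2).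
Proof.
move=> Cf; apply: (@C1_comp1 _ _ (fun s => pos s ^+ k.+2)
  (fun s => k.+2%:R * pos s ^+ k.+1)) => // x.
  exact: is_derive_pos.
apply: cvgM; first exact: cvg_cst.
rewrite /=; move: (f x) => s {x}.
elim: k => [|k IH].
  by rewrite (_ : (fun _ => _) = pos)//; exact: continuous_pos.
under eq_fun do rewrite exprS; rewrite exprS.
by apply: cvgM; [exact: continuous_pos|exact: IH].
Qed.

Section bump.
Variable n : nat.
Variable mask : pred 'I_n.
Local Notation cV := 'cV[R]_n.

Definition sqsum (q : cV) : R := \sum_(i < n | mask i) q i 0 ^+ 2.

(** The third power makes this truncated paraboloid a function of class C^2; its
    derivatives are of order [1 / S] and [1 / S ^ 2]. Only the coordinates
    selected by [mask] are cut off, the angles being compact already. *)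
Definition bump (S : R) (q : cV) : R := pos (1 - S ^- 2 * sqsum q) ^+ 3.

Definition dbump (S : R) (i : 'I_n) (q : cV) : R :=
  - (6 * S ^- 2) * (pos (1 - S ^- 2 * sqsum q) ^+ 2 * (if mask i then q i 0 else 0)).

Definition ddbump (S : R) (i j : 'I_n) (q : cV) : R :=
  - (6 * S ^- 2) * (pos (1 - S ^- 2 * sqsum q) ^+ 2 * (if mask i then (i == j)%:R else 0)
    + (if mask i then q i 0 else 0) *
      (2 * pos (1 - S ^- 2 * sqsum q) * - (S ^- 2 * (2 * if mask j then q j 0 else 0)))).

Lemma is_derive_sqsum (q : cV) i :
  is_derive q (delta_mx i 0) sqsum (2 * if mask i then q i 0 else 0).
Proof.
have H j : is_derive q (delta_mx i 0) (fun q : cV => q j 0 ^+ 2)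
    (2 * q j 0 * (j == i)%:R).
  have e := is_derive_entry j q (delta_mx i 0).
  apply: is_derive_eq (is_deriveM_fun e e) _.
  by rewrite mxE eqxx andbT; ring.
have h : is_derive q (delta_mx i 0) sqsum (\sum_(j < n | mask j) (2 * q j 0 * (j == i)%:R)).
  by rewrite /sqsum; apply: is_derive_bigsum => j _; exact: H.
apply: is_derive_eq h _.
case: ifPn => mi; last first.
  rewrite big1 ?mulr0// => j mj; case: eqP => [ji|_]; last by rewrite mulr0.
  by rewrite ji (negbTE mi) in mj.
rewrite (bigD1 i)//= eqxx mulr1 big1 ?addr0// => j /andP[_ /negbTE ->].
by rewrite mulr0.
Qed.

Lemma C1_sqsum : C1 sqsum.
Proof. by apply: C1_sum => i _; apply: C1M; exact: C1_entry. Qed.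

Let C1_arg S : C1 (fun q => 1 - S ^- 2 * sqsum q).
Proof. by apply: C1B; [exact: C1_cst|apply: C1Z; exact: C1_sqsum]. Qed.

Let is_derive_arg S q i : is_derive q (delta_mx i 0) (fun q => 1 - S ^- 2 * sqsum q)
  (- (S ^- 2 * (2 * if mask i then q i 0 else 0))).
Proof.
apply: is_derive_eq (is_deriveB_fun (is_derive_cst (1 : R) q _)
  (is_derive_cstM _ (is_derive_sqsum q i))) _.
by rewrite sub0r.
Qed.

Lemma C1_bump S : C1 (bump S).
Proof. exact: (C1_pos 1 (C1_arg S)). Qed.

Lemma derive_bump S i : 'D_(delta_mx i 0) (bump S) = dbump S i.
Proof.
rewrite funeqE => q; apply: derive_val_fun.
apply: is_derive_eq (is_derive_comp1 (is_derive_arg S q i) (is_derive_pos 1 _)) _.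
by rewrite /dbump /=; move: (if _ then _ else _) => Q; ring.
Qed.

Lemma C1_dbump S i : C1 (dbump S i).
Proof.
apply: C1Z; apply: C1M; first exact: (C1_pos 0 (C1_arg S)).
by case: (mask i); [exact: C1_entry|exact: C1_cst].
Qed.

Lemma derive_dbump S i j : 'D_(delta_mx j 0) (dbump S i) = ddbump S i j.
Proof.
rewrite funeqE => q; apply: derive_val_fun.
have e : is_derive q (delta_mx j 0) (fun q : cV => if mask i then q i 0 else 0)
    (if mask i then (i == j)%:R else 0).
  case: (mask i); last exact: is_derive_cst.
  by apply: is_derive_eq (is_derive_entry i q _) _; rewrite mxE eqxx andbT.
have p2 := is_derive_comp1 (is_derive_arg S q j) (is_derive_pos 0 _).
apply: is_derive_eq (is_derive_cstM _ (is_deriveM_fun p2 e)) _.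
by rewrite /ddbump /= expr1.
Qed.

Lemma sqsum_ge (i : 'I_n) (q : cV) : mask i -> q i 0 ^+ 2 <= sqsum q.
Proof.
by move=> mi; rewrite /sqsum (bigD1 i)//= lerDl sumr_ge0// => j _; exact: sqr_ge0.
Qed.

Lemma pos_arg_out (S : R) (i : 'I_n) (q : cV) : 0 < S -> mask i -> S <= `|q i 0| ->
  pos (1 - S ^- 2 * sqsum q) = 0.
Proof.
move=> S0 mi Sq; rewrite /pos max_l// subr_le0 mulrC ler_pdivlMr ?exprn_gt0// mul1r.
apply: le_trans (sqsum_ge q mi).
have -> : q i 0 ^+ 2 = `|q i 0| ^+ 2 by rewrite real_normK ?num_real.
by rewrite lerXn2r ?nnegrE// ltW.
Qed.

Lemma bump_out (S : R) (i : 'I_n) (q : cV) : 0 < S -> mask i -> S <= `|q i 0| -> bump S q = 0.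
Proof. by move=> S0 mi Sq; rewrite /bump (pos_arg_out S0 mi Sq) expr0n. Qed.

Lemma bump_ge0 (S : R) (q : cV) : 0 <= bump S q.
Proof. by rewrite exprn_ge0// pos_ge0. Qed.

Let pos_arg_le1 (S : R) (q : cV) : pos (1 - S ^- 2 * sqsum q) <= 1.
Proof.
rewrite /pos ge_max ler01/= gerBl mulr_ge0// ?invr_ge0 ?sqr_ge0//.
by apply: sumr_ge0 => i _; exact: sqr_ge0.
Qed.

Lemma bump_le1 (S : R) (q : cV) : bump S q <= 1.
Proof. by rewrite exprn_ile1// pos_ge0. Qed.

Let masked_le (S : R) (i : 'I_n) (q : cV) : 0 < S ->
  pos (1 - S ^- 2 * sqsum q) * `|if mask i then q i 0 else 0| <= S.
Proof.
move=> S0; case: ifPn => mi; last by rewrite normr0 mulr0 ltW.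
have [Sq|qS] := leP S `|q i 0|; first by rewrite (pos_arg_out S0 mi Sq) mul0r ltW.
by rewrite -[S in X in _ <= X]mul1r; apply: ler_pM; rewrite ?pos_ge0 ?pos_arg_le1// ltW.
Qed.

Lemma dbump_le (S : R) (i : 'I_n) (q : cV) : 0 < S -> `|dbump S i q| <= 6 / S.
Proof.
move=> S0; rewrite /dbump normrM normrN (@ger0_norm _ (6 * _)); last first.
  by rewrite mulr_ge0// invr_ge0 sqr_ge0.
rewrite normrM (@ger0_norm _ (_ ^+ 2)) ?exprn_ge0 ?pos_ge0//.
rewrite [pos _ ^+ 2]expr2 -[pos _ * pos _ * _]mulrA.
apply: (@le_trans _ _ (6 * S ^- 2 * (1 * S))).
  rewrite ler_wpM2l ?mulr_ge0 ?invr_ge0 ?sqr_ge0//; apply: ler_pM.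
  - exact: pos_ge0.
  - by rewrite mulr_ge0 ?pos_ge0.
  - exact: pos_arg_le1.
  - exact: masked_le.
by rewrite mul1r expr2 invfM -!mulrA mulVf ?gt_eqF// mulr1.
Qed.

Lemma ddbump_le (S : R) (i j : 'I_n) (q : cV) : 0 < S -> `|ddbump S i j q| <= 30 / S ^+ 2.
Proof.
move=> S0; rewrite /ddbump.
set P := pos _; have P0 : 0 <= P by exact: pos_ge0.
have P1 : P <= 1 by exact: pos_arg_le1.
set a := (if mask i then q i 0 else 0); set b := (if mask j then q j 0 else 0).
have Pa : P * `|a| <= S by exact: masked_le.
have bS : P != 0 -> `|b| <= S.
  rewrite /b /P; case: ifPn => mj Pn0; last by rewrite normr0 ltW.
  by rewrite leNgt; apply: contra Pn0 => /ltW Sq; rewrite (pos_arg_out S0 mj Sq).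
have Pab : P * `|a| * `|b| <= S ^+ 2.
  have [->|/bS bS'] := eqVneq P 0; first by rewrite !mul0r sqr_ge0.
  by rewrite expr2; apply: ler_pM => //; rewrite mulr_ge0.
set c := (if mask i then (i == j)%:R else 0) : R.
have c1 : `|c| <= 1.
  by rewrite /c; case: ifP => _; [case: eqP => _; rewrite ?normr1 ?normr0|rewrite normr0].
have S2 : 0 < S ^- 2 by rewrite invr_gt0 exprn_gt0.
rewrite normrM normrN (@ger0_norm _ (6 * _)) ?mulr_ge0 ?(ltW S2)//.
rewrite (_ : 30 / S ^+ 2 = (6 * S ^- 2) * 5); last by ring.
rewrite ler_wpM2l ?mulr_ge0 ?(ltW S2)//.
apply: le_trans (ler_normD _ _) _; rewrite (_ : 5 = 1 + 4); last by ring.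
apply: lerD.
  rewrite normrM ger0_norm ?exprn_ge0// -[1]mulr1; apply: ler_pM => //.
    by rewrite exprn_ge0.
  by rewrite exprn_ile1.
rewrite (_ : a * _ = - (4 * S ^- 2 * (P * a * b))); last by ring.
rewrite normrN normrM (@ger0_norm _ (4 * _)) ?mulr_ge0 ?(ltW S2)//.
rewrite -mulrA ger_pMr// mulrC ler_pdivrMr ?exprn_gt0// mul1r.
by rewrite !normrM (ger0_norm P0).
Qed.

Lemma cvg_bump (q : cV) (S_ : nat -> R) :
  (fun k => (S_ k)^-1) @ \oo --> (0 : R) ->
  (fun k => bump (S_ k) q) @ \oo --> (1 : R).
Proof.
move=> S0; have h1 : (fun k => S_ k ^- 2) @ \oo --> (0 : R).
  have h := cvgM S0 S0; rewrite mulr0 in h.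
  by under eq_fun do rewrite expr2 invfM; exact: h.
have h2 : (fun k => 1 - S_ k ^- 2 * sqsum q) @ \oo --> (1 : R).
  have : (fun k => 1 - S_ k ^- 2 * sqsum q) @ \oo --> (1 - 0 * sqsum q : R).
    apply: cvgB; first exact: cvg_cst.
    by apply: cvgM => //; exact: cvg_cst.
  by rewrite mul0r subr0.
have h3 : (fun k => pos (1 - S_ k ^- 2 * sqsum q)) @ \oo --> (1 : R).
  have h := continuous_cvg _ (@continuous_pos (1 : R)) h2.
  have p1 : pos 1 = 1 by rewrite /pos max_r.
  by rewrite p1 in h; exact: h.
have h4 := cvgM h3 (cvgM h3 h3); rewrite !mulr1 in h4.
have e3 (x : R) : x ^+ 3 = x * (x * x) by ring.
by rewrite /bump; under eq_fun do rewrite e3; exact: h4.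
Qed.

End bump.

End cutoffs.

Section growth.
Context {R : realType}.

Lemma poly_gauss_bound (m : nat) (k : R) : 0 < k ->
  exists C : R, forall s, 0 <= s -> (1 + s) ^+ m * expR (- (k * s ^+ 2)) <= C.
Proof.
case: m => [|m] k0.
  by exists 1 => s s0; rewrite expr0 mul1r -expR0 ler_expR oppr_le0 mulr_ge0 ?sqr_ge0 ?ltW.
pose a := k / m.+1%:R; have a0 : 0 < a by rewrite divr_gt0.
pose c := Num.max 2 a^-1; have c0 : 0 < c by rewrite lt_max ltr0n.
exists (c ^+ m.+1) => s s0.
rewrite expRN ler_pdivrMr ?expR_gt0//.
have -> : expR (k * s ^+ 2) = expR (a * s ^+ 2) ^+ m.+1.
  by rewrite -expRM_natr; congr expR; rewrite /a; field.
rewrite -exprMn lerXn2r ?nnegrE ?addr_ge0 ?mulr_ge0 ?expR_ge0 ?(ltW c0)//.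
apply: (@le_trans _ _ (c * (1 + a * s ^+ 2))); last first.
  by rewrite ler_wpM2l ?(ltW c0)// expR_ge1Dx.
apply: (@le_trans _ _ (2 + s ^+ 2)).
  by have := sqr_ge0 (s - 1); rewrite sqrrB1; lra.
rewrite mulrDr mulr1; apply: lerD; first by rewrite le_max lexx.
rewrite mulrA ler_peMl ?sqr_ge0// -ler_pdivrMr// mul1r le_max lexx orbT//.
Qed.

(** Landau's inequality. Moving by [s] against the slope decreases [f] by at least
    [s |f'| - B s ^ 2], which cannot exceed [f]; take [s = |f'| / (2 B)]. *)
Lemma landau_bound {V : normedModType R} (f : V -> R) (v : V) (B : R) :
  C1 f -> C1 ('D_v f) -> (forall x, 0 <= f x) -> (forall x, `|'D_v ('D_v f) x| <= B) ->
  forall x, 'D_v f x ^+ 2 <= 4 * B * f x.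
Proof.
move=> Cf CDf f0 fB x.
have B0 : 0 <= B by apply: le_trans (fB x).
have k1 s : 0 < s -> 0 <= f x + s * 'D_v f x + B * s ^+ 2.
  move=> s0.
  have [c /andP[c0 cs] E] := C1_MVT x v Cf s0.
  have [b /andP[b0 bc] E2] := C1_MVT x v CDf c0.
  have := f0 (x + s *: v).
  rewrite -[f (x + s *: v)](subrK (f x)) E.
  rewrite -['D_v f (x + c *: v)](subrK ('D_v f x)) E2 => /le_trans; apply.
  have := fB (x + b *: v); rewrite ler_norml => /andP[_].
  move: ('D_v ('D_v f) _) ('D_v f x) (f x) => DD D F DB.
  rewrite -subr_ge0 (_ : _ - _ = s * (B * s - c * DD)); last by ring.
  rewrite mulr_ge0 ?(ltW s0)// subr_ge0.
  apply: (@le_trans _ _ (c * B)); first by rewrite ler_wpM2l// ltW.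
  by rewrite mulrC ler_wpM2l// ltW.
have k2 s : 0 < s -> 0 <= f x - s * 'D_v f x + B * s ^+ 2.
  move=> s0; pose x' := x - s *: v.
  have [c /andP[c0 cs] E] := C1_MVT x' v Cf s0.
  have sc0 : 0 < s - c by rewrite subr_gt0.
  have xE : x' + c *: v + (s - c) *: v = x.
    have e : c + (s - c) = s by ring.
    by rewrite -addrA -scalerDl e /x' subrK.
  have xE' : x' + s *: v = x by rewrite /x' subrK.
  have [b /andP[b0 bc] E2] := C1_MVT (x' + c *: v) v CDf sc0.
  rewrite xE in E2; rewrite xE' in E.
  have := f0 x'.
  have -> : f x' = f x - s * 'D_v f (x' + c *: v) by rewrite -E subKr.
  have -> : 'D_v f (x' + c *: v) = 'D_v f x - (s - c) * 'D_v ('D_v f) (x' + c *: v + b *: v).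
    by rewrite -E2 subKr.
  move=> /le_trans; apply.
  have := fB (x' + c *: v + b *: v); rewrite ler_norml => /andP[_].
  move: ('D_v ('D_v f) _) ('D_v f x) (f x) => DD D F DB.
  rewrite -subr_ge0 (_ : _ - _ = s * (B * s - (s - c) * DD)); last by ring.
  rewrite mulr_ge0 ?(ltW s0)// subr_ge0.
  apply: (@le_trans _ _ ((s - c) * B)); first by rewrite ler_wpM2l// ltW.
  by rewrite mulrC ler_wpM2l// gerBl ltW.
have fx0 := f0 x.
have k3 s : 0 < s -> s * `|'D_v f x| <= f x + B * s ^+ 2.
  move=> s0; have h1 := k1 s s0; have h2 := k2 s s0.
  move: h1 h2; case: (ger0P ('D_v f x)) => d0; move: ('D_v f x) (f x) => D F h1 h2.
    by rewrite -subr_ge0; apply: le_trans h2 _; rewrite le_eqVlt; apply/orP; left; apply/eqP; ring.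
  by rewrite -subr_ge0; apply: le_trans h1 _; rewrite le_eqVlt; apply/orP; left; apply/eqP; ring.
rewrite -[_ ^+ 2]real_normK ?num_real//.
move: (`|'D_v f x|) (normr_ge0 ('D_v f x)) k3 => D D0 k3 {k1 k2}.
have [->|Dn0] := eqVneq D 0; first by rewrite expr0n/= mulr_ge0// mulr_ge0.
have Dp : 0 < D by rewrite lt_neqAle eq_sym Dn0.
have [B00|Bn0] := eqVneq B 0.
  have sp : 0 < (f x + 1) / D by rewrite divr_gt0// ltr_wpDl.
  have := k3 _ sp; rewrite B00 mul0r addr0 divfK// => h.
  by exfalso; move: h; rewrite leNgt => /negP; apply; rewrite ltrDl.
have Bp : 0 < B by rewrite lt_neqAle eq_sym Bn0.
have sp : 0 < D / (2 * B) by rewrite divr_gt0// mulr_gt0.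
have := k3 _ sp.
rewrite (_ : D / (2 * B) * D = 2 * (D ^+ 2 / (4 * B))); last by field.
rewrite (_ : B * _ ^+ 2 = D ^+ 2 / (4 * B)); last by field.
move=> h; rewrite mulrC -ler_pdivrMr ?mulr_gt0//.
move: h; move: (D ^+ 2 / (4 * B)) (f x) => a F h; lra.
Qed.

End growth.

(** * Regular functions on the phase space *)

Section full_support.
Context {R : realType} (n r : nat).
Local Notation cV := 'cV[R]_n.
Local Notation phase := (cV * cV)%type.
Local Notation mR := (measurableTypeR R).
Local Notation mx := (phase_measure R n r).

Let box (a : cV) (w : 'I_n -> R) : set cV :=
  [set q | forall i, `[a i 0, a i 0 + w i[%classic (q i 0)].

Let measurable_box (a : cV) w : measurable (box a w).
Proof.
rewrite (_ : box a w = \bigcap_(i in [set: 'I_n])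
    [set q : cV | `[a i 0, a i 0 + w i[%classic (q i 0)]).
  apply: fin_bigcap_measurable => [|i _]; first exact: finite_finset.
  have := @measurable_fun_entry R n 1 i 0 measurableT
    `[a i 0, a i 0 + w i[%classic (measurable_itv _).
  by rewrite setTI.
by apply/seteqP; split => q qa i; [move=> _; exact: qa|exact: qa].
Qed.

Let box_gt0 (mu : nat -> {sigma_finite_measure set mR -> \bar R}) (a : cV) w :
  (forall i : 'I_n, mu i `[a i 0, a i 0 + w i[%classic = (w i)%:E) ->
  (forall i, 0 < w i) -> (0 < cV_prod_measure n mu (box a w))%E.
Proof.
move=> mw w0.
have -> : cV_prod_measure n mu (box a w) = (\prod_(i < n) (w i)%:E)%E.
  rewrite /box (@cV_prod_measure_box R n mu (fun i => `[a i 0, a i 0 + w i[%classic)).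
    by apply: eq_bigr => i _; exact: mw.
  by move=> i; exact: measurable_itv.
by rewrite prodEFin lte_fin; apply: prodr_gt0 => i _.
Qed.

Let leb_itv (a w : R) : 0 < w ->
  lebesgue_measure (`[a, a + w[%classic : set mR) = w%:E.
Proof.
move=> w0; rewrite lebesgue_measure_itv/= lte_fin ltrDl w0 -EFinD.
by rewrite addrC addKr.
Qed.

(** The phase measure charges every open set, up to reduction of the angles. *)
Lemma continuous_integral_eq0 (F : phase -> R) : continuous F -> periodic r F ->
  (forall x, 0 <= F x) -> (\int[mx]_x (F x)%:E <= 0)%E -> forall x, F x = 0.
Proof.
move=> cF pF F0 iF -[q0 p0].
have := congr1 (fun g => g p0) (qperiodic_reduce q0 pF) => /= <-.
set q := reduce r q0.
apply/eqP; rewrite eq_le F0 andbT leNgt; apply/negP => Fq.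
have c0 : 0 < F (q, p0) / 2 by rewrite divr_gt0.
have : \forall y \near (q, p0), F (q, p0) / 2 < F y.
  by apply: (cvgr_gt _ (cF (q, p0))); rewrite ltr_pdivrMr// mulr_natr mulr2n ltrDl.
move=> /nbhs_ballP[d /= d0 dF].
pose wq i := if angle r i then Num.min (d / 2) (2 * pi - q i 0) else d / 2.
have d2 : 0 < d / 2 by rewrite divr_gt0.
have wq0 i : 0 < wq i.
  rewrite /wq; case: ifPn => // ai; rewrite lt_min d2 subr_gt0.
  by have /andP[] := reduce_angle q0 ai.
have wqd i : wq i <= d / 2 by rewrite /wq; case: ifPn => // _; rewrite ge_min lexx.
pose B := box q wq `*` box p0 (fun=> d / 2).
have mB : measurable B by apply: measurableX; exact: measurable_box.
have muB : (0 < mx B)%E.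
  rewrite /phase_measure product_measure1E; do ?exact: measurable_box.
  rewrite mule_gt0//; apply: box_gt0 => // i.
  - case: (boolP (angle r i)) => ai.
      rewrite ltnNge -/(angle r i) ai/=.
      transitivity (lebesgue_measure (`[q i 0, q i 0 + wq i[%classic : set mR)).
        change (lebesgue_measure ((`[q i 0, (q i 0 + wq i)%R[%classic : set mR)
          `&` `[0, (2 * pi)%R[%classic) =
          lebesgue_measure (`[q i 0, (q i 0 + wq i)%R[%classic : set mR)).
        rewrite setIidl// => s /=; rewrite !in_itv/= => /andP[s1 s2].
        have /andP[q1 q2] := reduce_angle q0 ai.
        rewrite (le_trans q1 s1)/=; apply: lt_le_trans s2 _.
        by rewrite -lerBrDl /wq ai ge_min lexx orbT.
      exact: leb_itv.
    by rewrite ltnNge -/(angle r i) ai/=; exact: leb_itv.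
  - exact: leb_itv.
have FB x : B x -> F (q, p0) / 2 <= F x.
  move=> [Bq Bp]; apply/ltW/dF.
  have hb (a b : cV) w : (forall i, w i <= d / 2) -> box a w b -> `|a - b| < d.
    move=> wd ab; apply: (@le_lt_trans _ _ (d / 2)).
      apply: cV_norm_le; first exact: ltW.
      move=> i; have := ab i; rewrite /= in_itv/= => /andP[h1 h2].
      rewrite !mxE distrC ger0_norm ?subr_ge0// lerBlDl.
      by rewrite (le_trans (ltW h2))// lerD2l.
    by rewrite ltr_pdivrMr// mulr_natr mulr2n ltrDl.
  rewrite -ball_normE /= prod_normE gt_max/=; apply/andP; split.
    exact: hb wqd Bq.
  exact: (hb _ _ (fun=> d / 2)).
have : ((F (q, p0) / 2)%:E * mx B <= 0)%E.
  apply: le_trans iF.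
  rewrite -integral_cst//.
  apply: (@le_trans _ _ (\int[mx]_(x in B) (F x)%:E)%E).
    apply: ge0_le_integral => //.
    - by move=> x _; rewrite lee_fin ltW.
    - apply/measurable_EFinP/measurable_funTS.
      exact: continuous_measurable_phase.
  apply: ge0_subset_integral => //.
  - by apply/measurable_EFinP; exact: continuous_measurable_phase.
  - by move=> x _; rewrite lee_fin.
by rewrite leNgt mule_gt0.
Qed.

End full_support.

Section regular_functions.
Context {R : realType} (n r : nat).
Local Notation cV := 'cV[R]_n.
Local Notation phase := (cV * cV)%type.
Implicit Types F G : phase -> R.

Lemma periodicP F : periodic r F <-> forall i, angle r i -> forall q p,
  F (q + (2 * pi) *: delta_mx i 0, p) = F (q, p).
Proof.
split=> [pF i ai q p|h i ai q]; first exact: (congr1 (fun g => g p) (pF i ai q)).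
by apply/funext => p; exact: h.
Qed.

Lemma periodic_op (op : R -> R -> R) F G : periodic r F -> periodic r G ->
  periodic r (fun x => op (F x) (G x)).
Proof.
by move=> /periodicP pF /periodicP pG; apply/periodicP => i ai q p; rewrite pF// pG.
Qed.

Lemma periodic_comp (g : R -> R) F : periodic r F -> periodic r (fun x => g (F x)).
Proof. by move=> /periodicP pF; apply/periodicP => i ai q p; rewrite pF. Qed.

Definition CP F := C1 F /\ periodic r F.

Lemma CP_cst (c : R) : CP (fun=> c).
Proof. by split; [exact: C1_cst|]. Qed.

Lemma CPD F G : CP F -> CP G -> CP (fun x => F x + G x).
Proof. by move=> [CF pF] [CG pG]; split; [exact: C1D|exact: periodic_op]. Qed.

Lemma CPM F G : CP F -> CP G -> CP (fun x => F x * G x).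
Proof. by move=> [CF pF] [CG pG]; split; [exact: C1M|exact: periodic_op]. Qed.

Lemma CPB F G : CP F -> CP G -> CP (fun x => F x - G x).
Proof. by move=> [CF pF] [CG pG]; split; [exact: C1B|exact: (periodic_op (fun a b => a - b))]. Qed.

Lemma CPN F : CP F -> CP (fun x => - F x).
Proof. by move=> [CF pF]; split; [exact: C1N|exact: periodic_comp]. Qed.

Lemma CPZ (c : R) F : CP F -> CP (fun x => c * F x).
Proof. by move=> CF; apply: CPM => //; exact: CP_cst. Qed.

Lemma CP_sum (I : Type) (s : seq I) (P : pred I) (h : I -> phase -> R) :
  (forall i, P i -> CP (h i)) -> CP (fun x => \sum_(i <- s | P i) h i x).
Proof.
move=> Ch; split; first by apply: C1_sum => i Pi; exact: (Ch i Pi).1.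
apply/periodicP => i ai q p; apply: eq_bigr => j Pj.
by have [_ /periodicP] := Ch j Pj; exact.
Qed.

Lemma CP_q (phi : cV -> R) : C1 phi -> qperiodic r phi -> CP (fun x => phi x.1).
Proof.
move=> Cphi pphi; split; first exact: C1_fst.
by apply/periodicP => i ai q p; exact: pphi.
Qed.

Lemma CP_p (i : 'I_n) : CP (fun x => x.2 i 0).
Proof.
split; last by [].
by apply: (@C1_snd _ _ _ (fun p : cV => p i 0)); exact: C1_entry.
Qed.

Lemma CP_pfun (phi : cV -> R) : C1 phi -> CP (fun x => phi x.2).
Proof. by move=> Cphi; split; [exact: C1_snd|]. Qed.

Lemma CP_expR F : CP F -> CP (fun x => expR (F x)).
Proof. by move=> [CF pF]; split; [exact: C1_expR|exact: (periodic_comp expR)]. Qed.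

Lemma CP_V F : (forall x, F x != 0) -> CP F -> CP (fun x => (F x)^-1).
Proof. by move=> F0 [CF pF]; split; [exact: C1V|exact: (periodic_comp GRing.inv)]. Qed.

Lemma CP_measurable F : CP F -> measurable_fun [set: phase] F.
Proof. by move=> [CF _]; apply: continuous_measurable_phase; exact: C1_continuous. Qed.

(** Polynomial growth in the momentum, locally uniformly in the position. *)
Definition pgrow F := forall c : R, exists C m, 0 <= C /\
  forall x : phase, `|euclidean_part r x.1| <= c -> `|F x| <= C * (1 + `|x.2|) ^+ m.

Lemma pgrowM F G : pgrow F -> pgrow G -> pgrow (fun x => F x * G x).
Proof.
move=> hF hG c; have [C1 [m1 [C10 h1]]] := hF c; have [C2 [m2 [C20 h2]]] := hG c.
exists (C1 * C2), (m1 + m2)%N; split; first exact: mulr_ge0.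
move=> x xc; rewrite normrM exprD mulrACA.
by apply: ler_pM => //; [exact: h1|exact: h2].
Qed.

Lemma pgrowD F G : pgrow F -> pgrow G -> pgrow (fun x => F x + G x).
Proof.
move=> hF hG c; have [C1 [m1 [C10 h1]]] := hF c; have [C2 [m2 [C20 h2]]] := hG c.
exists (C1 + C2), (m1 + m2)%N; split; first exact: addr_ge0.
move=> x xc; apply: le_trans (ler_normD _ _) _; rewrite mulrDl.
have p1 : 1 <= 1 + `|x.2| by rewrite lerDl.
apply: lerD.
  apply: le_trans (h1 _ xc) _; by rewrite ler_wpM2l// exprD ler_peMr ?exprn_ge0 ?exprn_ege1// (le_trans ler01).
apply: le_trans (h2 _ xc) _; by rewrite ler_wpM2l// exprD ler_peMl ?exprn_ge0 ?exprn_ege1// (le_trans ler01).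
Qed.

Lemma pgrow_cst (k : R) : pgrow (fun=> k).
Proof. by move=> c; exists `|k|, 0%N; split => // x _; rewrite expr0 mulr1. Qed.

Lemma pgrowZ k F : pgrow F -> pgrow (fun x => k * F x).
Proof. by move=> hF; apply: pgrowM => //; exact: pgrow_cst. Qed.

Lemma pgrow_sum (I : Type) (s : seq I) (P : pred I) (h : I -> phase -> R) :
  (forall i, P i -> pgrow (h i)) -> pgrow (fun x => \sum_(i <- s | P i) h i x).
Proof.
move=> Ch; elim: s => [|i s IH].
  rewrite (_ : (fun _ => _) = fun=> 0); first exact: pgrow_cst.
  by rewrite funeqE => y; rewrite big_nil.
case Pi : (P i); last first.
  rewrite (_ : (fun _ => _) = (fun x => \sum_(j <- s | P j) h j x)) //.
  by rewrite funeqE => x; rewrite big_cons Pi.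
rewrite (_ : (fun _ => _) = (fun x => h i x + \sum_(j <- s | P j) h j x)).
  by apply: pgrowD => //; exact: Ch.
by rewrite funeqE => x; rewrite big_cons Pi.
Qed.

Lemma pgrow_q (phi : cV -> R) : continuous phi -> qperiodic r phi ->
  pgrow (fun x => phi x.1).
Proof.
move=> cphi pphi c.
have cF : continuous (fun x : phase => phi x.1).
  by move=> x; apply: (@continuous_comp _ _ _ fst phi); [exact: cvg_fst|exact: cphi].
have pF : periodic r (fun x : phase => phi x.1).
  by apply/periodicP => i ai q p; exact: pphi.
have [C CP_] := periodic_bounded (Num.max c 0) cF pF.
exists (Num.max C 0), 0%N; split; first by rewrite le_max lexx orbT.
move=> x xc; rewrite expr0 mulr1 le_max; apply/orP; left.
apply: (CP_ (x.1, 0)); rewrite /enorm prod_normE/= normr0 ge_max.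
by rewrite !le_max xc lexx orbT.
Qed.

Lemma pgrow_p (i : 'I_n) : pgrow (fun x => x.2 i 0).
Proof.
move=> c; exists 1, 1%N; split => // x _; rewrite mul1r expr1.
by rewrite (le_trans (entry_le_norm x.2 i))// lerDr.
Qed.

End regular_functions.

(** * Positive definite matrices *)

Section posdef_matrices.
Context {R : realType} (n : nat).
Implicit Types N : 'M[R]_n.

Lemma qform N (u v : 'cV[R]_n) :
  (u^T *m N *m v) 0 0 = \sum_i \sum_j N i j * (u i 0 * v j 0).
Proof.
rewrite mxE exchange_big /=; apply: eq_bigr => j _.
by rewrite mxE mulr_suml; apply: eq_bigr => i _; rewrite mxE; ring.
Qed.

Lemma dotE (u v : 'cV[R]_n) : (u^T *m v) 0 0 = \sum_i u i 0 * v i 0.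
Proof. by rewrite mxE; apply: eq_bigr => i _; rewrite mxE. Qed.

Lemma posdef_unit N : posdef N -> N \in unitmx.
Proof.
move=> [NT N0]; rewrite -row_free_unit; apply: inj_row_free => v vN.
apply/eqP; apply/negP => /negP v0; have vT0 : v^T != 0.
  by apply: contra v0 => /eqP h; rewrite -[v]trmxK h trmx0.
by have := N0 _ vT0; rewrite trmxK vN mul0mx mxE ltxx.
Qed.

Lemma posdef_inv_sym N : posdef N -> (invmx N)^T = invmx N.
Proof. by move=> [NT _]; rewrite trmx_inv NT. Qed.

Lemma posdef_inv N : posdef N -> posdef (invmx N).
Proof.
move=> pN; have uN := posdef_unit pN; split; first exact: posdef_inv_sym.
move=> v v0; have Nv0 : invmx N *m v != 0.
  apply: contra v0 => /eqP h.
  by rewrite -[v]mul1mx -(mulmxV uN) -mulmxA h mulmx0.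
have [_ /(_ _ Nv0)] := pN.
by rewrite trmx_mul posdef_inv_sym// -!mulmxA [N *m _]mulmxA mulmxV// mul1mx.
Qed.

Lemma posdef_ge0 N (v : 'cV[R]_n) : posdef N -> 0 <= (v^T *m N *m v) 0 0.
Proof.
move=> [_ pN]; have [->|v0] := eqVneq v 0; first by rewrite mulmx0 mxE.
exact/ltW/pN.
Qed.

Lemma wnorm_sq N (v : 'cV[R]_n) : posdef N -> wnorm N v ^+ 2 = (v^T *m N *m v) 0 0.
Proof. by move=> pN; rewrite /wnorm sqr_sqrtr// posdef_ge0. Qed.

(** Cauchy-Schwarz for the form [N], through the discriminant. *)
Lemma posdef_cauchy_schwarz N (u v : 'cV[R]_n) : posdef N ->
  (u^T *m N *m v) 0 0 ^+ 2 <= (u^T *m N *m u) 0 0 * (v^T *m N *m v) 0 0.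
Proof.
move=> pN; have [NT _] := pN.
have B0 := posdef_ge0 v pN; have A0 := posdef_ge0 u pN.
have sym : (v^T *m N *m u) 0 0 = (u^T *m N *m v) 0 0.
  rewrite !qform exchange_big; apply: eq_bigr => i _; apply: eq_bigr => j _.
  by rewrite -{1}NT mxE [u _ _ * _]mulrC.
have Q s : 0 <= (u^T *m N *m u) 0 0 + 2 * s * (u^T *m N *m v) 0 0 +
     s ^+ 2 * (v^T *m N *m v) 0 0.
  have := posdef_ge0 (u + s *: v) pN.
  have eD (A B : 'M[R]_1) : (A + B) 0 0 = A 0 0 + B 0 0 by rewrite mxE.
  have eZ k (A : 'M[R]_1) : (k *: A) 0 0 = k * A 0 0 by rewrite mxE.
  have eT : (u + s *: v)^T = u^T + s *: v^T by apply/matrixP => i j; rewrite !mxE.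
  rewrite eT !mulmxDl !mulmxDr -!scalemxAl -!scalemxAr !(eD, eZ).
  rewrite sym => /le_trans; apply.
  by rewrite le_eqVlt; apply/orP; left; apply/eqP; ring.
move: ((u^T *m N *m u) 0 0) ((u^T *m N *m v) 0 0) ((v^T *m N *m v) 0 0) Q A0 B0.
move=> A C B Q A0 B0.
have [B00|Bn0] := eqVneq B 0.
  have [->|C0] := eqVneq C 0; first by rewrite expr0n/= B00 mulr0.
  have := Q (- (A + 1) / (2 * C)).
  rewrite B00 mulr0 addr0 (_ : 2 * _ * C = - (A + 1)); last by field.
  by rewrite opprD addrA subrr add0r oppr_ge0 leNgt ltr01.
have Bp : 0 < B by rewrite lt_neqAle eq_sym Bn0.
have := Q (- C / B).
rewrite (_ : _ + _ = A - C ^+ 2 / B); last by field.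
by rewrite subr_ge0 ler_pdivrMr.
Qed.

(** Cauchy-Schwarz for the form of [invmx N] between [p] and the column [i] of
    [N]. *)
Lemma inv_coord_le N (p : 'cV[R]_n) i : posdef N ->
  p i 0 ^+ 2 <= N i i * (p^T *m invmx N *m p) 0 0.
Proof.
move=> pN; have uN := posdef_unit pN; have [NT _] := pN.
pose e : 'cV[R]_n := delta_mx i 0.
have := posdef_cauchy_schwarz (N *m e) p (posdef_inv pN).
rewrite trmx_mul NT.
have -> : e^T *m N *m invmx N *m p = e^T *m p by rewrite -!mulmxA mulKVmx.
have -> : (e^T *m p) 0 0 = p i 0.
  rewrite dotE (bigD1 i)//= big1 ?addr0 => [|j ji]; first by rewrite mxE !eqxx mul1r.
  by rewrite mxE (negbTE ji) mul0r.
have -> : e^T *m N *m invmx N *m (N *m e) = e^T *m N *m e.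
  by rewrite -!mulmxA [invmx N *m _]mulmxA mulVmx// mul1mx.
have -> : (e^T *m N *m e) 0 0 = N i i.
  rewrite qform (bigD1 i)//= [X in _ + X]big1 ?addr0 => [|j ji]; last first.
    by rewrite big1// => k _; rewrite mxE (negbTE ji) mul0r mulr0.
  rewrite (bigD1 i)//= big1 ?addr0 => [|j ji]; first by rewrite !mxE !eqxx !mulr1.
  by rewrite [e j 0]mxE (negbTE ji) !mulr0.
by [].
Qed.

Lemma posdef_diag_gt0 N i : posdef N -> 0 < N i i.
Proof.
move=> [NT pN]; have e0 : delta_mx i 0 != 0 :> 'cV[R]_n.
  apply/eqP => /matrixP/(_ i 0)/eqP; rewrite !mxE !eqxx.
  by rewrite oner_eq0.
have := pN _ e0.
rewrite qform (bigD1 i)//= [X in _ + X]big1 ?addr0 => [|j ji]; last first.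
  by rewrite big1// => k _; rewrite mxE (negbTE ji) mul0r mulr0.
rewrite (bigD1 i)//= big1 ?addr0 => [|j ji]; first by rewrite !mxE !eqxx !mulr1.
by rewrite [delta_mx i 0 j 0]mxE (negbTE ji) !mulr0.
Qed.

End posdef_matrices.

(** * The Hamiltonian flow and the Gibbs density *)

Section system.
Context {R : realType} (n r : nat) (T : R).
Variables (V : 'cV[R]_n -> R) (M : 'cV[R]_n -> 'M[R]_n).
Local Notation cV := 'cV[R]_n.
Local Notation phase := (cV * cV)%type.
Local Notation mx := (phase_measure R n r).
Local Notation mp := (lebesgue_cV R n).
Local Notation beta := (T^-1).
Local Notation H := (hamiltonian V M).

Definition Mi (j k : 'I_n) (q : cV) : R := invmx (M q) j k.
(** The components of the velocity [M^-1 p] and of the gradient of the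
    Hamiltonian in the position. *)
Definition vel (i : 'I_n) (x : phase) : R := \sum_k Mi i k x.1 * x.2 k 0.
Definition Hq (i : 'I_n) : phase -> R := 'D_(dq i) H.

Hypotheses (T_gt0 : 0 < T) (V_smooth : smooth_position r V) (V_ge0 : forall q, 0 <= V q)
  (M_spd : smooth_posdef r M).

Let Msm i j : smooth (fun q => M q i j). Proof. by have [h _ _] := M_spd; exact: h. Qed.
Let Mper : qperiodic r M. Proof. by have [_ h _] := M_spd. Qed.
Let Mpd q : posdef (M q). Proof. by have [_ _ h] := M_spd; exact: h. Qed.
Let Mu q : M q \in unitmx. Proof. exact/posdef_unit. Qed.

Lemma Mi_sym j k q : Mi j k q = Mi k j q.
Proof. by rewrite /Mi -[in LHS](posdef_inv_sym (Mpd q)) mxE. Qed.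

Lemma C1_Mi j k : C1 (Mi j k).
Proof. by apply: C1_invmx => // a b; exact: smooth_C1. Qed.

Lemma Mi_periodic j k : qperiodic r (Mi j k).
Proof. by move=> i ai q; rewrite /Mi Mper. Qed.

(** Differentiate [M^-1 M = 1]. *)
Lemma derive_Mi j k v q : 'D_v (Mi j k) q =
  - \sum_a \sum_b Mi j a q * 'D_v (fun q => M q a b) q * Mi b k q.
Proof.
pose dMi := \matrix_(j, k) 'D_v (Mi j k) q; pose dM := \matrix_(a, b) 'D_v (fun q => M q a b) q.
have e : dMi *m M q + invmx (M q) *m dM = 0.
  apply/matrixP => a c; rewrite !mxE.
  have h : is_derive q v (fun q => \sum_b Mi a b q * M q b c)
     (\sum_b (Mi a b q * 'D_v (fun q => M q b c) q + M q b c * 'D_v (Mi a b) q)).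
    apply: is_derive_bigsum => b _; apply: is_deriveM_fun.
      by apply: C1_is_derive; exact: C1_Mi.
    by apply: C1_is_derive; exact: smooth_C1.
  have ecst : (fun q => \sum_b Mi a b q * M q b c) = cst ((a == c)%:R).
    rewrite funeqE => q'; have := congr1 (fun A : 'M[R]_n => A a c) (mulVmx (Mu q')).
    by rewrite !mxE.
  rewrite ecst in h; have := derive_val_fun h; rewrite derive_cst => /esym.
  rewrite big_split/= addrC => E0; apply: etrans E0; congr (_ + _).
    by apply: eq_bigr => b _; rewrite mxE mulrC.
  by apply: eq_bigr => b _; rewrite mxE.
have e2 : dMi = - (invmx (M q) *m dM *m invmx (M q)).
  have := congr1 (mulmx^~ (invmx (M q))) e.
  rewrite mul0mx mulmxDl -[dMi *m _ *m _]mulmxA mulmxV// mulmx1 => /eqP.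
  by rewrite addr_eq0 => /eqP.
have := congr1 (fun A : 'M[R]_n => A j k) e2; rewrite !mxE => ->; congr (- _).
rewrite exchange_big /=; apply: eq_bigr => b _.
by rewrite mxE mulr_suml; apply: eq_bigr => a _; rewrite mxE.
Qed.

Lemma C1_derive_Mi j k v : C1 ('D_v (Mi j k)).
Proof.
rewrite (_ : 'D_v (Mi j k) = fun q => - \sum_a \sum_b Mi j a q *
    'D_v (fun q => M q a b) q * Mi b k q); last by rewrite funeqE => q; rewrite derive_Mi.
apply: C1N; apply: C1_sum => a _; apply: C1_sum => b _.
apply: C1M; last exact: C1_Mi.
by apply: C1M; [exact: C1_Mi|apply: smooth_C1; exact: smooth_derive].
Qed.

Let CP_Mi j k : CP r (fun x : phase => Mi j k x.1).
Proof. by apply: CP_q; [exact: C1_Mi|exact: Mi_periodic]. Qed.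

Lemma CP_vel i : CP r (vel i).
Proof. by apply: CP_sum => k _; apply: CPM; [exact: CP_Mi|exact: CP_p]. Qed.

Lemma pgrow_vel i : pgrow r (vel i).
Proof.
apply: pgrow_sum => k _; apply: pgrowM; last exact: pgrow_p.
by apply: pgrow_q; [exact/C1_continuous/C1_Mi|exact: Mi_periodic].
Qed.

Lemma hamiltonianE x :
  H x = V x.1 + 2^-1 * \sum_j \sum_k Mi j k x.1 * (x.2 j 0 * x.2 k 0).
Proof. by rewrite /hamiltonian wnorm_sq ?qform//; exact: posdef_inv. Qed.

Lemma CP_H : CP r H.
Proof.
rewrite (_ : H = fun x => V x.1 + 2^-1 * \sum_j \sum_k Mi j k x.1 * (x.2 j 0 * x.2 k 0)).
  apply: CPD.
    by apply: CP_q; [apply: smooth_C1; exact: V_smooth.1|exact: V_smooth.2].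
  apply: CPZ; apply: CP_sum => j _; apply: CP_sum => k _.
  by apply: CPM; [exact: CP_Mi|apply: CPM; exact: CP_p].
by rewrite funeqE => x; exact: hamiltonianE.
Qed.

Lemma is_derive_liftq (phi : cV -> R) (x v : phase) : C1 phi ->
  is_derive x v (fun x : phase => phi x.1) ('D_(v.1) phi x.1).
Proof. by move=> Cphi; have := C1_is_derive x v (@C1_fst R cV cV phi Cphi). Qed.

Lemma is_derive_p j (x v : phase) : is_derive x v (fun x : phase => x.2 j 0) (v.2 j 0).
Proof.
apply: is_derive_eq (C1_is_derive x v (@C1_snd R cV cV _ (C1_entry j))) _.
exact: (derive_val_fun (is_derive_entry j x.2 v.2)).
Qed.

Lemma is_derive_H (x v : phase) : is_derive x v H ('D_(v.1) V x.1 + 2^-1 *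
  \sum_j \sum_k (Mi j k x.1 * (x.2 j 0 * v.2 k 0 + x.2 k 0 * v.2 j 0) +
                (x.2 j 0 * x.2 k 0) * 'D_(v.1) (Mi j k) x.1)).
Proof.
rewrite (_ : H = fun x => V x.1 + 2^-1 * \sum_j \sum_k Mi j k x.1 * (x.2 j 0 * x.2 k 0)).
  apply: is_deriveD_fun.
    by apply: is_derive_liftq; apply: smooth_C1; exact: V_smooth.1.
  apply: is_derive_cstM; apply: is_derive_bigsum => j _; apply: is_derive_bigsum => k _.
  apply: is_deriveM_fun; first by apply: is_derive_liftq; exact: C1_Mi.
  by apply: is_deriveM_fun; exact: is_derive_p.
by rewrite funeqE => y; exact: hamiltonianE.
Qed.

Lemma derive_Hp i : 'D_(dp i) H = vel i.
Proof.
rewrite funeqE => x; rewrite (derive_val_fun (is_derive_H x (dp i))) /= derive0 add0r.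
have E j k : Mi j k x.1 * (x.2 j 0 * (delta_mx i 0 : cV) k 0 +
      x.2 k 0 * (delta_mx i 0 : cV) j 0) + x.2 j 0 * x.2 k 0 * 'D_0 (Mi j k) x.1 =
    Mi j k x.1 * x.2 j 0 * (k == i)%:R + Mi j k x.1 * x.2 k 0 * (j == i)%:R.
  by rewrite derive0 !mxE !eqxx !andbT; ring.
under eq_bigr => j _ do under eq_bigr => k _ do rewrite E.
under eq_bigr => j _ do rewrite big_split/=.
rewrite big_split/= /vel.
have -> : \sum_j \sum_k Mi j k x.1 * x.2 j 0 * (k == i)%:R = \sum_k Mi i k x.1 * x.2 k 0.
  apply: eq_bigr => j _; rewrite (bigD1 i)//= big1 ?addr0 => [|k ki].
    by rewrite eqxx mulr1 Mi_sym.
  by rewrite (negbTE ki) mulr0.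
have -> : \sum_j \sum_k Mi j k x.1 * x.2 k 0 * (j == i)%:R = \sum_k Mi i k x.1 * x.2 k 0.
  rewrite (bigD1 i)//= [X in _ + X]big1 ?addr0 => [|j ji].
    by apply: eq_bigr => k _; rewrite eqxx mulr1.
  by rewrite big1// => k _; rewrite (negbTE ji) mulr0.
by move: (\sum_k Mi i k x.1 * x.2 k 0) => A; field.
Qed.

Lemma HqE i : Hq i = fun x => 'D_(delta_mx i 0) V x.1 +
  2^-1 * \sum_j \sum_k (x.2 j 0 * x.2 k 0) * 'D_(delta_mx i 0) (Mi j k) x.1.
Proof.
rewrite funeqE => x; rewrite /Hq (derive_val_fun (is_derive_H x (dq i))) /=.
congr (_ + _ * _); apply: eq_bigr => j _; apply: eq_bigr => k _.
by rewrite !mxE !mulr0 addr0 mulr0 add0r.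
Qed.

Let qper_derive (phi : cV -> R) i : C1 phi -> qperiodic r phi ->
  qperiodic r ('D_(delta_mx i 0) phi).
Proof.
move=> Cphi pphi j aj q.
have := periodic_derive (dq i) (CP_q (n := n) Cphi pphi).2.
by move=> /periodicP/(_ j aj q 0).
Qed.

Lemma CP_Hq i : CP r (Hq i).
Proof.
rewrite HqE; apply: CPD.
  have C := smooth_C1 V_smooth.1.
  apply: (CP_q (phi := 'D_(delta_mx i 0) V)).
    by apply: smooth_C1; apply: smooth_derive; exact: V_smooth.1.
  by apply: qper_derive => //; exact: V_smooth.2.
apply: CPZ; apply: CP_sum => j _; apply: CP_sum => k _.
apply: CPM; first by apply: CPM; exact: CP_p.
apply: (CP_q (phi := 'D_(delta_mx i 0) (Mi j k))); first exact: C1_derive_Mi.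
by apply: qper_derive; [exact: C1_Mi|exact: Mi_periodic].
Qed.

Lemma pgrow_Hq i : pgrow r (Hq i).
Proof.
rewrite HqE; apply: pgrowD.
  have C := smooth_C1 V_smooth.1.
  apply: (pgrow_q (phi := 'D_(delta_mx i 0) V)); last first.
    by apply: qper_derive => //; exact: V_smooth.2.
  by apply: C1_continuous; apply: smooth_C1; apply: smooth_derive; exact: V_smooth.1.
apply: pgrowZ; apply: pgrow_sum => j _; apply: pgrow_sum => k _.
apply: pgrowM; first by apply: pgrowM; exact: pgrow_p.
apply: (pgrow_q (phi := 'D_(delta_mx i 0) (Mi j k))).
  exact/C1_continuous/C1_derive_Mi.
by apply: qper_derive; [exact: C1_Mi|exact: Mi_periodic].
Qed.

Lemma Hq_vel i : 'D_(dp i) (Hq i) = 'D_(dq i) (vel i).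
Proof.
have CV := (CP_vel i).1; rewrite -derive_Hp in CV *.
exact: (derive_comm CP_H.1 CV (CP_Hq i).1).
Qed.

Lemma Hq_velx i x : 'D_(dp i) (Hq i) x = 'D_(dq i) (vel i) x.
Proof. exact: (congr1 (fun g : phase -> R => g x) (Hq_vel i)). Qed.

Lemma derive_Hpx i x : 'D_(dp i) H x = vel i x.
Proof. exact: (congr1 (fun g : phase -> R => g x) (derive_Hp i)). Qed.

(** ** The Poisson bracket with the Hamiltonian *)

Definition pb (phi : phase -> R) (x : phase) : R :=
  \sum_i (Hq i x * 'D_(dp i) phi x - vel i x * 'D_(dq i) phi x).

Lemma testfunM (F0 F1 : phase -> R) : CP r F0 -> testfun r F1 -> testfun r (fun x => F0 x * F1 x).
Proof.
move=> [C0 p0] [CF1 p1 [c Fc]]; split; first exact: C1M.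
  exact: periodic_op.
by exists c => x cx; rewrite Fc// mulr0.
Qed.

(** The Hamiltonian vector field is divergence-free. *)
Lemma integral_pb (Theta : phase -> R) : testfun r Theta -> \int[mx]_x pb Theta x = 0.
Proof.
move=> tT; have CT : C1 Theta by case: tT.
have tp i := testfunM (CP_Hq i) tT; have tq i := testfunM (CP_vel i) tT.
have E x : pb Theta x = \sum_i ('D_(dp i) (fun x => Hq i x * Theta x) x -
    'D_(dq i) (fun x => vel i x * Theta x) x).
  apply: eq_bigr => i _.
  rewrite (derive_val_fun (is_deriveM_fun (C1_is_derive x (dp i) (CP_Hq i).1) (C1_is_derive x (dp i) CT))).
  rewrite (derive_val_fun (is_deriveM_fun (C1_is_derive x (dq i) (CP_vel i).1) (C1_is_derive x (dq i) CT))).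
  by rewrite Hq_velx; ring.
under eq_Rintegral do rewrite E.
rewrite Rint_sum => [|i _]; last by apply: intgB; apply: testfun_intg_derive.
rewrite big1// => i _; rewrite RintB; [|exact: testfun_intg_derive|exact: testfun_intg_derive].
by rewrite integral_dp// integral_dq// subrr.
Qed.

Lemma pbM (phi psi : phase -> R) x : C1 phi -> C1 psi ->
  pb (fun x => phi x * psi x) x = phi x * pb psi x + psi x * pb phi x.
Proof.
move=> Cphi Cpsi; rewrite /pb !mulr_sumr -big_split/=; apply: eq_bigr => i _.
rewrite (derive_val_fun (is_deriveM_fun (C1_is_derive x (dp i) Cphi) (C1_is_derive x (dp i) Cpsi))).
rewrite (derive_val_fun (is_deriveM_fun (C1_is_derive x (dq i) Cphi) (C1_is_derive x (dq i) Cpsi))).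
by ring.
Qed.

Lemma pb_comp (g : R -> R) (dg : R) (phi : phase -> R) x : C1 phi -> is_derive (phi x) (1 : R) g dg ->
  pb (fun x => g (phi x)) x = dg * pb phi x.
Proof.
move=> Cphi gd; rewrite /pb mulr_sumr; apply: eq_bigr => i _.
rewrite (derive_val_fun (is_derive_comp1 (C1_is_derive x (dp i) Cphi) gd)).
rewrite (derive_val_fun (is_derive_comp1 (C1_is_derive x (dq i) Cphi) gd)).
by ring.
Qed.

(** ** The Gibbs density *)

Definition Zpart : R := \int[mx]_y gibbs_weight T V M y.
Local Notation fs := (f_star r T V M).

Lemma fsE x : fs x = Zpart^-1 * expR (- (beta * H x)).
Proof. by rewrite /f_star mulrC. Qed.

Lemma CP_fs : CP r fs.
Proof.
rewrite (_ : fs = fun x => Zpart^-1 * expR (- (beta * H x))).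
  by apply: CPZ; apply: CP_expR; apply: CPN; apply: CPZ; exact: CP_H.
by rewrite funeqE => x; exact: fsE.
Qed.

Hypothesis Z_finite : partition_finite r T V M.

Let CP_gibbs : CP r (gibbs_weight T V M).
Proof. by apply: CP_expR; apply: CPN; apply: CPZ; exact: CP_H. Qed.

Let intg_gibbs : intg mx (gibbs_weight T V M).
Proof.
by apply: intg_ge0P => [|x|]; [exact: CP_measurable CP_gibbs|exact: expR_ge0|exact: Z_finite].
Qed.

Lemma Zpart_gt0 : 0 < Zpart.
Proof.
rewrite lt_neqAle Rintegral_ge0 => [|x _]; last exact: expR_ge0.
rewrite andbT eq_sym; apply/eqP => Z0.
have [CG pG] := CP_gibbs.
have := continuous_integral_eq0 (C1_continuous CG) pG (fun x => expR_ge0 _).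
rewrite -Rint_EFin// -/Zpart Z0 lexx => /(_ isT (0, 0)) /eqP.
by rewrite gt_eqF// expR_gt0.
Qed.

Lemma fs_gt0 x : 0 < fs x.
Proof. by rewrite fsE mulr_gt0 ?invr_gt0 ?Zpart_gt0 ?expR_gt0. Qed.

Lemma intg_fs : intg mx fs.
Proof.
rewrite (_ : fs = fun x => Zpart^-1 * gibbs_weight T V M x); first exact: intgZ.
by rewrite funeqE => x; exact: fsE.
Qed.

Lemma int_fs : \int[mx]_x fs x = 1.
Proof.
rewrite (_ : fs = fun x => Zpart^-1 * gibbs_weight T V M x); last first.
  by rewrite funeqE => x; exact: fsE.
by rewrite RintZ// mulVf// gt_eqF// Zpart_gt0.
Qed.

Lemma derive_fs (x v : phase) : 'D_v fs x = - (beta * 'D_v H x * fs x).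
Proof.
rewrite (_ : fs = fun x => Zpart^-1 * expR (- (beta * H x))); last first.
  by rewrite funeqE => y; exact: fsE.
have dH := is_deriveN_fun (is_derive_cstM beta (C1_is_derive x v CP_H.1)).
rewrite (derive_val_fun (is_derive_cstM _ (is_derive_comp1 dH (is_derive_expR _)))).
by ring.
Qed.

Lemma derive_fsp x i : 'D_(dp i) fs x = - (beta * vel i x * fs x).
Proof. by rewrite derive_fs derive_Hpx. Qed.

Lemma derive_fsq x i : 'D_(dq i) fs x = - (beta * Hq i x * fs x).
Proof. exact: derive_fs. Qed.

(** The Gibbs density is a function of the Hamiltonian. *)
Lemma pb_fs x : pb fs x = 0.
Proof. by rewrite /pb big1// => i _; rewrite derive_fsp derive_fsq; ring. Qed.

(** The Gibbs density is Gaussian in the momentum, with a width that is bounded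
    on bounded sets of positions. *)
Lemma fs_gauss (c : R) (m : nat) : exists C : R, 0 <= C /\
  forall x, `|euclidean_part r x.1| <= c -> (1 + `|x.2|) ^+ m * fs x <= C.
Proof.
have trM : pgrow r (fun x : phase => \sum_i M x.1 i i).
  apply: pgrow_sum => i _; apply: (pgrow_q (phi := fun q => M q i i)).
    by apply: C1_continuous; exact: smooth_C1.
  by move=> j aj q; rewrite Mper.
have [C0 [m0 [C00 trC]]] := trM c.
pose k := beta / 2 / (C0 + 1).
have k0 : 0 < k by rewrite !divr_gt0 ?invr_gt0// ltr_wpDl.
have [C1' Cb] := poly_gauss_bound m k0.
exists (Zpart^-1 * Num.max C1' 0); split.
  by rewrite mulr_ge0 ?invr_ge0 ?(ltW Zpart_gt0)// le_max lexx orbT.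
move=> x xc; rewrite fsE mulrCA ler_wpM2l ?invr_ge0 ?(ltW Zpart_gt0)//.
have trx : \sum_i M x.1 i i <= C0.
  have := trC (x.1, 0) xc; rewrite /= normr0 addr0 expr1n mulr1.
  exact: le_trans (ler_norm _).
rewrite le_max; apply/orP; left; apply: le_trans (Cb _ (normr_ge0 x.2)).
rewrite ler_wpM2l ?exprn_ge0 ?addr_ge0// ler_expR lerN2.
pose Q := (x.2^T *m invmx (M x.1) *m x.2) 0 0.
have Q0 : 0 <= Q by apply: posdef_ge0; exact: posdef_inv.
have pQ : `|x.2| ^+ 2 <= C0 * Q.
  have h i : x.2 i 0 ^+ 2 <= C0 * Q.
    apply: le_trans (inv_coord_le x.2 i (Mpd x.1)) _; rewrite ler_wpM2r//.
    apply: le_trans trx; rewrite (bigD1 i)//= lerDl sumr_ge0// => j _.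
    by rewrite ltW// posdef_diag_gt0.
  have C0Q : 0 <= C0 * Q by exact: mulr_ge0.
  rewrite -(sqr_sqrtr C0Q) lerXn2r ?nnegrE ?sqrtr_ge0//.
  apply: cV_norm_le; first exact: sqrtr_ge0.
  by move=> i; rewrite -sqrtr_sqr ler_sqrt.
have HQ : Q / 2 <= H x.
  rewrite /hamiltonian wnorm_sq; last exact: posdef_inv.
  by rewrite -/Q [Q / 2]mulrC lerDr.
apply: (@le_trans _ _ (beta * (Q / 2))); last by rewrite ler_wpM2l// invr_ge0 ltW.
rewrite /k -!mulrA ler_wpM2l ?invr_ge0 ?(ltW T_gt0)//.
rewrite [Q / 2]mulrC ler_wpM2l ?invr_ge0//.
rewrite mulrC ler_pdivrMr ?ltr_wpDl//; apply: le_trans pQ _.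
by rewrite mulrC ler_wpM2l// lerDl.
Qed.

End system.

(** * Decay and supports *)

Section integrable_classes.
Context {R : realType} (n r : nat).
Local Notation cV := 'cV[R]_n.
Local Notation phase := (cV * cV)%type.
Local Notation mx := (phase_measure R n r).
Implicit Types F K : phase -> R.

Definition contper F := continuous F /\ periodic r F.
Definition compsupp F := [/\ continuous F, periodic r F & bounded_support r F].

Lemma CP_contper F : CP r F -> contper F.
Proof. by move=> [CF pF]; split => //; exact: C1_continuous. Qed.

Lemma derive_contper F v : CP r F -> contper ('D_v F).
Proof. by move=> [CF pF]; split; [exact: C1_continuous_derive|exact: periodic_derive]. Qed.

Lemma contperM F K : contper F -> contper K -> contper (fun x => F x * K x).
Proof.
move=> [cF pF] [cK pK]; split; last exact: periodic_op.
by move=> x; apply: cvgM; [exact: cF|exact: cK].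
Qed.

Lemma contperD F K : contper F -> contper K -> contper (fun x => F x + K x).
Proof.
move=> [cF pF] [cK pK]; split; last exact: periodic_op.
by move=> x; apply: cvgD; [exact: cF|exact: cK].
Qed.

Lemma contper_cst (k : R) : contper (fun=> k).
Proof. by apply: CP_contper; exact: CP_cst. Qed.

Lemma contperZ k F : contper F -> contper (fun x => k * F x).
Proof. by move=> cF; apply: contperM => //; exact: contper_cst. Qed.

Lemma contperB F K : contper F -> contper K -> contper (fun x => F x - K x).
Proof.
move=> [cF pF] [cK pK]; split; last exact: (periodic_op (fun a b => a - b)).
by move=> x; apply: cvgB; [exact: cF|exact: cK].
Qed.

Lemma contper_sum (I : Type) (s : seq I) (P : pred I) (h : I -> phase -> R) :
  (forall i, P i -> contper (h i)) -> contper (fun x => \sum_(i <- s | P i) h i x).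
Proof.
move=> Ch; elim: s => [|i s IH].
  rewrite (_ : (fun _ => _) = fun=> 0); first exact: contper_cst.
  by rewrite funeqE => y; rewrite big_nil.
case Pi : (P i); last first.
  rewrite (_ : (fun _ => _) = (fun x => \sum_(j <- s | P j) h j x)) //.
  by rewrite funeqE => x; rewrite big_cons Pi.
rewrite (_ : (fun _ => _) = (fun x => h i x + \sum_(j <- s | P j) h j x)).
  by apply: contperD => //; exact: Ch.
by rewrite funeqE => x; rewrite big_cons Pi.
Qed.

Lemma contper_measurable F : contper F -> measurable_fun [set: phase] F.
Proof. by move=> [cF _]; exact: continuous_measurable_phase. Qed.

Lemma testfun_compsupp F : testfun r F -> compsupp F.
Proof. by move=> [CF pF sF]; split => //; exact: C1_continuous. Qed.

Lemma derive_compsupp F v : testfun r F -> compsupp ('D_v F).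
Proof.
move=> [CF pF sF]; split; [exact: C1_continuous_derive|exact: periodic_derive|].
exact: bounded_support_derive.
Qed.

Lemma compsuppMl F K : compsupp F -> contper K -> compsupp (fun x => F x * K x).
Proof.
move=> [cF pF [c Fc]] cK; have [cM pM] := contperM (conj cF pF) cK.
by split => //; exists c => x cx; rewrite Fc// mul0r.
Qed.

Lemma compsuppMr F K : contper F -> compsupp K -> compsupp (fun x => F x * K x).
Proof.
move=> cF [cK pK [c Kc]]; have [cM pM] := contperM cF (conj cK pK).
by split => //; exists c => x cx; rewrite Kc// mulr0.
Qed.

Lemma compsuppD F K : compsupp F -> compsupp K -> compsupp (fun x => F x + K x).
Proof.
move=> [cF pF [c Fc]] [cK pK [b Kb]]; have [cD pD] := contperD (conj cF pF) (conj cK pK).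
split => //; exists (Num.max c b) => x; rewrite gt_max => /andP[cx bx].
by rewrite Fc// Kb// addr0.
Qed.

Lemma compsupp_sum (I : Type) (s : seq I) (P : pred I) (h : I -> phase -> R) :
  (forall i, P i -> compsupp (h i)) -> compsupp (fun x => \sum_(i <- s | P i) h i x).
Proof.
move=> Ch; elim: s => [|i s IH].
  rewrite (_ : (fun _ => _) = fun=> 0); last by rewrite funeqE => y; rewrite big_nil.
  by have [c0 p0] := contper_cst 0; split => //; exists 0.
case Pi : (P i); last first.
  rewrite (_ : (fun _ => _) = (fun x => \sum_(j <- s | P j) h j x)) //.
  by rewrite funeqE => x; rewrite big_cons Pi.
rewrite (_ : (fun _ => _) = (fun x => h i x + \sum_(j <- s | P j) h j x)).
  by apply: compsuppD => //; exact: Ch.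
by rewrite funeqE => x; rewrite big_cons Pi.
Qed.

Lemma compsupp_intg F : compsupp F -> intg mx F.
Proof. by move=> [cF pF sF]; exact: intg_bounded_support. Qed.

Lemma testfunMr F K : testfun r F -> CP r K -> testfun r (fun x => F x * K x).
Proof.
move=> tF CK; rewrite (_ : (fun x => _) = (fun x => K x * F x)); first exact: testfunM.
by rewrite funeqE => x; rewrite mulrC.
Qed.

Definition rapid F := forall m : nat, exists C : R, 0 <= C /\
  forall x, (1 + enorm r x) ^+ m * `|F x| <= C.

Lemma rapid_weight F (k : nat) : rapid F -> exists C : R, 0 <= C /\
  forall x, `|F x| <= C * weight r x ^+ k.
Proof.
move=> /(_ (4 * n * k)%N)[C [C0 FC]]; exists C; split=> // x.
have w0 := weight_gt0 r x; have e0 : 0 < 1 + enorm r x by rewrite ltr_wpDr// enorm_ge0.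
have := FC x; rewrite exprM => h.
rewrite -ler_pdivrMr ?exprn_gt0// mulrC; apply: le_trans h.
rewrite ler_wpM2r// -exprVn lerXn2r ?nnegrE ?invr_ge0 ?(ltW w0) ?exprn_ge0 ?(ltW e0)//.
exact: weight_enorm.
Qed.

(** A factor that grows polynomially in the momentum is absorbed by the decay,
    as long as the position stays bounded. *)
Lemma rapid_pgrow_weight F K (c : R) : rapid F -> pgrow r K ->
  exists C : R, 0 <= C /\ forall x, `|euclidean_part r x.1| <= c ->
    `|F x * K x| <= C * weight r x.
Proof.
move=> rF /(_ c)[C1 [m [C10 KC]]].
have [C2 [C20 FC]] := rF (4 * n + m)%N.
exists (C1 * C2); split; first exact: mulr_ge0.
move=> x xc; have w0 := weight_gt0 r x.
have e0 : 0 < 1 + enorm r x by rewrite ltr_wpDr// enorm_ge0.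
rewrite normrM -ler_pdivrMr//.
have h1 := KC x xc; have h2 := FC x.
have h3 : `|K x| <= C1 * (1 + enorm r x) ^+ m.
  apply: le_trans h1 _; rewrite ler_wpM2l// lerXn2r ?nnegrE ?addr_ge0 ?enorm_ge0//.
  by rewrite lerD2l enorm_snd.
apply: (@le_trans _ _ (C1 * ((1 + enorm r x) ^+ (4 * n + m) * `|F x|))); last first.
  by rewrite ler_wpM2l.
apply: (@le_trans _ _ (`|F x| * (C1 * (1 + enorm r x) ^+ m) * (1 + enorm r x) ^+ (4 * n))).
  apply: ler_pM; rewrite ?mulr_ge0 ?invr_ge0 ?(ltW w0) ?weight_enorm//.
  by rewrite ler_wpM2l.
by rewrite exprD le_eqVlt; apply/orP; left; apply/eqP; ring.
Qed.

End integrable_classes.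

(** * The Fokker-Planck operator *)

Section fokker_planck.
Context {R : realType} (n r : nat) (T : R).
Variables (V : 'cV[R]_n -> R) (M G F : 'cV[R]_n -> 'M[R]_n).
Local Notation cV := 'cV[R]_n.
Local Notation phase := (cV * cV)%type.
Local Notation mx := (phase_measure R n r).
Local Notation beta := (T^-1).
Local Notation H := (hamiltonian V M).
Hypotheses (T_gt0 : 0 < T) (V_smooth : smooth_position r V) (V_ge0 : forall q, 0 <= V q)
  (M_spd : smooth_posdef r M) (G_spd : smooth_posdef r G)
  (FG : forall q, F q = (T^-1 / 2) *: G q).

Definition Gij (i j : 'I_n) (x : phase) : R := G x.1 i j.

Lemma CP_Gij i j : CP r (Gij i j).
Proof.
have [Gs Gp _] := G_spd.
apply: (CP_q (phi := fun q => G q i j)); first exact: smooth_C1.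
by move=> k ak q; rewrite Gp.
Qed.

Lemma pgrow_Gij i j : pgrow r (Gij i j).
Proof.
have [Gs Gp _] := G_spd.
apply: (pgrow_q (phi := fun q => G q i j)); first exact/C1_continuous/smooth_C1.
by move=> k ak q; rewrite Gp.
Qed.

Lemma Gij_sym i j x : Gij i j x = Gij j i x.
Proof. by have [_ _ /(_ x.1)[h _]] := G_spd; rewrite /Gij -[in LHS]h mxE. Qed.

(** The momentum flux [G (d_p phi + beta M^-1 p phi)], up to sign. *)
Definition wgrad (phi : phase -> R) (j : 'I_n) (x : phase) : R :=
  'D_(dp j) phi x + beta * vel M j x * phi x.
Definition flow (phi : phase -> R) (i : 'I_n) (x : phase) : R :=
  \sum_j Gij i j x * wgrad phi j x.

(** The right-hand side of the Fokker-Planck equation in divergence form, when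
    [F = beta / 2 G]; the flow then vanishes on the Gibbs density. *)
Definition Lop (phi : phase -> R) (x : phase) : R :=
  pb V M phi x + 2^-1 * \sum_i 'D_(dp i) (flow phi i) x.

Definition CP2 (phi : phase -> R) := CP r phi /\ forall j, C1 ('D_(dp j) phi).

Lemma CP_wgrad phi j : CP2 phi -> CP r (wgrad phi j).
Proof.
move=> [Cphi CD]; apply: CPD.
  by split; [exact: CD|apply: periodic_derive; exact: Cphi.2].
by apply: CPM => //; apply: CPZ; exact: CP_vel.
Qed.

Lemma CP_flow phi i : CP2 phi -> CP r (flow phi i).
Proof.
by move=> Cphi; apply: CP_sum => j _; apply: CPM; [exact: CP_Gij|exact: CP_wgrad].
Qed.

Lemma contper_pb phi : CP r phi -> contper r (pb V M phi).
Proof.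
move=> Cphi; apply: contper_sum => i _; apply: contperB; apply: contperM.
- exact/CP_contper/CP_Hq.
- exact: derive_contper.
- exact/CP_contper/CP_vel.
- exact: derive_contper.
Qed.

Lemma compsupp_pb phi : testfun r phi -> compsupp r (pb V M phi).
Proof.
move=> tphi; apply: compsupp_sum => i _.
rewrite (_ : (fun x => _) = (fun x => Hq V M i x * 'D_(dp i) phi x +
    (- vel M i x) * 'D_(dq i) phi x)); last first.
  by rewrite funeqE => x; rewrite mulNr.
apply: compsuppD; apply: compsuppMr.
- exact/CP_contper/CP_Hq.
- exact: derive_compsupp.
- by apply: CP_contper; apply: CPN; exact: CP_vel.
- exact: derive_compsupp.
Qed.

Lemma contper_Lop phi : CP2 phi -> contper r (Lop phi).
Proof.
move=> Cphi; apply: contperD; first exact: contper_pb Cphi.1.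
apply: contperZ; apply: contper_sum => i _; apply: derive_contper; exact: CP_flow.
Qed.

Lemma is_derive_velp i k (x : phase) : is_derive x (dp i : phase) (vel M k) (Mi M k i x.1).
Proof.
have gv0 : is_derive x (dp i : phase) (vel M k)
    (\sum_l (Mi M k l x.1 * (dp i : phase).2 l 0 +
      x.2 l 0 * 'D_((dp i : phase).1) (Mi M k l) x.1)).
  apply: is_derive_bigsum => l _; apply: (@is_deriveM_fun R phase).
    exact: is_derive_liftq (C1_Mi M_spd k l).
  exact: is_derive_p.
apply: is_derive_eq gv0 _.
rewrite (bigD1 i)//= big1 ?addr0 => [|l li].
  by rewrite derive0 !mxE !eqxx mulr1 mulr0 addr0.
by rewrite derive0 !mxE (negbTE li) mulr0 mulr0 addr0.
Qed.

Lemma derive_flow (phi : phase -> R) i (x : phase) : CP2 phi ->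
  'D_(dp i) (flow phi i) x = \sum_j Gij i j x *
    ('D_(dp i) ('D_(dp j) phi) x + (beta * Mi M j i x.1 * phi x +
      beta * vel M j x * 'D_(dp i) phi x)).
Proof.
move=> [[Cphi _] CD].
apply: derive_val_fun; apply: is_derive_bigsum => j _.
have gG : is_derive x (dp i : phase) (Gij i j) 0.
  apply: is_derive_eq (@is_derive_liftq R n (fun q => G q i j) x (dp i) _) _.
    by have [h _ _] := G_spd; apply: smooth_C1.
  by rewrite /= derive0.
have gv := is_derive_velp i j x.
have gD := C1_is_derive x (dp i) (CD j).
have gphi := C1_is_derive x (dp i) Cphi.
apply: is_derive_eq (is_deriveM_fun gG (is_deriveD_fun gD (is_deriveM_fun (is_derive_cstM beta gv) gphi))) _.
by rewrite mulr0 addr0; ring.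
Qed.

(** Since the velocity is the momentum gradient of the Hamiltonian, the
    Fokker-Planck operator is a Poisson bracket plus a divergence in momentum. *)
Lemma fpk_Lop phi x : CP2 phi ->
  poisson H phi x + (x.2^T *m invmx (M x.1) *m F x.1 *m grad_p phi x) 0 0
    + frobenius (F x.1) (invmx (M x.1)) * phi x
    + 2^-1 * frobenius (G x.1) (hess_p phi x) = Lop phi x.
Proof.
case: x => q p [[Cphi pphi] CD] /=.
have CDvel := CP_vel M_spd.
have dq_ (g : phase -> R) i : grad_q g (q, p) i 0 = 'D_(dq i) g (q, p).
  by rewrite mxE /= derive_pairl.
have dp_ (g : phase -> R) i : grad_p g (q, p) i 0 = 'D_(dp i) g (q, p).
  by rewrite mxE /= derive_pairr.
have E1 : poisson H phi (q, p) = pb V M phi (q, p).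
  rewrite /poisson mxE [X in _ + X]mxE !dotE -sumrB /pb; apply: eq_bigr => i _.
  by rewrite !dq_ !dp_ (derive_Hpx V_smooth M_spd).
have E2 : (p^T *m invmx (M q) *m F q *m grad_p phi (q, p)) 0 0 =
    2^-1 * \sum_i \sum_j Gij i j (q, p) * (beta * vel M j (q, p) * 'D_(dp i) phi (q, p)).
  have -> : p^T *m invmx (M q) *m F q = (F q *m (invmx (M q) *m p))^T.
    have FT : (F q)^T = F q.
      apply/matrixP => a b; rewrite FG !mxE; congr (_ * _).
      exact: (Gij_sym b a (q, p)).
    rewrite !trmx_mul FT (posdef_inv_sym _)//.
    by have [_ _ h] := M_spd.
  rewrite dotE mulr_sumr; apply: eq_bigr => i _.
  rewrite dp_ mxE mulr_suml mulr_sumr; apply: eq_bigr => j _.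
  rewrite FG !mxE /Gij /vel /=.
  have -> : \sum_j0 invmx (M q) j j0 * p j0 0 = \sum_k Mi M j k q * p k 0 by [].
  by ring.
have E3 : frobenius (F q) (invmx (M q)) = 2^-1 * \sum_i \sum_j Gij i j (q, p) * (beta * Mi M j i q).
  rewrite /frobenius /mxtrace mulr_sumr; apply: eq_bigr => i _.
  rewrite mxE mulr_sumr; apply: eq_bigr => j _.
  by rewrite FG !mxE (Gij_sym i j) /Gij /Mi /=; ring.
have E4 : frobenius (G q) (hess_p phi (q, p)) =
    \sum_i \sum_j Gij i j (q, p) * 'D_(dp i) ('D_(dp j) phi) (q, p).
  rewrite /frobenius /mxtrace; apply: eq_bigr => i _.
  rewrite mxE; apply: eq_bigr => j _.
  have -> : (G q)^T i j = Gij i j (q, p) by rewrite mxE -/(Gij j i (q, p)) Gij_sym.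
  congr (_ * _); rewrite mxE /=.
  have -> : 'D_(delta_mx i 0) (fun p => phi (q, p)) = (fun p => 'D_(dp i) phi (q, p)).
    by rewrite funeqE => p'; rewrite derive_pairr.
  rewrite (derive_pairr (fun x => 'D_(dp i) phi x)).
  by have := congr1 (fun g : phase -> R => g (q, p)) (derive_comm Cphi (CD i) (CD j)) => ->.
have E5 i := derive_flow i (q, p) (conj (conj Cphi pphi) CD).
rewrite E1 E2 E3 E4 /Lop -!addrA; congr (_ + _).
under [in RHS]eq_bigr => i _ do rewrite E5.
rewrite [2^-1 * _ * phi _]mulrAC -!mulrA -!mulrDr; congr (_ * _).
rewrite mulr_sumr -!big_split/=; apply: eq_bigr => i _.
rewrite mulr_sumr -!big_split/=; apply: eq_bigr => j _.
by ring.
Qed.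

(** ** Integration by parts *)

Lemma pb_by_parts theta phi : testfun r theta -> CP r phi ->
  \int[mx]_x (theta x * pb V M phi x) = - \int[mx]_x (phi x * pb V M theta x).
Proof.
move=> tt Cphi; have Ct : C1 theta by case: tt.
have := integral_pb V_smooth M_spd (testfunMr tt Cphi).
have E x : pb V M (fun x => theta x * phi x) x =
    theta x * pb V M phi x + phi x * pb V M theta x.
  exact: (pbM V M x Ct Cphi.1).
under eq_Rintegral do rewrite E.
rewrite RintD; first by move/eqP; rewrite addr_eq0 => /eqP.
  by apply: compsupp_intg; apply: compsuppMl; [exact: testfun_compsupp|exact: contper_pb].
by apply: compsupp_intg; apply: compsuppMr; [exact: CP_contper|exact: compsupp_pb].
Qed.

Lemma dp_by_parts theta (phi : phase -> R) i : testfun r theta -> CP r phi ->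
  \int[mx]_x (theta x * 'D_(dp i) phi x) = - \int[mx]_x ('D_(dp i) theta x * phi x).
Proof.
move=> tt Cphi; have Ct : C1 theta by case: tt.
have := integral_dp i (testfunMr tt Cphi).
have E x : 'D_(dp i) (fun x => theta x * phi x) x =
    theta x * 'D_(dp i) phi x + 'D_(dp i) theta x * phi x.
  rewrite (derive_val_fun (is_deriveM_fun (C1_is_derive x (dp i) Ct) (C1_is_derive x (dp i) Cphi.1))).
  by rewrite [phi x * _]mulrC.
under eq_Rintegral do rewrite E.
rewrite RintD; first by move/eqP; rewrite addr_eq0 => /eqP.
  by apply: compsupp_intg; apply: compsuppMl; [exact: testfun_compsupp|exact: derive_contper].
by apply: compsupp_intg; apply: compsuppMl; [exact: derive_compsupp|exact: CP_contper].
Qed.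

Lemma Lop_by_parts theta phi : testfun r theta -> CP2 phi ->
  \int[mx]_x (theta x * Lop phi x) =
  \int[mx]_x (theta x * pb V M phi x)
  - 2^-1 * \int[mx]_x \sum_i 'D_(dp i) theta x * flow phi i x.
Proof.
move=> tt Cphi.
have E x : theta x * Lop phi x = theta x * pb V M phi x +
    2^-1 * \sum_i theta x * 'D_(dp i) (flow phi i) x.
  by rewrite /Lop mulrDr -mulr_sumr; ring.
under eq_Rintegral do rewrite E.
have cf i := derive_contper (dp i) (CP_flow i Cphi).
have ct := testfun_compsupp tt.
have it i : intg mx (fun x => theta x * 'D_(dp i) (flow phi i) x).
  by apply: compsupp_intg; apply: compsuppMl.
have id_ i : intg mx (fun x => 'D_(dp i) theta x * flow phi i x).
  apply: compsupp_intg; apply: compsuppMl; first exact: derive_compsupp.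
  by apply: CP_contper; exact: CP_flow.
rewrite RintD; last 2 first.
- by apply: compsupp_intg; apply: compsuppMl => //; apply: contper_pb; exact: Cphi.1.
- by apply: intgZ; apply: intg_sum => i _.
congr (_ + _); rewrite RintZ; last by apply: intg_sum => i _.
rewrite !Rint_sum; [|by move=> i _|by move=> i _].
rewrite -mulrN -sumrN; congr (_ * _); apply: eq_bigr => i _.
by rewrite dp_by_parts//; exact: CP_flow.
Qed.

End fokker_planck.

(** * Renormalization of the entropy *)

Section renormalization.
Context {R : realType}.
Implicit Types e u : R.

(** The square [u ^ 2] cannot be used as an entropy, because its transport term
    is not known to be integrable. It is approximated by the convex function
    [u ^ 2 / (1 + e u)], of linear growth. *)
Definition renormw e u : R := (1 + e * u)^-1.
Definition renorm e u : R := u ^+ 2 * renormw e u.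
Definition drenorm e u : R := u * renormw e u * (1 + renormw e u).
Definition ddrenorm e u : R := 2 * renormw e u ^+ 3.

(** A solution of [corrector - u corrector' = renorm e u]: with it,
    [renorm e u d_p fs = d_p (fs corrector) - corrector' d_p f] for [f = u fs]. *)
Definition corrector e u : R := - (e^-1 * (u * ln (1 + e * u))).
Definition dcorrector e u : R := - (e^-1 * ln (1 + e * u)) - u * renormw e u.

Section bounds.
Variables (e u : R).
Hypotheses (e0 : 0 < e) (u0 : 0 <= u).

Let ei0 : 0 <= e^-1. Proof. by rewrite invr_ge0 ltW. Qed.
Let d0 : 0 < 1 + e * u. Proof. by rewrite ltr_pwDl// mulr_ge0// ltW. Qed.
Lemma renormw_gt0 : 0 < renormw e u. Proof. by rewrite invr_gt0. Qed.
Lemma renormw_le1 : renormw e u <= 1.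
Proof. by rewrite invf_le1// lerDl mulr_ge0// ltW. Qed.
Lemma renormwE : e * u * renormw e u = 1 - renormw e u.
Proof.
have : (1 + e * u) * renormw e u = 1 by rewrite /renormw divff ?gt_eqF.
by move: (renormw e u) => w h; rewrite -h; ring.
Qed.

Lemma is_derive_renormw : is_derive u (1 : R) (renormw e) (- (e * renormw e u ^+ 2)).
Proof.
have h : is_derive u (1 : R) (fun u => 1 + e * u) (0 + e * 1).
  exact: is_deriveD_fun (is_derive_cst (1 : R) u (1 : R)) (is_derive_cstM e (is_derive_id u (1 : R))).
have h2 := @is_deriveV_fun R R (fun u => 1 + e * u) u 1 _ (lt0r_neq0 d0) h.
by apply: is_derive_eq h2 _; rewrite /renormw exprVn; ring.
Qed.

Lemma is_derive_renorm : is_derive u (1 : R) (renorm e) (drenorm e u).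
Proof.
have h := is_deriveM_fun (is_deriveM_fun (is_derive_id u (1 : R)) (is_derive_id u (1 : R))) is_derive_renormw.
apply: is_derive_eq h _.
have := renormwE; rewrite /drenorm; move: (renormw e u) => w E.
have -> : u * u * - (e * w ^+ 2) + w * (u * 1 + u * 1) =
  - (u * w * (e * u * w)) + 2 * u * w by ring.
by rewrite E; ring.
Qed.

Lemma is_derive_drenorm : is_derive u (1 : R) (drenorm e) (ddrenorm e u).
Proof.
have h1 := is_deriveD_fun (is_derive_cst (1 : R) u (1 : R)) is_derive_renormw.
have h := is_deriveM_fun (is_deriveM_fun (is_derive_id u (1 : R)) is_derive_renormw) h1.
apply: is_derive_eq h _.
have := renormwE; rewrite /ddrenorm; move: (renormw e u) => w E.
have -> : u * w * (0 - e * w ^+ 2) + (1 + w) * (u * - (e * w ^+ 2) + w * 1) =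
  - (w * w * (e * u * w)) - (1 + w) * w * (e * u * w) + w * (1 + w) by ring.
by rewrite E; ring.
Qed.

Let is_derive_ln1 : is_derive u (1 : R) (fun u => ln (1 + e * u)) (e * renormw e u).
Proof.
have h : is_derive u (1 : R) (fun u => 1 + e * u) (0 + e * 1).
  exact: is_deriveD_fun (is_derive_cst (1 : R) u (1 : R)) (is_derive_cstM e (is_derive_id u (1 : R))).
apply: is_derive_eq (@is_derive_comp1 R R (@ln R) (fun u => 1 + e * u) u 1 _ _ h (is_derive1_ln d0)) _.
by rewrite /renormw; ring.
Qed.

Lemma is_derive_corrector : is_derive u (1 : R) (corrector e) (dcorrector e u).
Proof.
have h := is_deriveN_fun (is_derive_cstM e^-1 (is_deriveM_fun (is_derive_id u (1 : R)) is_derive_ln1)).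
apply: is_derive_eq h _; rewrite /dcorrector; move: (ln _) (renormw e u) => l w.
by field; rewrite gt_eqF.
Qed.

Lemma correctorE : corrector e u - u * dcorrector e u = renorm e u.
Proof. by rewrite /corrector /dcorrector /renorm; ring. Qed.

Lemma renorm_ge0 : 0 <= renorm e u.
Proof. by rewrite mulr_ge0 ?sqr_ge0// ltW// renormw_gt0. Qed.

Lemma renorm_le : renorm e u <= e^-1 * u.
Proof.
have -> : renorm e u = e^-1 * (u * (e * u * renormw e u)) by rewrite /renorm; field; rewrite gt_eqF.
rewrite renormwE ler_wpM2l// ler_piMr// gerBl; exact/ltW/renormw_gt0.
Qed.

Lemma drenorm_ge0 : 0 <= drenorm e u.
Proof. by have w0 := renormw_gt0; rewrite /drenorm !mulr_ge0// ?addr_ge0// ltW. Qed.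

Lemma drenorm_le : drenorm e u <= 2 * u.
Proof.
rewrite /drenorm -mulrA [2 * u]mulrC ler_wpM2l//.
have := renormw_le1; have := renormw_gt0; move: (renormw e u) => w w0 w1; nra.
Qed.

Lemma drenorm_leV : drenorm e u <= e^-1.
Proof.
have -> : drenorm e u = e^-1 * ((e * u * renormw e u) * (1 + renormw e u)).
  by rewrite /drenorm; field; rewrite gt_eqF.
rewrite renormwE -[leRHS]mulr1 ler_wpM2l//.
have := renormw_gt0; move: (renormw e u) => w w0; nra.
Qed.

Lemma ddrenorm_ge0 : 0 <= ddrenorm e u.
Proof. by rewrite /ddrenorm mulr_ge0// exprn_ge0// ltW// renormw_gt0. Qed.

Hypothesis e1 : e <= 1.

Let ln1_le : 0 <= ln (1 + e * u) <= ln (1 + u).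
Proof.
have eu0 : 0 <= e * u by rewrite mulr_ge0// ltW.
apply/andP; split; first by rewrite ln_ge0// lerDl.
by rewrite ler_ln ?posrE ?ltr_pwDl// lerD2l ler_piMl.
Qed.

Lemma corrector_le : `|corrector e u| <= e^-1 * (u * ln (1 + u)).
Proof.
case/andP: ln1_le => l0 l1.
rewrite /corrector normrN normrM (ger0_norm ei0) ler_wpM2l//.
by rewrite ger0_norm ?mulr_ge0// ler_wpM2l.
Qed.

Lemma dcorrector_le : `|dcorrector e u| <= e^-1 * (ln (1 + u) + 1).
Proof.
case/andP: ln1_le => l0 l1; have w0 := renormw_gt0.
rewrite /dcorrector -opprD normrN ger0_norm; last first.
  by rewrite addr_ge0// mulr_ge0// ltW.
have -> : u * renormw e u = e^-1 * (e * u * renormw e u) by field; rewrite gt_eqF.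
by rewrite -mulrDr ler_wpM2l// lerD// renormwE gerBl ltW.
Qed.

End bounds.

Lemma cvg_drenorm u (e_ : nat -> R) : 0 <= u -> e_ @ \oo --> (0 : R) ->
  (fun k => drenorm (e_ k) u) @ \oo --> 2 * u /\ (fun k => ddrenorm (e_ k) u) @ \oo --> (2 : R).
Proof.
move=> u0 ee.
have hw : (fun k => renormw (e_ k) u) @ \oo --> (1 : R).
  rewrite -[X in _ --> X]invr1; apply: cvgV; first exact: oner_neq0.
  rewrite -[X in _ --> X]addr0; apply: cvgD; first exact: cvg_cst.
  by rewrite -(mul0r u); apply: cvgMl.
split.
  rewrite (_ : 2 * u = u * 1 * (1 + 1)); last by ring.
  apply: cvgM; first exact: cvgMr.
  by apply: cvgD => //; exact: cvg_cst.
rewrite (_ : (2 : R) = 2 * (1 * (1 * 1))) in |- * ; last by ring.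
rewrite (_ : (fun k => _) = (fun k => 2 * (renormw (e_ k) u * (renormw (e_ k) u * renormw (e_ k) u)))); last first.
  by rewrite funeqE => k; rewrite /ddrenorm; ring.
apply: cvgMr; apply: cvgM => //; exact: cvgM.
Qed.

(** Because [1 + y ^ 4 <= (1 + y) ^ 4] with [y ^ 4 = u]. *)
Lemma ln1_le_root u : 0 <= u -> ln (1 + u) <= 4 * Num.sqrt (Num.sqrt u).
Proof.
move=> u0; set y := Num.sqrt (Num.sqrt u).
have y0 : 0 <= y by exact: sqrtr_ge0.
have uE : u = y ^+ 4 by rewrite (exprM y 2 2) !sqr_sqrtr// sqrtr_ge0.
apply: (@le_trans _ _ (ln ((1 + y) ^+ 4))).
  rewrite ler_ln ?posrE ?ltr_pwDl ?exprn_gt0 ?ltr_pwDl// uE.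
  have -> : (1 + y) ^+ 4 = 1 + y ^+ 4 + (4 * y + 6 * y ^+ 2 + 4 * y ^+ 3) by ring.
  by rewrite lerDl !addr_ge0// mulr_ge0// exprn_ge0.
rewrite lnXn ?ltr_pwDl// -[leLHS]mulr_natl; apply: ler_wpM2l => //.
apply: le_ln1Dx; exact: lt_le_trans y0.
Qed.

(** The logarithm is absorbed by interpolation between the rapid decay of [x]
    and the integrability of [f * u]. *)
Lemma tail_bound (x f u w B C : R) : 0 <= x -> 0 <= u -> 0 < w -> w <= 1 -> 0 <= f ->
  0 <= B -> x ^+ 2 <= B * f -> x <= C * w ^+ 2 ->
  x * ln (1 + u) <= 4 * (1 + B * C ^+ 2) * (w + f * u).
Proof.
move=> x0 u0 w0 w1 f0 B0 xf xw; set y := Num.sqrt (Num.sqrt u).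
have y0 : 0 <= y by exact: sqrtr_ge0.
have uE : u = y ^+ 4 by rewrite (exprM y 2 2) !sqr_sqrtr// sqrtr_ge0.
apply: (@le_trans _ _ (x * (4 * y))); first by rewrite ler_wpM2l// ln1_le_root.
rewrite mulrCA -mulrA ler_wpM2l//.
set K := 1 + _; have K1 : 1 <= K by rewrite lerDl mulr_ge0// sqr_ge0.
have fu0 : 0 <= f * u by rewrite mulr_ge0.
have N0 : 0 <= w + f * u by rewrite addr_ge0// ltW.
rewrite -(@ler_pXn2r _ 4)// ?nnegrE ?mulr_ge0 ?(le_trans _ K1)//.
have -> : (x * y) ^+ 4 = x ^+ 2 * (x ^+ 2 * u) by rewrite uE; ring.
apply: (@le_trans _ _ ((C * w ^+ 2) ^+ 2 * (B * f * u))).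
  apply: ler_pM; rewrite ?mulr_ge0 ?sqr_ge0//.
    by rewrite lerXn2r ?nnegrE// (le_trans x0).
  by rewrite ler_wpM2r.
have -> : (C * w ^+ 2) ^+ 2 * (B * f * u) = (B * C ^+ 2) * (w ^+ 4 * (f * u)) by ring.
have BC0 : 0 <= B * C ^+ 2 by rewrite mulr_ge0// sqr_ge0.
have K4 : B * C ^+ 2 <= K ^+ 4.
  apply: (@le_trans _ _ K); first by rewrite /K addrC lerDl.
  by rewrite -[leLHS]expr1; apply: ler_weXn2l.
have w4 : 0 <= w ^+ 4 * (f * u) by rewrite mulr_ge0// exprn_ge0// ltW.
rewrite exprMn; apply: ler_pM => //.
move: (f * u) fu0 => s s0 in N0 *.
have [s1|s1] := leP s 1.
  apply: (@le_trans _ _ (w ^+ 4)); first by rewrite ler_piMr// exprn_ge0// ltW.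
  by rewrite lerXn2r ?nnegrE ?(ltW w0)// lerDl.
apply: (@le_trans _ _ (s ^+ 4)); last by rewrite lerXn2r ?nnegrE// lerDr ltW.
apply: (@le_trans _ _ s); first by rewrite ler_piMl// exprn_ile1// ltW.
by rewrite -[leLHS]expr1; apply: ler_weXn2l => //; exact: ltW.
Qed.

End renormalization.

(** * Cutoffs in position and in momentum *)

Section cutoff_functions.
Context {R : realType} (n r : nat).
Local Notation cV := 'cV[R]_n.
Local Notation phase := (cV * cV)%type.
Implicit Types psi eta : cV -> R.

Definition qcut (c : R) psi := [/\ C1 psi, qperiodic r psi &
  forall q, c < `|euclidean_part r q| -> psi q = 0].
Definition pcut (c : R) eta := C1 eta /\ forall p, c < `|p| -> eta p = 0.

Lemma euclidean_part_continuous : continuous (fun q : cV => `|euclidean_part r q|).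
Proof.
move=> q.
have e (q' : cV) : enorm r (q', (0 : cV)) = `|euclidean_part r q'|.
  by rewrite /enorm prod_normE/= normr0 max_l.
rewrite (_ : (fun q => _) = (fun q' => enorm r (q', (0 : cV)))); last first.
  by rewrite funeqE => q'; rewrite e.
have cpair : continuous (fun q' : cV => (q', (0 : cV)) : phase).
  have c1 : continuous (fun q' : cV => q') by move=> z; exact: cvg_id.
  have c2 : continuous (fun _ : cV => (0 : cV)) by exact: cst_continuous.
  by move=> z; exact: (cvg_pair (c1 z) (c2 z)).
by apply: (@continuous_comp _ _ _ _ (@enorm R n r)); [exact: cpair|exact: enorm_continuous].
Qed.

Lemma derive_qcut c psi v q : qcut c psi -> c < `|euclidean_part r q| ->
  'D_v psi q = 0.
Proof.
move=> [_ _ h] cq; transitivity ('D_v (cst 0 : cV -> R) q); last exact: derive_cst.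
apply: near_eq_derive.
have : \forall q' \near q, c < `|euclidean_part r q'|.
  exact: (cvgr_gt _ (@euclidean_part_continuous q) _ cq).
by apply: filterS => q' /h.
Qed.

Lemma qperiodic_derive psi v : qperiodic r psi -> qperiodic r ('D_v psi).
Proof.
move=> ppsi i ai q; rewrite /derive.
set g1 := fun h => h^-1 *: _; set g2 := fun h => h^-1 *: _.
suff -> : g1 = g2 by []; rewrite funeqE => h; rewrite /g1 /g2 /=; congr (_ *: _).
by rewrite ppsi// addrA ppsi.
Qed.

Lemma testfun_cut c b psi eta : qcut c psi -> pcut b eta ->
  testfun r (fun x : phase => psi x.1 * eta x.2).
Proof.
move=> [Cpsi ppsi h] [Ceta h'].
have [C P] := CPM (@CP_q R n r psi Cpsi ppsi) (@CP_pfun R n r eta Ceta).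
split => //; exists (Num.max c b) => x.
have [/h -> _|ce] := ltP c `|euclidean_part r x.1|; first by rewrite mul0r.
have [/h' -> _|be] := ltP b `|x.2|; first by rewrite mulr0.
rewrite /enorm prod_normE/= ltNge ge_max !le_max ce/= be orbT.
by [].
Qed.

Lemma derive_cutp psi eta i x : C1 psi -> C1 eta ->
  'D_(dp i) (fun x : phase => psi x.1 * eta x.2) x = psi x.1 * 'D_(delta_mx i 0) eta x.2.
Proof.
move=> Cpsi Ceta.
have h := is_deriveM_fun (C1_is_derive x (dp i : phase) (C1_fst Cpsi))
  (C1_is_derive x (dp i : phase) (C1_snd Ceta)).
rewrite (derive_val_fun h) (derive_fst psi) (derive_snd eta) /= derive0.
by rewrite mulr0 addr0.
Qed.

Lemma derive_cutq psi eta i x : C1 psi -> C1 eta ->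
  'D_(dq i) (fun x : phase => psi x.1 * eta x.2) x = 'D_(delta_mx i 0) psi x.1 * eta x.2.
Proof.
move=> Cpsi Ceta.
have h := is_deriveM_fun (C1_is_derive x (dq i : phase) (C1_fst Cpsi))
  (C1_is_derive x (dq i : phase) (C1_snd Ceta)).
rewrite (derive_val_fun h) (derive_fst psi) (derive_snd eta) /= derive0.
by rewrite mulr0 add0r mulrC.
Qed.

Lemma qcut_derive c psi i : qcut c psi -> C1 ('D_(delta_mx i 0) psi) ->
  qcut c ('D_(delta_mx i 0) psi).
Proof.
move=> cpsi CD; split => //; first by case: cpsi => _ p _; exact: qperiodic_derive.
by move=> q cq; exact: derive_qcut cpsi cq.
Qed.

Lemma qcut_bump (S : R) : 0 < S -> qcut S (bump (fun i : 'I_n => ~~ angle r i) S).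
Proof.
move=> S0; split; first exact: C1_bump.
  move=> i ai q; rewrite /bump /sqsum; congr (pos (1 - _ * _) ^+ 3).
  apply: eq_bigr => j nj; rewrite !mxE.
  by case: eqP => [ji|_]; [move: nj; rewrite ji ai|rewrite mulr0 addr0].
move=> q Sq.
have [i [ni Si]] : exists i, ~~ angle r i /\ S < `|q i 0|.
  apply: contrapT => h; move: Sq; apply/negP; rewrite -leNgt.
  apply: cV_norm_le => [|i]; first exact: ltW.
  rewrite mxE; case: ifPn => ai; first by rewrite normr0 ltW.
  by rewrite leNgt; apply/negP => Si; apply: h; exists i.
by rewrite (bump_out S0 ni)// ltW.
Qed.

Lemma pcut_bump (S : R) : 0 < S -> pcut S (bump (fun=> true) S : cV -> R).
Proof.
move=> S0; split; first exact: C1_bump.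
move=> p Sp; have [i Si] : exists i, S < `|p i 0|.
  apply: contrapT => h; move: Sp; apply/negP; rewrite -leNgt.
  apply: cV_norm_le => [|i]; first exact: ltW.
  by rewrite leNgt; apply/negP => Si; apply: h; exists i.
by rewrite (@bump_out _ _ _ S i)// ltW.
Qed.

End cutoff_functions.

(** * The renormalized dissipation identity *)

Section renormalized_identity.
Context {R : realType} (n r : nat) (T : R).
Variables (V : 'cV[R]_n -> R) (M G : 'cV[R]_n -> 'M[R]_n).
Local Notation cV := 'cV[R]_n.
Local Notation phase := (cV * cV)%type.
Local Notation mx := (phase_measure R n r).
Local Notation beta := (T^-1).
Local Notation fs := (f_star r T V M).
Local Notation Lc := (Lop T V M G).
Local Notation flw := (flow T M G).
Hypotheses (T_gt0 : 0 < T) (V_smooth : smooth_position r V) (V_ge0 : forall q, 0 <= V q)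
  (M_spd : smooth_posdef r M) (G_spd : smooth_posdef r G)
  (Z_finite : partition_finite r T V M).

Definition ratio (f : phase -> R) (x : phase) : R := f x * (fs x)^-1.

(** Density of the Dirichlet form of the momentum diffusion. *)
Definition energy (f : phase -> R) (x : phase) : R :=
  \sum_i 'D_(dp i) (ratio f) x * flw f i x.

Let fs0 x : 0 < fs x. Proof. exact: fs_gt0. Qed.
Let fsn0 x : fs x != 0. Proof. exact/lt0r_neq0. Qed.

Variable f : phase -> R.
Hypotheses (Cf : CP2 r f) (f0 : forall x, 0 <= f x).

Local Notation u := (ratio f).

Lemma CP_ratio : CP r u.
Proof. by apply: CPM; [exact: Cf.1|apply: CP_V => //; exact: CP_fs]. Qed.

Lemma ratio_ge0 x : 0 <= u x. Proof. by rewrite mulr_ge0// invr_ge0 ltW. Qed.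

Lemma ratioK x : u x * fs x = f x.
Proof. by rewrite /ratio mulfVK. Qed.

Lemma derive_ratio x j : 'D_(dp j) u x = wgrad T M f j x * (fs x)^-1.
Proof.
have Cfs := CP_fs T V_smooth M_spd.
have h := is_deriveM_fun (C1_is_derive x (dp j : phase) Cf.1.1)
  (is_deriveV_fun (fsn0 x) (C1_is_derive x (dp j : phase) Cfs.1)).
rewrite (derive_val_fun h) (derive_fsp T V_smooth M_spd) /wgrad.
move: (fsn0 x) (vel _ _ _) ('D_(dp j) f x) (f x); move: (fs x) => s s0 v d a.
by field; rewrite s0 gt_eqF.
Qed.

Lemma CP_derive_ratio j : CP r ('D_(dp j) u).
Proof.
have -> : 'D_(dp j) u = (fun x => wgrad T M f j x * (fs x)^-1).
  by rewrite funeqE => x; exact: derive_ratio.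
by apply: CPM; [exact: CP_wgrad|apply: CP_V => //; exact: CP_fs].
Qed.

Lemma flow_ratio i x : flw f i x = fs x * \sum_j G x.1 i j * 'D_(dp j) u x.
Proof.
rewrite mulr_sumr; apply: eq_bigr => j _; rewrite derive_ratio /Gij.
by field.
Qed.

Lemma CP_energy : CP r (energy f).
Proof.
by apply: CP_sum => i _; apply: CPM; [exact: CP_derive_ratio|exact: CP_flow].
Qed.

Lemma energyE x : energy f x = fs x *
  ((\col_i 'D_(dp i) u x)^T *m G x.1 *m (\col_i 'D_(dp i) u x)) 0 0.
Proof.
set D := \col_i _; have DE i : 'D_(dp i) u x = D i 0 by rewrite mxE.
rewrite qform mulr_sumr; apply: eq_bigr => i _; rewrite flow_ratio DE.
rewrite mulrCA; congr (_ * _); rewrite mulr_sumr; apply: eq_bigr => j _.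
by rewrite DE mulrCA.
Qed.

Lemma energy_ge0 x : 0 <= energy f x.
Proof.
rewrite energyE mulr_ge0 ?(ltW (fs0 x))//; apply: posdef_ge0.
by have [_ _ h] := G_spd.
Qed.

Variable e : R.
Hypothesis e0 : 0 < e.

Lemma CP_ratio_comp (g dg : R -> R) :
  (forall a : R, 0 <= a -> is_derive a (1 : R) g (dg a)) ->
  (forall a : R, 0 <= a -> {for a, continuous dg}) -> CP r (fun x => g (u x)).
Proof.
move=> gd dgc; split; last by apply: periodic_comp; exact: CP_ratio.2.
by apply: (@C1_comp1 _ _ g dg) => [|x|x]; [exact: CP_ratio.1|exact/gd/ratio_ge0|exact/dgc/ratio_ge0].
Qed.

Let is_derive_continuous (g : R -> R) (a d : R) : is_derive a (1 : R) g d -> {for a, continuous g}.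
Proof. by move=> h; apply: differentiable_continuous; apply/derivable1_diffP; case: h. Qed.

Lemma continuous_renormw a : 0 <= a -> {for a, continuous (renormw e)}.
Proof. by move=> a0; exact: is_derive_continuous (is_derive_renormw e0 a0). Qed.

Lemma continuous_ddrenorm a : 0 <= a -> {for a, continuous (ddrenorm e)}.
Proof.
move=> a0; have w := continuous_renormw a0.
rewrite (_ : ddrenorm e = fun u => 2 * (renormw e u * (renormw e u * renormw e u))); last first.
  by rewrite funeqE => b; rewrite /ddrenorm; ring.
by apply: cvgMr; apply: cvgM => //; exact: cvgM.
Qed.

Lemma continuous_dcorrector a : 0 <= a -> {for a, continuous (dcorrector e)}.
Proof.
move=> a0; have w := continuous_renormw a0.
have d0 : 0 < 1 + e * a by rewrite ltr_pwDl// mulr_ge0// ltW.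
apply: cvgB; last by apply: cvgM => //; exact: cvg_id.
apply: cvgN; apply: cvgMr.
apply: (@continuous_comp _ _ _ (fun u => 1 + e * u) (@ln R)).
  by apply: cvgD; [exact: cvg_cst|apply: cvgMr; exact: cvg_id].
exact: continuous_ln.
Qed.

Lemma CP_renorm : CP r (fun x => renorm e (u x)).
Proof.
apply: (CP_ratio_comp (dg := drenorm e)) => a a0; first exact: is_derive_renorm.
exact: is_derive_continuous (is_derive_drenorm e0 a0).
Qed.

Lemma CP_drenorm : CP r (fun x => drenorm e (u x)).
Proof.
by apply: (CP_ratio_comp (dg := ddrenorm e)) => a a0; [exact: is_derive_drenorm|exact: continuous_ddrenorm].
Qed.

Lemma CP_corrector : CP r (fun x => corrector e (u x)).
Proof.
by apply: (CP_ratio_comp (dg := dcorrector e)) => a a0; [exact: is_derive_corrector|exact: continuous_dcorrector].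
Qed.

Lemma contper_ddrenorm : contper r (fun x => ddrenorm e (u x)).
Proof.
split; last by apply: periodic_comp; exact: CP_ratio.2.
move=> x; apply: (@continuous_comp _ _ _ u (ddrenorm e)).
  exact: (C1_continuous CP_ratio.1).
exact/continuous_ddrenorm/ratio_ge0.
Qed.

Lemma contper_dcorrector : contper r (fun x => dcorrector e (u x)).
Proof.
split; last by apply: periodic_comp; exact: CP_ratio.2.
move=> x; apply: (@continuous_comp _ _ _ u (dcorrector e)).
  exact: (C1_continuous CP_ratio.1).
exact/continuous_dcorrector/ratio_ge0.
Qed.

Variables (c b : R) (psi eta : cV -> R).
Hypotheses (Kpsi : qcut r c psi) (CDpsi : forall i, C1 ('D_(delta_mx i 0) psi))
  (Keta : pcut b eta).
Local Notation dpsi i := ('D_(delta_mx i 0) psi).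
Local Notation deta i := ('D_(delta_mx i 0) eta).

(** What the position cutoff [psi] leaves of the transport: a source that remains
    once the momentum cutoff is removed, and a flux that is paired with the
    gradient of the momentum cutoff and disappears with it. *)
Definition renorm_source (x : phase) : R :=
  T * \sum_i dpsi i x.1 * (dcorrector e (u x) * 'D_(dp i) f x).
Definition renorm_flux (i : 'I_n) (x : phase) : R :=
  - (psi x.1 * (renorm e (u x) * fs x * Hq V M i x))
  + T * (dpsi i x.1 * (fs x * corrector e (u x)))
  - 2^-1 * (psi x.1 * (drenorm e (u x) * flw f i x)).

Let Cpsi : C1 psi. Proof. by case: Kpsi. Qed.
Let Ceta : C1 eta. Proof. by case: Keta. Qed.
Let w (x : phase) : R := psi x.1 * eta x.2.
Let wi (i : 'I_n) (x : phase) : R := dpsi i x.1 * eta x.2.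
Let tw : testfun r w. Proof. exact: testfun_cut Kpsi Keta. Qed.
Let twi i : testfun r (wi i).
Proof. by apply: testfun_cut Keta; exact: qcut_derive Kpsi (CDpsi i). Qed.
Let wp i x : 'D_(dp i) w x = psi x.1 * deta i x.2.
Proof. exact: derive_cutp. Qed.
Let wq i x : 'D_(dq i) w x = wi i x.
Proof. exact: derive_cutq. Qed.
Let wip i j x : 'D_(dp j) (wi i) x = dpsi i x.1 * deta j x.2.
Proof. exact: derive_cutp. Qed.
Let Cfs : CP r fs. Proof. exact: CP_fs. Qed.

Let flux_intg1 i : intg mx (fun x => 'D_(dp i) w x * (renorm e (u x) * fs x * Hq V M i x)).
Proof.
apply: compsupp_intg; apply: compsuppMl; first exact: derive_compsupp.
by apply: CP_contper; apply: CPM; [exact: CPM CP_renorm _|exact: CP_Hq].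
Qed.
Let flux_intg2 i : intg mx (fun x => 'D_(dp i) (wi i) x * (fs x * corrector e (u x))).
Proof.
apply: compsupp_intg; apply: compsuppMl; first exact: derive_compsupp.
exact: CP_contper (CPM Cfs CP_corrector).
Qed.
Let flux_intg3 i : intg mx (fun x => 'D_(dp i) w x * (drenorm e (u x) * flw f i x)).
Proof.
apply: compsupp_intg; apply: compsuppMl; first exact: derive_compsupp.
by apply: CP_contper; apply: CPM; [exact: CP_drenorm|exact: CP_flow].
Qed.
Let source_intg i : intg mx (fun x => wi i x * (dcorrector e (u x) * 'D_(dp i) f x)).
Proof.
apply: compsupp_intg; apply: compsuppMl; first exact: testfun_compsupp.
by apply: contperM; [exact: contper_dcorrector|apply: derive_contper; exact: Cf.1].
Qed.
Let energy_intg : intg mx (fun x => w x * (ddrenorm e (u x) * energy f x)).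
Proof.
apply: compsupp_intg; apply: compsuppMl; first exact: testfun_compsupp.
by apply: contperM; [exact: contper_ddrenorm|exact/CP_contper/CP_energy].
Qed.

(** Multiplying the Fokker-Planck operator by [drenorm e u]: the transport part turns
    into a boundary term at infinity in position, which is integrable thanks to
    the identity [vel fs = - T d_p fs] and an integration by parts. *)
Lemma renormalized_identity :
  \int[mx]_x (w x * (drenorm e (u x) * Lc f x))
    + 2^-1 * \int[mx]_x (w x * (ddrenorm e (u x) * energy f x)) =
  \int[mx]_x (eta x.2 * renorm_source x) + \int[mx]_x (\sum_i deta i x.2 * renorm_flux i x).
Proof.
have ttheta : testfun r (fun x => w x * drenorm e (u x)).
  by apply: (@testfunMr R n r w (fun x => drenorm e (u x)) tw); exact: CP_drenorm.
have Clc := contper_Lop T V_smooth M_spd G_spd Cf.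
(* transport: [f = u fs] and [pb fs = 0], then [vel fs = - T d_p fs] with the corrector *)
have E1 x : (w x * drenorm e (u x)) * pb V M f x = w x * pb V M (fun x => renorm e (u x) * fs x) x.
  rewrite -mulrA; congr (_ * _).
  have -> : pb V M f x = fs x * pb V M u x.
    have -> : f = (fun x => u x * fs x) by rewrite funeqE => y; rewrite ratioK.
    have -> : ratio (fun x => u x * fs x) = u.
      by rewrite /ratio funeqE => y; rewrite mulfVK.
    by rewrite (pbM V M x CP_ratio.1 Cfs.1) (pb_fs T V_smooth M_spd) mulr0 add0r.
  have -> := pbM V M x CP_renorm.1 Cfs.1.
  rewrite (pb_fs T V_smooth M_spd) mulr0 add0r.
  have -> := pb_comp V M CP_ratio.1 (is_derive_renorm e0 (ratio_ge0 x)).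
  by rewrite mulrCA.
have E2 x : - (renorm e (u x) * fs x * pb V M w x) =
    T * (\sum_i wi i x * (dcorrector e (u x) * 'D_(dp i) f x))
    - (\sum_i 'D_(dp i) w x * (renorm e (u x) * fs x * Hq V M i x))
    - T * (\sum_i wi i x * 'D_(dp i) (fun x => fs x * corrector e (u x)) x).
  rewrite /pb !mulr_sumr -!sumrB -sumrN; apply: eq_bigr => i _.
  have hu := C1_is_derive x (dp i : phase) CP_ratio.1.
  have hs := C1_is_derive x (dp i : phase) Cfs.1.
  have -> : 'D_(dp i) (fun x => fs x * corrector e (u x)) x =
      fs x * (dcorrector e (u x) * 'D_(dp i) u x) + corrector e (u x) * 'D_(dp i) fs x.
    exact: derive_val_fun (is_deriveM_fun hs (is_derive_comp1 hu (is_derive_corrector e0 (ratio_ge0 x)))).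
  have -> : 'D_(dp i) f x = u x * 'D_(dp i) fs x + fs x * 'D_(dp i) u x.
    rewrite -(derive_val_fun (is_deriveM_fun hu hs)); congr ('D__ _ x).
    by rewrite funeqE => y; rewrite ratioK.
  rewrite derive_fsp// wq -(correctorE e (u x)).
  move: (corrector e (u x)) (dcorrector e (u x)) (u x) (vel _ _ _) (Hq _ _ _ _) (fs x) => a d y v h s.
  by field; rewrite gt_eqF.
have E3 : \int[mx]_x (w x * drenorm e (u x) * pb V M f x) =
    \int[mx]_x (T * (\sum_i wi i x * (dcorrector e (u x) * 'D_(dp i) f x)))
    - \int[mx]_x (\sum_i 'D_(dp i) w x * (renorm e (u x) * fs x * Hq V M i x))
    + T * \int[mx]_x (\sum_i 'D_(dp i) (wi i) x * (fs x * corrector e (u x))).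
  under eq_Rintegral do rewrite E1.
  rewrite (pb_by_parts V_smooth M_spd tw (CPM CP_renorm Cfs)).
  have iw i : intg mx (fun x => wi i x * 'D_(dp i) (fun x => fs x * corrector e (u x)) x).
    apply: compsupp_intg; apply: compsuppMl; first exact: testfun_compsupp.
    exact: derive_contper (CPM Cfs CP_corrector).
  rewrite -RintN; last first.
    apply: compsupp_intg; apply: compsuppMr; last exact: compsupp_pb.
    exact: CP_contper (CPM CP_renorm Cfs).
  under eq_Rintegral do rewrite E2.
  rewrite !RintB; last 4 first.
  - by apply: intgZ; apply: intg_sum => i _; exact: source_intg.
  - by apply: intg_sum => i _; exact: flux_intg1.
  - apply: intgB; last by apply: intg_sum => i _; exact: flux_intg1.
    by apply: intgZ; apply: intg_sum => i _; exact: source_intg.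
  - by apply: intgZ; apply: intg_sum => i _; exact: iw.
  congr (_ + _); rewrite RintZ; last by apply: intg_sum => i _; exact: iw.
  rewrite -mulrN !Rint_sum//; congr (_ * _); rewrite -sumrN; apply: eq_bigr => i _.
  by rewrite (dp_by_parts i (twi i) (CPM Cfs CP_corrector)) opprK.
(* diffusion: the flow is [fs G d_p u], so that [drenorm] gives the energy *)
have E4 x : \sum_i 'D_(dp i) (fun x => w x * drenorm e (u x)) x * flw f i x =
    w x * (ddrenorm e (u x) * energy f x) + \sum_i 'D_(dp i) w x * (drenorm e (u x) * flw f i x).
  rewrite /energy !mulr_sumr -big_split/=; apply: eq_bigr => i _.
  have hu := C1_is_derive x (dp i : phase) CP_ratio.1.
  have hw : is_derive x (dp i : phase) w ('D_(dp i) w x).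
    by apply: C1_is_derive; case: tw.
  rewrite (derive_val_fun (is_deriveM_fun hw (is_derive_comp1 hu (is_derive_drenorm e0 (ratio_ge0 x))))).
  by ring.
have -> : \int[mx]_x (w x * (drenorm e (u x) * Lc f x)) = \int[mx]_x (w x * drenorm e (u x) * Lc f x).
  by apply: eq_Rintegral => x _; rewrite mulrA.
rewrite (Lop_by_parts T V_smooth M_spd G_spd ttheta Cf) E3.
under [X in _ - 2^-1 * X]eq_Rintegral do rewrite E4.
rewrite [X in _ - 2^-1 * X]RintD//; last by apply: intg_sum => i _; exact: flux_intg3.
have E5 x : \sum_i deta i x.2 * renorm_flux i x =
   T * (\sum_i 'D_(dp i) (wi i) x * (fs x * corrector e (u x)))
   - (\sum_i 'D_(dp i) w x * (renorm e (u x) * fs x * Hq V M i x))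
   - 2^-1 * (\sum_i 'D_(dp i) w x * (drenorm e (u x) * flw f i x)).
  rewrite !mulr_sumr -!sumrB; apply: eq_bigr => i _; rewrite wp wip /renorm_flux.
  by ring.
rewrite [X in _ = _ + X](eq_Rintegral _ (fun x _ => E5 x)).
rewrite [X in _ = _ + X]RintB; last 2 first.
- apply: intgB; first by apply: intgZ; apply: intg_sum => i _; exact: flux_intg2.
  by apply: intg_sum => i _; exact: flux_intg1.
- by apply: intgZ; apply: intg_sum => i _; exact: flux_intg3.
rewrite [X in _ = _ + (X - _)]RintB; last 2 first.
- by apply: intgZ; apply: intg_sum => i _; exact: flux_intg2.
- by apply: intg_sum => i _; exact: flux_intg1.
rewrite [X in _ = _ + (X - _ - _)]RintZ; last by apply: intg_sum => i _; exact: flux_intg2.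
rewrite [X in _ = _ + (_ - _ - X)]RintZ; last by apply: intg_sum => i _; exact: flux_intg3.
have -> : \int[mx]_x (eta x.2 * renorm_source x) =
    \int[mx]_x (T * (\sum_i wi i x * (dcorrector e (u x) * 'D_(dp i) f x))).
  apply: eq_Rintegral => x _; rewrite /renorm_source mulrCA; congr (_ * _).
  by rewrite mulr_sumr; apply: eq_bigr => i _; rewrite /wi; ring.
do 5 (set I := \int[mx]_x _; move: I => ?).
by ring.
Qed.

End renormalized_identity.

(** * Momentum equilibrium at a break time *)

Lemma cvg_mul1 (R : realType) (a_ b_ : nat -> R) (b : R) :
  a_ @ \oo --> (1 : R) -> b_ @ \oo --> b -> (fun k => a_ k * b_ k) @ \oo --> b.
Proof. by move=> ha hb; rewrite -[X in _ --> X]mul1r; exact: cvgM. Qed.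

Lemma cvg_cutoff (R : realType) (a_ : nat -> R) (b c : R) :
  a_ @ \oo --> (1 : R) -> (fun k => c * a_ k * b) @ \oo --> c * b.
Proof.
move=> ha; rewrite (_ : (fun k => _) = fun k => a_ k * (c * b)).
  by apply: cvg_mul1 => //; exact: cvg_cst.
by rewrite funeqE => k; ring.
Qed.

Lemma dbump_derive_le (R : realType) (n : nat) (mask : pred 'I_n) (S : R) i (q : 'cV[R]_n) :
  0 < S -> `|'D_(delta_mx i 0) (bump mask S) q| <= 6 / S.
Proof.
move=> S0; have := congr1 (fun g : 'cV[R]_n -> R => g q) (derive_bump mask S i).
by move=> /= ->; exact: dbump_le.
Qed.

Section momentum_equilibrium.
Context {R : realType} (n r : nat) (T : R).
Variables (V : 'cV[R]_n -> R) (M G : 'cV[R]_n -> 'M[R]_n).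
Local Notation cV := 'cV[R]_n.
Local Notation phase := (cV * cV)%type.
Local Notation mx := (phase_measure R n r).
Local Notation beta := (T^-1).
Local Notation fs := (f_star r T V M).
Local Notation Lc := (Lop T V M G).
Local Notation flw := (flow T M G).
Hypotheses (T_gt0 : 0 < T) (V_smooth : smooth_position r V) (V_ge0 : forall q, 0 <= V q)
  (M_spd : smooth_posdef r M) (G_spd : smooth_posdef r G)
  (Z_finite : partition_finite r T V M).
Variable f : phase -> R.
Hypotheses (Cf : CP2 r f) (f0 : forall x, 0 <= f x) (rf : rapid r f)
  (rDf : forall j, rapid r ('D_(dp j) f))
  (rDDf : forall j, rapid r ('D_(dp j) ('D_(dp j) f)))
  (Lf : L2 mx (fun x => f x / Num.sqrt (fs x)))
  (LLf : L2 mx (fun x => Lc f x / Num.sqrt (fs x)))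
  (f_break : ip mx (fun x => f x / Num.sqrt (fs x)) (fun x => Lc f x / Num.sqrt (fs x)) = 0).
Local Notation u := (ratio r T V M f).

Let fs0 x : 0 < fs x. Proof. exact: fs_gt0. Qed.
Let u0 x : 0 <= u x. Proof. exact: ratio_ge0. Qed.
Let Cu : CP r u. Proof. exact: CP_ratio. Qed.

Let sqrt_mul (a b : R) x : a / Num.sqrt (fs x) * (b / Num.sqrt (fs x)) = a * (b / fs x).
Proof.
have s0 : Num.sqrt (fs x) != 0 by rewrite gt_eqF// sqrtr_gt0.
by rewrite -[X in _ = _ * (_ / X)](sqr_sqrtr (ltW (fs0 x))); field.
Qed.

(** Integrability of [f u] is the finiteness of the chi-square divergence: with
    the weight, it is all that is known at infinity. *)
Definition majorant (x : phase) : R := weight r x + f x * u x.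

Lemma majorant_ge0 x : 0 <= majorant x.
Proof. by rewrite addr_ge0 ?(ltW (weight_gt0 r x))// mulr_ge0. Qed.

Lemma weight_majorant x : weight r x <= majorant x.
Proof. by rewrite lerDl mulr_ge0. Qed.

Lemma intg_majorant : intg mx majorant.
Proof.
apply: intgD; first exact: intg_weight.
rewrite (_ : (fun x => _) = fun x => f x / Num.sqrt (fs x) * (f x / Num.sqrt (fs x))).
  exact: L2_mul.
by rewrite funeqE => x; rewrite sqrt_mul.
Qed.

(** Landau's inequality and the decay control the momentum gradient. *)
Lemma log_tail : exists K : R, 0 <= K /\ forall x,
  f x * (ln (1 + u x) + 1) <= K * majorant x /\
  forall j, `|'D_(dp j) f x| * (ln (1 + u x) + 1) <= K * majorant x.
Proof.
have [Cf0 [Cf00 fC]] := rapid_weight 2 rf.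
have tf x : f x * (ln (1 + u x) + 1) <= (4 * (1 + Cf0 * Cf0 ^+ 2) + Cf0) * majorant x.
  have w0 := weight_gt0 r x; have w1 := weight_le1 r x.
  have h : f x <= Cf0 * weight r x ^+ 2 by have := fC x; rewrite ger0_norm.
  rewrite mulrDr mulr1 [leRHS]mulrDl; apply: lerD.
    apply: tail_bound => //.
    rewrite expr2 ler_wpM2r//; apply: le_trans h _; apply: ler_piMr => //.
    by rewrite exprn_ile1// ltW.
  apply: le_trans h _; rewrite ler_wpM2l// (le_trans _ (weight_majorant x))//.
  by rewrite expr2 ler_piMr// ltW.
have tD j : exists K : R, 0 <= K /\ forall x,
    `|'D_(dp j) f x| * (ln (1 + u x) + 1) <= K * majorant x.
  have [C [C0 DC]] := rapid_weight 2 (rDf j).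
  have [B [B0 DB]] := rapid_weight 0 (rDDf j).
  have CD : C1 ('D_(dp j) f) by exact: Cf.2.
  exists (4 * (1 + 4 * B * C ^+ 2) + C); split.
    by rewrite !addr_ge0// mulr_ge0// addr_ge0// !mulr_ge0// sqr_ge0.
  move=> x; have w0 := weight_gt0 r x; have w1 := weight_le1 r x.
  rewrite mulrDr mulr1 [leRHS]mulrDl; apply: lerD.
    apply: tail_bound => //.
      by rewrite !mulr_ge0.
    rewrite real_normK ?num_real//; apply: (landau_bound Cf.1.1 CD f0).
    by move=> y; have := DB y; rewrite expr0 mulr1.
  apply: le_trans (DC x) _; rewrite ler_wpM2l// (le_trans _ (weight_majorant x))//.
  by rewrite expr2 ler_piMr// ltW.
pose K0 := 4 * (1 + Cf0 * Cf0 ^+ 2) + Cf0.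
have K00 : 0 <= K0 by rewrite !addr_ge0// mulr_ge0// addr_ge0// mulr_ge0// sqr_ge0.
pose KD j := sval (cid (tD j)).
have KD0 j : 0 <= KD j by rewrite /KD; case: cid => ? [].
exists (K0 + \sum_j KD j); split; first by rewrite addr_ge0// sumr_ge0.
move=> x; split=> [|j].
  apply: le_trans (tf x) _; rewrite ler_wpM2r ?majorant_ge0// lerDl.
  by rewrite sumr_ge0.
have h : `|'D_(dp j) f x| * (ln (1 + u x) + 1) <= KD j * majorant x.
  by rewrite /KD; case: cid => ? [].
apply: le_trans h _; rewrite ler_wpM2r ?majorant_ge0//.
by rewrite (bigD1 j)//= addrCA lerDl addr_ge0// sumr_ge0.
Qed.

Section fixed_cutoff.
Variables (e c delta : R) (psi : cV -> R).
Hypotheses (e0 : 0 < e) (e1 : e <= 1) (Kpsi : qcut r c psi)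
  (CDpsi : forall i, C1 ('D_(delta_mx i 0) psi))
  (psi0 : forall q, 0 <= psi q) (psi1 : forall q, psi q <= 1)
  (delta0 : 0 <= delta) (dpsi_le : forall i q, `|'D_(delta_mx i 0) psi q| <= delta).
Local Notation dpsi i := ('D_(delta_mx i 0) psi).
Local Notation src := (renorm_source r T V M f e psi).
Local Notation flx := (renorm_flux r T V M G f e psi).

Let ei0 : 0 <= e^-1. Proof. by rewrite invr_ge0 ltW. Qed.

Lemma renorm_source_le (K : R) x : 0 <= K ->
  (forall j, `|'D_(dp j) f x| * (ln (1 + u x) + 1) <= K * majorant x) ->
  `|src x| <= (delta * e^-1) * (T * n%:R * K) * majorant x.
Proof.
move=> K0 DK; rewrite /renorm_source normrM gtr0_norm//.
have -> : delta * e^-1 * (T * n%:R * K) * majorant x =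
   T * \sum_(i < n) (delta * (e^-1 * (K * majorant x))).
  by rewrite sumr_const card_ord -[_ *+ n]mulr_natl; ring.
rewrite ler_wpM2l ?(ltW T_gt0)//; apply: le_trans (ler_norm_sum _ _ _) _.
apply: ler_sum => i _; rewrite normrM; apply: ler_pM => //; rewrite normrM.
apply: (@le_trans _ _ (e^-1 * (ln (1 + u x) + 1) * `|'D_(dp i) f x|)).
  by rewrite ler_wpM2r//; exact: dcorrector_le.
by rewrite -mulrA ler_wpM2l// mulrC.
Qed.

Lemma renorm_flux_le i : exists K : R, 0 <= K /\ forall x, `|flx i x| <= K * majorant x.
Proof.
have [K [K0 HK]] := log_tail.
have [C1_ [C10 H1]] := rapid_pgrow_weight c rf (pgrow_Hq V_smooth M_spd i).
have tF j : exists C : R, 0 <= C /\ forall x, `|euclidean_part r x.1| <= c ->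
    `|Gij G i j x * wgrad T M f j x| <= C * weight r x.
  have [A [A0 HA]] := rapid_pgrow_weight c (rDf j) (pgrow_Gij G_spd i j).
  have [B [B0 HB]] := rapid_pgrow_weight c rf (pgrowM (pgrow_Gij G_spd i j) (pgrow_vel M_spd j)).
  exists (A + beta * B); split; first by rewrite addr_ge0// mulr_ge0// invr_ge0 ltW.
  move=> x xc.
  have -> : Gij G i j x * wgrad T M f j x =
      'D_(dp j) f x * Gij G i j x + beta * (f x * (Gij G i j x * vel M j x)).
    by rewrite /wgrad; ring.
  apply: le_trans (ler_normD _ _) _; rewrite [leRHS]mulrDl; apply: lerD; first exact: HA.
  rewrite normrM ger0_norm ?invr_ge0 ?(ltW T_gt0)// -mulrA.
  by rewrite ler_wpM2l ?invr_ge0 ?(ltW T_gt0)//; exact: HB.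
pose KF j := sval (cid (tF j)).
have KF0 j : 0 <= KF j by rewrite /KF; case: cid => ? [].
have HF j x : `|euclidean_part r x.1| <= c ->
    `|Gij G i j x * wgrad T M f j x| <= KF j * weight r x.
  by rewrite /KF; case: cid => ? [? h]; exact: h.
pose K1 := e^-1 * C1_; pose K2 := T * (delta * (e^-1 * K)).
pose K3 := e^-1 * \sum_j KF j.
have K10 : 0 <= K1 by rewrite mulr_ge0.
have K20 : 0 <= K2 by rewrite !mulr_ge0// ltW.
have K30 : 0 <= K3 by rewrite mulr_ge0// sumr_ge0.
exists (K1 + K2 + 2^-1 * K3); split; first by rewrite !addr_ge0// mulr_ge0.
move=> x; have [HK1 _] := HK x; have w0 := ltW (weight_gt0 r x).
have m0 := majorant_ge0 x; have wm := weight_majorant x.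
have psi_in (a C : R) : 0 <= C -> (`|euclidean_part r x.1| <= c -> `|a| <= C * weight r x) ->
    `|psi x.1 * a| <= C * majorant x.
  move=> C0 h; have [|xc] := ltP c `|euclidean_part r x.1|.
    by case: Kpsi => _ _ hc /hc ->; rewrite mul0r normr0 mulr_ge0.
  rewrite normrM ger0_norm//; apply: (@le_trans _ _ (1 * (C * weight r x))).
    by apply: ler_pM => //; exact: h.
  by rewrite mul1r ler_wpM2l.
have l0 : 0 <= ln (1 + u x) by rewrite ln_ge0// lerDl.
apply: le_trans (ler_normB _ _) _; rewrite [leRHS]mulrDl; apply: lerD.
  apply: le_trans (ler_normD _ _) _; rewrite [leRHS]mulrDl; apply: lerD.
    rewrite normrN; apply: psi_in => // xc.
    have n0 : 0 <= renorm e (u x) * fs x := mulr_ge0 (renorm_ge0 e0 (u0 x)) (ltW (fs0 x)).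
    rewrite normrM (ger0_norm n0).
    apply: (@le_trans _ _ (e^-1 * `|f x * Hq V M i x|)); last first.
      by rewrite /K1 -mulrA ler_wpM2l//; exact: H1.
    rewrite normrM [leRHS]mulrA; apply: ler_wpM2r => //; rewrite (ger0_norm (f0 x)).
    have <- := ratioK V_smooth M_spd Z_finite f x.
    by rewrite [leRHS]mulrA; apply: ler_wpM2r; [exact: ltW|exact: renorm_le].
  rewrite normrM (gtr0_norm T_gt0) /K2 -mulrA ler_wpM2l ?(ltW T_gt0)//.
  rewrite normrM -mulrA; apply: ler_pM => //.
  rewrite normrM (gtr0_norm (fs0 x)).
  apply: (@le_trans _ _ (fs x * (e^-1 * (u x * ln (1 + u x))))).
    by rewrite ler_wpM2l ?(ltW (fs0 x))//; exact: corrector_le.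
  rewrite mulrCA -[leRHS]mulrA; apply: ler_wpM2l => //; apply: le_trans HK1.
  rewrite mulrA [fs x * _]mulrC (ratioK V_smooth M_spd Z_finite).
  by apply: ler_wpM2l => //; rewrite lerDl.
rewrite normrM ger0_norm ?invr_ge0// -[leRHS]mulrA; apply: ler_wpM2l; rewrite ?invr_ge0//.
apply: psi_in => // xc; rewrite normrM ger0_norm ?drenorm_ge0//.
rewrite /K3 -[leRHS]mulrA; apply: ler_pM; rewrite ?drenorm_ge0 ?drenorm_leV//.
rewrite mulr_suml; apply: le_trans (ler_norm_sum _ _ _) _.
by apply: ler_sum => j _; exact: HF.
Qed.

Let Cpsi : CP r (fun x : phase => psi x.1).
Proof. by case: Kpsi => Cp pp _; exact: CP_q. Qed.
Let Cdpsi i : CP r (fun x : phase => dpsi i x.1).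
Proof. by apply: CP_q => //; case: Kpsi => _ pp _; exact: qperiodic_derive. Qed.
Let Cfs : CP r fs. Proof. exact: CP_fs. Qed.

Lemma contper_renorm_source : contper r src.
Proof.
apply: contperZ; apply: contper_sum => i _; apply: contperM; first exact/CP_contper/Cdpsi.
apply: contperM; first exact: contper_dcorrector.
by apply: derive_contper; exact: Cf.1.
Qed.

Lemma CP_renorm_flux i : CP r (flx i).
Proof.
have Crn := CP_renorm V_smooth M_spd Z_finite Cf f0 e0.
have Cdrn := CP_drenorm V_smooth M_spd Z_finite Cf f0 e0.
have Cal := CP_corrector V_smooth M_spd Z_finite Cf f0 e0.
have CH := CP_Hq V_smooth M_spd i.
have Cfl := CP_flow T M_spd G_spd i Cf.
exact: CPB (CPD (CPN (CPM Cpsi (CPM (CPM Crn Cfs) CH))) (CPZ T (CPM (Cdpsi i) (CPM Cfs Cal))))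
  (CPZ 2^-1 (CPM Cpsi (CPM Cdrn Cfl))).
Qed.

Lemma intg_renorm_source : intg mx src.
Proof.
have [K [K0 HK]] := log_tail.
apply: (intg_le (g := fun x => delta * e^-1 * (T * n%:R * K) * majorant x)).
- exact: contper_measurable contper_renorm_source.
- by apply: intgZ; exact: intg_majorant.
- by move=> x; apply: renorm_source_le => // j; exact: (HK x).2.
Qed.

Lemma intg_ratio_Lop : intg mx (fun x => u x * Lc f x).
Proof.
rewrite (_ : (fun x => _) = fun x => f x / Num.sqrt (fs x) * (Lc f x / Num.sqrt (fs x))).
  exact: L2_mul.
by rewrite funeqE => x; rewrite sqrt_mul /ratio; ring.
Qed.

(** The momentum cutoff is removed first: at fixed position cutoff the flux is
    integrable and its factor is of order [1 / S]. *)
Lemma renormalized_dissipation :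
  (\int[mx]_x (psi x.1 * (ddrenorm e (u x) * energy r T V M G f x))%:E <=
  (2 * (\int[mx]_x src x - \int[mx]_x (psi x.1 * (drenorm e (u x) * Lc f x))))%:E)%E.
Proof.
pose eta (k : nat) : cV -> R := bump (fun=> true) k.+1%:R.
have Keta k : pcut k.+1%:R (eta k) by exact: pcut_bump.
have eta0 k p : 0 <= eta k p by exact: bump_ge0.
have eta1 k p : eta k p <= 1 by exact: bump_le1.
have etac p : (fun k => eta k p) @ \oo --> (1 : R).
  by apply: (@cvg_bump _ _ _ _ (fun k => k.+1%:R)); exact: cvg_harmonic.
have deta_le k i p : `|'D_(delta_mx i 0) (eta k) p| <= 6 / k.+1%:R.
  exact: dbump_derive_le.
have Ceta k : CP r (fun x : phase => eta k x.2) by apply: CP_pfun; exact: C1_bump.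
have Cdeta k i : CP r (fun x : phase => 'D_(delta_mx i 0) (eta k) x.2).
  have CD : C1 ('D_(delta_mx i 0) (eta k)) by rewrite /eta derive_bump; exact: C1_dbump.
  exact: (@CP_pfun R n r _ CD).
have Cdd := contper_ddrenorm V_smooth M_spd Z_finite Cf f0 e0.
have CE := CP_energy T_gt0 V_smooth M_spd G_spd Z_finite Cf.
have Cdrn := CP_contper (CP_drenorm V_smooth M_spd Z_finite Cf f0 e0).
have CL := contper_Lop T V_smooth M_spd G_spd Cf.
have E0 x := energy_ge0 T_gt0 V_smooth M_spd G_spd Z_finite Cf x.
have mf := @contper_measurable R n r.
have Cw k := CPM Cpsi (Ceta k).
apply: (@fatou_le _ _ _ mx (fun k x => psi x.1 * eta k x.2 * (ddrenorm e (u x) * energy r T V M G f x)) _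
  (fun k => 2 * (\int[mx]_x (eta k x.2 * src x)
     + \int[mx]_x (\sum_i 'D_(delta_mx i 0) (eta k) x.2 * flx i x)
     - \int[mx]_x (psi x.1 * eta k x.2 * (drenorm e (u x) * Lc f x))))).
- by move=> k; apply: mf; exact: contperM (CP_contper (Cw k)) (contperM Cdd (CP_contper CE)).
- move=> k x; apply: mulr_ge0 (mulr_ge0 (psi0 x.1) (eta0 k x.2)) _.
  exact: mulr_ge0 (ddrenorm_ge0 e0 (u0 x)) (E0 x).
- by move=> x; apply: cvg_cutoff; exact: etac.
- move=> k.
  have := renormalized_identity T_gt0 V_smooth M_spd G_spd Z_finite Cf f0 e0 Kpsi CDpsi (Keta k).
  set A := \int[mx]_x _; set B := \int[mx]_x _; set C := \int[mx]_x _; set D := \int[mx]_x _.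
  move=> h; rewrite (_ : 2 * _ = B); last by lra.
  rewrite -Rint_EFin//; apply: compsupp_intg; apply: compsuppMl.
    by apply: testfun_compsupp; exact: testfun_cut Kpsi (Keta k).
  exact: contperM Cdd (CP_contper CE).
- apply: cvgMr; apply: cvgB; last first.
    apply: (Rint_dct (g := fun x => 2 * `|u x * Lc f x|)).
    + by move=> k; apply: mf; exact: contperM (CP_contper (Cw k)) (contperM Cdrn CL).
    + by apply: mf; exact: contperM (CP_contper Cpsi) (contperM Cdrn CL).
    + by apply: intgZ; apply: intg_norm; exact: intg_ratio_Lop.
    + move=> k x; have dr0 := drenorm_ge0 e0 (u0 x).
      have pe0 : 0 <= psi x.1 * eta k x.2 := mulr_ge0 (psi0 x.1) (eta0 k x.2).
      rewrite normrM (ger0_norm pe0) normrM (ger0_norm dr0).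
      rewrite normrM (ger0_norm (u0 x)).
      apply: (@le_trans _ _ (1 * (drenorm e (u x) * `|Lc f x|))).
        apply: ler_wpM2r; first exact: mulr_ge0.
        exact: mulr_ile1.
      by rewrite mul1r mulrA; apply: ler_wpM2r => //; exact: drenorm_le.
    + by move=> x; apply: cvg_cutoff; exact: etac.
  rewrite -[X in _ --> X]addr0; apply: cvgD.
    apply: (Rint_dct (g := fun x => `|src x|)).
    + by move=> k; apply: mf; exact: contperM (CP_contper (Ceta k)) contper_renorm_source.
    + exact: mf contper_renorm_source.
    + exact: intg_norm intg_renorm_source.
    + by move=> k x; rewrite normrM (ger0_norm (eta0 _ _)) ler_piMl.
    + by move=> x; apply: cvg_mul1; [exact: etac|exact: cvg_cst].
  have h i := renorm_flux_le i.
  pose K i := sval (cid (h i)).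
  have HK i x : `|flx i x| <= K i * majorant x by rewrite /K; case: cid => ? [].
  rewrite [X in _ --> X](_ : 0 = \int[mx]_x (fun=> 0 : R) x); last first.
    by rewrite /Rintegral integral0.
  have bnd k x : `|\sum_i 'D_(delta_mx i 0) (eta k) x.2 * flx i x| <=
      6 / k.+1%:R * ((\sum_i K i) * majorant x).
    rewrite mulr_suml mulr_sumr; apply: le_trans (ler_norm_sum _ _ _) _.
    by apply: ler_sum => i _; rewrite normrM; apply: ler_pM.
  apply: (Rint_dct (f_ := fun k x => \sum_i 'D_(delta_mx i 0) (eta k) x.2 * flx i x)
    (g := fun x => 6 * ((\sum_i K i) * majorant x))).
  + move=> k; have CS : contper r (fun x => \sum_i 'D_(delta_mx i 0) (eta k) x.2 * flx i x).
      by apply: contper_sum => i _; exact: CP_contper (CPM (Cdeta k i) (CP_renorm_flux i)).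
    exact: mf CS.
  + exact: measurable_cst.
  + by apply: intgZ; apply: intgZ; exact: intg_majorant.
  + move=> k x; apply: le_trans (bnd k x) _.
    have K0 : 0 <= (\sum_i K i) * majorant x.
      by rewrite mulr_suml sumr_ge0// => i _; exact: le_trans (HK i x).
    by rewrite ler_wpM2r// ler_pdivrMr// ler_peMr// ler1n.
  + move=> x; apply/cvgrPdist_le => eps eps0.
    have lim : (fun k => 6 / k.+1%:R * ((\sum_i K i) * majorant x)) @ \oo --> (0 : R).
      rewrite -[X in _ --> X](mul0r ((\sum_i K i) * majorant x)); apply: cvgMl.
      by rewrite -[X in _ --> X](mulr0 6); apply: cvgMr; exact: cvg_harmonic.
    have /cvgrPdist_le/(_ _ eps0) := lim.
    apply: filterS => k; rewrite !sub0r !normrN; apply: le_trans.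
    by apply: le_trans (bnd k x) _; exact: ler_norm.
Qed.

End fixed_cutoff.

(** Removing the position cutoff at the rate [R = 1 / e^2] makes the source
    term vanish in the limit. *)
Lemma energy_eq0 x : energy r T V M G f x = 0.
Proof.
have CE := CP_energy T_gt0 V_smooth M_spd G_spd Z_finite Cf.
have E0 y := energy_ge0 T_gt0 V_smooth M_spd G_spd Z_finite Cf y.
pose e (k : nat) : R := k.+1%:R^-1; pose S (k : nat) : R := k.+1%:R ^+ 2.
pose mask (i : 'I_n) := ~~ angle r i.
pose psi (k : nat) : cV -> R := bump mask (S k).
have S0 k : 0 < S k by rewrite exprn_gt0.
have e0 k : 0 < e k by rewrite invr_gt0.
have e1 k : e k <= 1 by rewrite invf_le1// ler1n.
have Kpsi k : qcut r (S k) (psi k) by exact: qcut_bump.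
have CDpsi k i : C1 ('D_(delta_mx i 0) (psi k)) by rewrite /psi derive_bump; exact: C1_dbump.
have psi0 k q : 0 <= psi k q by exact: bump_ge0.
have psi1 k q : psi k q <= 1 by exact: bump_le1.
have dpsi_le k i q : `|'D_(delta_mx i 0) (psi k) q| <= 6 / S k.
  exact: dbump_derive_le.
have ec : e @ \oo --> (0 : R) by exact: cvg_harmonic.
have psic q : (fun k => psi k q) @ \oo --> (1 : R).
  apply: cvg_bump; rewrite (_ : (fun k => _) = fun k => e k * e k).
    by rewrite -[X in _ --> X](mulr0 0); exact: cvgM.
  by rewrite funeqE => k; rewrite /S /e -expr2 exprVn.
have Cpsi k : CP r (fun x : phase => psi k x.1).
  by have [Cp pp _] := Kpsi k; exact: CP_q.
have Cdd k := contper_ddrenorm V_smooth M_spd Z_finite Cf f0 (e0 k).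
have Cdrn k := CP_contper (CP_drenorm V_smooth M_spd Z_finite Cf f0 (e0 k)).
have CL := contper_Lop T V_smooth M_spd G_spd Cf.
have mf := @contper_measurable R n r.
have [K [K0 HK]] := log_tail.
have d0 k : 0 <= 6 / S k by rewrite divr_ge0// ltW.
have uL0 : \int[mx]_x (2 * (u x * Lc f x)) = 0.
  rewrite RintZ; last exact: intg_ratio_Lop.
  rewrite (_ : \int[mx]_x _ = 0) ?mulr0// -[RHS]f_break; apply: eq_Rintegral => y _.
  by rewrite sqrt_mul /ratio; ring.
have CE2 : contper r (fun y => 2 * energy r T V M G f y).
  exact: contperZ (CP_contper CE).
suff le0 : (\int[mx]_y (2 * energy r T V M G f y)%:E <= 0)%E.
  have [cE pE] := CE2.
  have := continuous_integral_eq0 cE pE (fun y => mulr_ge0 (ler0n _ 2) (E0 y)) le0 x.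
  by move/eqP; rewrite mulf_eq0 pnatr_eq0/= => /eqP.
apply: (@fatou_le _ _ _ mx (fun k x => psi k x.1 * (ddrenorm (e k) (u x) * energy r T V M G f x)) _
  (fun k => 2 * (\int[mx]_x renorm_source r T V M f (e k) (psi k) x
     - \int[mx]_x (psi k x.1 * (drenorm (e k) (u x) * Lc f x))))).
- by move=> k; apply: mf; exact: contperM (CP_contper (Cpsi k)) (contperM (Cdd k) (CP_contper CE)).
- by move=> k y; exact: mulr_ge0 (psi0 k y.1) (mulr_ge0 (ddrenorm_ge0 (e0 k) (u0 y)) (E0 y)).
- move=> y; apply: cvg_mul1; first exact: psic.
  by apply: cvgMl; exact: (cvg_drenorm (u0 y) ec).2.
- move=> k; exact: (renormalized_dissipation (e0 k) (e1 k) (Kpsi k) (CDpsi k) (psi0 k) (psi1 k) (d0 k) (dpsi_le k)).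
- rewrite [X in _ --> X](_ : 0 = 2 * (0 - \int[mx]_x (2 * (u x * Lc f x)))); last first.
    by rewrite uL0 subr0 mulr0.
  apply: cvgMr; apply: cvgB; last first.
    apply: (Rint_dct (g := fun x => 2 * `|u x * Lc f x|)).
    + by move=> k; apply: mf; exact: contperM (CP_contper (Cpsi k)) (contperM (Cdrn k) CL).
    + by apply: mf; apply: contperZ; exact: contperM (CP_contper Cu) CL.
    + by apply: intgZ; apply: intg_norm; exact: intg_ratio_Lop.
    + move=> k y; have dr0 := drenorm_ge0 (e0 k) (u0 y).
      rewrite normrM (ger0_norm (psi0 k y.1)) normrM (ger0_norm dr0).
      rewrite normrM (ger0_norm (u0 y)).
      apply: (@le_trans _ _ (1 * (drenorm (e k) (u y) * `|Lc f y|))).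
        by apply: ler_wpM2r => //; exact: mulr_ge0.
      by rewrite mul1r mulrA; apply: ler_wpM2r => //; exact: drenorm_le.
    + move=> y; rewrite mulrA; apply: cvg_mul1; first exact: psic.
      by apply: cvgMl; exact: (cvg_drenorm (u0 y) ec).1.
  pose B := \int[mx]_y (T * n%:R * K * majorant y).
  have bnd k : `|\int[mx]_x renorm_source r T V M f (e k) (psi k) x| <= 6 * e k * B.
    apply: le_trans (Rint_norm_le (g := fun y => 6 / S k * (e k)^-1 * (T * n%:R * K * majorant y)) _ _ _) _.
    + exact: (intg_renorm_source (e0 k) (e1 k) (Kpsi k) (CDpsi k) (dpsi_le k)).
    + by do 2 apply: intgZ; exact: intg_majorant.
    + move=> y; apply: le_trans (renorm_source_le (e0 k) (e1 k) (dpsi_le k) K0 (HK y).2) _.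
      by rewrite [leRHS]mulrA.
    rewrite RintZ; last by apply: intgZ; exact: intg_majorant.
    rewrite le_eqVlt; apply/orP; left; apply/eqP; congr (_ * _).
    by rewrite /S /e; field.
  apply/cvgrPdist_le => eps eps0.
  have lim : (fun k => 6 * e k * B) @ \oo --> (0 : R).
    by rewrite -(mul0r B) -(mulr0 6); apply: cvgMl; apply: cvgMr.
  have /cvgrPdist_le/(_ _ eps0) := lim.
  apply: filterS => k; rewrite !sub0r !normrN; apply: le_trans.
  by apply: le_trans (bnd k) _; exact: ler_norm.
Qed.

Lemma derive_ratio_eq0 j x : 'D_(dp j) u x = 0.
Proof.
have := energy_eq0 x; rewrite (energyE G T_gt0 V_smooth M_spd Z_finite Cf).
set D := \col_i _; move/eqP; rewrite mulf_eq0 gt_eqF//= => /eqP GD.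
have [_ _ /(_ x.1)[_ Gpos]] := G_spd.
have [D0|/Gpos] := eqVneq D 0; last by rewrite GD ltxx.
by have := congr1 (fun A : 'cV[R]_n => A j 0) D0; rewrite !mxE.
Qed.

(** The energy vanishes and [G] is definite, so the ratio does not depend on the
    momentum: it is constant along each momentum axis. *)
Lemma equilibrium x : f x = u (x.1, 0) * fs x.
Proof.
have step (q p : cV) j (s : R) : u (q, p + s *: delta_mx j 0) = u (q, p).
  have pos (p' : cV) (s' : R) : 0 < s' -> u (q, p' + s' *: delta_mx j 0) = u (q, p').
    move=> s0; have [z _] := C1_MVT (q, p') (dp j : phase) Cu.1 s0.
    rewrite derive_ratio_eq0 mulr0 => /eqP; rewrite subr_eq0 => /eqP <-.
    by congr (u (_, _)); rewrite /= scaler0 addr0.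
  have [s0|s0|->] := ltgtP s 0; last by rewrite scale0r addr0.
    have := pos (p + s *: delta_mx j 0) (- s); rewrite oppr_gt0 => /(_ s0) <-.
    by rewrite -addrA -scalerDl subrr scale0r addr0.
  exact: pos.
have all_ (s : seq 'I_n) (q p : cV) : u (q, \sum_(j <- s) p j 0 *: delta_mx j 0) = u (q, 0).
  elim: s => [|j s IH]; first by rewrite big_nil.
  by rewrite big_cons addrC step.
rewrite -(all_ (index_enum 'I_n) x.1 x.2).
have -> : \sum_j x.2 j 0 *: delta_mx j 0 = x.2.
  apply: cV_eqP => i; rewrite summxE (bigD1 i)//= !mxE !eqxx mulr1 big1 ?addr0// => j ji.
  by rewrite !mxE eq_sym (negbTE ji) mulr0.
by case: x => q p /=; rewrite ratioK.
Qed.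

End momentum_equilibrium.

(** * Testing with functions of the position *)

Section gaussian_tests.
Context {R : realType} (n r : nat) (T : R).
Variables (V : 'cV[R]_n -> R) (M G : 'cV[R]_n -> 'M[R]_n).
Local Notation cV := 'cV[R]_n.
Local Notation phase := (cV * cV)%type.
Local Notation mx := (phase_measure R n r).
Local Notation mp := (lebesgue_cV R n).
Local Notation beta := (T^-1).
Local Notation fs := (f_star r T V M).
Local Notation Lc := (Lop T V M G).
Hypotheses (T_gt0 : 0 < T) (V_smooth : smooth_position r V) (V_ge0 : forall q, 0 <= V q)
  (M_spd : smooth_posdef r M) (G_spd : smooth_posdef r G)
  (Z_finite : partition_finite r T V M).

Let fs0 x : 0 < fs x. Proof. exact: fs_gt0. Qed.
Let Cfs : CP r fs. Proof. exact: CP_fs. Qed.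

Lemma gauss_weight (c : R) (K : phase -> R) : pgrow r K -> exists C : R, 0 <= C /\
  forall x, `|euclidean_part r x.1| <= c -> `|K x| * fs x <= C * weight r x.
Proof.
move=> gK; pose c' := Num.max 0 c.
have [C1_ [m [C10 KC]]] := gK c.
have [C2 [C20 FC]] := fs_gauss T_gt0 V_smooth V_ge0 M_spd Z_finite c (m + 4 * n).
exists (C1_ * ((1 + c') ^+ (4 * n) * C2)).
have c'0 : 0 <= c' by rewrite le_max lexx.
split; first by rewrite mulr_ge0// mulr_ge0// exprn_ge0// addr_ge0.
move=> x xc; have w0 := weight_gt0 r x.
have p0 : 0 < 1 + `|x.2| by rewrite ltr_pwDl.
rewrite -ler_pdivrMr//.
have we : (weight r x)^-1 <= ((1 + c') * (1 + `|x.2|)) ^+ (4 * n).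
  apply: le_trans (weight_enorm r x) _.
  rewrite lerXn2r ?nnegrE ?mulr_ge0 ?addr_ge0 ?enorm_ge0//.
  have h : enorm r x <= c' + `|x.2|.
    rewrite /enorm prod_normE/= ge_max; apply/andP; split; last by rewrite lerDr.
    by rewrite (le_trans xc)// (@le_trans _ _ c') ?lerDl// le_max lexx orbT.
  have cp : 0 <= c' * `|x.2| by rewrite mulr_ge0.
  by rewrite mulrDl mul1r mulrDr mulr1; lra.
apply: (@le_trans _ _ (C1_ * (1 + `|x.2|) ^+ m * fs x * ((1 + c') * (1 + `|x.2|)) ^+ (4 * n))).
  apply: ler_pM => //.
  - by apply: mulr_ge0 => //; exact: ltW.
  - by rewrite invr_ge0 ltW.
  - by apply: ler_wpM2r; [exact: ltW|exact: KC].
rewrite [leLHS](_ : _ = C1_ * ((1 + c') ^+ (4 * n) * ((1 + `|x.2|) ^+ (m + 4 * n) * fs x))).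
  by rewrite ler_wpM2l// ler_wpM2l ?exprn_ge0 ?addr_ge0//; exact: FC.
rewrite exprMn exprD; move: (fs x) ((1 + c') ^+ _) ((1 + `|x.2|) ^+ _) ((1 + `|x.2|) ^+ _) => a b d e.
by ring.
Qed.

Lemma slice_gauss (K : phase -> R) q : continuous K -> pgrow r K ->
  intg mp (fun p => K (q, p) * fs (q, p)).
Proof.
move=> cK gK; have [C [C0 h]] := gauss_weight `|euclidean_part r q| gK.
have cKf : continuous (fun x => K x * fs x).
  by move=> x; apply: cvgM; [exact: cK|exact: (C1_continuous Cfs.1)].
apply: (intg_le (g := fun p => C * pweight p)).
- exact: (measurable_funTS (measurableT_comp (continuous_measurable_phase cKf) (measurable_pair1 q))).
- by apply: intgZ; exact: intg_pweight.
- move=> p; rewrite normrM (gtr0_norm (fs0 (q, p))).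
  apply: le_trans (h (q, p) (lexx _)) _; rewrite ler_wpM2l//.
  by rewrite /weight /= ler_piMl ?(ltW (pweight_gt0 p))//; exact: qweight_le1.
Qed.

Lemma gauss_L2 (c : R) (K : phase -> R) : contper r K -> pgrow r K ->
  (forall x, c < `|euclidean_part r x.1| -> K x = 0) ->
  L2 mx (fun x => K x * Num.sqrt (fs x)).
Proof.
move=> cK gK K0; have [C [C0 h]] := gauss_weight c (pgrowM gK gK).
have mfs := CP_measurable Cfs.
have E x : (K x * Num.sqrt (fs x)) ^+ 2 = K x * K x * fs x.
  by rewrite exprMn (sqr_sqrtr (ltW (fs0 x))) expr2.
split.
  apply: measurable_funM; first exact: (contper_measurable cK).
  apply: (@contper_measurable R n r); split; last by apply: periodic_comp; exact: Cfs.2.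
  move=> x; apply: (@continuous_comp _ _ _ fs (@Num.sqrt R)); last exact: sqrt_continuous.
  exact: (C1_continuous Cfs.1).
rewrite (_ : (fun x => _) = fun x => K x * K x * fs x); last by rewrite funeqE.
have cKf := contperM (contperM cK cK) (CP_contper Cfs).
apply: (intg_weight_le (c := C)); first by case: cKf.
move=> x; have w0 := ltW (weight_gt0 r x).
have [/K0 ->|xc] := ltP c `|euclidean_part r x.1|; first by rewrite !mul0r normr0 mulr_ge0.
by rewrite normrM (gtr0_norm (fs0 x)); exact: h.
Qed.

Lemma gauss_intg (c : R) (K a : phase -> R) : contper r K -> pgrow r K ->
  (forall x, c < `|euclidean_part r x.1| -> K x = 0) ->
  L2 mx (fun x => a x / Num.sqrt (fs x)) -> intg mx (fun x => K x * a x).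
Proof.
move=> cK gK K0 La; have := L2_mul (gauss_L2 cK gK K0) La.
rewrite (_ : (fun x => _) = fun x => K x * a x)//.
rewrite funeqE => x; have : Num.sqrt (fs x) != 0 by rewrite gt_eqF// sqrtr_gt0.
by move: (Num.sqrt _) => s s0; field.
Qed.

Variables (phi : phase -> R) (c : R) (psi : cV -> R).
Hypotheses (Cphi : CP2 r phi) (Kpsi : qcut r c psi)
  (Lphi : L2 mx (fun x => phi x / Num.sqrt (fs x)))
  (LLphi : L2 mx (fun x => Lc phi x / Num.sqrt (fs x))).
Local Notation dpsi i := ('D_(delta_mx i 0) psi).

Let Cpsi : C1 psi. Proof. by case: Kpsi. Qed.
Let ppsi : qperiodic r psi. Proof. by case: Kpsi. Qed.
Let CPpsi : CP r (fun x : phase => psi x.1). Proof. exact: CP_q. Qed.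
Let psi_out (a : R) (x : phase) : c < `|euclidean_part r x.1| -> psi x.1 * a = 0.
Proof. by case: Kpsi => _ _ h /h ->; rewrite mul0r. Qed.
Let gpsi : pgrow r (fun x : phase => psi x.1).
Proof. by apply: pgrow_q => //; exact: C1_continuous. Qed.
Let cdpsi i : contper r (fun x : phase => dpsi i x.1).
Proof.
split; last first.
  by apply/periodicP => j aj q p /=; rewrite (qperiodic_derive (delta_mx i 0) ppsi aj q).
by move=> x; apply: (@continuous_comp _ _ _ fst (dpsi i)); [exact: cvg_fst|exact: C1_continuous_derive].
Qed.
Let gdpsi i : pgrow r (fun x : phase => dpsi i x.1).
Proof. by apply: pgrow_q; [exact: C1_continuous_derive|exact: qperiodic_derive]. Qed.

Let err (i : 'I_n) (x : phase) : R :=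
  psi x.1 * (Hq V M i x + 2^-1 * beta * \sum_j Gij G i j x * vel M j x) * phi x.
Let err2 (i j : 'I_n) (x : phase) : R := psi x.1 * Gij G i j x * phi x.

Let CPerr i : CP r (fun x => psi x.1 * (Hq V M i x + 2^-1 * beta * \sum_j Gij G i j x * vel M j x)).
Proof.
have CS : CP r (fun x => \sum_j Gij G i j x * vel M j x).
  by apply: CP_sum => j _; exact: CPM (CP_Gij G_spd i j) (CP_vel M_spd j).
exact: CPM CPpsi (CPD (CP_Hq V_smooth M_spd i) (CPZ (2^-1 * beta) CS)).
Qed.

Let intg_err i : intg mx (err i).
Proof.
apply: (gauss_intg (c := c)) => //; first exact: CP_contper (CPerr i).
- apply: pgrowM => //; apply: pgrowD; first exact: pgrow_Hq.
  apply: pgrowZ; apply: pgrow_sum => j _.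
  by apply: pgrowM; [exact: pgrow_Gij|exact: pgrow_vel].
- by move=> x xc; exact: psi_out.
Qed.

Let intg_err2 i j : intg mx (err2 i j).
Proof.
apply: (gauss_intg (c := c)) => //.
- exact: CP_contper (CPM CPpsi (CP_Gij G_spd i j)).
- by apply: pgrowM => //; exact: pgrow_Gij.
- by move=> x xc; exact: psi_out.
Qed.

Lemma intg_transport i : intg mx (fun x => vel M i x * dpsi i x.1 * phi x).
Proof.
apply: (gauss_intg (c := c)) => //.
- exact: contperM (CP_contper (CP_vel M_spd i)) (cdpsi i).
- by apply: pgrowM => //; exact: pgrow_vel.
- by move=> x xc; rewrite (derive_qcut _ Kpsi xc) mulr0.
Qed.

Let intg_Lop : intg mx (fun x => psi x.1 * Lc phi x).
Proof.
apply: (gauss_intg (c := c)) => //; first exact: CP_contper.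
by case: Kpsi => _ _ h x /h.
Qed.

Let cut_identity (b : R) (eta : cV -> R) : pcut b eta ->
  (forall i, C1 ('D_(delta_mx i 0) eta)) ->
  \int[mx]_x (psi x.1 * eta x.2 * Lc phi x) =
  \int[mx]_x (eta x.2 * \sum_i vel M i x * dpsi i x.1 * phi x)
  - \int[mx]_x (\sum_i 'D_(delta_mx i 0) eta x.2 * err i x)
  + 2^-1 * \int[mx]_x (\sum_i \sum_j 'D_(delta_mx j 0) ('D_(delta_mx i 0) eta) x.2 * err2 i j x).
Proof.
move=> Keta CDeta; have Ceta : C1 eta by case: Keta.
pose w (x : phase) : R := psi x.1 * eta x.2.
have tw : testfun r w by exact: testfun_cut Kpsi Keta.
have Kdeta i : pcut b ('D_(delta_mx i 0) eta).
  split => // p bp; case: Keta => _ h.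
  transitivity ('D_(delta_mx i 0) (cst 0 : cV -> R) p); last exact: derive_cst.
  apply: near_eq_derive.
  have : \forall p' \near p, b < `|p'| by exact: (cvgr_gt _ (@norm_continuous _ _ p) _ bp).
  by apply: filterS => p' /h.
pose wd i (x : phase) : R := psi x.1 * 'D_(delta_mx i 0) eta x.2.
have twd i : testfun r (wd i) by exact: testfun_cut Kpsi (Kdeta i).
have wp i x : 'D_(dp i) w x = wd i x by exact: derive_cutp.
have wq i x : 'D_(dq i) w x = dpsi i x.1 * eta x.2 by exact: derive_cutq.
have wdp i j x : 'D_(dp j) (wd i) x = psi x.1 * 'D_(delta_mx j 0) ('D_(delta_mx i 0) eta) x.2.
  exact: derive_cutp.
have Gp i j x : 'D_(dp j) (Gij G i j) x = 0.
  have C : C1 (fun q => G q i j) by have [h _ _] := G_spd; exact: smooth_C1.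
  by rewrite (derive_val_fun (is_derive_liftq x (dp j) C)) derive0.
rewrite (Lop_by_parts T V_smooth M_spd G_spd tw Cphi) (pb_by_parts V_smooth M_spd tw Cphi.1).
have cphi := CP_contper Cphi.1.
(* the diffusion term is integrated by parts once more *)
have E1 : \int[mx]_x (\sum_i 'D_(dp i) w x * flow T M G phi i x) =
    \int[mx]_x (\sum_i wd i x * ((beta * \sum_j Gij G i j x * vel M j x) * phi x))
    - \int[mx]_x (\sum_i \sum_j 'D_(delta_mx j 0) ('D_(delta_mx i 0) eta) x.2 * err2 i j x).
  have P x : \sum_i 'D_(dp i) w x * flow T M G phi i x =
     \sum_i wd i x * ((beta * \sum_j Gij G i j x * vel M j x) * phi x) +
     \sum_i \sum_j (wd i x * Gij G i j x) * 'D_(dp j) phi x.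
    rewrite -big_split/=; apply: eq_bigr => i _; rewrite wp /flow /wgrad.
    rewrite !mulr_sumr !mulr_suml !mulr_sumr -big_split/=; apply: eq_bigr => j _.
    move: ('D_(dp j) phi x) (wd i x) (vel _ _ _) => a b' d.
    by ring.
  under eq_Rintegral do rewrite P.
  have I1 i : intg mx (fun x => wd i x * ((beta * \sum_j Gij G i j x * vel M j x) * phi x)).
    apply: compsupp_intg; apply: compsuppMl; first exact: testfun_compsupp.
    apply: contperM => //; apply: contperZ; apply: contper_sum => j _.
    exact: CP_contper (CPM (CP_Gij G_spd i j) (CP_vel M_spd j)).
  have tG i j : testfun r (fun x => wd i x * Gij G i j x).
    by apply: (@testfunMr R n r (wd i) _ (twd i)); exact: CP_Gij.
  have I2 i j : intg mx (fun x => (wd i x * Gij G i j x) * 'D_(dp j) phi x).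
    apply: compsupp_intg; apply: compsuppMl; first exact: (testfun_compsupp (tG i j)).
    exact: derive_contper Cphi.1.
  have I3 i j : intg mx (fun x => 'D_(delta_mx j 0) ('D_(delta_mx i 0) eta) x.2 * err2 i j x).
    rewrite (_ : (fun x => _) = fun x => 'D_(dp j) (wd i) x * (Gij G i j x * phi x)).
      apply: compsupp_intg; apply: compsuppMl; first exact: derive_compsupp (twd i).
      exact: CP_contper (CPM (CP_Gij G_spd i j) Cphi.1).
    by rewrite funeqE => x; rewrite wdp /err2; ring.
  rewrite RintD; last 2 first.
  - by apply: intg_sum => i _; exact: I1.
  - by apply: intg_sum => i _; apply: intg_sum => j _; exact: I2.
  congr (_ + _).
  rewrite Rint_sum => [|i _]; last by apply: intg_sum => j _; exact: I2.
  rewrite Rint_sum => [|i _]; last by apply: intg_sum => j _; exact: I3.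
  rewrite -sumrN; apply: eq_bigr => i _.
  rewrite Rint_sum => [|j _]; last exact: I2.
  rewrite Rint_sum => [|j _]; last exact: I3.
  rewrite -sumrN; apply: eq_bigr => j _.
  rewrite (dp_by_parts j (tG i j) Cphi.1); congr (- _); apply: eq_Rintegral => x _.
  have h1 : is_derive x (dp j : phase) (wd i) ('D_(dp j) (wd i) x).
    by apply: C1_is_derive; case: (twd i).
  have h2 : is_derive x (dp j : phase) (Gij G i j) ('D_(dp j) (Gij G i j) x).
    by apply: C1_is_derive; exact: (CP_Gij G_spd i j).1.
  rewrite (derive_val_fun (is_deriveM_fun h1 h2)) Gp wdp /err2.
  by rewrite mulr0 add0r; ring.
rewrite E1.
have E2 x : - (phi x * pb V M w x) = eta x.2 * (\sum_i vel M i x * dpsi i x.1 * phi x)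
   - \sum_i wd i x * (Hq V M i x * phi x).
  rewrite /pb !mulr_sumr -sumrB -sumrN; apply: eq_bigr => i _; rewrite wp wq.
  by ring.
have I4 i : intg mx (fun x => wd i x * (Hq V M i x * phi x)).
  apply: compsupp_intg; apply: compsuppMl; first exact: testfun_compsupp.
  exact: CP_contper (CPM (CP_Hq V_smooth M_spd i) Cphi.1).
have I5 : intg mx (fun x => eta x.2 * (\sum_i vel M i x * dpsi i x.1 * phi x)).
  rewrite (_ : (fun x => _) = fun x => \sum_i 'D_(dq i) w x * (vel M i x * phi x)).
    apply: intg_sum => i _; apply: compsupp_intg; apply: compsuppMl; first exact: derive_compsupp.
    exact: CP_contper (CPM (CP_vel M_spd i) Cphi.1).
  by rewrite funeqE => x; rewrite mulr_sumr; apply: eq_bigr => i _; rewrite wq; ring.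
have I6 i : intg mx (fun x => wd i x * ((beta * \sum_j Gij G i j x * vel M j x) * phi x)).
  apply: compsupp_intg; apply: compsuppMl; first exact: testfun_compsupp.
  apply: contperM => //; apply: contperZ; apply: contper_sum => j _.
  exact: CP_contper (CPM (CP_Gij G_spd i j) (CP_vel M_spd j)).
rewrite -RintN; last first.
  apply: compsupp_intg; apply: compsuppMr => //; exact: compsupp_pb.
rewrite (eq_Rintegral _ (fun x _ => E2 x)) RintB//; last by apply: intg_sum => i _; exact: I4.
have E3 x : \sum_i 'D_(delta_mx i 0) eta x.2 * err i x = (\sum_i wd i x * (Hq V M i x * phi x))
   + 2^-1 * \sum_i wd i x * ((beta * \sum_j Gij G i j x * vel M j x) * phi x).
  rewrite mulr_sumr -big_split/=; apply: eq_bigr => i _; rewrite /err /wd.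
  by ring.
rewrite [X in _ = _ - X + _](eq_Rintegral _ (fun x _ => E3 x)) RintD; last 2 first.
- by apply: intg_sum => i _; exact: I4.
- by apply: intgZ; apply: intg_sum => i _; exact: I6.
rewrite [X in _ = _ - (_ + X) + _]RintZ; last by apply: intg_sum => i _; exact: I6.
do 4 (set I := \int[mx]_x _; move: I => ?).
by ring.
Qed.

(** The diffusion is a momentum divergence, invisible to functions of the
    position. Integrating by parts moves every momentum derivative onto the
    momentum cutoff; what is left is a polynomial times [phi], integrable because
    [phi / sqrt fs] is square integrable and [sqrt fs] decays like a Gaussian. *)
Lemma position_test :
  \int[mx]_x (psi x.1 * Lc phi x) = \int[mx]_x (\sum_i vel M i x * dpsi i x.1 * phi x).
Proof.
pose eta (k : nat) : cV -> R := bump (fun=> true) k.+1%:R.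
have Keta k : pcut k.+1%:R (eta k) by exact: pcut_bump.
have eta0 k p : 0 <= eta k p by exact: bump_ge0.
have eta1 k p : eta k p <= 1 by exact: bump_le1.
have etac p : (fun k => eta k p) @ \oo --> (1 : R).
  by apply: (@cvg_bump _ _ _ _ (fun k => k.+1%:R)); exact: cvg_harmonic.
have CDeta k i : C1 ('D_(delta_mx i 0) (eta k)).
  by rewrite /eta derive_bump; exact: C1_dbump.
have d1 k i p : `|'D_(delta_mx i 0) (eta k) p| <= 6 / k.+1%:R by exact: dbump_derive_le.
have d2E k i j : 'D_(delta_mx j 0) ('D_(delta_mx i 0) (eta k)) = ddbump (fun=> true) k.+1%:R i j.
  by rewrite /eta derive_bump derive_dbump.
have d2 k i j p : `|'D_(delta_mx j 0) ('D_(delta_mx i 0) (eta k)) p| <= 30 / k.+1%:R.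
  have -> := congr1 (fun g : cV -> R => g p) (d2E k i j).
  apply: le_trans (ddbump_le _ _ _ _ _) _ => //.
  rewrite ler_wpM2l// lef_pV2 ?posrE ?exprn_gt0//.
  by rewrite expr2 ler_peMr// ler1n.
have mf := @contper_measurable R n r.
have Ceta k : contper r (fun x : phase => eta k x.2).
  by apply: CP_contper; apply: CP_pfun; exact: C1_bump.
have Cdeta k i : contper r (fun x : phase => 'D_(delta_mx i 0) (eta k) x.2).
  exact: CP_contper (@CP_pfun R n r _ (CDeta k i)).
have Cddeta k i j : contper r (fun x : phase => 'D_(delta_mx j 0) ('D_(delta_mx i 0) (eta k)) x.2).
  split; last by move=> l _ q.
  by move=> x; apply: (@continuous_comp _ _ _ snd ('D_(delta_mx j 0) ('D_(delta_mx i 0) (eta k)))); [exact: cvg_snd|apply: C1_continuous_derive; exact: CDeta].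
have cphi := CP_contper Cphi.1.
have cL := contper_Lop T V_smooth M_spd G_spd Cphi.
have ctr : contper r (fun x => \sum_i vel M i x * dpsi i x.1 * phi x).
  by apply: contper_sum => i _; exact: contperM (contperM (CP_contper (CP_vel M_spd i)) (cdpsi i)) cphi.
have itr : intg mx (fun x => \sum_i vel M i x * dpsi i x.1 * phi x).
  by apply: intg_sum => i _; exact: intg_transport.
have cerr i : contper r (err i) by exact: contperM (CP_contper (CPerr i)) cphi.
have cerr2 i j : contper r (err2 i j).
  exact: contperM (CP_contper (CPM CPpsi (CP_Gij G_spd i j))) cphi.
have vanish (g : nat -> phase -> R) (B : phase -> R) : (forall k, contper r (g k)) ->
    intg mx B -> (forall k x, `|g k x| <= k.+1%:R^-1 * B x) ->
    (fun k => \int[mx]_x g k x) @ \oo --> (0 : R).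
  move=> cg iB gB; rewrite [X in _ --> X](_ : 0 = \int[mx]_x (fun=> 0 : R) x); last first.
    by rewrite /Rintegral integral0.
  have B0 x : 0 <= B x by have := gB 0%N x; rewrite invr1 mul1r; exact: le_trans.
  apply: (Rint_dct (f_ := g) (g := B)) => //.
  + by move=> k; exact: mf.
  + move=> k x; apply: le_trans (gB k x) _.
    by rewrite ler_piMl// invf_le1// ler1n.
  + move=> x; apply/cvgrPdist_le => eps eps0.
    have lim : (fun k => k.+1%:R^-1 * B x) @ \oo --> (0 : R).
      by rewrite -[X in _ --> X](mul0r (B x)); apply: cvgMl; exact: cvg_harmonic.
    have /cvgrPdist_le/(_ _ eps0) := lim.
    apply: filterS => k; rewrite !sub0r !normrN; apply: le_trans.
    by apply: le_trans (gB k x) _; exact: ler_norm.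
have L1 : (fun k => \int[mx]_x (psi x.1 * eta k x.2 * Lc phi x)) @ \oo -->
    \int[mx]_x (psi x.1 * Lc phi x).
  apply: (Rint_dct (f_ := fun k x => psi x.1 * eta k x.2 * Lc phi x)
     (g := fun x => `|psi x.1 * Lc phi x|)).
  + by move=> k; apply: mf; exact: contperM (contperM (CP_contper CPpsi) (Ceta k)) cL.
  + by apply: mf; exact: contperM (CP_contper CPpsi) cL.
  + exact: intg_norm.
  + move=> k x; rewrite mulrAC normrM (ger0_norm (eta0 k x.2)).
    by apply: ler_piMr.
  + by move=> x; apply: cvg_cutoff; exact: etac.
have L2_ : (fun k => \int[mx]_x (eta k x.2 * \sum_i vel M i x * dpsi i x.1 * phi x)) @ \oo -->
    \int[mx]_x (\sum_i vel M i x * dpsi i x.1 * phi x).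
  apply: (Rint_dct (f_ := fun k x => eta k x.2 * \sum_i vel M i x * dpsi i x.1 * phi x)
     (g := fun x => `|\sum_i vel M i x * dpsi i x.1 * phi x|)).
  + by move=> k; apply: mf; exact: contperM (Ceta k) ctr.
  + exact: mf.
  + exact: intg_norm.
  + by move=> k x; rewrite normrM (ger0_norm (eta0 k x.2)); apply: ler_piMl.
  + by move=> x; apply: cvg_mul1; [exact: etac|exact: cvg_cst].
have L3 : (fun k => \int[mx]_x (\sum_i 'D_(delta_mx i 0) (eta k) x.2 * err i x)) @ \oo --> (0 : R).
  apply: (vanish _ (fun x => 6 * \sum_i `|err i x|)).
  + by move=> k; apply: contper_sum => i _; exact: contperM.
  + by apply: intgZ; apply: intg_sum => i _; exact: intg_norm.
  + move=> k x; rewrite mulrA mulr_sumr; apply: le_trans (ler_norm_sum _ _ _) _.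
    by apply: ler_sum => i _; rewrite normrM ler_wpM2r// mulrC.
have L4 : (fun k => \int[mx]_x (\sum_i \sum_j
    'D_(delta_mx j 0) ('D_(delta_mx i 0) (eta k)) x.2 * err2 i j x)) @ \oo --> (0 : R).
  apply: (vanish _ (fun x => 30 * \sum_i \sum_j `|err2 i j x|)).
  + by move=> k; apply: contper_sum => i _; apply: contper_sum => j _; exact: contperM.
  + by apply: intgZ; apply: intg_sum => i _; apply: intg_sum => j _; exact: intg_norm.
  + move=> k x; rewrite mulrA mulr_sumr; apply: le_trans (ler_norm_sum _ _ _) _.
    apply: ler_sum => i _; rewrite mulr_sumr; apply: le_trans (ler_norm_sum _ _ _) _.
    by apply: ler_sum => j _; rewrite normrM ler_wpM2r// mulrC.
have := cvgD (cvgB L2_ L3) (cvgM (cvg_cst (2^-1 : R)) L4).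
rewrite subr0 mulr0 addr0 => L5.
have L6 : (fun k => \int[mx]_x (psi x.1 * eta k x.2 * Lc phi x)) @ \oo -->
    \int[mx]_x (\sum_i vel M i x * dpsi i x.1 * phi x).
  rewrite (_ : (fun k => _) = (fun k =>
    \int[mx]_x (eta k x.2 * \sum_i vel M i x * dpsi i x.1 * phi x)
    - \int[mx]_x (\sum_i 'D_(delta_mx i 0) (eta k) x.2 * err i x)
    + 2^-1 * \int[mx]_x (\sum_i \sum_j
        'D_(delta_mx j 0) ('D_(delta_mx i 0) (eta k)) x.2 * err2 i j x))); first exact: L5.
  by rewrite funeqE => k; exact: cut_identity (Keta k) (CDeta k).
exact: etrans (esym (cvg_lim (@Rhausdorff R) L1)) (cvg_lim (@Rhausdorff R) L6).
Qed.

End gaussian_tests.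

(** * Dissipation at local equilibrium *)

Lemma intg_ae d (T : measurableType d) (R : realType) (mu : {measure set T -> \bar R})
    (a b : T -> R) : measurable_fun setT b -> {ae mu, forall x, a x = b x} ->
  intg mu a -> intg mu b.
Proof.
move=> mb ab ia; apply/integrableP; split; first exact/measurable_EFinP.
move/integrableP : (ia) => [_]; apply: le_lt_trans.
rewrite le_eqVlt; apply/orP; left; apply/eqP/ae_eq_integral => //.
- by apply: measurableT_comp => //; apply/measurable_EFinP.
- by apply: measurableT_comp => //; apply/measurable_EFinP; exact: intg_measurable ia.
- by apply: filterS ab => x abx _ /=; rewrite abx.
Qed.

Lemma Rint_fubini_intg (R : realType) (n r : nat) (F : 'cV[R]_n * 'cV[R]_n -> R) :
  intg (phase_measure R n r) F ->
  intg (position_measure R n r) (fun q => \int[lebesgue_cV R n]_p F (q, p)).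
Proof.
move=> iF; have iG := integrable_fubini_F iF.
move/integrableP : (iG) => [mG G_lty].
apply/integrableP; split.
  apply/measurable_EFinP; apply: (measurableT_comp (fine_measurable measurableT)).
  exact: mG.
apply: le_lt_trans G_lty; apply: ge0_le_integral => //.
- apply: measurableT_comp => //; apply/measurable_EFinP.
  by apply: (measurableT_comp (fine_measurable measurableT)); exact: mG.
- exact: measurableT_comp.
- move=> q _ /=; rewrite /Rintegral /fubini_F.
  by case: (integral _ _ _) => [a||] //=; rewrite ?leey ?normr0.
Qed.

Section gaussian_moments.
Context {R : realType} (n r : nat) (T : R).
Variables (V : 'cV[R]_n -> R) (M G : 'cV[R]_n -> 'M[R]_n).
Local Notation cV := 'cV[R]_n.
Local Notation phase := (cV * cV)%type.
Local Notation mx := (phase_measure R n r).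
Local Notation mq := (position_measure R n r).
Local Notation mp := (lebesgue_cV R n).
Local Notation beta := (T^-1).
Local Notation fs := (f_star r T V M).
Local Notation gs := (g_star r T V M).
Local Notation Lc := (Lop T V M G).
Hypotheses (T_gt0 : 0 < T) (V_smooth : smooth_position r V) (V_ge0 : forall q, 0 <= V q)
  (M_spd : smooth_posdef r M) (G_spd : smooth_posdef r G)
  (Z_finite : partition_finite r T V M).

Let fs0 x : 0 < fs x. Proof. exact: fs_gt0. Qed.
Let Cfs : CP r fs. Proof. exact: CP_fs. Qed.

(** The velocity is, up to the factor [- T], the logarithmic momentum gradient of
    the Gibbs density. *)
Lemma gauss_by_parts (K : phase -> R) i q : C1 K -> pgrow r K -> pgrow r ('D_(dp i) K) ->
  \int[mp]_p (vel M i (q, p) * K (q, p) * fs (q, p)) =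
  T * \int[mp]_p ('D_(dp i) K (q, p) * fs (q, p)).
Proof.
move=> CK gK gDK.
have cK := C1_continuous CK; have cDK := @C1_continuous_derive _ _ K (dp i) CK.
have cv := C1_continuous (CP_vel (r := r) M_spd i).1.
have iK := slice_gauss T_gt0 V_smooth V_ge0 M_spd Z_finite q cK gK.
have iDK := slice_gauss T_gt0 V_smooth V_ge0 M_spd Z_finite q cDK gDK.
have cvK : continuous (fun x => vel M i x * K x).
  by move=> x; apply: cvgM; [exact: cv|exact: cK].
have ivK := slice_gauss T_gt0 V_smooth V_ge0 M_spd Z_finite q cvK (pgrowM (pgrow_vel M_spd i) gK).
pose eta (k : nat) : cV -> R := bump (fun=> true) k.+1%:R.
have eta0 k p : 0 <= eta k p by exact: bump_ge0.
have eta1 k p : eta k p <= 1 by exact: bump_le1.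
have etac p : (fun k => eta k p) @ \oo --> (1 : R).
  by apply: (@cvg_bump _ _ _ _ (fun k => k.+1%:R)); exact: cvg_harmonic.
have d1 k p : `|'D_(delta_mx i 0) (eta k) p| <= 6 / k.+1%:R by exact: dbump_derive_le.
have Ceta k : C1 (eta k) by exact: C1_bump.
pose D k p := 'D_(delta_mx i 0) (eta k) p * (K (q, p) * fs (q, p)) +
  eta k p * ('D_(dp i) K (q, p) * fs (q, p) - beta * (vel M i (q, p) * K (q, p) * fs (q, p))).
have CKf : C1 (fun x => K x * fs x) by exact: C1M CK Cfs.1.
have DE k : 'D_(delta_mx i 0) (fun p => eta k p * (K (q, p) * fs (q, p))) = D k.
  rewrite funeqE => p.
  have h1 := C1_is_derive p (delta_mx i 0 : cV) (Ceta k).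
  have h2 := C1_is_derive p (delta_mx i 0 : cV) (C1_restrr q CKf).
  rewrite (derive_val_fun (is_deriveM_fun h1 h2)) /D addrC mulrC; congr (_ + eta k p * _).
  rewrite (derive_pairr (fun x => K x * fs x)).
  have h3 := is_deriveM_fun (C1_is_derive (q, p) (dp i : phase) CK)
    (C1_is_derive (q, p) (dp i : phase) Cfs.1).
  rewrite (derive_val_fun h3) (derive_fsp T V_smooth M_spd).
  by move: (fs _) (vel _ _ _) ('D_(dp i) K _) (K _) => a b d e; ring.
have mKf : measurable_fun setT (fun p => K (q, p) * fs (q, p)) := intg_measurable iK.
have mE := intg_measurable iDK; have mF := intg_measurable ivK.
have mdeta k : measurable_fun setT ('D_(delta_mx i 0) (eta k)).
  by apply: continuous_measurable_cV; exact: C1_continuous_derive.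
have meta k : measurable_fun setT (eta k).
  by apply: continuous_measurable_cV; exact: C1_continuous.
have mD k : measurable_fun setT (D k).
  apply: measurable_funD; apply: measurable_funM => //.
  by apply: measurable_funB => //; apply: measurable_funM.
pose dom p := 6 * `|K (q, p) * fs (q, p)| + `|'D_(dp i) K (q, p) * fs (q, p) -
  beta * (vel M i (q, p) * K (q, p) * fs (q, p))|.
have iB : intg mp (fun p => 'D_(dp i) K (q, p) * fs (q, p) -
  beta * (vel M i (q, p) * K (q, p) * fs (q, p))).
  by apply: intgB => //; apply: intgZ.
have idom : intg mp dom.
  by apply: intgD; [apply: intgZ; exact: intg_norm|exact: intg_norm].
have Ddom k p : `|D k p| <= dom p.
  apply: le_trans (ler_normD _ _) _; rewrite /dom; apply: lerD; rewrite normrM.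
    apply: ler_wpM2r => //; apply: le_trans (d1 k p) _.
    by rewrite ler_pdivrMr// ler_peMr// ler1n.
  by apply: ler_piMl => //; rewrite ger0_norm.
have D0 k : \int[mp]_p D k p = 0.
  rewrite -DE; apply: (@integral_dp_cV _ _ _ k.+1%:R).
  - by apply: C1M => //; exact: C1_restrr CKf.
  - move=> p kp; have [_ h] := @pcut_bump R n k.+1%:R (ltr0Sn _ _).
    by rewrite /eta h// mul0r.
  - by rewrite DE; exact: intg_le (mD k) idom (Ddom k).
have lim : (fun k => \int[mp]_p D k p) @ \oo --> \int[mp]_p ('D_(dp i) K (q, p) * fs (q, p) -
    beta * (vel M i (q, p) * K (q, p) * fs (q, p))).
  apply: (Rint_dct (g := dom)) => //.
    exact: intg_measurable iB.
  move=> p; rewrite -[X in _ --> X]add0r; apply: cvgD.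
    rewrite -[X in _ --> X](mul0r (K (q, p) * fs (q, p))); apply: cvgMl.
    apply/cvgrPdist_le => eps eps0.
    have lim6 : (fun k => 6 / k.+1%:R) @ \oo --> (0 : R).
      by rewrite -[X in _ --> X](mulr0 6); apply: cvgMr; exact: cvg_harmonic.
    have /cvgrPdist_le/(_ _ eps0) := lim6.
    apply: filterS => k; rewrite !sub0r !normrN; apply: le_trans.
    by apply: le_trans (d1 k p) _; exact: ler_norm.
  by apply: cvg_mul1; [exact: etac|exact: cvg_cst].
have := cvg_lim (@Rhausdorff R) lim.
rewrite (_ : (fun k => \int[mp]_p D k p) = fun=> 0); last by rewrite funeqE.
rewrite lim_cst; last exact: Rhausdorff.
rewrite RintB//; last exact: intgZ.
rewrite (RintZ _ ivK) => h0; have /eqP : \int[mp]_p ('D_(dp i) K (q, p) * fs (q, p)) -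
    beta * \int[mp]_p (vel M i (q, p) * K (q, p) * fs (q, p)) = 0 by rewrite h0.
rewrite subr_eq0 => /eqP ->.
by rewrite mulrA divff ?gt_eqF// mul1r.
Qed.

Lemma g_starE q : gs q = \int[mp]_p fs (q, p). Proof. by []. Qed.

Lemma intg_fs_slice q : intg mp (fun p => fs (q, p)).
Proof.
have := slice_gauss T_gt0 V_smooth V_ge0 M_spd Z_finite q (K := fun=> 1).
under [X in intg mp X]eq_fun do rewrite mul1r.
by apply; [exact: cst_continuous|exact: pgrow_cst].
Qed.

Lemma intg_vel2 i l q : intg mp (fun p => vel M i (q, p) * vel M l (q, p) * fs (q, p)).
Proof.
apply: (slice_gauss T_gt0 V_smooth V_ge0 M_spd Z_finite q (K := fun x => vel M i x * vel M l x)).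
  exact: C1_continuous (CPM (CP_vel (r := r) M_spd i) (CP_vel M_spd l)).1.
by apply: pgrowM; exact: (pgrow_vel M_spd).
Qed.

(** The equipartition identity: the velocity has covariance [T M^-1] given the
    position. *)
Lemma vel_moment i l q : \int[mp]_p (vel M i (q, p) * vel M l (q, p) * fs (q, p)) =
  T * Mi M l i q * gs q.
Proof.
have DE x : 'D_(dp i) (vel M l) x = Mi M l i x.1.
  exact: derive_val_fun (is_derive_velp M_spd i l x).
have DEf : 'D_(dp i) (vel M l) = fun x => Mi M l i x.1 by rewrite funeqE => x; exact: DE.
rewrite gauss_by_parts; last 3 first.
- exact: (CP_vel (r := r) M_spd l).1.
- exact: (pgrow_vel M_spd).
- rewrite DEf; apply: pgrow_q; first exact: C1_continuous (C1_Mi M_spd l i).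
  exact: (Mi_periodic M_spd).
rewrite -mulrA; congr (_ * _); rewrite g_starE -RintZ; last exact: intg_fs_slice.
by apply: eq_Rintegral => p _; rewrite DE.
Qed.

End gaussian_moments.

Lemma measurable_g_star (R : realType) (n r : nat) (T : R) (V : 'cV[R]_n -> R)
  (M : 'cV[R]_n -> 'M[R]_n) : smooth_position r V -> smooth_posdef r M ->
  partition_finite r T V M -> measurable_fun setT (g_star r T V M).
Proof.
move=> V_smooth M_spd Z_finite; apply: (intg_measurable (mu := position_measure R n r)).
apply: Rint_fubini_intg; exact: intg_fs.
Qed.

Section local_equilibrium.
Context {R : realType} (n r : nat) (T : R).
Variables (V : 'cV[R]_n -> R) (M G : 'cV[R]_n -> 'M[R]_n).
Local Notation cV := 'cV[R]_n.
Local Notation phase := (cV * cV)%type.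
Local Notation mx := (phase_measure R n r).
Local Notation mq := (position_measure R n r).
Local Notation mp := (lebesgue_cV R n).
Local Notation beta := (T^-1).
Local Notation fs := (f_star r T V M).
Local Notation gs := (g_star r T V M).
Local Notation Lc := (Lop T V M G).
Hypotheses (T_gt0 : 0 < T) (V_smooth : smooth_position r V) (V_ge0 : forall q, 0 <= V q)
  (M_spd : smooth_posdef r M) (G_spd : smooth_posdef r G)
  (Z_finite : partition_finite r T V M).
Variable xi : cV -> R.
Hypotheses (Cxi : C1 xi) (CDxi : forall i, C1 ('D_(delta_mx i 0) xi)) (pxi : qperiodic r xi).
Local Notation dxi i := ('D_(delta_mx i 0) xi).

Let fs0 x : 0 < fs x. Proof. exact: fs_gt0. Qed.
Let Cfs : CP r fs. Proof. exact: CP_fs. Qed.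
Let CPxi : CP r (fun x : phase => xi x.1). Proof. exact: CP_q. Qed.
Let CPdxi i : CP r (fun x : phase => dxi i x.1).
Proof. by apply: CP_q => //; exact: qperiodic_derive. Qed.

(** The transport derivative of the profile [xi], and the vector [M^-1 grad xi];
    the latter is also the momentum gradient of the former. *)
Definition drift_xi (x : phase) : R := \sum_i vel M i x * dxi i x.1.
Definition bxi (j : 'I_n) (q : cV) : R := \sum_k Mi M k j q * dxi k q.

Lemma CP_drift_xi : CP r drift_xi.
Proof. by apply: CP_sum => i _; exact: CPM (CP_vel M_spd i) (CPdxi i). Qed.

Lemma derive_drift_xip i (x : phase) : 'D_(dp i) drift_xi x = bxi i x.1.
Proof.
have h : is_derive x (dp i : phase) drift_xi
    (\sum_k (vel M k x * 'D_((dp i : phase).1) (dxi k) x.1 + dxi k x.1 * Mi M k i x.1)).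
  apply: is_derive_bigsum => k _; apply: (@is_deriveM_fun R phase).
    exact: (is_derive_velp M_spd).
  exact: is_derive_liftq.
rewrite (derive_val_fun h); apply: eq_bigr => k _.
by rewrite derive0 mulr0 add0r mulrC.
Qed.

(** The flow vanishes on the products of [fs] with a function of the position, and
    [pb fs = 0]. *)
Lemma Lop_equilibrium x : Lc (fun x => xi x.1 * fs x) x = - (drift_xi x * fs x).
Proof.
have dxi0 i y : 'D_(dp i) (fun x : phase => xi x.1) y = 0.
  by rewrite (derive_val_fun (is_derive_liftq y (dp i) Cxi)) derive0.
have fl0 i : flow T M G (fun x => xi x.1 * fs x) i = fun=> 0.
  rewrite funeqE => y; rewrite /flow big1// => j _; rewrite /wgrad.
  have h := is_deriveM_fun (C1_is_derive y (dp j : phase) CPxi.1) (C1_is_derive y (dp j : phase) Cfs.1).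
  rewrite (derive_val_fun h) dxi0 (derive_fsp T V_smooth M_spd).
  by move: (fs y) (vel _ _ _) (Gij _ _ _ _) (xi _) => a b c d; ring.
rewrite /Lop (pbM V M x CPxi.1 Cfs.1) (pb_fs T V_smooth M_spd) mulr0 add0r.
rewrite big1 ?mulr0 ?addr0 => [|i _]; last first.
  by rewrite fl0; exact: derive_cst.
rewrite /pb mulr_sumr /drift_xi mulr_suml -sumrN; apply: eq_bigr => i _.
rewrite dxi0 (derive_val_fun (is_derive_liftq x (dq i) Cxi)) /=.
by move: (fs x) (vel _ _ _) ('D_(delta_mx i 0) xi _) => a b c; ring.
Qed.

Let e1 (x : phase) : R := - (drift_xi x * fs x).

(** The flow of [- drift_xi fs] has no other momentum dependence than that of
    [fs], because [drift_xi] is linear in the momentum. *)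
Lemma Lop_drift x : Lc e1 x = - (fs x * pb V M drift_xi x)
  + 2^-1 * beta * (\sum_i \sum_j vel M i x * Gij G i j x * bxi j x.1) * fs x.
Proof.
have Ce1 : CP r e1 by exact: CPN (CPM CP_drift_xi Cfs).
have fl i : flow T M G e1 i = fun x => - (fs x * \sum_j Gij G i j x * bxi j x.1).
  rewrite funeqE => y; rewrite /flow mulr_sumr -sumrN; apply: eq_bigr => j _; rewrite /wgrad.
  have h := is_deriveN_fun (is_deriveM_fun (C1_is_derive y (dp j : phase) CP_drift_xi.1)
    (C1_is_derive y (dp j : phase) Cfs.1)).
  rewrite (derive_val_fun h) derive_drift_xip (derive_fsp T V_smooth M_spd) /e1.
  by move: (fs y) (vel _ _ _) (Gij _ _ _ _) (drift_xi _) (bxi _ _) => a b c d e; ring.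
have pbe : pb V M e1 x = - (fs x * pb V M drift_xi x).
  have -> : e1 = fun x => drift_xi x * (- fs x) by rewrite funeqE => y; rewrite /e1 mulrN.
  rewrite (pbM V M x CP_drift_xi.1 (CPN Cfs).1).
  have -> : pb V M (fun x => - fs x) x = 0.
    rewrite (pb_comp V M Cfs.1 (is_deriveN_fun (is_derive_id (fs x) (1 : R)))).
    by rewrite (pb_fs T V_smooth M_spd) mulr0.
  by rewrite mulr0 add0r mulNr.
rewrite /Lop pbe; congr (_ + _).
rewrite -mulrA -mulrA; congr (_ * _); rewrite mulr_suml mulr_sumr; apply: eq_bigr => i _.
rewrite fl.
have Cb j : C1 (bxi j).
  by apply: C1_sum => k _; apply: C1M => //; exact: (C1_Mi M_spd).
have CG k j : C1 (fun q => G q k j) by have [h _ _] := G_spd; exact: smooth_C1.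
pose S q := \sum_j G q i j * bxi j q.
have CS : C1 S by apply: C1_sum => j _; apply: C1M.
have h : is_derive x (dp i : phase) (fun x => - (fs x * \sum_j Gij G i j x * bxi j x.1))
   (- (fs x * 'D_((dp i : phase).1) S x.1 + S x.1 * 'D_(dp i) fs x)).
  apply: is_deriveN_fun; apply: (@is_deriveM_fun R phase).
    by apply: C1_is_derive; exact: Cfs.1.
  exact: is_derive_liftq.
rewrite (derive_val_fun h) derive0 (derive_fsp T V_smooth M_spd).
have -> : \sum_j vel M i x * Gij G i j x * bxi j x.1 = vel M i x * S x.1.
  by rewrite mulr_sumr; apply: eq_bigr => j _; rewrite /Gij mulrA.
by move: (fs x) (vel _ _ _) (S _) => a b c; ring.
Qed.

Let flip (x : phase) : phase := (x.1, - x.2).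

Let derive_flip (F : phase -> R) i x :
  'D_(dq i) F (flip x) = 'D_(dq i) (fun y => F (flip y)) x.
Proof.
rewrite /derive; set g1 := fun h => h^-1 *: _; set g2 := fun h => h^-1 *: _.
suff -> : g1 = g2 by []; rewrite funeqE => h; rewrite /g1 /g2 /=; congr (_ *: (F _ - _)).
transitivity ((h *: delta_mx i 0 + x.1, h *: 0 + - x.2) : phase) => //.
by rewrite /flip /=; congr pair; rewrite scaler0 !add0r.
Qed.

Let vel_flip i x : vel M i (flip x) = - vel M i x.
Proof.
by rewrite /vel -sumrN; apply: eq_bigr => k _; rewrite /flip /= mxE mulrN.
Qed.

Let H_flip x : hamiltonian V M (flip x) = hamiltonian V M x.
Proof.
rewrite !(hamiltonianE V M_spd); congr (_ + _ * _).
by apply: eq_bigr => j _; apply: eq_bigr => k _; rewrite /flip /= !mxE mulrNN.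
Qed.

Let Hq_flip i x : Hq V M i (flip x) = Hq V M i x.
Proof.
have E : (fun y => hamiltonian V M (flip y)) = hamiltonian V M.
  by rewrite funeqE => y; exact: H_flip.
by rewrite /Hq (derive_flip (hamiltonian V M)) E.
Qed.

Let fs_flip x : fs (flip x) = fs x.
Proof. by rewrite /f_star /gibbs_weight H_flip. Qed.

Let drift_flip x : drift_xi (flip x) = - drift_xi x.
Proof. by rewrite /drift_xi -sumrN; apply: eq_bigr => i _; rewrite vel_flip mulNr. Qed.

Let pb_flip x : pb V M drift_xi (flip x) = pb V M drift_xi x.
Proof.
rewrite /pb; apply: eq_bigr => i _.
rewrite Hq_flip vel_flip !derive_drift_xip derive_flip; congr (_ - _).
have -> : (fun y => drift_xi (flip y)) = (fun y => - drift_xi y).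
  by rewrite funeqE => y; rewrite drift_flip.
rewrite (derive_val_fun (is_deriveN_fun (C1_is_derive x (dq i : phase) CP_drift_xi.1))).
by rewrite mulrNN.
Qed.

(** The drift is odd in the momentum. *)
Lemma drift_mean q : intg mp (fun p => drift_xi (q, p) * fs (q, p)) /\
  \int[mp]_p (drift_xi (q, p) * fs (q, p)) = 0.
Proof.
have im : intg mp (fun p => drift_xi (q, p) * fs (q, p)).
  rewrite (_ : (fun p => _) = fun p => \sum_i dxi i q * (vel M i (q, p) * fs (q, p))).
    apply: intg_sum => i _; apply: intgZ.
    apply: (slice_gauss T_gt0 V_smooth V_ge0 M_spd Z_finite q (K := vel M i)).
      exact: C1_continuous (CP_vel (r := r) M_spd i).1.
    exact: pgrow_vel.
  rewrite funeqE => p; rewrite /drift_xi mulr_suml; apply: eq_bigr => i _.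
  by rewrite mulrAC [dxi i q * _]mulrC.
split => //; apply: integral_odd im _ => p.
have := fs_flip (q, p); have := drift_flip (q, p).
by rewrite /flip /= => -> ->; rewrite mulNr.
Qed.

Let intg_prod (h k : 'I_n -> R) q : intg mp (fun p => \sum_i \sum_j h i * k j *
   (vel M i (q, p) * vel M j (q, p) * fs (q, p))).
Proof.
apply: intg_sum => i _; apply: intg_sum => j _; apply: intgZ.
exact: (intg_vel2 T_gt0 V_smooth V_ge0 M_spd Z_finite).
Qed.

Let Rint_prod (h k : 'I_n -> R) q : \int[mp]_p (\sum_i \sum_j h i * k j *
   (vel M i (q, p) * vel M j (q, p) * fs (q, p))) =
   T * (\sum_i \sum_j h i * k j * Mi M j i q) * gs q.
Proof.
have iv := intg_vel2 T_gt0 V_smooth V_ge0 M_spd Z_finite.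
rewrite Rint_sum => [|i _]; last by apply: intg_sum => j _; exact: intgZ.
rewrite mulr_sumr mulr_suml; apply: eq_bigr => i _.
rewrite Rint_sum => [|j _]; last exact: intgZ.
rewrite mulr_sumr mulr_suml; apply: eq_bigr => j _.
rewrite RintZ//.
by rewrite (vel_moment T_gt0 V_smooth V_ge0 M_spd Z_finite); ring.
Qed.

Lemma drift_sq x : drift_xi x ^+ 2 * fs x =
  \sum_i \sum_j dxi i x.1 * dxi j x.1 * (vel M i x * vel M j x * fs x).
Proof.
rewrite expr2 /drift_xi mulr_suml mulr_suml; apply: eq_bigr => i _.
rewrite mulr_sumr mulr_suml; apply: eq_bigr => j _.
by move: (vel M i x) (vel M j x) (fs x) (dxi i x.1) (dxi j x.1) => a b c d e; ring.
Qed.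

Lemma kinetic_slice q : \int[mp]_p (drift_xi (q, p) ^+ 2 * fs (q, p)) =
  T * (\sum_i \sum_j dxi i q * dxi j q * Mi M j i q) * gs q.
Proof. by rewrite -Rint_prod; apply: eq_Rintegral => p _; exact: drift_sq. Qed.

Lemma kinetic_dissipation : intg mx (fun x => drift_xi x ^+ 2 * fs x) ->
  \int[mx]_x (drift_xi x ^+ 2 * fs x) =
  \int[mq]_q (T * (\sum_i \sum_j dxi i q * dxi j q * Mi M j i q) * gs q).
Proof.
move=> i0; rewrite Rint_fubini//; apply: eq_Rintegral => q _; exact: kinetic_slice.
Qed.

Let L := fun x => e1 x * Lc e1 x / fs x.

Let slice_odd q p : drift_xi (q, - p) * pb V M drift_xi (q, - p) * fs (q, - p) =
  - (drift_xi (q, p) * pb V M drift_xi (q, p) * fs (q, p)).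
Proof.
have := fs_flip (q, p); have := pb_flip (q, p); have := drift_flip (q, p).
by rewrite /flip /= => -> -> ->; rewrite !mulNr.
Qed.

Let LE x : L x = drift_xi x * pb V M drift_xi x * fs x
  - 2^-1 * beta * \sum_i \sum_j dxi i x.1 * (\sum_k Gij G j k x * bxi k x.1) *
     (vel M i x * vel M j x * fs x).
Proof.
rewrite /L Lop_drift {1}/e1.
have -> : \sum_i \sum_j dxi i x.1 * (\sum_k Gij G j k x * bxi k x.1) *
     (vel M i x * vel M j x * fs x) =
  drift_xi x * (\sum_i \sum_j vel M i x * Gij G i j x * bxi j x.1) * fs x.
  rewrite /drift_xi mulr_suml mulr_suml; apply: eq_bigr => i _.
  rewrite mulr_sumr mulr_suml; apply: eq_bigr => j _.
  rewrite -[X in _ = X * _]mulrA.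
  have -> : \sum_k vel M j x * Gij G j k x * bxi k x.1 =
      vel M j x * (\sum_k Gij G j k x * bxi k x.1).
    by rewrite mulr_sumr; apply: eq_bigr => k _; rewrite mulrA.
  move: (\sum_k _) (vel M i x) (vel M j x) (fs x) (dxi i x.1) => a b c d e.
  by ring.
have := fs0 x; move: (fs x) => a a0.
move: (drift_xi x) (pb _ _ _ _) (\sum_i _) => b c d.
by field; rewrite !gt_eqF.
Qed.

(** The transport part is odd in the momentum and averages out. *)
Lemma diffusive_dissipation : intg mx (fun x => e1 x * Lc e1 x / fs x) ->
  intg mq (fun q => (\sum_i \sum_j G q i j * (bxi i q * bxi j q)) * gs q) /\
  \int[mx]_x (e1 x * Lc e1 x / fs x) =
  - 2^-1 * \int[mq]_q ((\sum_i \sum_j G q i j * (bxi i q * bxi j q)) * gs q).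
Proof.
move=> iL; pose W q := (\sum_i \sum_j G q i j * (bxi i q * bxi j q)) * gs q.
have inner q : intg mp (fun p => L (q, p)) -> \int[mp]_p L (q, p) = - 2^-1 * W q.
  move=> iq.
  pose k j := \sum_k Gij G j k (q, 0 : cV) * bxi k q.
  have i2 := intg_prod (fun i => dxi i q) k q.
  have i1 : intg mp (fun p => drift_xi (q, p) * pb V M drift_xi (q, p) * fs (q, p)).
    rewrite (_ : (fun p => _) = fun p => L (q, p) + 2^-1 * beta *
      \sum_i \sum_j dxi i q * k j * (vel M i (q, p) * vel M j (q, p) * fs (q, p))).
      by apply: intgD => //; exact: intgZ.
    by rewrite funeqE => p; rewrite LE subrK.
  have -> : \int[mp]_p L (q, p) = \int[mp]_p (drift_xi (q, p) * pb V M drift_xi (q, p) * fs (q, p)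
    - 2^-1 * beta * \sum_i \sum_j dxi i q * k j * (vel M i (q, p) * vel M j (q, p) * fs (q, p))).
    by apply: eq_Rintegral => p _; rewrite LE.
  rewrite RintB//; last exact: intgZ.
  rewrite (integral_odd i1) ?sub0r; last by move=> p; exact: slice_odd.
  rewrite RintZ// Rint_prod /W.
  have -> : \sum_i \sum_j dxi i q * k j * Mi M j i q =
      \sum_i \sum_j G q i j * (bxi i q * bxi j q).
    rewrite exchange_big/=; apply: eq_bigr => j _.
    have -> : \sum_i dxi i q * k j * Mi M j i q = k j * bxi j q.
      rewrite /bxi mulr_sumr; apply: eq_bigr => i _.
      by rewrite (Mi_sym M_spd j i); ring.
    by rewrite /k mulr_suml; apply: eq_bigr => l _; rewrite /Gij /=; ring.
  rewrite mulrA mulrA -[2^-1 * beta * T]mulrA mulVf ?gt_eqF// mulr1.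
  by rewrite -mulrA mulNr.
have slices : {ae mq, forall q, \int[mp]_p L (q, p) = - 2^-1 * W q}.
  have [N [mN N0 NP]] := ae_integrable1 iL.
  exists N; split => // q /= nq; apply: NP => /= h; apply: nq; apply: inner.
  exact: h.
have iF := Rint_fubini_intg iL.
have mW : measurable_fun setT W.
  apply: measurable_funM; last exact: measurable_g_star.
  have C : C1 (fun q => \sum_i \sum_j G q i j * (bxi i q * bxi j q)).
    have Cb j : C1 (bxi j).
      by apply: C1_sum => k _; apply: C1M => //; exact: (C1_Mi M_spd).
    have CG k j : C1 (fun q => G q k j) by have [h _ _] := G_spd; exact: smooth_C1.
    by apply: C1_sum => i _; apply: C1_sum => j _; apply: C1M => //; exact: C1M.
  by apply: continuous_measurable_cV; exact: C1_continuous.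
have mW2 : measurable_fun setT (fun q => - 2^-1 * W q) by exact: measurable_funM.
have iW2 := intg_ae mW2 slices iF.
have iW : intg mq W.
  have := intgZ (- 2) iW2.
  rewrite (_ : (fun x => _) = W)//.
  by rewrite funeqE => q; field.
split => //; rewrite Rint_fubini//.
by rewrite (Rint_ae (intg_measurable iF) mW2 slices) RintZ.
Qed.

End local_equilibrium.

(** * Testing with the density ratio *)

(** The identity [3 v^2 = 4 (v^2 - m) - 4 ((v / 2)^2 - m)]. *)
Lemma split_bound (R : realFieldType) (v m a b : R) : 0 <= a -> a <= b ->
  v ^+ 2 * a <= 2 * `|(v ^+ 2 - m) * a| + 2 * `|((2^-1 * v) ^+ 2 - m) * b|.
Proof.
move=> a0 ab; have b0 := le_trans a0 ab.
have k1 : (v ^+ 2 - m) * a <= `|(v ^+ 2 - m) * a| by exact: ler_norm.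
have k2 : - (((2^-1 * v) ^+ 2 - m) * a) <= `|((2^-1 * v) ^+ 2 - m) * b|.
  apply: le_trans (ler_norm _) _; rewrite normrN !normrM (ger0_norm a0) (ger0_norm b0).
  by rewrite ler_wpM2l.
have k3 := normr_ge0 ((v ^+ 2 - m) * a).
have k4 := normr_ge0 (((2^-1 * v) ^+ 2 - m) * b).
have -> : v ^+ 2 * a = (4 / 3) * ((v ^+ 2 - m) * a) + (4 / 3) * (- (((2^-1 * v) ^+ 2 - m) * a)).
  by field.
set A := (v ^+ 2 - m) * a in k1 k3 *; set B := ((2^-1 * v) ^+ 2 - m) * a in k2 *.
set C := ((2^-1 * v) ^+ 2 - m) * b in k2 k4 *.
by clearbody A B C; lra.
Qed.

Section velocity_moment_bound.
Context {R : realType} (n r : nat) (T : R).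
Variables (V : 'cV[R]_n -> R) (M : 'cV[R]_n -> 'M[R]_n).
Local Notation cV := 'cV[R]_n.
Local Notation phase := (cV * cV)%type.
Local Notation mx := (phase_measure R n r).
Local Notation beta := (T^-1).
Local Notation fs := (f_star r T V M).
Hypotheses (T_gt0 : 0 < T) (V_smooth : smooth_position r V)
  (M_spd : smooth_posdef r M) (Z_finite : partition_finite r T V M).
Variable xi : cV -> R.
Hypotheses (Cxi : C1 xi) (pxi : qperiodic r xi) (xi0 : forall q, 0 <= xi q).
Local Notation f := (fun x : phase => xi x.1 * fs x).

Let fs0 x : 0 < fs x. Proof. exact: fs_gt0. Qed.
Let Cfs : CP r fs. Proof. exact: CP_fs. Qed.
Let CPxi : CP r (fun x : phase => xi x.1). Proof. exact: CP_q. Qed.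
Let Cf : CP r f. Proof. exact: CPM CPxi Cfs. Qed.

Lemma derive2_equilibrium i (x : phase) : T ^+ 2 * 'D_(dp i) ('D_(dp i) f) x =
  (vel M i x ^+ 2 - T * Mi M i i x.1) * f x.
Proof.
have D1 (y : phase) : 'D_(dp i) f y = - (beta * (vel M i y * f y)).
  have h := is_deriveM_fun (is_derive_liftq y (dp i) Cxi) (C1_is_derive y (dp i : phase) Cfs.1).
  rewrite (derive_val_fun h) derive0 mulr0 addr0 (derive_fsp T V_smooth M_spd).
  by move: (fs y) (vel _ _ _) (xi _) => a b c; ring.
have D1f : 'D_(dp i) f = fun y => - (beta * (vel M i y * f y)) by rewrite funeqE.
have h := is_deriveN_fun (is_derive_cstM beta (is_deriveM_fun (is_derive_velp M_spd i i x)
  (C1_is_derive x (dp i : phase) Cf.1))).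
rewrite D1f (derive_val_fun h) D1.
move: (f x) (vel _ _ _) (Mi _ _ _ _) => a b c.
by field; rewrite gt_eqF.
Qed.

Let half (x : phase) : phase := (x.1, 2^-1 *: x.2).

Let fs_half x : fs x <= fs (half x).
Proof.
rewrite !fsE ler_wpM2l ?invr_ge0 ?(ltW (Zpart_gt0 V_smooth M_spd Z_finite))//.
rewrite ler_expR lerN2 ler_wpM2l ?invr_ge0 ?(ltW T_gt0)//.
rewrite !(hamiltonianE V M_spd) /half /= lerD2l ler_wpM2l ?invr_ge0//.
have [_ _ /(_ x.1)/posdef_inv/(posdef_ge0 x.2)] := M_spd.
rewrite qform; set S := \sum_i _ => S0.
have -> : \sum_j \sum_k Mi M j k x.1 * ((2^-1 *: x.2) j 0 * (2^-1 *: x.2) k 0) = 4^-1 * S.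
  rewrite /S mulr_sumr; apply: eq_bigr => j _; rewrite mulr_sumr; apply: eq_bigr => k _.
  by rewrite !mxE /Mi; field.
by move: S S0 => s s0; lra.
Qed.

Let vel_half i x : vel M i (half x) = 2^-1 * vel M i x.
Proof.
by rewrite /vel mulr_sumr; apply: eq_bigr => k _; rewrite /half /= mxE; ring.
Qed.

Let weight_half x : weight r (half x) <= 4 ^+ n * weight r x.
Proof.
rewrite /weight /half /= mulrCA ler_wpM2l ?(ltW (qweight_gt0 _ _))//.
have -> : 4 ^+ n * pweight x.2 = \prod_(i < n) (4 * (1 + x.2 i 0 ^+ 2)^-1).
  by rewrite big_split/= prodr_const card_ord.
apply: ler_prod => i _; rewrite invr_ge0 addr_ge0 ?sqr_ge0//=.
rewrite mxE; move: (x.2 i 0) => s.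
have h1 : 0 < 1 + s ^+ 2 by rewrite ltr_pwDl ?sqr_ge0.
have h2 : 0 < 1 + (2^-1 * s) ^+ 2 by rewrite ltr_pwDl ?sqr_ge0.
rewrite -div1r ler_pdivrMr// mulrAC ler_pdivlMr// mul1r.
by rewrite exprMn; lra.
Qed.

(** The second momentum derivatives at [p] and [p/2] control the density times
    the squared velocity: where one of them degenerates, the other does not. *)
Lemma vel_sq_intg i : rapid r ('D_(dp i) ('D_(dp i) f)) ->
  intg mx (fun x => vel M i x ^+ 2 * f x).
Proof.
move=> /(rapid_weight 1)[C [C0 hC]].
pose D := 'D_(dp i) ('D_(dp i) f).
have f0 x : 0 <= f x by rewrite mulr_ge0// ltW.
have vf x : vel M i x ^+ 2 * f x <= T ^+ 2 * (2 * `|D x| + 2 * `|D (half x)|).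
  have h1 := derive2_equilibrium i x; have h2 := derive2_equilibrium i (half x).
  rewrite vel_half in h2; rewrite -/D in h1 h2.
  have ff : f x <= f (half x) by apply: ler_wpM2l; [exact: xi0|exact: fs_half].
  have n2 (a : R) : T ^+ 2 * (2 * `|a|) = 2 * `|T ^+ 2 * a|.
    by rewrite normrM (ger0_norm (sqr_ge0 T)) mulrCA.
  have hb := split_bound (vel M i x) (T * Mi M i i x.1) (f0 x) ff.
  have e1 : 2 * `|(vel M i x ^+ 2 - T * Mi M i i x.1) * f x| = T ^+ 2 * (2 * `|D x|).
    by rewrite n2 h1.
  have e2 : 2 * `|((2^-1 * vel M i x) ^+ 2 - T * Mi M i i x.1) * f (half x)| =
      T ^+ 2 * (2 * `|D (half x)|) by rewrite n2 h2.
  by apply: le_trans hb _; rewrite e1 e2 -mulrDr.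
have cv2f : continuous (fun x => vel M i x ^+ 2 * f x).
  rewrite (_ : (fun x => _) = fun x => vel M i x * vel M i x * f x); last first.
    by rewrite funeqE => x; rewrite expr2.
  exact: C1_continuous (CPM (CPM (CP_vel M_spd i) (CP_vel M_spd i)) Cf).1.
apply: (intg_weight_le (c := T ^+ 2 * (2 * C + 2 * (C * 4 ^+ n)))) => // x.
rewrite ger0_norm; last by apply: mulr_ge0 => //; exact: sqr_ge0.
apply: le_trans (vf x) _; rewrite -mulrA; apply: ler_wpM2l; first exact: sqr_ge0.
have d1 : `|D x| <= C * weight r x by have := hC x; rewrite expr1.
have d2 : `|D (half x)| <= C * (4 ^+ n * weight r x).
  have := hC (half x); rewrite expr1 => /le_trans; apply.
  exact: ler_wpM2l C0 _ _ (weight_half x).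
have -> : (2 * C + 2 * (C * 4 ^+ n)) * weight r x =
    2 * (C * weight r x) + 2 * (C * (4 ^+ n * weight r x)) by move: (weight r x) => w; ring.
exact: lerD (ler_wpM2l (ler0n _ 2) d1) (ler_wpM2l (ler0n _ 2) d2).
Qed.

End velocity_moment_bound.

Section position_truncation.
Context {R : realType} (n r : nat) (T : R).
Variables (V : 'cV[R]_n -> R) (M G : 'cV[R]_n -> 'M[R]_n).
Local Notation cV := 'cV[R]_n.
Local Notation phase := (cV * cV)%type.
Local Notation mx := (phase_measure R n r).
Local Notation beta := (T^-1).
Local Notation fs := (f_star r T V M).
Local Notation Lc := (Lop T V M G).
Hypotheses (T_gt0 : 0 < T) (V_smooth : smooth_position r V) (V_ge0 : forall q, 0 <= V q)
  (M_spd : smooth_posdef r M) (G_spd : smooth_posdef r G)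
  (Z_finite : partition_finite r T V M).
Variables (xi : cV -> R) (phi : phase -> R).
Hypotheses (Cxi : C1 xi) (pxi : qperiodic r xi) (xi0 : forall q, 0 <= xi q)
  (Cphi : CP2 r phi)
  (Lphi : L2 mx (fun x => phi x / Num.sqrt (fs x)))
  (LLphi : L2 mx (fun x => Lc phi x / Num.sqrt (fs x)))
  (Lxi : L2 mx (fun x => xi x.1 * fs x / Num.sqrt (fs x)))
  (Ldrift : L2 mx (fun x => drift_xi M xi x * fs x / Num.sqrt (fs x)))
  (ivel : forall i, intg mx (fun x => vel M i x ^+ 2 * (xi x.1 * fs x))).
Local Notation dxi i := ('D_(delta_mx i 0) xi).

Let fs0 x : 0 < fs x. Proof. exact: fs_gt0. Qed.
Let sfs0 x : Num.sqrt (fs x) != 0. Proof. by rewrite gt_eqF// sqrtr_gt0. Qed.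
Let sqrt_mul (a b : R) x : a * fs x / Num.sqrt (fs x) * (b / Num.sqrt (fs x)) = a * b.
Proof.
rewrite -{1}(sqr_sqrtr (ltW (fs0 x))); have := sfs0 x.
by move: (Num.sqrt _) => s s0; field.
Qed.

Let CPxi : CP r (fun x : phase => xi x.1). Proof. exact: CP_q. Qed.
Let cdrift : contper r (drift_xi M xi).
Proof.
apply: contper_sum => i _; apply: contperM; first exact/CP_contper/(CP_vel M_spd).
split; last first.
  by apply/periodicP => j aj q p /=; rewrite (qperiodic_derive (delta_mx i 0) pxi aj q).
by move=> x; apply: (@continuous_comp _ _ _ fst (dxi i)); [exact: cvg_fst|exact: C1_continuous_derive].
Qed.

Let iL : intg mx (fun x => xi x.1 * Lc phi x).
Proof.
have := L2_mul Lxi LLphi; rewrite (_ : (fun x => _) = fun x => xi x.1 * Lc phi x)//.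
by rewrite funeqE => x; rewrite sqrt_mul.
Qed.

Let iD : intg mx (fun x => drift_xi M xi x * phi x).
Proof.
have := L2_mul Ldrift Lphi; rewrite (_ : (fun x => _) = fun x => drift_xi M xi x * phi x)//.
by rewrite funeqE => x; rewrite sqrt_mul.
Qed.

Let dom (x : phase) : R := \sum_(i < n) (vel M i x ^+ 2 * (xi x.1 * fs x) + phi x ^+ 2 / fs x).

Let idom : intg mx dom.
Proof.
apply: intg_sum => i _; apply: intgD => //.
have := L2_mul Lphi Lphi; rewrite (_ : (fun x => _) = fun x => phi x ^+ 2 / fs x)//.
rewrite funeqE => x; rewrite -[in RHS](sqr_sqrtr (ltW (fs0 x))); have := sfs0 x.
by move: (Num.sqrt _) => s s0; field.
Qed.

(** The profile is cut off both in value, as [xi / (1 + e xi)], and in position,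
    at a radius of order [1 / e ^ 2]. The error comes from the gradient of the
    position cutoff; it tends to zero because [(xi / (1 + e xi)) ^ 2 <= xi / e]
    and the squared velocity is integrable against the density. *)
Lemma profile_test :
  \int[mx]_x (xi x.1 * Lc phi x) = \int[mx]_x (drift_xi M xi x * phi x).
Proof.
pose e (k : nat) : R := k.+1%:R^-1; pose S (k : nat) : R := k.+1%:R ^+ 2.
pose mask (i : 'I_n) := ~~ angle r i.
pose chi (k : nat) : cV -> R := bump mask (S k).
pose w k q := renormw (e k) (xi q).
pose psi k q := xi q * w k q * chi k q.
have S0 k : 0 < S k by rewrite exprn_gt0.
have e0 k : 0 < e k by rewrite invr_gt0.
have Kchi k : qcut r (S k) (chi k) by exact: qcut_bump.
have chi0 k q : 0 <= chi k q by exact: bump_ge0.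
have chi1 k q : chi k q <= 1 by exact: bump_le1.
have dchi k i q : `|'D_(delta_mx i 0) (chi k) q| <= 6 / S k by exact: dbump_derive_le.
have w0 k q : 0 < w k q by exact: renormw_gt0.
have w1 k q : w k q <= 1 by exact: renormw_le1.
have wE k q : e k * xi q * w k q = 1 - w k q by exact: renormwE.
have ec : e @ \oo --> (0 : R) by exact: cvg_harmonic.
have wc q : (fun k => w k q) @ \oo --> (1 : R).
  rewrite -[X in _ --> X]invr1; apply: cvgV; first exact: oner_neq0.
  rewrite -[X in _ --> X]addr0; apply: cvgD; first exact: cvg_cst.
  by rewrite -(mul0r (xi q)); apply: cvgMl.
have chic q : (fun k => chi k q) @ \oo --> (1 : R).
  apply: cvg_bump; rewrite (_ : (fun k => _) = fun k => e k * e k).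
    by rewrite -[X in _ --> X](mulr0 0); exact: cvgM.
  by rewrite funeqE => k; rewrite /S /e -expr2 exprVn.
have Cw k : C1 (w k).
  apply: C1V => [q|]; first by rewrite gt_eqF// ltr_pwDl// mulr_ge0// ltW.
  by apply: C1D; [exact: C1_cst|exact: C1Z].
have pw k : qperiodic r (w k) by move=> i ai q; rewrite /w pxi.
have Kpsi k : qcut r (S k) (psi k).
  have [Cc pc oc] := Kchi k; split; first by apply: C1M => //; exact: C1M.
    by move=> i ai q; rewrite /psi pxi// pw// pc.
  by move=> q /oc; rewrite /psi => ->; rewrite mulr0.
have dpsi k i q : 'D_(delta_mx i 0) (psi k) q =
    w k q ^+ 2 * dxi i q * chi k q + xi q * w k q * 'D_(delta_mx i 0) (chi k) q.
  have [Cc _ _] := Kchi k.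
  have hx := C1_is_derive q (delta_mx i 0 : cV) Cxi.
  have hw := is_derive_comp1 hx (is_derive_renormw (e0 k) (xi0 q)).
  have h := is_deriveM_fun (is_deriveM_fun hx hw) (C1_is_derive q (delta_mx i 0 : cV) Cc).
  rewrite (derive_val_fun h) -/(w k q); have := wE k q.
  move: (w k q) ('D__ (chi k) q) (dxi i q) => a b d E.
  rewrite [RHS]addrC; congr (_ + _).
  have -> : xi q * (- (e k * a ^+ 2) * d) + a * d = a * d * (1 - e k * xi q * a) by ring.
  by rewrite E; ring.
have Kpsi_test k := position_test T_gt0 V_smooth V_ge0 M_spd G_spd Z_finite Cphi (Kpsi k) Lphi LLphi.
have mf := @contper_measurable R n r.
have cL := contper_Lop T V_smooth M_spd G_spd Cphi.
have cphi := CP_contper Cphi.1.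
have CPpsi k : CP r (fun x : phase => psi k x.1).
  by have [Cp pp _] := Kpsi k; exact: CP_q.
have psi_le k q : 0 <= psi k q <= xi q.
  have xw0 : 0 <= xi q * w k q := mulr_ge0 (xi0 q) (ltW (w0 k q)).
  rewrite mulr_ge0//=; apply: le_trans (ler_piMr xw0 (chi1 k q)) _.
  exact: ler_piMr.
have limL : (fun k => \int[mx]_x (psi k x.1 * Lc phi x)) @ \oo --> \int[mx]_x (xi x.1 * Lc phi x).
  apply: (Rint_dct (f_ := fun k x => psi k x.1 * Lc phi x) (g := fun x => `|xi x.1 * Lc phi x|)).
  - by move=> k; apply: mf; exact: contperM (CP_contper (CPpsi k)) cL.
  - by apply: mf; exact: contperM (CP_contper CPxi) cL.
  - exact: intg_norm.
  - move=> k x; have /andP[p0 p1] := psi_le k x.1.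
    rewrite normrM (ger0_norm p0) [leRHS]normrM (ger0_norm (xi0 x.1)).
    exact: ler_wpM2r.
  - move=> x; apply: cvgMl; rewrite -[X in _ --> X]mulr1; apply: cvgM => //.
    by rewrite -[X in _ --> X]mulr1; apply: cvgMr.
pose E k (x : phase) := \sum_i vel M i x * (xi x.1 * w k x.1 * 'D_(delta_mx i 0) (chi k) x.1) * phi x.
have fluxE k x : \sum_i vel M i x * 'D_(delta_mx i 0) (psi k) x.1 * phi x =
    w k x.1 ^+ 2 * chi k x.1 * (drift_xi M xi x * phi x) + E k x.
  rewrite /drift_xi /E mulr_suml mulr_sumr -big_split/=; apply: eq_bigr => i _.
  rewrite dpsi; move: (w k _) (chi k _) ('D__ (chi k) _) (vel _ _ _) (dxi i _) => a b c d g.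
  by ring.
have E_le k x : `|E k x| <= k.+1%:R^-1 * (3 * dom x).
  rewrite /E /dom !mulr_sumr; apply: le_trans (ler_norm_sum _ _ _) _.
  apply: ler_sum => i _.
  have fx := fs0 x; have d1 := dchi k i x.1.
  have xw : (xi x.1 * w k x.1) ^+ 2 <= k.+1%:R * xi x.1.
    have -> : (xi x.1 * w k x.1) ^+ 2 = k.+1%:R * xi x.1 * ((e k * xi x.1 * w k x.1) * w k x.1).
      by rewrite /e; field.
    apply: ler_piMr; first by rewrite mulr_ge0.
    by rewrite wE mulr_ile1 ?gerBl ?subr_ge0 ?w1 ?(ltW (w0 k x.1)).
  have xw0 : 0 <= xi x.1 * w k x.1 := mulr_ge0 (xi0 x.1) (ltW (w0 k x.1)).
  have k0 : (0 : R) < k.+1%:R by rewrite ltr0n.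
  have k1 : (1 : R) <= k.+1%:R by rewrite ler1n.
  rewrite normrM normrM [`|xi x.1 * _ * _|]normrM (ger0_norm xw0).
  apply: (@le_trans _ _ (`|vel M i x| * (xi x.1 * w k x.1 * (6 / S k)) * `|phi x|)).
    by apply: ler_wpM2r => //; apply: ler_wpM2l => //; exact: ler_wpM2l.
  have amgm : 2 * (`|vel M i x| * (xi x.1 * w k x.1) * `|phi x|) <=
     k.+1%:R * (vel M i x ^+ 2 * (xi x.1 * fs x)) + phi x ^+ 2 / fs x.
    apply: (@le_trans _ _ ((vel M i x ^+ 2 * (xi x.1 * w k x.1) ^+ 2) * fs x + phi x ^+ 2 / fs x)).
      rewrite -[vel M i x ^+ 2]real_normK ?num_real// -[phi x ^+ 2]real_normK ?num_real//.
      move: (`|vel M i x|) (xi x.1 * w k x.1) (`|phi x|) (fs x) fx => a b c d d0.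
      rewrite -subr_ge0.
      have -> : a ^+ 2 * b ^+ 2 * d + c ^+ 2 / d - 2 * (a * b * c) = (a * b * d - c) ^+ 2 / d.
        by field; rewrite gt_eqF.
      by rewrite divr_ge0 ?sqr_ge0// ltW.
    rewrite lerD2r; apply: (@le_trans _ _ (vel M i x ^+ 2 * (k.+1%:R * xi x.1) * fs x)).
      by apply: ler_wpM2r; [exact: ltW|apply: ler_wpM2l; [exact: sqr_ge0|]].
    by rewrite le_eqVlt; apply/orP; left; apply/eqP; ring.
  have A0 : 0 <= vel M i x ^+ 2 * (xi x.1 * fs x).
    by apply: mulr_ge0; [exact: sqr_ge0|apply: mulr_ge0 => //; exact: ltW].
  have B0 : 0 <= phi x ^+ 2 / fs x by rewrite divr_ge0 ?sqr_ge0// ltW.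
  move: (vel M i x ^+ 2 * _) (phi x ^+ 2 / fs x) A0 B0 amgm => A B A0 B0 amgm.
  have -> : `|vel M i x| * (xi x.1 * w k x.1 * (6 / S k)) * `|phi x| =
     3 / S k * (2 * (`|vel M i x| * (xi x.1 * w k x.1) * `|phi x|)) by ring.
  apply: (@le_trans _ _ (3 / S k * (k.+1%:R * A + B))).
    by apply: ler_wpM2l => //; rewrite divr_ge0// ltW.
  have -> : 3 / S k * (k.+1%:R * A + B) = k.+1%:R^-1 * (3 * (A + k.+1%:R^-1 * B)).
    by rewrite /S; field.
  rewrite ler_wpM2l ?invr_ge0 ?(ltW k0)// ler_wpM2l// lerD2l ler_piMl// invf_le1//.
have dom0 x : 0 <= dom x.
  have := E_le 0%N x; rewrite invr1 mul1r => h.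
  have : 0 <= 3 * dom x by exact: le_trans h.
  by rewrite pmulr_rge0.
have limR : (fun k => \int[mx]_x (\sum_i vel M i x * 'D_(delta_mx i 0) (psi k) x.1 * phi x)) @ \oo -->
    \int[mx]_x (drift_xi M xi x * phi x).
  apply: (Rint_dct (f_ := fun k x => \sum_i vel M i x * 'D_(delta_mx i 0) (psi k) x.1 * phi x)
      (g := fun x => `|drift_xi M xi x * phi x| + 3 * dom x)).
  - move=> k; apply: (intg_measurable (mu := mx)); apply: intg_sum => i _.
    exact: (intg_transport T_gt0 V_smooth V_ge0 M_spd Z_finite (Kpsi k) Lphi i).
  - by apply: mf; exact: contperM.
  - by apply: intgD; [exact: intg_norm|exact: intgZ].
  - move=> k x; rewrite fluxE; apply: le_trans (ler_normD _ _) _; apply: lerD.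
      rewrite normrM; apply: ler_piMl => //.
      have wc0 : 0 <= w k x.1 ^+ 2 * chi k x.1 by rewrite mulr_ge0 ?sqr_ge0.
      rewrite (ger0_norm wc0); apply: mulr_ile1; rewrite ?sqr_ge0//.
      by apply: exprn_ile1 => //; exact: ltW.
    apply: le_trans (E_le k x) _; apply: ler_piMl; first by rewrite mulr_ge0.
    by rewrite invf_le1// ler1n.
  - move=> x; rewrite (_ : (fun k => _) = fun k => w k x.1 ^+ 2 * chi k x.1 * (drift_xi M xi x * phi x) + E k x); last first.
      by rewrite funeqE => k; exact: fluxE.
    rewrite -[X in _ --> X]addr0; apply: cvgD.
      apply: cvg_mul1; last exact: cvg_cst.
      apply: cvg_mul1 => //; rewrite (_ : (fun k => _) = fun k => w k x.1 * w k x.1); last first.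
        by rewrite funeqE => k; rewrite expr2.
      exact: cvg_mul1.
    apply/cvgrPdist_le => eps eps0.
    have lim : (fun k => e k * (3 * dom x)) @ \oo --> (0 : R).
      by rewrite -[X in _ --> X](mul0r (3 * dom x)); apply: cvgMl.
    have /cvgrPdist_le/(_ _ eps0) := lim.
    apply: filterS => k; rewrite !sub0r !normrN; apply: le_trans.
    by apply: le_trans (E_le k x) _; exact: ler_norm.
have limL' : (fun k => \int[mx]_x (psi k x.1 * Lc phi x)) @ \oo --> \int[mx]_x (drift_xi M xi x * phi x).
  rewrite (_ : (fun k => _) = (fun k => \int[mx]_x (\sum_i vel M i x * 'D_(delta_mx i 0) (psi k) x.1 * phi x)))//.
  by rewrite funeqE => k; exact: Kpsi_test.
exact: etrans (esym (cvg_lim (@Rhausdorff R) limL)) (cvg_lim (@Rhausdorff R) limL').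
Qed.

End position_truncation.

(** * Time derivatives of the density *)

Section smooth_representative.
Context d (T : measurableType d) (R : realType) (mu : {measure set T -> \bar R}).

(** By [chain_identify] the two families agree almost everywhere, and norms do not
    distinguish them; the smooth one has the advantage of being defined
    everywhere, with the equation holding at each point. *)
Lemma smooth_representative (D E : nat -> R -> T -> R) :
  (forall k t, 0 <= t -> L2 mu (D k t)) ->
  (forall k t, 0 <= t ->
     (fun h => nrm mu (fun x => quot (D k) t h x - D k.+1 t x)) @ time_increment t --> 0) ->
  (forall k t, 0 <= t -> measurable_fun setT (E k t)) ->
  (forall k t x, 0 <= t -> (fun h => quot (E k) t h x) @ time_increment t --> E k.+1 t x) ->
  (forall t, 0 <= t -> {ae mu, forall x, D 0%N t x = E 0%N t x}) ->
  L2chain mu E.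
Proof.
move=> LD dD mE dE D0; have DE := chain_identify LD dD mE dE D0.
move=> k t t0; have t0' := ltW t0.
split; first exact: L2_ae (mE k t t0') (DE k t t0') (LD k t t0').
have lim : (fun h => nrm mu (fun x => quot (D k) t h x - D k.+1 t x)) @ 0^' --> 0.
  by move=> A nA; exact: (time_increment_pos t0 (dD k t t0' A nA)).
apply: cvg_trans lim; apply: near_eq_cvg.
have tp : time_increment t [set h | 0 <= t + h].
  by rewrite /time_increment /within /=; apply: filterE => h; exact: id.
have nh := time_increment_pos t0 tp.
near=> h.
have th : 0 <= t + h by near: h.
rewrite /= /nrm; congr Num.sqrt.
have mq (F : nat -> R -> T -> R) : measurable_fun setT (F k t) -> measurable_fun setT (F k (t + h)) ->
    measurable_fun setT (F k.+1 t) -> measurable_fun setT (fun x => quot (F k) t h x - F k.+1 t x).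
  move=> m1 m2 m3; apply: measurable_funB => //; apply: measurable_funM => //.
  exact: measurable_funB.
have mD j s (s0 : 0 <= s) : measurable_fun setT (D j s) by case: (LD j s s0).
have ae : {ae mu, forall x, quot (D k) t h x - D k.+1 t x = quot (E k) t h x - E k.+1 t x}.
  apply: filterS3 (DE k t t0') (DE k _ th) (DE k.+1 t t0') => x.
  by rewrite /quot => -> -> ->.
by apply: ip_ae => //; apply: mq; first [exact: mD|exact: mE].
Unshelve. all: by end_near. Qed.

End smooth_representative.

Section time_derivatives.
Context {R : realType} (n r : nat) (T : R).
Variables (V : 'cV[R]_n -> R) (M G : 'cV[R]_n -> 'M[R]_n).
Local Notation cV := 'cV[R]_n.
Local Notation phase := (cV * cV)%type.
Local Notation beta := (T^-1).
Local Notation Lc := (Lop T V M G).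
Hypotheses (V_smooth : smooth_position r V)
  (M_spd : smooth_posdef r M) (G_spd : smooth_posdef r G).
Implicit Types g : R * phase -> R.

Definition dt g : R * phase -> R := 'D_((1, 0) : R * phase) g.
Definition space_dir (v : phase) : R * phase := (0, v).

Lemma smooth_dt g : smooth g -> smooth (dt g). Proof. exact: smooth_derive. Qed.

Lemma dt_comm g v : smooth g -> dt ('D_v g) = 'D_v (dt g).
Proof. exact: smooth_derive_comm. Qed.

Lemma is_derive_dt g t (x : phase) : smooth g ->
  is_derive t (1 : R) (fun s => g (s, x)) (dt g (t, x)).
Proof.
move=> sg; apply: is_derive_eq (C1_is_derive t (1 : R) (C1_restrl x (smooth_C1 sg))) _.
by rewrite derive_pairl.
Qed.

Lemma derive_slice g t (v : phase) : 'D_v (fun x => g (t, x)) = fun x => 'D_(space_dir v) g (t, x).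
Proof. by rewrite funeqE => x; rewrite derive_pairr. Qed.

Lemma C1_slice g t : smooth g -> C1 (fun x => g (t, x)).
Proof. by move=> sg; apply: C1_restrr; exact: smooth_C1. Qed.

Lemma CP2_slice g t : smooth g -> periodic r (fun x => g (t, x)) -> CP2 r (fun x => g (t, x)).
Proof.
move=> sg pg; split; first by split => //; exact: C1_slice.
move=> j; rewrite derive_slice.
by apply: (@C1_slice ('D_(space_dir (dp j)) g) t); exact: smooth_derive.
Qed.

(** Written with derivatives in the product of time and phase, the operator
    commutes with [dt] by the symmetry of second derivatives. *)
Definition Ltime g (y : R * phase) : R :=
  \sum_i (Hq V M i y.2 * 'D_(space_dir (dp i)) g y - vel M i y.2 * 'D_(space_dir (dq i)) g y)
  + 2^-1 * \sum_i \sum_j Gij G i j y.2 *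
    ('D_(space_dir (dp i)) ('D_(space_dir (dp j)) g) y + (beta * Mi M j i y.2.1 * g y +
      beta * vel M j y.2 * 'D_(space_dir (dp i)) g y)).

Lemma Lop_slice g t x : smooth g -> periodic r (fun x => g (t, x)) ->
  Lc (fun x => g (t, x)) x = Ltime g (t, x).
Proof.
move=> sg pg; have C2 := CP2_slice sg pg.
have E (v : phase) (h : R * phase -> R) y : 'D_v (fun x => h (t, x)) y = 'D_(space_dir v) h (t, y).
  by rewrite derive_pairr.
have A : pb V M (fun x => g (t, x)) x =
    \sum_i (Hq V M i x * 'D_(space_dir (dp i)) g (t, x) - vel M i x * 'D_(space_dir (dq i)) g (t, x)).
  by apply: eq_bigr => i _; rewrite !(E _ g x).
have B i : 'D_(dp i) (flow T M G (fun x => g (t, x)) i) x = \sum_j Gij G i j x *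
    ('D_(space_dir (dp i)) ('D_(space_dir (dp j)) g) (t, x) + (beta * Mi M j i x.1 * g (t, x) +
      beta * vel M j x * 'D_(space_dir (dp i)) g (t, x))).
  rewrite (derive_flow T M_spd G_spd i x C2); apply: eq_bigr => j _.
  have D2 : 'D_(dp i) ('D_(dp j) (fun x => g (t, x))) x =
      'D_(space_dir (dp i)) ('D_(space_dir (dp j)) g) (t, x).
    by rewrite (derive_slice g t (dp j)); exact: (E _ (fun y => 'D_(space_dir (dp j)) g y)).
  by rewrite D2 (E (dp i) g x).
by rewrite /Lop A (eq_bigr _ (fun i _ => B i)).
Qed.

Lemma is_derive_Ltime g t x : smooth g ->
  is_derive t (1 : R) (fun s => Ltime g (s, x)) (Ltime (dt g) (t, x)).
Proof.
move=> sg.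
have h0 := is_derive_dt t x sg.
have h1 v : is_derive t (1 : R) (fun s => 'D_(space_dir v) g (s, x)) ('D_(space_dir v) (dt g) (t, x)).
  apply: is_derive_eq (is_derive_dt t x (smooth_derive (space_dir v) sg)) _.
  by rewrite (dt_comm _ sg).
have h2 v w : is_derive t (1 : R) (fun s => 'D_(space_dir v) ('D_(space_dir w) g) (s, x))
    ('D_(space_dir v) ('D_(space_dir w) (dt g)) (t, x)).
  apply: is_derive_eq (is_derive_dt t x (smooth_derive (space_dir v) (smooth_derive (space_dir w) sg))) _.
  by rewrite (dt_comm _ (smooth_derive (space_dir w) sg)) (dt_comm _ sg).
have A i := is_deriveB_fun (is_derive_cstM (Hq V M i x) (h1 (dp i)))
  (is_derive_cstM (vel M i x) (h1 (dq i))).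
have B i j := is_derive_cstM (Gij G i j x) (is_deriveD_fun (h2 (dp i) (dp j))
  (is_deriveD_fun (is_derive_cstM (beta * Mi M j i x.1) h0)
    (is_derive_cstM (beta * vel M j x) (h1 (dp i))))).
have SA := @is_derive_bigsum R R 'I_n (index_enum _) xpredT _ t 1 _ (fun i _ => A i).
have SB i := @is_derive_bigsum R R 'I_n (index_enum _) xpredT _ t 1 _ (fun j _ => B i j).
have SSB := @is_derive_bigsum R R 'I_n (index_enum _) xpredT _ t 1 _ (fun i _ => SB i).
exact: (is_deriveD_fun SA (is_derive_cstM 2^-1 SSB)).
Qed.

Variables (e : R * phase -> R).
Hypotheses (e_smooth : smooth e) (e_periodic : forall t, 0 <= t -> periodic r (fun x => e (t, x)))
  (e_fpk : forall t x, 0 < t -> dt e (t, x) = Lc (fun x => e (t, x)) x).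

Definition dtn (k : nat) : R * phase -> R := iter k dt e.

Lemma dtn_smooth k : smooth (dtn k).
Proof. by elim: k => [|k IH]; [exact: e_smooth|exact: (smooth_dt IH)]. Qed.

Lemma dtn_periodic k t : 0 < t -> periodic r (fun x => dtn k (t, x)).
Proof.
elim: k t => [t /ltW /e_periodic//|k IH t t0].
apply/periodicP => i ai q p.
have h1 := derive_val_fun (is_derive_dt t (q + (2 * pi) *: delta_mx i 0, p) (dtn_smooth k)).
have h2 := derive_val_fun (is_derive_dt t (q, p) (dtn_smooth k)).
apply: etrans (esym h1) (etrans _ h2).
apply: near_eq_derive; apply: filterS (near_pos t0) => s s0.
by move/periodicP : (IH s s0); apply.
Qed.

(** Differentiate the equation in time: the coefficients are autonomous. *)
Lemma dtn_fpk k t x : 0 < t -> dtn k.+1 (t, x) = Lc (fun x => dtn k (t, x)) x.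
Proof.
elim: k t x => [t x t0|k IH t x t0]; first exact: e_fpk.
rewrite (Lop_slice x (dtn_smooth k.+1) (dtn_periodic k.+1 t0)).
rewrite -(derive_val_fun (is_derive_Ltime t x (dtn_smooth k))).
rewrite -[LHS](derive_val_fun (is_derive_dt t x (dtn_smooth k.+1))).
apply: near_eq_derive; apply: filterS (near_pos t0) => s s0.
by rewrite IH// (Lop_slice x (dtn_smooth k) (dtn_periodic k s0)).
Qed.

End time_derivatives.

(** * Pairings at a break time *)

Section break_values.
Context {R : realType} (n r : nat) (T : R).
Variables (V : 'cV[R]_n -> R) (M G : 'cV[R]_n -> 'M[R]_n).
Local Notation cV := 'cV[R]_n.
Local Notation phase := (cV * cV)%type.
Local Notation mx := (phase_measure R n r).
Local Notation mq := (position_measure R n r).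
Local Notation mp := (lebesgue_cV R n).
Local Notation beta := (T^-1).
Local Notation fs := (f_star r T V M).
Local Notation gs := (g_star r T V M).
Local Notation Lc := (Lop T V M G).
Hypotheses (T_gt0 : 0 < T) (V_smooth : smooth_position r V) (V_ge0 : forall q, 0 <= V q)
  (M_spd : smooth_posdef r M) (G_spd : smooth_posdef r G)
  (Z_finite : partition_finite r T V M).
Variables (e : R * phase -> R) (t : R).
Hypotheses (e_smooth : smooth e) (e_periodic : forall t, 0 <= t -> periodic r (fun x => e (t, x)))
  (e_fpk : forall t x, 0 < t -> dt e (t, x) = Lc (fun x => e (t, x)) x).

(** Division by [sqrt fs] maps the density to the curve [r_t] of the Hilbert
    space; these are the derivatives of that curve. *)
Definition Es (k : nat) (s : R) (x : phase) : R := dtn e k (s, x) / Num.sqrt (fs x).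

Local Notation f := (fun x => e (t, x)).
Hypotheses (chain : L2chain mx Es) (t_gt0 : 0 < t) (f0 : forall x, 0 <= f x)
  (rf : rapid r f) (rDf : forall j, rapid r ('D_(dp j) f))
  (rDDf : forall j, rapid r ('D_(dp j) ('D_(dp j) f)))
  (f_break : ip mx (Es 0 t) (Es 1 t) = 0).

Definition profile (q : cV) : R := ratio r T V M f (q, 0).
Local Notation xi := profile.

Let fs0 x : 0 < fs x. Proof. exact: fs_gt0. Qed.
Let sfs0 x : Num.sqrt (fs x) != 0. Proof. by rewrite gt_eqF// sqrtr_gt0. Qed.
Let Cfs : CP r fs. Proof. exact: CP_fs. Qed.
Let pf : periodic r f. Proof. exact/e_periodic/ltW. Qed.
Let Cf : CP2 r f. Proof. exact: (CP2_slice e_smooth). Qed.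
Let fpk k x : dtn e k.+1 (t, x) = Lc (fun x => dtn e k (t, x)) x.
Proof. exact: (dtn_fpk M_spd G_spd e_smooth e_periodic e_fpk k x t_gt0). Qed.
Let LE k : L2 mx (Es k t). Proof. by case: (chain k t_gt0). Qed.
Let LLE k : L2 mx (fun x => Lc (fun x => dtn e k (t, x)) x / Num.sqrt (fs x)).
Proof.
have E : (fun x => Lc (fun x => dtn e k (t, x)) x / Num.sqrt (fs x)) = Es k.+1 t.
  by rewrite funeqE => x; rewrite /Es fpk.
by rewrite E; exact: LE.
Qed.

Lemma local_equilibrium x : e (t, x) = xi x.1 * fs x.
Proof.
apply: (equilibrium (f := f) T_gt0 V_smooth M_spd G_spd Z_finite Cf f0 rf rDf rDDf (LE 0) (LLE 0)).
rewrite -f_break; apply: eq_Rintegral => y _; rewrite /Es (fpk 0).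
by [].
Qed.

Lemma C1_profile : C1 xi.
Proof. exact: C1_restrl (CP_ratio V_smooth M_spd Z_finite Cf).1. Qed.

Lemma profile_periodic : qperiodic r xi.
Proof.
move=> i ai q; have [_ pu] := CP_ratio V_smooth M_spd Z_finite Cf.
by move/periodicP : pu => /(_ i ai q 0).
Qed.

Lemma profile_ge0 q : 0 <= xi q.
Proof. exact: ratio_ge0. Qed.

Lemma C1_derive_profile i : C1 ('D_(delta_mx i 0) xi).
Proof.
have fsn0 x : fs x != 0 by exact/lt0r_neq0.
have D : 'D_(dq i) (ratio r T V M f) = fun x => ('D_(dq i) f x + beta * Hq V M i x * f x) * (fs x)^-1.
  rewrite funeqE => x.
  have h := is_deriveM_fun (C1_is_derive x (dq i : phase) Cf.1.1)
    (is_deriveV_fun (fsn0 x) (C1_is_derive x (dq i : phase) Cfs.1)).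
  rewrite (derive_val_fun h) (derive_fsq T V_smooth M_spd).
  move: (fsn0 x) (Hq _ _ _ _) ('D_(dq i) f x) (e (t, x)); move: (fs x) => s s0 v d a.
  by field; rewrite s0 gt_eqF.
have CDf : C1 ('D_(dq i) f).
  by rewrite derive_slice; apply: (@C1_slice _ _ ('D_(space_dir (dq i)) e) t); exact: smooth_derive.
have CD : C1 ('D_(dq i) (ratio r T V M f)).
  rewrite D; apply: C1M.
    by apply: C1D => //; apply: C1M; [apply: C1Z; exact: (CP_Hq V_smooth M_spd i).1|exact: Cf.1.1].
  by apply: C1V => //; exact: Cfs.1.
rewrite (_ : 'D_(delta_mx i 0) xi = fun q => 'D_(dq i) (ratio r T V M f) (q, 0)).
  exact: (@C1_restrl _ _ _ (fun x => 'D_(dq i) (ratio r T V M f) x) 0 CD).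
by rewrite funeqE => q; rewrite -derive_pairl.
Qed.

Local Notation CX := C1_profile.
Local Notation drift := (drift_xi M xi).

Let fE : f = fun x => xi x.1 * fs x.
Proof. by rewrite funeqE => x; exact: local_equilibrium. Qed.

Lemma Es0E x : Es 0 t x = xi x.1 * fs x / Num.sqrt (fs x).
Proof. by rewrite /Es /= local_equilibrium. Qed.

Let dtn1E x : dtn e 1 (t, x) = - (drift x * fs x).
Proof.
rewrite fpk /= -(Lop_equilibrium T G V_smooth M_spd CX profile_periodic).
by rewrite -fE.
Qed.

Lemma Es1E x : Es 1 t x = - (drift x * fs x / Num.sqrt (fs x)).
Proof. by rewrite /Es dtn1E mulNr. Qed.

Let dtn2E x : dtn e 2 (t, x) = Lc (fun x => - (drift x * fs x)) x.
Proof.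
rewrite fpk; congr (Lc _ x).
by rewrite funeqE => y; exact: dtn1E.
Qed.

Let cancel (a b c : R) : c != 0 -> a * c ^+ 2 / c * (b / c) = a * b.
Proof. by move=> c0; field. Qed.

Let cancel_sq (d s F : R) : s != 0 -> F = s ^+ 2 -> d * F / s * (d * F / s) = d ^+ 2 * F.
Proof. by move=> s0 ->; field. Qed.

Let cancel_mul (a b s F : R) : s != 0 -> F = s ^+ 2 -> a / s * (b / s) = a * b / F.
Proof. by move=> s0 ->; field. Qed.

Let Rint_L2 (a b : phase -> R) (c : phase -> R) : (forall x, a x * b x = c x) ->
  L2 mx a -> L2 mx b -> intg mx c.
Proof.
move=> E La Lb; have := L2_mul La Lb.
by rewrite (_ : (fun x => _) = c)// funeqE.
Qed.

(** [Es 0 = xi sqrt fs] and [Es 1 = - drift sqrt fs]: pairing [Es k.+1] with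
    [Es 0] tests the Fokker-Planck operator with [xi], which leaves the transport
    of [xi], that is the pairing of [Es k] with [- Es 1]. *)
Lemma profile_pairing k : ip mx (Es 0 t) (Es k.+1 t) = - ip mx (Es 1 t) (Es k t).
Proof.
have E0 x : Es 0 t x * Es k.+1 t x = xi x.1 * Lc (fun x => dtn e k (t, x)) x.
  rewrite Es0E /Es fpk -{1}(sqr_sqrtr (ltW (fs0 x))); exact: cancel.
have E1 x : Es 1 t x * Es k t x = - (drift x * dtn e k (t, x)).
  rewrite Es1E /Es -{1}(sqr_sqrtr (ltW (fs0 x))) mulNr; congr (- _); exact: cancel.
rewrite /ip (eq_Rintegral _ (fun x _ => E0 x)).
rewrite [X in _ = - X](eq_Rintegral _ (fun x _ => E1 x)).
have CPk : CP2 r (fun x => dtn e k (t, x)).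
  apply: CP2_slice; first exact: dtn_smooth.
  exact: dtn_periodic.
rewrite (profile_test T_gt0 V_smooth V_ge0 M_spd G_spd Z_finite CX profile_periodic profile_ge0
  CPk (LE k) (LLE k)); last 3 first.
- rewrite (_ : (fun x => _) = Es 0 t); first exact: LE.
  by rewrite funeqE => x; rewrite Es0E.
- rewrite (_ : (fun x => _) = fun x => -1 * Es 1 t x); first exact: L2Z (LE 1).
  by rewrite funeqE => x; rewrite Es1E mulN1r opprK.
- move=> i; apply: (vel_sq_intg T_gt0 V_smooth M_spd Z_finite CX profile_periodic profile_ge0).
  by rewrite -fE.
rewrite RintN ?opprK//.
have E1' x : Es 1 t x * (-1 * Es k t x) = drift x * dtn e k (t, x).
  by rewrite mulN1r mulrN E1 opprK.
exact: Rint_L2 E1' (LE 1) (L2Z (-1) (LE k)).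
Qed.

Local Notation dxi i := ('D_(delta_mx i 0) xi).

Lemma first_dissipation :
  intg mq (fun q => T * (\sum_i \sum_j dxi i q * dxi j q * Mi M j i q) * gs q) /\
  ip mx (Es 1 t) (Es 1 t) =
  \int[mq]_q (T * (\sum_i \sum_j dxi i q * dxi j q * Mi M j i q) * gs q).
Proof.
have E x : Es 1 t x * Es 1 t x = drift x ^+ 2 * fs x.
  by rewrite Es1E mulrNN (cancel_sq _ (sfs0 x) (esym (sqr_sqrtr (ltW (fs0 x))))).
have iE : intg mx (fun x => drift x ^+ 2 * fs x) by exact: Rint_L2 E (LE 1) (LE 1).
have kd := kinetic_dissipation T_gt0 V_smooth V_ge0 M_spd Z_finite iE.
split; last by rewrite /ip (eq_Rintegral _ (fun x _ => E x)).
have := Rint_fubini_intg iE.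
rewrite (_ : (fun q => _) = fun q => T * (\sum_i \sum_j dxi i q * dxi j q * Mi M j i q) * gs q)//.
by rewrite funeqE => q; exact: kinetic_slice.
Qed.

Lemma second_dissipation :
  intg mq (fun q => (\sum_i \sum_j G q i j * (bxi M xi i q * bxi M xi j q)) * gs q) /\
  ip mx (Es 1 t) (Es 2 t) =
  - 2^-1 * \int[mq]_q ((\sum_i \sum_j G q i j * (bxi M xi i q * bxi M xi j q)) * gs q).
Proof.
have E x : Es 1 t x * Es 2 t x =
    - (drift x * fs x) * Lc (fun x => - (drift x * fs x)) x / fs x.
  by rewrite /Es dtn1E dtn2E (cancel_mul _ _ (sfs0 x) (esym (sqr_sqrtr (ltW (fs0 x))))).
have iE := Rint_L2 E (LE 1) (LE 2).
have [iW IW] := diffusive_dissipation T_gt0 V_smooth V_ge0 M_spd G_spd Z_finite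
  C1_derive_profile profile_periodic iE.
by split => //; rewrite /ip (eq_Rintegral _ (fun x _ => E x)).
Qed.

End break_values.

(** * The position component *)

Section marginal.
Context {R : realType} (n r : nat) (T : R).
Variables (V : 'cV[R]_n -> R) (M : 'cV[R]_n -> 'M[R]_n).
Local Notation cV := 'cV[R]_n.
Local Notation phase := (cV * cV)%type.
Local Notation mx := (phase_measure R n r).
Local Notation mq := (position_measure R n r).
Local Notation mp := (lebesgue_cV R n).
Local Notation fs := (f_star r T V M).
Local Notation gs := (g_star r T V M).
Hypotheses (T_gt0 : 0 < T) (V_smooth : smooth_position r V) (V_ge0 : forall q, 0 <= V q)
  (M_spd : smooth_posdef r M) (Z_finite : partition_finite r T V M)
  (gs0 : forall q, 0 < gs q).

Let fs0 x : 0 < fs x. Proof. exact: fs_gt0. Qed.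
Let Cfs : CP r fs. Proof. exact: CP_fs. Qed.

(** With the square root of the equilibrium momentum density as kernel, the
    projection of [a / sqrt fs] is the momentum integral of [a] divided by
    [sqrt gs]. *)
Definition kern (x : phase) : R := Num.sqrt (fs x / gs x.1).

Let sqrt_div (a b : R) : 0 <= a -> 0 <= b -> Num.sqrt (a / b) = Num.sqrt a / Num.sqrt b.
Proof. by move=> a0 b0; rewrite sqrtrM// sqrtrV. Qed.

Let kernE x : kern x = Num.sqrt (fs x) / Num.sqrt (gs x.1).
Proof. exact: sqrt_div (ltW (fs0 x)) (ltW (gs0 x.1)). Qed.

Let sf0 x : Num.sqrt (fs x) != 0. Proof. by rewrite gt_eqF// sqrtr_gt0. Qed.
Let sg0 q : Num.sqrt (gs q) != 0. Proof. by rewrite gt_eqF// sqrtr_gt0. Qed.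

Lemma measurable_kern : measurable_fun [set: phase] kern.
Proof.
have mg := measurable_g_star V_smooth M_spd Z_finite.
have mgV : measurable_fun setT (fun q => (gs q)^-1).
  rewrite (_ : (fun q => _) = (fun a => a `^ (-1)) \o gs); last first.
    by rewrite funeqE => q /=; rewrite powR_inv1// ltW.
  by apply: measurableT_comp => //; exact: measurable_powR.
apply: (measurableT_comp (f := @Num.sqrt R)).
  by apply: continuous_measurable_fun; exact: sqrt_continuous.
apply: measurable_funM; first exact: CP_measurable Cfs.
by apply: (measurableT_comp mgV); exact: measurable_fst.
Qed.

Lemma kern_sq q : (\int[mp]_p (kern (q, p) ^+ 2)%:E = 1)%E.
Proof.
have E p : kern (q, p) ^+ 2 = (gs q)^-1 * fs (q, p).
  by rewrite kernE exprMn exprVn (sqr_sqrtr (ltW (fs0 _))) (sqr_sqrtr (ltW (gs0 _))) mulrC.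
have iq := intg_fs_slice T_gt0 V_smooth V_ge0 M_spd Z_finite q.
transitivity (\int[mp]_p ((gs q)^-1 * fs (q, p))%:E)%E.
  by apply: eq_integral => p _; rewrite E.
rewrite -(Rint_EFin (intgZ _ iq)) RintZ// -g_starE mulVf// gt_eqF//.
Qed.

Let mul_kern a x : a / Num.sqrt (fs x) * kern x = (Num.sqrt (gs x.1))^-1 * a.
Proof.
by rewrite kernE [LHS]mulrA (mulfVK (sf0 x)) mulrC.
Qed.

Let scalar1 (a s g x F : R) : s != 0 -> g != 0 -> x != 0 -> F = s ^+ 2 ->
  a * (s / g) = (x * g)^-1 * (x * F / s * a).
Proof. by move=> s0 g0 x0 ->; field; rewrite s0 g0 x0. Qed.

Let scalar2 (g x b F : R) : g != 0 -> x != 0 -> F = g ^+ 2 ->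
  g^-1 * (x * F) * ((x * g)^-1 * b) = b.
Proof. by move=> g0 x0 ->; field; rewrite g0 x0. Qed.

Lemma proj_density (a : phase -> R) q : intg mp (fun p => a (q, p)) ->
  proj mp kern (fun x => a x / Num.sqrt (fs x)) q =
  (Num.sqrt (gs q))^-1 * \int[mp]_p a (q, p).
Proof.
move=> ia; rewrite -RintZ//; apply: eq_Rintegral => p _; exact: mul_kern.
Qed.

(** Since [xi sqrt fs] is the kernel times a function of the position, Fubini's
    theorem folds the projection back. The values of [xi] are positive, so that
    almost all slices of [a] are integrable against the kernel. *)
Lemma proj_pairing (xi : cV -> R) (a : phase -> R) : (forall q, 0 < xi q) ->
  L2 mx (fun x => xi x.1 * fs x / Num.sqrt (fs x)) -> L2 mx a ->
  ip mq (proj mp kern (fun x => xi x.1 * fs x / Num.sqrt (fs x))) (proj mp kern a) =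
  ip mx (fun x => xi x.1 * fs x / Num.sqrt (fs x)) a.
Proof.
move=> xi0 Lx La.
have [[mPx _] _] := proj_contraction measurable_kern kern_sq Lx.
have [[mPa _] _] := proj_contraction measurable_kern kern_sq La.
have ixa := L2_mul Lx La.
rewrite /ip [RHS]Rint_fubini//; apply: Rint_ae.
- exact: measurable_funM.
- exact: (intg_measurable (Rint_fubini_intg ixa)).
have [N [mN N0 NP]] := ae_integrable1 ixa.
exists N; split => // q /= nq; apply: NP => /= iq; apply: nq.
have iq' : intg mp (fun p => xi q * fs (q, p) / Num.sqrt (fs (q, p)) * a (q, p)) by exact: iq.
have ifx : intg mp (fun p => xi q * fs (q, p)).
  by apply: intgZ; exact: (intg_fs_slice T_gt0 V_smooth V_ge0 M_spd Z_finite).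
rewrite (proj_density (a := fun x => xi x.1 * fs x)) //=.
rewrite RintZ; last exact: (intg_fs_slice T_gt0 V_smooth V_ge0 M_spd Z_finite).
rewrite -g_starE.
have x0 : xi q != 0 by rewrite gt_eqF.
have E p : a (q, p) * kern (q, p) =
    (xi q * Num.sqrt (gs q))^-1 * (xi q * fs (q, p) / Num.sqrt (fs (q, p)) * a (q, p)).
  rewrite kernE; exact: scalar1 (sf0 _) (sg0 _) x0 (esym (sqr_sqrtr (ltW (fs0 _)))).
rewrite [proj mp kern a q](eq_Rintegral _ (fun p _ => E p)) RintZ//.
exact: scalar2 (sg0 _) x0 (esym (sqr_sqrtr (ltW (gs0 _)))).
Qed.

End marginal.

Lemma derivative_cvg (R : realType) (g : R -> R) (s l : R) : is_derive s (1 : R) g l ->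
  (fun h => h^-1 * (g (s + h) - g s)) @ 0^' --> l.
Proof.
case=> dg <-; rewrite (_ : (fun h => _) = fun h => h^-1 *: (g (h *: 1 + s) - g s)); first exact: dg.
by rewrite funeqE => h; rewrite /GRing.scale /= mulr1 [h + s]addrC.
Qed.

Lemma schwartz_rapid (R : realType) (n r : nat) (phi : 'cV[R]_n * 'cV[R]_n -> R)
  (vs : seq ('cV[R]_n * 'cV[R]_n)) : schwartz r phi -> rapid r (iter_derive vs phi).
Proof.
case=> _ _ S m; have [C hC] := S m vs; exists C; split; last exact: hC.
apply: le_trans (hC 0); rewrite mulr_ge0// exprn_ge0// addr_ge0//.
Qed.

(** * The two divergences *)

Section divergences.
Context {R : realType} (n r : nat) (T : R).
Variables (V : 'cV[R]_n -> R) (M : 'cV[R]_n -> 'M[R]_n).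
Local Notation cV := 'cV[R]_n.
Local Notation phase := (cV * cV)%type.
Local Notation mx := (phase_measure R n r).
Local Notation mq := (position_measure R n r).
Local Notation mp := (lebesgue_cV R n).
Local Notation fs := (f_star r T V M).
Local Notation gs := (g_star r T V M).
Hypotheses (T_gt0 : 0 < T) (V_smooth : smooth_position r V) (V_ge0 : forall q, 0 <= V q)
  (M_spd : smooth_posdef r M) (Z_finite : partition_finite r T V M).

Let fs0 x : 0 < fs x. Proof. exact: fs_gt0. Qed.

Lemma rapid_intg (f : phase -> R) : continuous f -> rapid r f ->
  intg mx f /\ forall q, intg mp (fun p => f (q, p)).
Proof.
move=> cf /(rapid_weight 1)[C [C0 hC]]; split.
  by apply: (intg_weight_le (c := C)) => // x; have := hC x; rewrite expr1.
move=> q; apply: (intg_le (g := fun p => C * pweight p)).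
- exact: (measurable_funTS (measurableT_comp (continuous_measurable_phase cf) (measurable_pair1 q))).
- by apply: intgZ; exact: intg_pweight.
- move=> p; have := hC (q, p); rewrite expr1 => /le_trans; apply.
  by rewrite ler_wpM2l// /weight /= ler_piMl ?(ltW (pweight_gt0 p))//; exact: qweight_le1.
Qed.

Lemma chi2_pairing (f : phase -> R) : intg mx f -> \int[mx]_x f x = 1 ->
  L2 mx (fun x => f x / Num.sqrt (fs x)) ->
  \int[mx]_x ((f x - fs x) ^+ 2 / fs x) =
  ip mx (fun x => f x / Num.sqrt (fs x)) (fun x => f x / Num.sqrt (fs x)) - 1.
Proof.
move=> iF F1 Lf; have iff := L2_mul Lf Lf; have ifs := intg_fs V_smooth M_spd Z_finite.
have scalar (a s F : R) : s != 0 -> F = s ^+ 2 ->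
    (a - F) ^+ 2 / F = a / s * (a / s) - 2 * a + F by move=> s0 ->; field.
have E x : (f x - fs x) ^+ 2 / fs x =
    f x / Num.sqrt (fs x) * (f x / Num.sqrt (fs x)) - 2 * f x + fs x.
  have s0 : Num.sqrt (fs x) != 0 by rewrite gt_eqF// sqrtr_gt0.
  exact: scalar s0 (esym (sqr_sqrtr (ltW (fs0 x)))).
rewrite (eq_Rintegral _ (fun x _ => E x)) RintD//; last by apply: intgB => //; exact: intgZ.
rewrite RintB//; last exact: intgZ.
by rewrite RintZ// F1 (int_fs V_smooth M_spd Z_finite) /ip; ring.
Qed.

Lemma chi2_position_pairing (f : phase -> R) : (forall q, 0 < gs q) ->
  (forall q, intg mp (fun p => f (q, p))) ->
  \int[mq]_q (position_pdf f q ^+ 2 / gs q) =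
  ip mq (proj mp (kern r T V M) (fun x => f x / Num.sqrt (fs x)))
        (proj mp (kern r T V M) (fun x => f x / Num.sqrt (fs x))).
Proof.
move=> gs0 iF; apply: eq_Rintegral => q _.
rewrite (proj_density V_smooth M_spd Z_finite gs0 (iF q)) -/(position_pdf f q).
have scalar (a s F : R) : s != 0 -> F = s ^+ 2 -> a ^+ 2 / F = s^-1 * a * (s^-1 * a).
  by move=> s0 ->; field.
apply: scalar; first by rewrite gt_eqF// sqrtr_gt0.
by rewrite sqr_sqrtr// ltW.
Qed.

Lemma gradient_velocity (xi : cV -> R) q j :
  (invmx (M q) *m gradient xi q) j 0 = bxi M xi j q.
Proof.
by rewrite mxE; apply: eq_bigr => k _; rewrite mxE (Mi_sym M_spd k j).
Qed.

End divergences.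

Theorem lemma7 (R : realType) (n r : nat) (n_gt0 : (0 < n)%N) (r_le_n : (r <= n)%N)
  (T : R) (T_gt0 : 0 < T)
  (V : 'cV[R]_n -> R) (M G F : 'cV[R]_n -> 'M[R]_n)
  (V_smooth : smooth_position r V) (V_ge0 : forall q, 0 <= V q)
  (M_spd : smooth_posdef r M) (G_spd : smooth_posdef r G)
  (F_spd : smooth_posdef r F)
  (Z_finite : partition_finite r T V M)
  (FG : forall q, F q = (T^-1 / 2) *: G q)
  (d : measure_display) (Omega : measurableType d) (Pr : probability Omega R)
  (W : R -> Omega -> 'cV[R]_n) (X : R -> Omega -> 'cV[R]_n * 'cV[R]_n)
  (W_wiener : wiener Pr W) (WX0_indep : independent_of_initial r Pr W (X 0))
  (X_sol : langevin_solution Pr V M G F W X)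
  (f : R -> 'cV[R]_n * 'cV[R]_n -> R)
  (f_pdf : forall t, 0 <= t -> has_pdf r Pr (X t) (f t))
  (f_ge0 : forall t x, 0 <= t -> 0 <= f t x)
  (f_fpk : fpk_equation V M G F f)
  (f_smooth : smooth_time_phase f)
  (f_schwartz : forall t, 0 <= t -> schwartz r (f t))
  (g_gt0 : forall t q, 0 <= t -> 0 < position_pdf (f t) q)
  (r_smooth : smooth_L2 r (fun t x => f t x / Num.sqrt (f_star r T V M x)))
  (t : R) (t_break : break_times r T V M f t) :
  let K := chi2 r T V M f in
  let K1 := chi2_position r T V M f in
  let xi := xi r T V M f in
  (nth_derivable 3 K t /\
   ((K^`(3))%classic t)%:E =
     (- 2%:E * E_star r T V M
        (fun q => wnorm (G q) (invmx (M q) *m gradient (xi t) q) ^+ 2)%R)%E) /\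
  (nth_derivable 2 K1 t /\
   ((K1^`(2))%classic t)%:E =
     (- (2 * T)%:E * E_star r T V M
        (fun q => wnorm (invmx (M q)) (gradient (xi t) q) ^+ 2)%R)%E).
Proof.
pose phase := ('cV[R]_n * 'cV[R]_n)%type.
pose mx := phase_measure R n r; pose mq := position_measure R n r.
pose fs := f_star r T V M; pose gs := g_star r T V M.
have fs0 x : 0 < fs x by exact: fs_gt0.
have sfs0 x : Num.sqrt (fs x) != 0 by rewrite gt_eqF// sqrtr_gt0.
have Cfs : CP r fs by exact: CP_fs.
have [e e_smooth eE] := f_smooth.
have fE s : 0 <= s -> f s = (fun x => e (s, x)) by move=> s0; rewrite funeqE => x; rewrite eE.
have e_periodic s : 0 <= s -> periodic r (fun x => e (s, x)).
  by move=> s0; rewrite -fE//; case: (f_schwartz s s0).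
have e_fpk s x : 0 < s -> dt e (s, x) = Lop T V M G (fun x => e (s, x)) x.
  move=> s0; have s0' := ltW s0.
  have := f_fpk s x s0'; rewrite (fE s s0').
  rewrite (fpk_Lop V_smooth M_spd G_spd FG x (CP2_slice e_smooth (e_periodic s s0'))) => lim.
  have lim0 : (fun h => h^-1 *: (f (s + h) x - f s x)) @ 0^' -->
      Lop T V M G (fun x => e (s, x)) x.
    by move=> A nA; exact: (time_increment_pos s0 (lim A nA)).
  have lim1 := derivative_cvg (is_derive_dt s x e_smooth).
  have lim2 : (fun h => h^-1 * (e (s + h, x) - e (s, x))) @ 0^' -->
      Lop T V M G (fun x => e (s, x)) x.
    apply: cvg_trans lim0; apply: near_eq_cvg.
    have tp : time_increment s [set h | 0 <= s + h].
      by rewrite /time_increment /within /=; apply: filterE => h; exact: id.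
    apply: filterS (time_increment_pos s0 tp) => h sh.
    by rewrite !eE.
  exact: etrans (esym (cvg_lim (@Rhausdorff R) lim1)) (cvg_lim (@Rhausdorff R) lim2).
pose E := Es r T V M e.
have chain : L2chain mx E.
  have [D [D0 DD]] := r_smooth.
  have [LD dD] := smooth_chain DD.
  have E0 s x : E 0%N s x = e (s, x) / Num.sqrt (fs x) by [].
  apply: (smooth_representative LD dD).
  - move=> k s s0; apply: (@continuous_measurable_phase R n n) => x.
    apply: cvgM; first exact: (C1_continuous (C1_slice s (dtn_smooth e_smooth k))).
    apply: cvgV => //; apply: (@continuous_comp _ _ _ fs (@Num.sqrt R)); last exact: sqrt_continuous.
    exact: (C1_continuous Cfs.1).
  - move=> k s x s0.
    have lim := derivative_cvg (is_derive_dt s x (dtn_smooth e_smooth k)).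
    have lim' : (fun h => h^-1 * (dtn e k (s + h, x) - dtn e k (s, x)) / Num.sqrt (fs x)) @ 0^' -->
        E k.+1 s x by exact: cvgMl lim.
    rewrite (_ : (fun h => _) = fun h => h^-1 * (dtn e k (s + h, x) - dtn e k (s, x)) / Num.sqrt (fs x)).
      exact: cvg_trans (cvg_app _ (@cvg_within _ _ _ _)) lim'.
    by rewrite funeqE => h; rewrite /quot /E /Es -mulrBl mulrA.
  - by move=> s s0; apply: aeW => x; rewrite D0// E0 -eE.
have schw s (s0 : 0 <= s) vs : rapid r (iter_derive vs (fun x => e (s, x))).
  by rewrite -fE//; apply: schwartz_rapid; exact: f_schwartz.
have rap s (s0 : 0 <= s) := rapid_intg (C1_continuous (C1_slice s e_smooth)) (schw s s0 [::]).
have mass s (s0 : 0 <= s) : \int[mx]_x e (s, x) = 1.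
  have evT : @phase_event R n r setT by split => // i ai q; apply/seteqP; split.
  have := f_pdf s s0 setT evT; rewrite preimage_setT probability_setT => h.
  have -> : \int[mx]_x e (s, x) = \int[mx]_x f s x by rewrite (fE s s0).
  by rewrite /Rintegral -h.
have K_E (s : R) : 0 < s -> chi2 r T V M f s = ip mx (E 0%N s) (E 0%N s) - 1.
  move=> s0; have s0' := ltW s0; rewrite /chi2 fE//.
  apply: chi2_pairing => //; first exact: (rap s s0').1.
    exact: mass.
  by case: (chain 0%N s s0).
have dE j k (s : R) (s0 : 0 < s) := chain_derive j k chain s0.
have dK0 (s : R) : 0 < s -> is_derive s (1 : R) (fun s => ip mx (E 0%N s) (E 0%N s) - 1)
    (2 * ip mx (E 0%N s) (E 1%N s)).
  move=> s0; apply: is_derive_eq (is_deriveB_fun (dE 0%N 0%N s s0) (is_derive_cst (1 : R) s (1 : R))) _.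
  by rewrite subr0 [X in X + _]ipC mulr2n mulrDl mul1r.
have [t0 dKt] := t_break; have t0' := ltW t0.
have f_break : ip mx (E 0%N t) (E 1%N t) = 0.
  have h : 'D_1 (chi2 r T V M f) t = 'D_1 (fun s => ip mx (E 0%N s) (E 0%N s) - 1) t.
    by apply: near_eq_derive; apply: filterS (near_pos t0) => s; exact: K_E.
  move: h; rewrite (derive_val_fun dKt) (derive_val_fun (dK0 t t0)) => /esym/eqP.
  by rewrite mulf_eq0 pnatr_eq0/= => /eqP.
have f0 x : 0 <= e (t, x) by rewrite eE//; exact: f_ge0.
have rf := schw t t0' [::].
have rDf j := schw t t0' [:: dp j].
have rDDf j := schw t t0' [:: dp j; dp j].
have loc := local_equilibrium T_gt0 V_smooth M_spd G_spd Z_finite e_smooth e_periodic e_fpk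
  chain t0 f0 rf rDf rDDf f_break.
have pair := profile_pairing T_gt0 V_smooth V_ge0 M_spd G_spd Z_finite e_smooth e_periodic e_fpk
  chain t0 f0 rf rDf rDDf f_break.
have [iA A1] := first_dissipation T_gt0 V_smooth V_ge0 M_spd G_spd Z_finite e_smooth e_periodic e_fpk
  chain t0 f0 rf rDf rDDf f_break.
have [iB B1] := second_dissipation T_gt0 V_smooth V_ge0 M_spd G_spd Z_finite e_smooth e_periodic e_fpk
  chain t0 f0 rf rDf rDDf f_break.
pose x0 := profile r T V M e t.
have posE q : position_pdf (f t) q = x0 q * gs q.
  rewrite /position_pdf fE// /gs g_starE -RintZ; last exact: (intg_fs_slice T_gt0 V_smooth V_ge0 M_spd Z_finite).
  by apply: eq_Rintegral => p _; rewrite loc.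
have gs_ge0 q : 0 <= gs q by rewrite /gs g_starE; apply: Rintegral_ge0 => p _; exact: ltW.
have x0_ge0 q : 0 <= x0 q by exact: ratio_ge0.
have prod_gt0 q : 0 < x0 q * gs q by rewrite -posE; exact: g_gt0.
have gs0 q : 0 < gs q.
  by rewrite lt_def gs_ge0 andbT; apply/eqP => h; have := prod_gt0 q; rewrite h mulr0 ltxx.
have x0_gt0 q : 0 < x0 q by rewrite -(pmulr_lgt0 _ (gs0 q)).
have xiE : xi r T V M f t = x0.
  by rewrite funeqE => q; rewrite /xi posE mulfK// gt_eqF.
split.
(* [K' = 2 <r, r'>], hence [K''' = 6 <r', r''> + 2 <r, r'''> = 4 <r', r''>] *)
- pose EK (j : nat) (s : R) : R := match j with
    | 0%N => ip mx (E 0%N s) (E 0%N s) - 1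
    | 1%N => 2 * ip mx (E 0%N s) (E 1%N s)
    | 2%N => 2 * ip mx (E 1%N s) (E 1%N s) + 2 * ip mx (E 0%N s) (E 2%N s)
    | _ => 6 * ip mx (E 1%N s) (E 2%N s) + 2 * ip mx (E 0%N s) (E 3%N s) end.
  have dEK j (s : R) : (j < 3)%N -> 0 < s -> is_derive s (1 : R) (EK j) (EK j.+1 s).
    case: j => [|[|[|//]]] _ s0; first exact: dK0.
      apply: is_derive_eq (is_derive_cstM 2 (dE 0%N 1%N s s0)) _.
      by rewrite /EK mulrDr.
    apply: is_derive_eq (is_deriveD_fun (is_derive_cstM 2 (dE 1%N 1%N s s0))
      (is_derive_cstM 2 (dE 0%N 2%N s s0))) _.
    rewrite /EK [ip mx (E 2%N s) (E 1%N s)]ipC.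
    move: (ip mx (E 1%N s) (E 2%N s)) (ip mx (E 0%N s) (E 3%N s)) => a b.
    by ring.
  have [dK ->] := nth_derivable_pos K_E dEK t0.
  split => //; rewrite /EK (pair 2%N).
  have -> : 6 * ip mx (E 1%N t) (E 2%N t) + 2 * - ip mx (E 1%N t) (E 2%N t) =
    4 * ip mx (E 1%N t) (E 2%N t).
    by move: (ip mx (E 1%N t) (E 2%N t)) => a; ring.
  rewrite B1 /E_star -/mq.
  have -> : (fun q => (wnorm (G q) (invmx (M q) *m gradient (xi r T V M f t) q) ^+ 2 * g_star r T V M q)%:E) =
     (fun q => ((\sum_i \sum_j G q i j * (bxi M x0 i q * bxi M x0 j q)) * gs q)%:E).
    rewrite funeqE => q; congr ((_ * _)%:E); rewrite xiE wnorm_sq; last by have [_ _] := G_spd.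
    rewrite qform; apply: eq_bigr => i _; apply: eq_bigr => j _.
    by rewrite !(gradient_velocity M_spd).
  rewrite -(Rint_EFin iB) -EFinN -EFinM; congr (_%:E).
  by move: (\int[mq]_q _) => a; field.
(* the projection of [r'] vanishes because [r'] is odd in the momentum *)
- pose P j s := proj (lebesgue_cV R n) (kern r T V M) (E j s).
  have mk := measurable_kern V_smooth M_spd Z_finite gs0.
  have k1 := kern_sq T_gt0 V_smooth V_ge0 M_spd Z_finite gs0.
  have pchain : L2chain mq P := proj_chain mk k1 chain.
  have dP j k (s : R) (s0 : 0 < s) := chain_derive j k pchain s0.
  have K1_E (s : R) : 0 < s -> chi2_position r T V M f s = ip mq (P 0%N s) (P 0%N s) - 1.
    move=> s0; have s0' := ltW s0; rewrite /chi2_position fE//.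
    by rewrite (chi2_position_pairing V_smooth M_spd Z_finite gs0 (rap s s0').2).
  pose EK (j : nat) (s : R) : R := match j with
    | 0%N => ip mq (P 0%N s) (P 0%N s) - 1
    | 1%N => 2 * ip mq (P 0%N s) (P 1%N s)
    | _ => 2 * ip mq (P 1%N s) (P 1%N s) + 2 * ip mq (P 0%N s) (P 2%N s) end.
  have dEK j (s : R) : (j < 2)%N -> 0 < s -> is_derive s (1 : R) (EK j) (EK j.+1 s).
    case: j => [|[|//]] _ s0.
      apply: is_derive_eq (is_deriveB_fun (dP 0%N 0%N s s0) (is_derive_cst (1 : R) s (1 : R))) _.
      rewrite subr0 [X in X + _]ipC /EK; move: (ip mq (P 0%N s) (P 1%N s)) => a.
      by ring.
    apply: is_derive_eq (is_derive_cstM 2 (dP 0%N 1%N s s0)) _.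
    by rewrite /EK mulrDr.
  have [dK1 ->] := nth_derivable_pos K1_E dEK t0.
  split => //; rewrite /EK.
  have P1 q : P 1%N t q = 0.
    have [im m0] := drift_mean T_gt0 V_smooth V_ge0 M_spd Z_finite x0 q.
    have E1x : E 1%N t = fun x => - (drift_xi M x0 x * fs x) / Num.sqrt (fs x).
      rewrite funeqE => x; rewrite mulNr.
      exact: (Es1E T_gt0 V_smooth M_spd G_spd Z_finite e_smooth e_periodic e_fpk
        chain t0 f0 rf rDf rDDf f_break).
    rewrite /P E1x (proj_density (a := fun x => - (drift_xi M x0 x * fs x)) V_smooth M_spd Z_finite gs0).
      by rewrite RintN// m0 oppr0 mulr0.
    exact: intgN.
  have -> : ip mq (P 1%N t) (P 1%N t) = 0.
    rewrite /ip -[RHS](_ : \int[mq]_q (fun=> 0 : R) q = 0); last by rewrite /Rintegral integral0.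
    by apply: eq_Rintegral => q _; rewrite P1 mulr0.
  have Es0 : E 0%N t = fun x => x0 x.1 * fs x / Num.sqrt (fs x).
    by rewrite funeqE => x; rewrite /E /Es /= loc.
  have L0 : L2 mx (fun x => x0 x.1 * fs x / Num.sqrt (fs x)) by rewrite -Es0; case: (chain 0%N t t0).
  have -> : ip mq (P 0%N t) (P 2%N t) = - ip mx (E 1%N t) (E 1%N t).
    rewrite -(pair 1%N) /P.
    have := proj_pairing T_gt0 V_smooth V_ge0 M_spd Z_finite gs0 x0_gt0 L0 (chain 2%N t t0).1.
    by rewrite -Es0.
  rewrite A1 /E_star -/mq.
  pose S q := \sum_i \sum_j 'D_(delta_mx i 0) x0 q * 'D_(delta_mx j 0) x0 q * Mi M j i q.
  have ES q : wnorm (invmx (M q)) (gradient (xi r T V M f t) q) ^+ 2 = S q.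
    rewrite xiE wnorm_sq; last by have [_ _ h] := M_spd; exact: posdef_inv.
    rewrite qform; apply: eq_bigr => i _; apply: eq_bigr => j _.
    by rewrite !mxE -/(Mi M i j q) (Mi_sym M_spd) mulrC.
  have iS : intg mq (fun q => S q * gs q).
    have := intgZ T^-1 iA; rewrite (_ : (fun q => _) = fun q => S q * gs q)//.
    by rewrite funeqE => q; rewrite -/(S q) 2!mulrA mulVf ?gt_eqF// mul1r.
  have -> : (fun q => (wnorm (invmx (M q)) (gradient (xi r T V M f t) q) ^+ 2 * g_star r T V M q)%:E) =
     (fun q => (S q * gs q)%:E) by rewrite funeqE => q; rewrite ES.
  rewrite -(Rint_EFin iS) -EFinN -EFinM; congr (_%:E).
  have -> : \int[mq]_q (T * (\sum_i \sum_j 'D_(delta_mx i 0) x0 q * 'D_(delta_mx j 0) x0 q * Mi M j i q) * gs q)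
     = T * \int[mq]_q (S q * gs q).
    by rewrite -RintZ//; apply: eq_Rintegral => q _; rewrite mulrA.
  by move: (\int[mq]_q _) => a; ring.
Qed.
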